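(* Let $\mathcal H_1,\mathcal H_2$ be Hilbert spaces, $A$ a self-adjoint operator in $\mathcal H_1$ bounded from below, $B$ a densely defined closable operator from $\mathcal H_2$ to $\mathcal H_1$, and $D$ a self-adjoint operator in $\mathcal H_2$ bounded from above; let $\mathfrak a$, $\mathfrak d$ be the closed quadratic forms associated with $A$, $D$. Assume that $\mathrm{dom}(\mathfrak a)\subset\mathrm{dom}(B^* )$ and that either (I) $\mathrm{dom}(B)\subset\mathrm{dom}(D)$ and $\mathrm{dom}(B)$ is a core for $D$, or (II) $\mathrm{dom}(\mathfrak d)\subset\mathrm{dom}(B)$. Let $\mathcal M$ be the closure of $\mathcal M_0=\begin{pmatrix}A&B\\ -B^*&D\end{pmatrix}$ with $\mathrm{dom}(\mathcal M_0)=(\mathrm{dom}(A)\cap\mathrm{dom}(B^* ))\times(\mathrm{dom}(B)\cap\mathrm{dom}(D))$ in $\mathcal H_1\oplus\mathcal H_2$. Let $a\in\mathbb R$, $b\ge0$ be such that $\|B^*x\|^2\le a\|x\|^2+b\,\mathfrak a[x]$ for all $x\in\mathrm{dom}(\mathfrak a)$, let $\delta_+=\max\sigma(D)$ and $\mu=\delta_++b+\sqrt{\max\{b\delta_++b^2+a,0\}}$. Let $S(\lambda)$, $\lambda\in(\mu,\infty)$, be the Schur complement, $p$ the generalised Rayleigh functional and $\kappa_-$ as defined in the context. Assume that there exists $\gamma\in(\mu,\infty)$ with $\kappa_-(S(\gamma))<\infty$. Then $$\mu<\lambda_{\rm e}:=\begin{cases}\inf\bigl(\sigma_{\rm ess}(\mathcal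 M)\cap(\mu,\infty)\bigr)&\text{if }\sigma_{\rm ess}(\mathcal M)\cap(\mu,\infty)\ne\varnothing,\\ \infty&\text{otherwise}.\end{cases}$$ Moreover, $\sigma(\mathcal M)\cap(\mu,\lambda_{\rm e})$ is at most countable, consists of eigenvalues only and has $\lambda_{\rm e}$ as only possible accumulation point. Let $\gamma_0\in(\mu,\lambda_{\rm e})$ be arbitrary and let $(\lambda_j)_{j=1}^N$, $N\in\mathbb N_0\cup\{\infty\}$, be the finite or infinite sequence of eigenvalues of $\mathcal M$ in the interval $[\gamma_0,\lambda_{\rm e})$ in non-decreasing order and repeated according to multiplicities. Then $\kappa:=\kappa_-(S(\gamma_0))<\infty$ and $$\lambda_n=\min_{\substack{\mathcal L\subset\mathrm{dom}(\mathfrak a)\\ \dim\mathcal L=\kappa+n}}\ \max_{x\in\mathcal L\setminus\{0\}}p(x)=\max_{\substack{\mathcal L\subset\mathcal H_1\\ \dim\mathcal L=\kappa+n-1}}\ \inf_{\substack{x\in\mathrm{dom}(\mathfrak a)\setminus\{0\}\\ x\perp\mathcal L}}p(x)$$ for $n\in\mathbb N$, $n\le N$. Moreover, if $N$ is finite and $\mathcal H_1$ is infinite-dimensional, then $\lambda_{\rm e}<\infty$ and $$\lambda_{\rm e}=\inf_{\substack{\mathcal L\subset\mathrm{dom}(\mathfrak a)\\ \dim\mathcal L=\kappa+n}}\ \max_{x\in\mathcal L\setminus\{0\}}p(x)=\sup_{\substack{\mathcal L\subset\mathcal H_1\\ \dim\mathcal L=\kappa+n-1}}\ \inf_{\substack{x\in\mathrm{dom}(\mathfrak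 a)\setminus\{0\}\\ x\perp\mathcal L}}p(x)$$ for $n>N$. (Here $\mathcal L$ ranges over linear subspaces.)
   Context: Hilbert spaces are non-zero and complex; inner products are linear in the first argument. $\mathfrak a$ has domain $\mathrm{dom}(|A|^{1/2})$, with sesquilinear form $\mathfrak a[x,y]$ and $\mathfrak a[x]=\mathfrak a[x,x]$; $\mathfrak d$ has domain $\mathrm{dom}(|D|^{1/2})$. Under the stated assumptions $\mathcal M_0$ is closable and such $a,b$ exist. $\sigma_{\rm ess}(T)=\{z\in\mathbb C:T-z\text{ is not Fredholm}\}$. For $\lambda\in(\mu,\infty)$ let $$\mathfrak s(\lambda)[x,y]=\mathfrak a[x,y]-\lambda\langle x,y\rangle+\langle(D-\lambda)^{-1}B^*x,B^*y\rangle,\qquad x,y\in\mathrm{dom}(\mathfrak a),\qquad \mathfrak s(\lambda)[x]=\mathfrak s(\lambda)[x,x];$$ this is a closed symmetric form bounded from below, and $S(\lambda)$ is the associated self-adjoint operator in $\mathcal H_1$ (the Schur complement). For each $x\in\mathrm{dom}(\mathfrak a)\setminus\{0\}$ the function $\mathfrak s(\cdot)[x]$ has at most one zero in $(\mu,\infty)$ and tends to $-\infty$ at $\infty$. The generalised Rayleigh functional $p:\mathrm{dom}(\mathfrak a)\setminus\{0\}\to\mathbb R\cup\{-\infty\}$ is defined by $p(x)=\lambda_0$ if $\mathfrak s(\lambda_0)[x]=0$ for a $\lambda_0\in(\mu,\infty)$, and $p(x)=-\infty$ if $\mathfrak s(\lambda)[x]<0$ for all $\lambda\in(\mu,\infty)$.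 For a self-adjoint operator $T$, $\kappa_-(T)$ denotes the dimension of the spectral subspace of $T$ corresponding to $(-\infty,0)$. *)

(* Defs.v *)
From HB Require Import structures.
From mathcomp Require Export all_boot all_order all_algebra sesquilinear.
From mathcomp Require Export all_classical all_reals all_analysis.
From mathcomp Require Export complex.

Set Implicit Arguments.
Unset Strict Implicit.
Unset Printing Implicit Defensive.

Export Order.TTheory GRing.Theory Num.Theory.
Export numFieldNormedType.Exports.

#[global] Open Scope classical_set_scope.
#[global] Open Scope complex_scope.
#[global] Open Scope ring_scope.

(* Non-zero complex Hilbert spaces.  [{dot V for conj}] is linear in its first
   argument and conjugate-linear in the second. *)
HB.mixin Record CompleteNormedModule_isHilbert (R : realType) V
    of CompleteNormedModule R[i] V := {
  ip : {dot V for Num.conj};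
  norm_ip : forall x : V, `|x| ^+ 2 = ip x x;
  hilbert_neq0 : exists x : V, x != 0 }.

#[short(type="hilbertType")]
HB.structure Definition Hilbert (R : realType) :=
  { V of CompleteNormedModule R[i] V & CompleteNormedModule_isHilbert R V }.

(* The inner product as a plain function. *)
Definition inner (R : realType) (H : hilbertType R) (x y : H) : R[i] :=
  (ip : {dot H for Num.conj}) x y.
Notation "''[' x , y ]" := (inner x y)
  (at level 0, format "''[' x ,  y ]") : ring_scope.

(* Unbounded operators are represented by their graphs; an operator with
   domain [dom T] maps [x] to the unique [y] with [T (x, y)].
   The carrier of H1 (+) H2 is the normed space [H1 * H2]: its norm is
   equivalent to the Hilbert norm, and for operators in H1 (+) H2 only the
   linear and topological structure is used below (closure, resolvent set,
   Fredholm property, eigenspaces). *)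
Notation op V W := (set (V * W)).

Section Operators.
Context {K : numFieldType}.
Implicit Types V W : normedModType K.

Definition dom V W (T : op V W) : set V := [set x | exists y, T (x, y)].
Definition ran V W (T : op V W) : set W := [set y | exists x, T (x, y)].
Definition ker V W (T : op V W) : set V := [set x | T (x, 0)].
Definition inverse V W (T : op V W) : op W V := [set p | T (p.2, p.1)].
Definition restrict V W (T : op V W) (X : set V) : op V W :=
  T `&` [set p | X p.1].
Definition shift V (T : op V V) (z : K) : op V V :=
  [set p | T (p.1, p.2 + z *: p.1)].

(* The value T x; it is only meaningful for x in [dom T]. *)
Definition app V W (T : op V W) (x : V) : W := xget 0 [set y | T (x, y)].

Definition single_valued V W (T : op V W) : Prop :=
  forall y, T (0, y) -> y = 0.

Definition linear_operator V W (T : op V W) : Prop :=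
  [/\ T 0, (forall (c : K) p q, T p -> T q -> T (c *: p + q))
    & single_valued T].

Definition densely_defined V W (T : op V W) : Prop := dense (dom T).

Definition closable V W (T : op V W) : Prop := single_valued (closure T).

(* [X] is a core for the closed operator [T]. *)
Definition is_core V W (T : op V W) (X : set V) : Prop :=
  X `<=` dom T /\ closure (restrict T X) = T.

(* [L] is a linear subspace of dimension [n]. *)
Definition has_dim V (L : set V) (n : nat) : Prop :=
  exists v : 'I_n -> V,
    (forall c : 'I_n -> K, \sum_i c i *: v i = 0 -> forall i, c i = 0) /\
    L = [set \sum_i c i *: v i | c in [set: 'I_n -> K]].

Definition finite_dim V (L : set V) : Prop := exists n, has_dim L n.

Definition resolvent_set V (T : op V V) : set K :=
  [set z | exists2 Q : V -> V, continuous Q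
     & forall x y, shift T z (x, y) <-> x = Q y].

Definition spectrum V (T : op V V) : set K := ~` resolvent_set T.

Definition fredholm V (T : op V V) : Prop :=
  [/\ closed T, finite_dim (ker T), closed (ran T)
    & exists2 F : set V, finite_dim F
        & forall y, exists r f, [/\ ran T r, F f & y = r + f]].

Definition ess_spectrum V (T : op V V) : set K :=
  [set z | ~ fredholm (shift T z)].

Definition eigenvalue V (T : op V V) (z : K) : Prop :=
  exists2 x, x != 0 & T (x, z *: x).

End Operators.

Section HilbertOperators.
Context {R : realType}.
Implicit Types H : hilbertType R.

Definition adjoint H1 H2 (T : op H1 H2) : op H2 H1 :=
  [set p | forall q, T q -> '[q.2, p.1] = '[q.1, p.2]].

Definition self_adjoint H (T : op H H) : Prop :=
  densely_defined T /\ T = adjoint T.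

Definition bounded_from_below H (T : op H H) : Prop :=
  exists c : R, forall x y, T (x, y) -> c%:C * '[x, x] <= '[y, x].

Definition bounded_from_above H (T : op H H) : Prop :=
  exists c : R, forall x y, T (x, y) -> '[y, x] <= c%:C * '[x, x].

(* Projection-valued measures on the Borel sets of the real line;
   [diag E x] is the measure X |-> <E X x, x>. *)
Record pvm H := Pvm {
  proj :> set R -> H -> H;
  diag : H -> {measure set (measurableTypeR R) -> \bar R};
  proj_linear : forall X : set (measurableTypeR R), measurable X ->
    forall (c : R[i]) x y, proj X (c *: x + y) = c *: proj X x + proj X y;
  proj_sym : forall X : set (measurableTypeR R), measurable X ->
    forall x y, '[proj X x, y] = '[x, proj X y];
  projI : forall X Y : set (measurableTypeR R), measurable X -> measurable Y ->
    forall x, proj (X `&` Y) x = proj X (proj Y x);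
  projT : forall x, proj setT x = x;
  diagE : forall X : set (measurableTypeR R), measurable X ->
    forall x, (diag x X = (complex.Re '[proj X x, x])%:E)%E }.

(* [E] is the spectral measure of [T], i.e. T is the integral of t dE(t). *)
Definition is_spectral_measure H (E : pvm H) (T : op H H) : Prop :=
  (forall x, dom T x <-> (\int[diag E x]_t (t ^+ 2)%:E < +oo)%E) /\
  (forall x y, T (x, y) -> '[y, x] = (\int[diag E x]_t t)%R%:C).

(* [kappa_minus T k] means kappa_-(T) = k; in particular it is finite. *)
Definition kappa_minus H (T : op H H) (k : nat) : Prop :=
  exists2 E : pvm H, is_spectral_measure E T
    & has_dim (range (E `]-oo, 0[%classic)) k.

(* Sesquilinear forms; only the values on [fdom] x [fdom] are meaningful. *)
Record form H := Form { fdom : set H; fval :> H -> H -> R[i] }.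

Definition sesquilinear_on H (X : set H) (t : H -> H -> R[i]) : Prop :=
  forall c x y z, X x -> X y -> X z ->
    t (c *: x + y) z = c * t x z + t y z /\
    t z (c *: x + y) = c^* * t z x + t z y.

(* The closed form associated with the self-adjoint operator T: its domain is
   dom(|T|^(1/2)), given by the functional calculus for T, and its quadratic
   form is the integral of t d<E(t) x, x>. *)
Definition is_form_of H (T : op H H) (t : form H) : Prop :=
  exists2 E : pvm H, is_spectral_measure E T &
    [/\ fdom t = [set x | (\int[diag E x]_r `|r|%:E < +oo)%E],
        sesquilinear_on (fdom t) t
      & forall x, fdom t x -> t x x = (\int[diag E x]_r r)%R%:C].

(* The operator associated with a form (first representation theorem). *)
Definition form_operator H (t : form H) : op H H :=
  [set p | fdom t p.1 /\ forall y, fdom t y -> t p.1 y = '[p.2, y]].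

Section BlockOperator.
Variables H1 H2 : hilbertType R.
Variables (A : op H1 H1) (B : op H2 H1) (D : op H2 H2) (fa : form H1).

Definition block_operator0 : op (H1 * H2)%type (H1 * H2)%type :=
  [set q | [/\ dom A q.1.1, dom (adjoint B) q.1.1, dom B q.1.2, dom D q.1.2
    & q.2 = (app A q.1.1 + app B q.1.2,
             - app (adjoint B) q.1.1 + app D q.1.2)]].

Definition block_operator : op (H1 * H2)%type (H1 * H2)%type :=
  closure block_operator0.

Definition schur_form (l : R) : form H1 :=
  Form (fdom fa) (fun x y => fa x y - l%:C * '[x, y]
    + '[app (inverse (shift D l%:C)) (app (adjoint B) x),
        app (adjoint B) y]).

Definition schur_complement (l : R) : op H1 H1 :=
  form_operator (schur_form l).

(* The zero of s(.)[x] in (mu, oo), which is unique, and -oo if there is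
   none. *)
Definition rayleigh (mu : R) (x : H1) : \bar R :=
  xget -oo%E [set l%:E | l in [set l : R | mu < l /\ schur_form l x x = 0]].

End BlockOperator.

(* Variational characterisations for a functional [p] on X \ {0}. *)
Section Variational.
Variables (H : hilbertType R) (X : set H) (p : H -> \bar R).

Definition values_on (L : set H) : set (\bar R) :=
  [set p x | x in [set x | L x /\ x != 0]].

Definition subspaces_in (k : nat) : set (set H) :=
  [set L | L `<=` X /\ has_dim L k].

(* The suprema of p over L \ {0}, for L in X of dimension k. *)
Definition sups (k : nat) : set (\bar R) :=
  [set ereal_sup (values_on L) | L in subspaces_in k].

(* The suprema in [sups k] are maxima. *)
Definition sups_attained (k : nat) : Prop :=
  forall L, subspaces_in k L -> values_on L (ereal_sup (values_on L)).

(* The infima of p over the non-zero vectors of X orthogonal to L, for L of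
   dimension k. *)
Definition infs (k : nat) : set (\bar R) :=
  [set ereal_inf (values_on [set x | X x /\ forall y, L y -> '[x, y] = 0])
    | L in [set L : set H | has_dim L k]].

End Variational.

End HilbertOperators.

Definition is_min {R : realType} (X : set (\bar R)) (m : \bar R) : Prop :=
  X m /\ lbound X m.
Definition is_max {R : realType} (X : set (\bar R)) (m : \bar R) : Prop :=
  X m /\ ubound X m.

(* 1 <= j <= N, where N = None stands for N = oo. *)
Definition index_le (N : option nat) (j : nat) : bool :=
  (0 < j)%N && (if N is Some m then (j <= m)%N else true).

(* (lam j), 1 <= j <= N, lists in non-decreasing order the eigenvalues of T in
   I, each x being repeated dim ker(T - x) times (none if x is not an
   eigenvalue). *)
Definition lists_eigenvalues {R : realType} (V : normedModType R[i])
    (T : op V V) (I : set R) (N : option nat) (lam : nat -> R) : Prop :=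
  [/\ forall j, index_le N j -> I (lam j),
      forall i j, index_le N i -> index_le N j -> (i <= j)%N -> lam i <= lam j
    & forall x, I x -> exists2 m, has_dim (ker (shift T x%:C)) m
        & ([set j | index_le N j /\ lam j = x] #= `I_m)%card].

(* Main.v *)
(* For lambda > mu the resolvent equation of the block operator reduces, through
   its first component, to the weak equation s(lambda)[x, z] = <u, z> +
   <(D - lambda)^-1 v, B^* z>; so kernels, closed ranges and solvability of
   M - lambda and S(lambda) correspond.  The family s is decreasing: for l < l'
   one has s(l')[x] <= alpha s(l)[x] - beta |x|^2 with alpha >= 1, beta > 0, which
   makes kappa_-(S(.)) =: nu nondecreasing.  Near a point l where nu is finite
   slightly to the right, nu is left continuous and jumps by
   dim ker S(l) = dim ker (M - l) to the right of l; hence below the first point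
   where nu becomes infinite, which is lambda_e, the spectrum of M consists of the
   jumps of nu, and nu(gamma_0) + n <= nu(l) exactly when lambda_n < l.  As
   p(x) < l is equivalent to s(l)[x] < 0, the two variational principles are those
   for the negative and non-positive spectral subspaces of S(l).

   The spectral measure of S(l) comes from its bounded resolvent T, whose
   functional calculus starts from the positivity of f |-> <f(T)x, x> on
   polynomials f that are non-negative on [0, 1]. *)
From HB Require Import structures.
Require Import Defs.
From mathcomp Require Import ring lra measurable_realfun.

Set Implicit Arguments.
Unset Strict Implicit.
Unset Printing Implicit Defensive.

Import HBNNSimple.

(** * Hermitian forms and the Riesz representation *)

(** A spectral measure is only assumed to give the domain and the quadratic form of its operator,
    and [kappa_minus] accepts any such measure. Commutation of the projections with the operator is
    therefore derived, and the index is handled as the largest dimension of a subspace on which the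
    form is negative: this refers to no measure and is stable under small changes of lambda. The
    block operator is a closure whose domain is not explicit. The weak equation describes it exactly
    because, once a large constant is added in the first component only, the unclosed matrix has
    dense range and the solution operator of the weak equation is bounded. The number [mu] comes
    from a quadratic inequality in lambda - delta. Beyond [mu] the decrease of the resolvent term
    with lambda costs less than the decrease of -lambda |x|^2, up to a multiple of s(lambda)[x];
    hence beta > 0. The first point with infinite index to its right is essential because a Fredholm
    point gives S(lambda) closed range, closed range gives a spectral gap around 0, and a gap would
    keep the index finite a little further. *)

Section ComplexFacts.
Context {R : realType}.
Implicit Types (z w : R[i]) (r : R).

Lemma ReD z w : complex.Re (z + w) = complex.Re z + complex.Re w.
Proof. by case: z; case: w. Qed.
Lemma ReN z : complex.Re (- z) = - complex.Re z.
Proof. by case: z. Qed.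
Lemma ReZ r z : complex.Re (r%:C * z) = r * complex.Re z.
Proof. by case: z => a b /=; rewrite mul0r subr0. Qed.
Lemma ImD z w : complex.Im (z + w) = complex.Im z + complex.Im w.
Proof. by case: z; case: w. Qed.
Lemma conjCE z : z^* = Complex (complex.Re z) (- complex.Im z).
Proof. by case: z. Qed.
Lemma Re_conj z : complex.Re z^* = complex.Re z.
Proof. by case: z. Qed.
Lemma conj_real r : (r%:C)^* = r%:C :> R[i].
Proof. by rewrite conjCE /= oppr0. Qed.
Lemma complexE z : z = Complex (complex.Re z) (complex.Im z).
Proof. by case: z. Qed.
Lemma Re_sum (I : Type) (s : seq I) (P : pred I) (F : I -> R[i]) :
  complex.Re (\sum_(i <- s | P i) F i) = \sum_(i <- s | P i) complex.Re (F i).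
Proof. exact: (big_morph _ ReD). Qed.
End ComplexFacts.

Lemma le0_eps (R : realType) (a K : R) :
  (forall e, 0 < e -> a <= e * K) -> a <= 0.
Proof.
move=> h; case: (leP K 0) => K0; first by have := h 1 ltr01; lra.
rewrite leNgt; apply/negP => a0.
have := h (a / (2 * K)); rewrite divr_gt0 ?mulr_gt0// => /(_ isT).
have -> : a / (2 * K) * K = a / 2 by field; rewrite gt_eqF.
by lra.
Qed.

Lemma discriminant_le (R : realType) (a b d : R) : 0 <= d ->
  (forall t, 0 <= a + 2 * t * b + t ^+ 2 * d) -> b ^+ 2 <= a * d.
Proof.
rewrite le_eqVlt => /orP[/eqP d0|d0] q.
  rewrite -d0 mulr0; case: (eqVneq b 0) => [->|b0]; first by rewrite expr0n.
  (* If [d = 0] the polynomial is affine in [t], and this [t] gives it the value -1. *)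
  have := q (- (a + 1) / (2 * b)); rewrite -d0.
  have -> : 2 * (- (a + 1) / (2 * b)) * b = - (a + 1) by field.
  by move=> ?; exfalso; lra.
have := q (- b / d).
have -> : a + 2 * (- b / d) * b + (- b / d) ^+ 2 * d = (a * d - b ^+ 2) / d.
  by field; rewrite gt_eqF.
by rewrite pmulr_lge0 ?invr_gt0// subr_ge0.
Qed.

Lemma invS_lt (R : realType) (e : R) : 0 < e ->
  exists N : nat, forall n, (N <= n)%N -> n.+1%:R^-1 < e.
Proof.
move=> e0; exists (Num.bound e^-1) => n Nn.
rewrite -[ltRHS]invrK ltf_pV2 ?posrE ?invr_gt0//.
apply: lt_le_trans (archi_boundP _) _; first by rewrite ltW ?invr_gt0.
by rewrite ler_nat leqW.
Qed.

Definition subsp (K : pzRingType) (V : lmodType K) (X : set V) : Prop :=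
  X 0 /\ forall c x y, X x -> X y -> X (c *: x + y).

Section Subspaces.
Context {K : pzRingType} {V : lmodType K} {X : set V}.
Hypothesis hX : subsp X.

Lemma subsp0 : X 0. Proof. by case: hX. Qed.
Lemma subspP c x y : X x -> X y -> X (c *: x + y).
Proof. by case: hX => _; apply. Qed.
Lemma subspD x y : X x -> X y -> X (x + y).
Proof. by move=> Xx Xy; rewrite -(scale1r x); exact: subspP. Qed.
Lemma subspZ c x : X x -> X (c *: x).
Proof. by move=> Xx; rewrite -[_ *: _]addr0; apply: subspP => //; exact: subsp0. Qed.
Lemma subspN x : X x -> X (- x).
Proof. by rewrite -scaleN1r; exact: subspZ. Qed.
Lemma subspB x y : X x -> X y -> X (x - y).
Proof. by move=> Xx /subspN; exact: subspD. Qed.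
Lemma subsp_sum (I : Type) (r : seq I) (P : pred I) (F : I -> V) :
  (forall i, P i -> X (F i)) -> X (\sum_(i <- r | P i) F i).
Proof.
by move=> h; elim/big_rec: _ => [|i x Pi]; [exact: subsp0|apply: subspD; exact: h].
Qed.
End Subspaces.

Lemma subspT (K : pzRingType) (V : lmodType K) : subsp [set: V].
Proof. by split. Qed.

(** Forms are bare functions together with the set on which their values count, so inner products,
    restrictions, shifted forms and the forms of operators share one set of lemmas. *)
Definition hermitian_on (R : realType) (V : lmodType R[i]) (X : set V)
    (h : V -> V -> R[i]) : Prop :=
  [/\ subsp X,
      (forall c x y z, X x -> X y -> X z -> h (c *: x + y) z = c * h x z + h y z)
    & (forall x y, X x -> X y -> h y x = (h x y)^*)].

Definition nonneg_on (R : realType) (V : lmodType R[i]) (X : set V)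
    (h : V -> V -> R[i]) : Prop := forall x, X x -> 0 <= complex.Re (h x x).

(** Cauchy sequences and limits are measured by the quadratic form of [h], so a form domain serves
    as a Hilbert space without being given a norm of its own. *)
Definition complete_on (R : realType) (V : lmodType R[i]) (X : set V)
    (h : V -> V -> R[i]) : Prop :=
  forall u : nat -> V, (forall n, X (u n)) ->
   (forall e : R, 0 < e -> exists N : nat, forall m n, (N <= m)%N -> (N <= n)%N ->
      complex.Re (h (u m - u n) (u m - u n)) < e) ->
   exists2 l, X l & forall e : R, 0 < e -> exists N : nat, forall n, (N <= n)%N ->
      complex.Re (h (u n - l) (u n - l)) < e.

Section HermitianForm.
Context {R : realType} {V : lmodType R[i]} {X : set V} {h : V -> V -> R[i]}.
Hypothesis hh : hermitian_on X h.

Let sX : subsp X. Proof. by case: hh. Qed.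

Lemma formPl c x y z : X x -> X y -> X z -> h (c *: x + y) z = c * h x z + h y z.
Proof. by case: hh => _ + _; exact. Qed.
Lemma formC x y : X x -> X y -> h y x = (h x y)^*.
Proof. by case: hh => _ _; exact. Qed.
Lemma formPr c x y z : X x -> X y -> X z ->
  h z (c *: x + y) = c^* * h z x + h z y.
Proof.
move=> Xx Xy Xz; rewrite formC ?formPl//; last exact: subspP.
by rewrite rmorphD rmorphM /= -!formC.
Qed.
Lemma formDl x y z : X x -> X y -> X z -> h (x + y) z = h x z + h y z.
Proof. by move=> Xx Xy Xz; rewrite -[x in LHS]scale1r formPl// mul1r. Qed.
Lemma formDr x y z : X x -> X y -> X z -> h z (x + y) = h z x + h z y.
Proof.
by move=> Xx Xy Xz; rewrite -[x in LHS]scale1r formPr// conjCE /= oppr0 mul1r.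
Qed.
Lemma form0l z : X z -> h 0 z = 0.
Proof.
move=> Xz; have X0 := subsp0 sX; have := formDl X0 X0 Xz.
by rewrite addr0 => /(congr1 (fun t => t - h 0 z)); rewrite subrr addrK.
Qed.
Lemma form0r z : X z -> h z 0 = 0.
Proof.
by move=> Xz; rewrite formC ?form0l//; [rewrite conjC0|exact: subsp0].
Qed.
Lemma formZl c x z : X x -> X z -> h (c *: x) z = c * h x z.
Proof.
move=> Xx Xz; rewrite -[c *: x]addr0 formPl ?form0l ?addr0//; exact: subsp0.
Qed.
Lemma formZr c x z : X x -> X z -> h z (c *: x) = c^* * h z x.
Proof.
move=> Xx Xz; rewrite -[c *: x]addr0 formPr ?form0r ?addr0//; exact: subsp0.
Qed.
Lemma formNl x z : X x -> X z -> h (- x) z = - h x z.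
Proof. by move=> Xx Xz; rewrite -scaleN1r formZl// mulN1r. Qed.
Lemma formNr x z : X x -> X z -> h z (- x) = - h z x.
Proof.
by move=> Xx Xz; rewrite -scaleN1r formZr// rmorphN1 mulN1r.
Qed.
Lemma formBl x y z : X x -> X y -> X z -> h (x - y) z = h x z - h y z.
Proof. by move=> Xx Xy Xz; rewrite formDl ?formNl//; exact: subspN. Qed.
Lemma formBr x y z : X x -> X y -> X z -> h z (x - y) = h z x - h z y.
Proof. by move=> Xx Xy Xz; rewrite formDr ?formNr//; exact: subspN. Qed.
Lemma form_suml (I : Type) (r : seq I) (P : pred I) (F : I -> V) z :
  (forall i, P i -> X (F i)) -> X z ->
  h (\sum_(i <- r | P i) F i) z = \sum_(i <- r | P i) h (F i) z.
Proof.
move=> hF Xz; elim: r => [|a r IH]; first by rewrite !big_nil form0l.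
rewrite !big_cons; case: ifP => Pa //.
by rewrite formDl ?IH//; [exact: hF|exact: subsp_sum].
Qed.
Lemma form_sumr (I : Type) (r : seq I) (P : pred I) (F : I -> V) z :
  (forall i, P i -> X (F i)) -> X z ->
  h z (\sum_(i <- r | P i) F i) = \sum_(i <- r | P i) h z (F i).
Proof.
move=> hF Xz; elim: r => [|a r IH]; first by rewrite !big_nil form0r.
rewrite !big_cons; case: ifP => Pa //.
by rewrite formDr ?IH//; [exact: hF|exact: subsp_sum].
Qed.
Lemma form_diag_real x : X x -> h x x = (complex.Re (h x x))%:C.
Proof.
move=> Xx; have := formC Xx Xx; rewrite conjCE; case: (h x x) => a b /= [] hb.
by congr Complex; lra.
Qed.
Lemma Re_formC x y : X x -> X y -> complex.Re (h y x) = complex.Re (h x y).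
Proof. by move=> Xx Xy; rewrite formC// Re_conj. Qed.
(** Identities between expressions antilinear in [y] need checking for real parts only: replacing
    [y] by i y yields the imaginary part. *)
Lemma form_Im x y : X x -> X y ->
  complex.Im (h x y) = complex.Re (h x (Complex 0 1 *: y)).
Proof. by move=> Xx Xy; rewrite formZr//; case: (h x y) => a b /=; lra. Qed.

Lemma Re_form_expand (t : R) x z : X x -> X z ->
  complex.Re (h (x + t%:C *: z) (x + t%:C *: z)) =
  complex.Re (h x x) + 2 * t * complex.Re (h x z) + t ^+ 2 * complex.Re (h z z).
Proof.
move=> Xx Xz; have Xt : X (t%:C *: z) by exact: subspZ.
have Xs : X (x + t%:C *: z) by exact: subspD.
rewrite formDl// !formDr// !formZl// !formZr// !ReD conj_real !ReZ.
by rewrite (@Re_formC x z)//; ring.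
Qed.

Lemma Re_formD x z : X x -> X z ->
  complex.Re (h (x + z) (x + z)) =
  complex.Re (h x x) + 2 * complex.Re (h x z) + complex.Re (h z z).
Proof.
move=> Xx Xz; rewrite -[z in LHS](scale1r z) (@Re_form_expand 1)//.
by rewrite expr1n !mul1r mulr1.
Qed.

Lemma Re_formB x z : X x -> X z ->
  complex.Re (h (x - z) (x - z)) =
  complex.Re (h x x) - 2 * complex.Re (h x z) + complex.Re (h z z).
Proof.
move=> Xx Xz; rewrite Re_formD//; last exact: subspN.
by rewrite formNr// formNl ?formNr// ?opprK ?ReN; [ring|exact: subspN].
Qed.

Lemma Re_form_scale c x : X x ->
  complex.Re (h (c *: x) (c *: x)) =
  (complex.Re c ^+ 2 + complex.Im c ^+ 2) * complex.Re (h x x).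
Proof.
move=> Xx; rewrite formZl ?formZr//; last exact: subspZ.
rewrite [in LHS]form_diag_real// [in RHS]form_diag_real//; set r := complex.Re (h x x).
by rewrite conjCE; case: c => p q /=; ring.
Qed.

Lemma parallelogram x y : X x -> X y ->
  complex.Re (h (x + y) (x + y)) + complex.Re (h (x - y) (x - y)) =
  2 * complex.Re (h x x) + 2 * complex.Re (h y y).
Proof. by move=> Xx Xy; rewrite Re_formD// Re_formB//; ring. Qed.

Hypothesis h0 : nonneg_on X h.

Lemma form_le2 x y : X x -> X y ->
  complex.Re (h (x + y) (x + y)) <=
  2 * complex.Re (h x x) + 2 * complex.Re (h y y).
Proof.
by move=> Xx Xy; rewrite -parallelogram// lerDl; apply: h0; exact: subspB.
Qed.

Lemma form_CS x y : X x -> X y ->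
  complex.Re (h x y) ^+ 2 <= complex.Re (h x x) * complex.Re (h y y).
Proof.
move=> Xx Xy.
apply: discriminant_le => [|t]; first exact: h0.
by rewrite -Re_form_expand//; apply: h0; apply: subspD => //; exact: subspZ.
Qed.

Lemma form_CS0 x y : X x -> X y -> complex.Re (h x x) = 0 -> h x y = 0.
Proof.
move=> Xx Xy hx.
have z0 z : X z -> complex.Re (h x z) = 0.
  move=> Xz; have := form_CS Xx Xz; rewrite hx mul0r => e.
  by apply/eqP; rewrite -sqrf_eq0 eq_le e sqr_ge0.
rewrite [h x y]complexE form_Im// !z0//; exact: subspZ.
Qed.

(* The representing vector minimises [h z z - 2 f z]; a minimising sequence is
   Cauchy by the parallelogram law. *)
Lemma riesz (f : V -> R[i]) (C : R) :
  complete_on X h ->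
  (forall c x y, X x -> X y -> f (c *: x + y) = c^* * f x + f y) ->
  (forall z, X z -> complex.Re (f z) ^+ 2 <= C * complex.Re (h z z)) ->
  exists2 x, X x & forall z, X z -> h x z = f z.
Proof.
move=> hc fl fC.
pose F z := complex.Re (f z).
have X0 := subsp0 sX.
have f0 : f 0 = 0.
  have := fl 1 0 0 X0 X0.
  by rewrite scale1r addr0 conj_real mul1r => /(congr1 (fun t => t - f 0)); rewrite subrr addrK.
have FP (t : R) x z : X x -> X z -> F (x + t%:C *: z) = F x + t * F z.
  by move=> Xx Xz; rewrite /F addrC fl// conj_real ReD ReZ addrC.
pose J z := complex.Re (h z z) - 2 * F z.
have C0 : exists2 C', 0 <= C' & forall z, X z -> F z ^+ 2 <= C' * complex.Re (h z z).
  exists (Num.max C 0); first by rewrite le_max lexx orbT.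
  move=> z Xz; apply: le_trans (fC _ Xz) _; apply: ler_wpM2r; first exact: h0.
  by rewrite le_max lexx.
case: C0 => C' C'0 {}fC.
(* If J z < -C', then 0 <= g + C' < 2 F z, so (g + C')^2 < 4 C' g, against (g - C')^2 >= 0. *)
have Jlb z : X z -> - C' <= J z.
  move=> Xz; have := fC _ Xz; have := h0 Xz; rewrite /J.
  set g := complex.Re _ => g0 Fg; rewrite leNgt; apply/negP => lt.
  have : (g + C') ^+ 2 < (2 * F z) ^+ 2.
    by rewrite ltr_pXn2r ?nnegrE//; lra.
  have := sqr_ge0 (g - C'); nra.
pose S := [set J z | z in X].
have hS : has_inf S.
  by split; [exists (J 0), 0|exists (- C') => _ [z Xz <-]; exact: Jlb].
pose m := inf S.
have mJ z : X z -> m <= J z by move=> Xz; apply: ge_inf; [case: hS|exists z].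
have /boolp.choice[u hu] (n : nat) : exists x, X x /\ J x < m + n.+1%:R^-1.
  have e0 : 0 < n.+1%:R^-1 :> R by rewrite invr_gt0.
  by have [_ [z Xz <-] lt] := inf_adherent e0 hS; exists z.
have Xu n : X (u n) by case: (hu n).
have Ju (e : R) : 0 < e -> exists N : nat, forall n, (N <= n)%N -> J (u n) < m + e.
  move=> /invS_lt[N hN]; exists N => n Nn.
  by case: (hu n) => _ /lt_trans; apply; rewrite ltrD2l; exact: hN.
have [|x Xx ux] := hc u Xu.
  move=> e e0; have [//|N hN] := Ju (e / 4); first by lra.
  exists N => p q Np Nq.
  (* The midpoint of [u p] and [u q] has value at least [m], while both end points are below
     [m + e / 4]; the parallelogram law then bounds the form at their difference. *)
  have := mJ _ (subspZ sX (2^-1)%:C (subspD sX (Xu p) (Xu q))).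
  have Xpq := subspD sX (Xu p) (Xu q).
  rewrite /J Re_form_scale//= [2^-1 ^+ 2 + 0 ^+ 2]( _ : _ = 4^-1); last first.
    by field.
  have -> : F ((2^-1)%:C *: (u p + u q)) = 2^-1 * (F (u p) + F (u q)).
    have := FP 2^-1 0 _ X0 Xpq; rewrite add0r {2}/F f0 add0r => ->.
    by have := FP 1 _ _ (Xu p) (Xu q); rewrite scale1r mul1r => ->.
  have := parallelogram (Xu p) (Xu q).
  have := hN _ Np; have := hN _ Nq; rewrite /J; lra.
exists x => // z Xz.
have key w : X w -> complex.Re (h x w) = F w.
  move=> Xw; apply/eqP; rewrite -subr_eq0 -sqrf_eq0 eq_le sqr_ge0 andbT.
  apply: (@le0_eps _ _ (4 * complex.Re (h w w))) => e e0.
  have [N1 hN1] := Ju e e0; have [N2 hN2] := ux e e0.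
  pose n := maxn N1 N2.
  have {}hN1 := hN1 n (leq_maxl _ _); have {}hN2 := hN2 n (leq_maxr _ _).
  set g := complex.Re (h w w).
  have g0 : 0 <= g by exact: h0.
  (* Minimality of [m] along the line u n + t w, with J (u n) < m + e, makes a quadratic polynomial
     in t nonnegative; its discriminant gives the bound. *)
  have A1 : (complex.Re (h (u n) w) - F w) ^+ 2 <= e * g.
    apply: discriminant_le => // t.
    have := mJ _ (subspD sX (Xu n) (subspZ sX t%:C Xw)).
    by rewrite /J Re_form_expand// FP//; move: hN1; rewrite /J -/g; lra.
  have A2 := form_CS (subspB sX (Xu n) Xx) Xw.
  rewrite formBl// ReD ReN -/g in A2.
  have A3 : complex.Re (h (u n - x) (u n - x)) * g <= e * g.
    by apply: ler_wpM2r => //; exact: ltW.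
  set p := complex.Re (h x w); set q := complex.Re (h (u n) w) in A1 A2 *.
  have := sqr_ge0 ((q - p) + (q - F w)); rewrite -/p in A2; nra.
rewrite [LHS]complexE [RHS]complexE form_Im// !key//; last exact: subspZ.
rewrite /F -[Complex 0 1 *: z]addr0 fl// f0 addr0.
by case: (f z) => p q /=; congr Complex; ring.
Qed.

End HermitianForm.

(** * Finite-dimensional subspaces *)

Section FiniteDimension.
Context {K : numFieldType} {V : normedModType K}.
Implicit Types (L : set V).

Definition span n (v : 'I_n -> V) : set V :=
  [set \sum_i c i *: v i | c in [set: 'I_n -> K]].
Definition indep n (v : 'I_n -> V) : Prop :=
  forall c : 'I_n -> K, \sum_i c i *: v i = 0 -> forall i, c i = 0.
Definition vcons T (x : T) n (v : 'I_n -> T) (i : 'I_n.+1) : T :=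
  oapp v x (unlift ord0 i).

Lemma sum_vcons (x : V) n (v : 'I_n -> V) (c : 'I_n.+1 -> K) :
  \sum_i c i *: vcons x v i =
  c ord0 *: x + \sum_(i < n) c (lift ord0 i) *: v i.
Proof.
rewrite big_ord_recl /vcons unlift_none /=; congr (_ + _).
by apply: eq_bigr => i _; rewrite liftK.
Qed.

Lemma span_vcons (x : V) n (v : 'I_n -> V) (a : K) (c : 'I_n -> K) :
  span (vcons x v) (a *: x + \sum_i c i *: v i).
Proof.
exists (vcons a c) => //; rewrite sum_vcons /vcons unlift_none /=; congr (_ + _).
by apply: eq_bigr => i _; rewrite liftK.
Qed.

Lemma subsp_span n (v : 'I_n -> V) : subsp (span v).
Proof.
split.
  by exists (fun=> 0) => //; rewrite big1// => i _; rewrite scale0r.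
move=> a x y [c _ <-] [d _ <-]; exists (fun i => a * c i + d i) => //.
rewrite scaler_sumr -big_split/=; apply: eq_bigr => i _.
by rewrite scalerDl scalerA.
Qed.

Lemma span_sub n (v : 'I_n -> V) L : subsp L -> (forall i, L (v i)) ->
  span v `<=` L.
Proof.
by move=> sL vL _ [c _ <-]; apply: subsp_sum => // i _; exact: subspZ.
Qed.

Lemma mem_span n (v : 'I_n -> V) i : span v (v i).
Proof.
exists (fun j => (j == i)%:R) => //; rewrite (bigD1 i)//= eqxx scale1r big1 ?addr0//.
by move=> j /negPf ->; rewrite scale0r.
Qed.

Lemma has_dim_span n (v : 'I_n -> V) : indep v -> has_dim (span v) n.
Proof. by move=> iv; exists v. Qed.

Lemma indep_vcons (x : V) n (v : 'I_n -> V) :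
  indep v -> ~ span v x -> indep (vcons x v).
Proof.
move=> iv nx c; rewrite sum_vcons => e.
have c0 : c ord0 = 0.
  apply/eqP/negP => /negP c0; apply: nx.
  exists (fun i => - (c ord0)^-1 * c (lift ord0 i)) => //.
  under eq_bigr do rewrite -scalerA; rewrite -scaler_sumr.
  move: e => /eqP; rewrite addrC addr_eq0 => /eqP ->.
  by rewrite scaleNr scalerN opprK scalerA mulVf// scale1r.
move=> i; case: (unliftP ord0 i) => [j ->|->//].
by apply: (iv (fun i => c (lift ord0 i))); rewrite c0 scale0r add0r in e.
Qed.

Lemma nontrivial_relation d n (M : 'I_d -> 'I_n -> K) : (n < d)%N ->
  exists2 c : 'I_d -> K, (exists i, c i != 0) &
    forall j, \sum_i c i * M i j = 0.
Proof.
move=> nd; pose A := \matrix_(i, j) M i j.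
have : kermx A != 0.
  rewrite -mxrank_eq0 mxrank_ker -lt0n subn_gt0.
  by apply: leq_ltn_trans nd; exact: rank_leq_col.
have := mulmx_ker A; move: (kermx A) => N NA /matrix0Pn[i [j Nij]].
exists (N i); first by exists j.
move=> k; have /matrixP/(_ i k) := NA; rewrite !mxE => e; rewrite -[RHS]e.
by apply: eq_bigr => l _; rewrite mxE.
Qed.

Lemma indep_le L m k (w : 'I_k -> V) :
  has_dim L m -> indep w -> (forall i, L (w i)) -> (k <= m)%N.
Proof.
move=> [v [iv ->]] iw wL; rewrite leqNgt; apply/negP => mk.
have /boolp.choice[M hM] (i : 'I_k) : exists c : 'I_m -> K, w i = \sum_j c j *: v j.
  by have [c _ <-] := wL i; exists c.
have [c [i ci] hc] := nontrivial_relation M mk.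
move: ci; rewrite (iw c) ?eqxx//.
under eq_bigr do rewrite hM scaler_sumr.
rewrite exchange_big/= big1// => j _.
under eq_bigr do rewrite scalerA; rewrite -scaler_suml.
by rewrite hc scale0r.
Qed.

Lemma has_dim_le L L' m n : has_dim L m -> has_dim L' n -> L `<=` L' -> (m <= n)%N.
Proof.
move=> [v [iv ->]] hL' LL'; apply: (indep_le hL' iv) => i; apply: LL'.
exact: mem_span.
Qed.

Lemma has_dim_uniq L m n : has_dim L m -> has_dim L n -> m = n.
Proof.
move=> hm hn; apply/eqP; rewrite eqn_leq.
by rewrite (has_dim_le hm hn)// (has_dim_le hn hm).
Qed.

Lemma has_dim_eq L L' n : has_dim L n -> has_dim L' n -> L `<=` L' -> L = L'.
Proof.
move=> [v [iv ->]] hL' LL'; apply/seteqP; split=> // x L'x.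
apply: contrapT => nx; have := indep_le hL' (indep_vcons iv nx).
rewrite ltnn => h; apply: notF; apply: h => i; rewrite /vcons.
by case: unliftP => [j _|_] //=; apply: LL'; exact: mem_span.
Qed.

(** A longest independent family in [L] spans it, since a vector outside the span would lengthen it.
    This produces dimensions where only a bound on independent families is known. *)
Lemma finite_dim_bound L n : subsp L ->
  (forall k (w : 'I_k -> V), indep w -> (forall i, L (w i)) -> (k <= n)%N) ->
  exists2 m, (m <= n)%N & has_dim L m.
Proof.
move=> sL h.
pose P k := `[< exists2 w : 'I_k -> V, indep w & forall i, L (w i) >].
have exP : exists k, P k.
  by exists 0; apply/asboolP; exists (fun=> 0) => [c _ []|[]].
have bP k : P k -> (k <= n)%N by move=> /asboolP[w]; exact: h.
case: (ex_maxnP exP bP) => m /asboolP[w iw wL] mmax.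
exists m; first exact: h iw wL.
exists w; split => //; apply/seteqP; split; last exact: span_sub.
move=> x Lx; apply: contrapT => nx.
suff /mmax : P m.+1 by rewrite ltnn.
apply/asboolP; exists (vcons x w); first exact: indep_vcons.
by move=> i; rewrite /vcons; case: unliftP => [j _|_] /=.
Qed.

Lemma has_dim_extend L n k : has_dim L n -> ~ finite_dim [set: V] ->
  exists2 L', L `<=` L' & has_dim L' (n + k)%N.
Proof.
move=> hL inf; elim: k => [|k [L' LL' [v [iv eL']]]]; first by exists L; rewrite ?addn0.
have [x nx] : exists x, ~ L' x.
  apply/existsNP => all; apply: inf; exists (n + k)%N, v; split => //.
  by rewrite -[X in _ = X]eL'; apply/seteqP; split.
exists (span (vcons x v)).
  move=> y /LL'; rewrite eL' => -[c _ <-].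
  by have := span_vcons x v 0 c; rewrite scale0r add0r.
by rewrite addnS; apply: has_dim_span; apply: indep_vcons => //; rewrite eL' in nx.
Qed.

Lemma not_finite_dim_indep L : subsp L -> ~ finite_dim L ->
  forall n, exists2 v : 'I_n -> V, indep v & forall i, L (v i).
Proof.
move=> sL nf n; apply: contrapT => h; apply: nf.
have [m _ hm] : exists2 m, (m <= n)%N & has_dim L m.
  apply: finite_dim_bound => // k w iw wL; rewrite leqNgt; apply/negP => nk.
  (* The first [n] members of the longer family will do; padding coefficients with zeros reduces
     their independence to that of [w]. *)
  apply: h; pose f (i : 'I_n) := w (widen_ord (ltnW nk) i).
  exists f => [c e i|i]; last exact: wL.
  pose c' (j : 'I_k) := oapp c 0 (insub (j : nat)).
  have c'w (l : 'I_n) : c' (widen_ord (ltnW nk) l) = c l.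
    by rewrite /c' insubT/=; [exact: ltn_ord|move=> p; congr c; exact: val_inj].
  rewrite -c'w; apply: iw.
  rewrite (bigID (fun j : 'I_k => (j < n)%N))/= [X in _ + X]big1 ?addr0; last first.
    by move=> j jn; rewrite /c' insubN ?scale0r.
  rewrite -[RHS]e [RHS](eq_bigr (fun l : 'I_n => c' (widen_ord (ltnW nk) l) *: w (widen_ord (ltnW nk) l))).
    rewrite (big_ord_narrow_cond (P := xpredT) (ltnW nk))/=.
    by [].
  by move=> l _; rewrite c'w.
by exists m.
Qed.

(** Only the first [k] basis vectors of [L2] are adjoined. With [k = b] this is the full direct sum,
    with [L1] trivial it yields subspaces of every smaller dimension, and in the max-min principle
    it places a subspace between the negative and the non-positive spectral subspace. *)
Lemma has_dim_direct L1 L2 a b k : has_dim L1 a -> has_dim L2 b ->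
  (forall x, L1 x -> L2 x -> x = 0) -> (k <= b)%N ->
  exists2 L, has_dim L (a + k)%N
    & [/\ L1 `<=` L, forall x, L x -> exists y z, [/\ L1 y, L2 z & x = y + z]
       & k = b -> forall y z, L1 y -> L2 z -> L (y + z)].
Proof.
move=> [v [iv eL1]] [w [iw eL2]] I kb.
pose u (i : 'I_(a + k)) := match fintype.split i with
  | inl j => v j | inr j => w (widen_ord kb j) end.
have uE (c : 'I_(a + k) -> K) : \sum_i c i *: u i =
    \sum_i c (lshift k i) *: v i + \sum_i c (rshift a i) *: w (widen_ord kb i).
  rewrite big_split_ord/=; congr (_ + _); apply: eq_bigr => i _; rewrite /u.
    by rewrite (unsplitK (inl i)).
  by rewrite (unsplitK (inr i)).
have L2w (c : 'I_k -> K) : L2 (\sum_i c i *: w (widen_ord kb i)).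
  rewrite eL2; apply: subsp_sum; first exact: subsp_span.
  by move=> i _; apply: subspZ; [exact: subsp_span|exact: mem_span].
have iw' : indep (fun i => w (widen_ord kb i)).
  move=> c e i.
  pose c' (j : 'I_b) := oapp c 0 (insub (j : nat)).
  have c'w (l : 'I_k) : c' (widen_ord kb l) = c l.
    by rewrite /c' insubT/=; [exact: ltn_ord|move=> p; congr c; exact: val_inj].
  rewrite -c'w; apply: iw.
  rewrite (bigID (fun j : 'I_b => (j < k)%N))/= [X in _ + X]big1 ?addr0; last first.
    by move=> j jn; rewrite /c' insubN ?scale0r.
  rewrite -[RHS]e [RHS](eq_bigr (fun l : 'I_k => c' (widen_ord kb l) *: w (widen_ord kb l))).
    rewrite (big_ord_narrow_cond (P := xpredT) kb)/=.
    by [].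
  by move=> l _; rewrite c'w.
exists (span u); first apply: has_dim_span.
  move=> c; rewrite uE => e.
  have e1 : \sum_i c (lshift k i) *: v i = 0.
    apply: I; first by rewrite eL1; exists (fun i => c (lshift k i)).
    move: e => /eqP; rewrite addr_eq0 => /eqP ->; rewrite -scaleN1r.
    by apply: subspZ; [rewrite eL2; exact: subsp_span|exact: (L2w (fun i => c (rshift a i)))].
  move: e; rewrite e1 add0r => e2 i; rewrite -(splitK i); case: (fintype.split i) => j /=.
    exact: (iv (fun i => c (lshift k i))).
  exact: (iw' (fun i => c (rshift a i))).
split.
- rewrite eL1 => _ [c _ <-]; exists (fun i => if fintype.split i is inl j then c j else 0) => //.
  rewrite uE [X in _ + X]big1 ?addr0.
    by apply: eq_bigr => i _; rewrite (unsplitK (inl i)).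
  by move=> i _; rewrite (unsplitK (inr i)) scale0r.
- move=> _ [c _ <-]; rewrite uE; exists (\sum_i c (lshift k i) *: v i).
exists (\sum_i c (rshift a i) *: w (widen_ord kb i)); split => //.
by rewrite eL1; exists (fun i => c (lshift k i)).
- move=> kb' y z; rewrite eL1 eL2 => -[c _ <-] [d _ <-].
exists (fun i => match fintype.split i with inl j => c j | inr j => d (widen_ord kb j) end) => //.
rewrite uE; congr (_ + _).
  by apply: eq_bigr => i _; rewrite (unsplitK (inl i)).
move: w iw eL2 @u uE L2w iw' d; case: b / kb' kb => kk w _ _ u _ _ _ d; apply: eq_bigr => i _.
by rewrite (unsplitK (inr i)) (_ : widen_ord kk i = i)//; exact: val_inj.
Qed.

End FiniteDimension.

Section Orthonormal.
Context {R : realType} {V : normedModType R[i]} {X : set V} {h : V -> V -> R[i]}.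
Hypothesis hh : hermitian_on X h.

(** Gram-Schmidt for [h], which need be positive on [L] alone; the forms used include -s(lambda) on
    a negative subspace. The recursion treats the tail of the basis and normalises the head vector
    last. *)
Lemma orthonormal_basis n L : has_dim L n -> L `<=` X ->
  (forall x, L x -> x != 0 -> 0 < complex.Re (h x x)) ->
  exists e : 'I_n -> V, [/\ forall i, L (e i),
    forall i j, h (e i) (e j) = (i == j)%:R
    & forall x, L x -> x = \sum_i h x (e i) *: e i].
Proof.
elim: n L => [|n IH] L [v [iv eL]] LX pos.
  exists v; split; [by case|by case|].
  by move=> x; rewrite eL => -[c _ <-]; rewrite !big_ord0.
pose v' i := v (lift ord0 i).
have iv' : indep v'.
  move=> c e i; have := iv (vcons 0 c).
  rewrite big_ord_recl {1}/vcons unlift_none /= scale0r add0r.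
  under eq_bigr do rewrite /vcons liftK /=.
  by move=> /(_ e) /(_ (lift ord0 i)); rewrite /vcons liftK.
have LL : span v' `<=` L.
  rewrite eL; apply: span_sub; first exact: subsp_span.
  by move=> i; exact: mem_span.
have [e [eL' eo ex]] := IH _ (has_dim_span iv') (subset_trans LL LX)
   (fun x Lx => pos x (LL x Lx)).
have Lv i : L (v i) by rewrite eL; exact: mem_span.
have sL : subsp L by rewrite eL; exact: subsp_span.
have Le i : L (e i) by apply: LL.
pose s := \sum_i h (v ord0) (e i) *: e i.
have Ls : L s by apply: subsp_sum => // i _; exact: subspZ.
have s's : span v' s by apply: subsp_sum; [exact: subsp_span|move=> i _; apply: subspZ => //; exact: subsp_span].
pose w := v ord0 - s.
have Lw : L w by exact: subspB.
have w0 : w != 0.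
  apply/negP => /eqP w0; case: s's => c _ ec.
  have := iv (vcons (-1) c); rewrite big_ord_recl {1}/vcons unlift_none /=.
  under eq_bigr do rewrite /vcons liftK /=.
  rewrite ec scaleN1r addrC -opprB -/w w0 oppr0 => /(_ erefl ord0).
  by rewrite /vcons unlift_none /= => /eqP; rewrite oppr_eq0 oner_eq0.
have we j : h w (e j) = 0.
  rewrite (formBl hh)//; [|by apply: LX..].
  rewrite (form_suml hh)//; [|by move=> i _; apply: LX; exact: subspZ|by apply: LX].
  rewrite (bigD1 j)//= (formZl hh) ?eo ?eqxx ?mulr1//; [|by apply: LX..].
  rewrite big1 ?addr0 ?subrr// => i ij.
  by rewrite (formZl hh) ?eo ?(negPf ij) ?mulr0//; apply: LX.
have pw := pos _ Lw w0.
pose r := (Num.sqrt (complex.Re (h w w)))^-1.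
have r0 : 0 < r by rewrite invr_gt0 sqrtr_gt0.
pose e0 := r%:C *: w.
have Le0 : L e0 by exact: subspZ.
have e0e j : h e0 (e j) = 0 by rewrite (formZl hh) ?we ?mulr0//; exact: LX.
have ee0 j : h (e j) e0 = 0.
  by rewrite (formC hh (LX _ Le0)) ?e0e ?conjC0//; exact: LX.
have e00 : h e0 e0 = 1.
  rewrite (formZl hh) ?(formZr hh)//; [|by apply: LX..].
  rewrite conj_real (form_diag_real hh (LX _ Lw)) -[1]/(1%:C) -!rmorphM/=.
  congr (_%:C); rewrite /r -[X in _ * (_ * X)]sqr_sqrtr ?ltW// expr2.
  by field; rewrite gt_eqF// sqrtr_gt0.
have sp x : L x -> exists2 y, span v' y & exists a, x = a *: e0 + y.
  rewrite eL => -[c _ <-]; rewrite big_ord_recl.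
  exists (c ord0 *: s + \sum_(i < n) c (lift ord0 i) *: v (lift ord0 i)).
    apply: subspP; [exact: subsp_span|by []|].
    by exists (fun i => c (lift ord0 i)).
  exists (c ord0 * (r%:C)^-1); rewrite addrA; congr (_ + _).
  rewrite /e0 scalerA mulfVK; last by rewrite eq_complex /= eqxx andbT gt_eqF.
  by rewrite -scalerDr subrK.
exists (vcons e0 e); split.
- by move=> i; rewrite /vcons; case: unliftP => [j _|_] /=.
- move=> i j; rewrite /vcons.
  case: (unliftP ord0 i) => [i' ->|->]; case: (unliftP ord0 j) => [j' ->|->] /=.
  + by rewrite eo (inj_eq lift_inj).
  + by rewrite ee0.
  + by rewrite e0e.
  + by rewrite e00.
- move=> x /sp[y sy [a ->]].
  have Ly : L y by exact: LL.
  have Xy := LX _ Ly; have Xe i := LX _ (Le i); have Xe0 := LX _ Le0.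
  have ye0 : h y e0 = 0.
    rewrite (ex _ sy) (form_suml hh)// => [|i _]; last by apply: (LX); exact: subspZ.
    by rewrite big1// => i _; rewrite (formZl hh)// ee0 mulr0.
  rewrite big_ord_recl /vcons unlift_none /= (formPl hh)// e00 ye0 addr0 mulr1.
  congr (_ + _); rewrite [LHS](ex _ sy); apply: eq_bigr => i _.
  by rewrite liftK /= (formPl hh)// e0e mulr0 add0r.
Qed.

(** This replaces compactness of the unit sphere of [L]: in an [h]-orthonormal basis [g] is a finite
    matrix, and [C] is read off from its entries. *)
Lemma finite_dim_form_bound n L (g : V -> V -> R[i]) :
  hermitian_on X g -> has_dim L n -> L `<=` X ->
  (forall x, L x -> x != 0 -> 0 < complex.Re (h x x)) ->
  exists2 C, 0 < C & forall x, L x -> complex.Re (g x x) <= C * complex.Re (h x x).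
Proof.
move=> hg hL LX pos.
have [e [Le eo ex]] := orthonormal_basis hL LX pos.
pose N z : R := complex.Re z ^+ 2 + complex.Im z ^+ 2.
(* A crude bound, [N] being the squared modulus: |z| |w| |c| <= (|z|^2 + |w|^2) (|c|^2 + 1). *)
have ReM (z w : R[i]) (c : R[i]) : complex.Re (z * (w^* * c)) <= (N z + N w) * (N c + 1).
  rewrite /N; case: z => a b; case: w => p q; case: c => u v; rewrite conjCE /=.
  have h1 := sqr_ge0 (u - 1); have h2 := sqr_ge0 (u + 1).
  have h3 := sqr_ge0 (v - 1); have h4 := sqr_ge0 (v + 1).
  set P := a * p + b * q; set Q := a * q - b * p.
  have -> : a * (p * u - - q * v) - b * (p * v + - q * u) = P * u + Q * v.
    by rewrite /P /Q; ring.
  have PQ : P ^+ 2 + Q ^+ 2 = (a ^+ 2 + b ^+ 2) * (p ^+ 2 + q ^+ 2).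
    by rewrite /P /Q; ring.
  set A := a ^+ 2 + b ^+ 2; set B := p ^+ 2 + q ^+ 2; set E := u ^+ 2 + v ^+ 2.
  have A0 : 0 <= A by rewrite /A addr_ge0 ?sqr_ge0.
  have B0 : 0 <= B by rewrite /B addr_ge0 ?sqr_ge0.
  have E0 : 0 <= E by rewrite /E addr_ge0 ?sqr_ge0.
  have : (P * u + Q * v) ^+ 2 <= ((A + B) * (E + 1)) ^+ 2.
    have : (P * u + Q * v) ^+ 2 <= (A * B) * E.
      by rewrite /A /B -PQ /E; have := sqr_ge0 (P * v - Q * u); lra.
    move=> /le_trans; apply; rewrite exprMn.
    apply: ler_pM; rewrite ?mulr_ge0//; first by have := mulr_ge0 A0 B0; nra.
    by have := sqr_ge0 E; lra.
  move=> hsq; apply: le_trans (ler_norm _) _.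
  have S0 : 0 <= (A + B) * (E + 1) by apply: mulr_ge0; lra.
  by rewrite -(ler_pXn2r (n := 2)) ?nnegrE// -normrX ger0_norm// sqr_ge0.
have Xe i := LX _ (Le i).
have N0 z : 0 <= N z by rewrite /N addr_ge0 ?sqr_ge0.
pose M := \sum_i \sum_j (N (g (e i) (e j)) + 1).
have M0 : 0 <= M by apply: sumr_ge0 => i _; apply: sumr_ge0 => j _; rewrite addr_ge0.
exists (2 * M + 1); first by lra.
move=> x Lx; have sX : subsp X by case: hh.
have Xx := LX _ Lx.
have XP i : X (h x (e i) *: e i) by exact: subspZ.
have hx : complex.Re (h x x) = \sum_i N (h x (e i)).
  have -> : h x x = \sum_i h x (e i) * h (e i) x.
    rewrite {1}(ex _ Lx) (form_suml hh)//.
    by apply: eq_bigr => i _; rewrite (formZl hh).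
  rewrite Re_sum; apply: eq_bigr => i _; rewrite (formC hh Xx)//.
  by rewrite conjCE /N; case: (h x (e i)) => a b /=; ring.
have Nle i : N (h x (e i)) <= complex.Re (h x x).
  by rewrite hx (bigD1 i)//= lerDl sumr_ge0.
have hx0 : 0 <= complex.Re (h x x) by rewrite hx sumr_ge0.
have -> : g x x = \sum_i \sum_j h x (e i) * ((h x (e j))^* * g (e i) (e j)).
  rewrite {1}(ex _ Lx) (form_suml hg)//; apply: eq_bigr => i _.
  rewrite (formZl hg)// -mulr_sumr; congr (_ * _).
  rewrite {1}(ex _ Lx) (form_sumr hg)//; apply: eq_bigr => j _.
  by rewrite (formZr hg).
rewrite Re_sum; apply: (@le_trans _ _ (\sum_i \sum_j 2 * complex.Re (h x x) * (N (g (e i) (e j)) + 1))).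
  apply: ler_sum => i _; rewrite Re_sum; apply: ler_sum => j _.
  apply: le_trans (ReM _ _ _) _; apply: ler_wpM2r; first by rewrite addr_ge0.
  by have := Nle i; have := Nle j; lra.
under eq_bigr do rewrite -mulr_sumr.
by rewrite -mulr_sumr -/M; nra.
Qed.

End Orthonormal.

(** The norm takes values in [R[i]]; its square as a real number turns estimates into polynomial
    inequalities over [R]. *)
Definition nsq (R : realType) (H : hilbertType R) (x : H) : R :=
  complex.Re '[x, x].

Lemma gt0_complexE (R : realType) (e : R[i]) : 0 < e -> exists2 r : R, 0 < r & e = r%:C.
Proof.
case: e => a b; rewrite ltcE /= => /andP[/eqP -> a0]; exists a => //.
Qed.

(** * Hilbert space geometry *)

Section HilbertBasics.
Context {R : realType} {H : hilbertType R}.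
Implicit Types x y z : H.

Lemma inner_hermitian : hermitian_on [set: H] (@inner R H).
Proof.
split; first exact: subspT.
  by move=> c x y z _ _ _; rewrite /inner linearPl.
by move=> x y _ _; rewrite /inner hermC expr0 mul1r.
Qed.

Lemma nsqE x : '[x, x] = (nsq x)%:C.
Proof. exact: (form_diag_real inner_hermitian). Qed.

Lemma norm_nsq x : `|x| ^+ 2 = (nsq x)%:C.
Proof. by rewrite norm_ip -nsqE. Qed.

Lemma nsq_ge0 x : 0 <= nsq x.
Proof. by rewrite -lecR -norm_nsq exprn_ge0. Qed.

Lemma inner_nonneg : nonneg_on [set: H] (@inner R H).
Proof. by move=> x _; exact: nsq_ge0. Qed.

Lemma nsq_eq0 x : nsq x = 0 -> x = 0.
Proof.
move=> e; apply/eqP; rewrite -normr_eq0 -sqrf_eq0 norm_nsq e.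
by [].
Qed.

Lemma nsq0 : nsq (0 : H) = 0.
Proof. by rewrite /nsq (form0l inner_hermitian). Qed.

Lemma nsq_gt0 x : x != 0 -> 0 < nsq x.
Proof.
by move=> x0; rewrite lt_neqAle nsq_ge0 andbT eq_sym; apply: contraNneq x0 => /nsq_eq0 ->.
Qed.

Lemma normE x : `|x| = (Num.sqrt (nsq x))%:C.
Proof.
apply/eqP; rewrite -(@eqrXn2 _ 2)// ?norm_nsq.
  by rewrite -rmorphXn/= sqr_sqrtr ?nsq_ge0.
by rewrite lecR sqrtr_ge0.
Qed.

Lemma normr_lt x (e : R) : 0 < e -> (`|x| < e%:C) = (nsq x < e ^+ 2).
Proof.
move=> e0; rewrite normE ltcR -[in RHS](sqr_sqrtr (nsq_ge0 x)).
by rewrite ltr_pXn2r// nnegrE ?sqrtr_ge0// ltW.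
Qed.

Lemma nsqD_le x y : nsq (x + y) <= 2 * nsq x + 2 * nsq y.
Proof. exact: (form_le2 inner_hermitian inner_nonneg). Qed.
Lemma nsqN x : nsq (- x) = nsq x.
Proof. by rewrite /nsq (formNl inner_hermitian)// (formNr inner_hermitian)// opprK. Qed.
Lemma nsqC x y : nsq (x - y) = nsq (y - x).
Proof. by rewrite -opprB nsqN. Qed.
Lemma nsqZ (c : R[i]) x :
  nsq (c *: x) = (complex.Re c ^+ 2 + complex.Im c ^+ 2) * nsq x.
Proof. exact: (Re_form_scale inner_hermitian). Qed.
Lemma innerDl x y z : '[x + y, z] = '[x, z] + '[y, z].
Proof. exact: (formDl inner_hermitian). Qed.
Lemma innerDr x y z : '[z, x + y] = '[z, x] + '[z, y].
Proof. exact: (formDr inner_hermitian). Qed.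
Lemma innerBl x y z : '[x - y, z] = '[x, z] - '[y, z].
Proof. exact: (formBl inner_hermitian). Qed.
Lemma innerBr x y z : '[z, x - y] = '[z, x] - '[z, y].
Proof. exact: (formBr inner_hermitian). Qed.
Lemma innerZl (c : R[i]) x z : '[c *: x, z] = c * '[x, z].
Proof. exact: (formZl inner_hermitian). Qed.
Lemma innerZr (c : R[i]) x z : '[z, c *: x] = c^* * '[z, x].
Proof. exact: (formZr inner_hermitian). Qed.
Lemma inner0l x : '[0, x] = 0.
Proof. exact: (form0l inner_hermitian). Qed.
Lemma inner0r x : '[x, 0] = 0.
Proof. exact: (form0r inner_hermitian). Qed.
Lemma innerNl x z : '[- x, z] = - '[x, z].
Proof. exact: (formNl inner_hermitian). Qed.
Lemma innerC x y : '[y, x] = '[x, y]^*.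
Proof. exact: (formC inner_hermitian). Qed.
Lemma Re_innerC x y : complex.Re '[y, x] = complex.Re '[x, y].
Proof. exact: (Re_formC inner_hermitian). Qed.
Lemma inner_CS x y : complex.Re '[x, y] ^+ 2 <= nsq x * nsq y.
Proof. exact: (form_CS inner_hermitian inner_nonneg). Qed.
Lemma inner_eq0 x : '[x, x] = 0 -> x = 0.
Proof. by rewrite nsqE => -[] /nsq_eq0. Qed.

Lemma ball_nsq x y (e : R) : 0 < e -> ball x e%:C y <-> nsq (x - y) < e ^+ 2.
Proof. by move=> e0; rewrite -ball_normE /ball_ /= normr_lt. Qed.

Lemma hilbert_complete : complete_on [set: H] (@inner R H).
Proof.
move=> u _ uc.
have /cauchy_cvg/cvg_ex[l ul] : cauchy (u @ \oo).
  apply/cauchy_ballP => e e0.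
  have [r r0 ->] := gt0_complexE e0.
  have [|N hN] := uc (r ^+ 2); first exact: exprn_gt0.
  exists (u @` [set n | (N <= n)%N], u @` [set n | (N <= n)%N]) => /=.
    by split; exists N => // n /= Nn; exists n.
  move=> [a b] /= [[m Nm <-] [n Nn <-]].
  by rewrite ball_nsq//; exact: hN.
exists l => // e e0.
have /cvg_ballP/(_ (Num.sqrt e)%:C) := ul.
rewrite ltcR sqrtr_gt0 => /(_ e0) [N _ hN]; exists N => n Nn.
have := hN n Nn; rewrite /= ball_nsq ?sqrtr_gt0// sqr_sqrtr ?ltW//.
by rewrite nsqC.
Qed.

End HilbertBasics.

Section ClosureBall.
Context {R : realType}.

Lemma closure_ballP (T : pseudoMetricType R[i]) (A : set T) p :
  closure A p <-> forall e : R, 0 < e -> exists2 q, A q & ball p e%:C q.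
Proof.
split=> [cA e e0|h U /nbhs_ballP[e /= /gt0_complexE[r r0 ->] bU]].
  have [|q [Aq bq]] := cA (ball p e%:C); first by apply: nbhsx_ballx; rewrite ltcR.
  by exists q.
by have [q Aq bq] := h r r0; exists q; split => //; exact: bU.
Qed.

Lemma continuous_ballP (T T' : pseudoMetricType R[i]) (f : T -> T') :
  (forall p (e : R), 0 < e -> exists2 d : R, 0 < d &
     forall q, ball p d%:C q -> ball (f p) e%:C (f q)) -> continuous f.
Proof.
move=> h p; apply/cvg_ballP => e /gt0_complexE[r r0 ->].
have [d d0 hd] := h p r r0; apply/nbhs_ballP; exists d%:C; first by rewrite /= ltcR.
by move=> q /hd.
Qed.

Lemma continuous_ball (T T' : pseudoMetricType R[i]) (f : T -> T') p (e : R) :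
  continuous f -> 0 < e -> exists2 d : R, 0 < d &
     forall q, ball p d%:C q -> ball (f p) e%:C (f q).
Proof.
move=> cf e0; have /cvg_ballP/(_ e%:C) := cf p.
rewrite ltcR => /(_ e0)/nbhs_ballP[d /= /gt0_complexE[r r0 ->] hd].
by exists r.
Qed.

Lemma closure_nsqP (H : hilbertType R) (A : set H) p :
  closure A p <-> forall e : R, 0 < e -> exists2 q, A q & nsq (p - q) < e.
Proof.
rewrite closure_ballP; split=> h e e0.
  have [|q Aq] := h (Num.sqrt e); first by rewrite sqrtr_gt0.
  by rewrite ball_nsq ?sqrtr_gt0// sqr_sqrtr ?ltW//; exists q.
have [|q Aq bq] := h (e ^+ 2); first exact: exprn_gt0.
by exists q => //; rewrite ball_nsq.
Qed.

Lemma closure2_nsqP (H K : hilbertType R) (A : set (H * K)%type) p :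
  closure A p <-> forall e : R, 0 < e ->
   exists2 q, A q & nsq (p.1 - q.1) < e /\ nsq (p.2 - q.2) < e.
Proof.
rewrite closure_ballP; split=> h e e0.
  have s0 : 0 < Num.sqrt e by rewrite sqrtr_gt0.
  have [q Aq [/= b1 b2]] := h _ s0; exists q => //.
  by move: b1 b2; rewrite !ball_nsq// sqr_sqrtr ?ltW.
have [|q Aq [b1 b2]] := h (e ^+ 2); first exact: exprn_gt0.
by exists q => //; split; rewrite /= ball_nsq.
Qed.

(** Closures of graphs in the orthogonal sum are read off componentwise, so the product norm never
    has to be compared with the Hilbert norm again. *)
Lemma closure4_nsqP (H K : hilbertType R) (A : set ((H * K) * (H * K))%type) p :
  closure A p <-> forall e : R, 0 < e ->
   exists2 q, A q & [/\ nsq (p.1.1 - q.1.1) < e, nsq (p.1.2 - q.1.2) < e,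
      nsq (p.2.1 - q.2.1) < e & nsq (p.2.2 - q.2.2) < e].
Proof.
rewrite closure_ballP; split=> h e e0.
  have s0 : 0 < Num.sqrt e by rewrite sqrtr_gt0.
  have [q Aq [/= [b1 b2] [b3 b4]]] := h _ s0; exists q => //.
  by move: b1 b2 b3 b4; rewrite !ball_nsq// sqr_sqrtr ?ltW.
have [|q Aq [b1 b2 b3 b4]] := h (e ^+ 2); first exact: exprn_gt0.
by exists q => //; split; split; rewrite /= ball_nsq.
Qed.
End ClosureBall.

(** * Spectral theorem for bounded operators *)

Section StepPolynomials.
Context {R : realType}.
Implicit Types (p q : {poly R}).

Lemma expr_small (t e : R) : 0 <= t -> t < 1 -> 0 < e -> exists m : nat, t ^+ m.+1 < e.
Proof.
move=> t0 t1 e0; have tn : `|t| < 1 by rewrite ger0_norm.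
have /cvgrPdist_lt/(_ e e0)[N _ hN] := cvg_expr tn.
exists N; have := hN N.+1 (leqnSn N).
by rewrite sub0r normrN ger0_norm// exprn_ge0.
Qed.

Lemma bernoulli_ge (x : R) k : 0 <= x <= 1 -> 1 - k%:R * x <= (1 - x) ^+ k.
Proof.
move=> /andP[x0 x1]; elim: k => [|k IH]; first by rewrite expr0; lra.
rewrite exprS -natr1.
have : (1 - x) * (1 - k%:R * x) <= (1 - x) * (1 - x) ^+ k by apply: ler_wpM2l => //; lra.
have : 0 <= k%:R * x * x by rewrite !mulr_ge0.
lra.
Qed.

Lemma bernoulli_le (x : R) k : 0 <= x <= 1 -> (1 - x) ^+ k * (1 + k%:R * x) <= 1.
Proof.
move=> /andP[x0 x1]; elim: k => [|k IH]; first by rewrite expr0; lra.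
apply: le_trans IH; rewrite exprS mulrAC mulrC; apply: ler_wpM2l; first by apply: exprn_ge0; lra.
rewrite -natr1; have : 0 <= k%:R * x * x by rewrite !mulr_ge0.
have := sqr_ge0 x; lra.
Qed.

(** Take (1 - X^(m+1))^k + 2d with [a] between l and l'. For s <= l Bernoulli gives at least 1 - k
    a^(m+1) + 2d >= 1; for s >= l' the value is at most 1 / (k l'^(m+1)) + 2d <= 3d. This works for
    k about 1 / (d l'^(m+1)) and m so large that (a / l')^(m+1) is negligible. *)
Lemma step_poly (l l' e : R) : l < l' -> 0 < e -> exists p, forall s, 0 <= s <= 1 ->
  [/\ 0 <= p.[s], p.[s] <= 1 + e, s <= l -> 1 <= p.[s] & l' <= s -> p.[s] <= e].
Proof.
move=> ll' e0; case: (ltP l 0) => [l0|l0].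
  by exists 0 => s /andP[s0 s1]; rewrite horner0; split; lra.
case: (ltP 1 l') => [l1|l1].
  by exists 1 => s /andP[s0 s1]; rewrite hornerE; split; lra.
have [a la al'] : exists2 a, l < a & a < l' by exists ((l + l') / 2); lra.
have a0 : 0 < a by lra.
have l'0 : 0 < l' by lra.
(* Smallness of [t ^+ m.+1] bounds both [a ^+ m.+1] and its quotient by [l' ^+ m.+1]. Both enter the
   bound on [k%:R * a ^+ m.+1], because [k] may exceed [(d * L)^-1] by up to 1. *)
pose t := Num.max a (a / l').
pose d := Num.min e 1 / 4.
have [d0 de d1] : [/\ 0 < d, d <= e / 4 & d <= 1 / 4].
  by rewrite /d; split; [case: (ltP e 1) => ?; lra|case: (ltP e 1) => ?; lra|case: (ltP e 1) => ?; lra].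
clearbody d.
have [|||m hm] := @expr_small t (d ^+ 2).
- by rewrite /t le_max ltW.
- by rewrite /t gt_max ltr_pdivrMr// mul1r al' andbT; lra.
- by rewrite exprn_gt0.
have t0 : 0 <= t by rewrite /t le_max ltW.
have am : a ^+ m.+1 <= d ^+ 2.
  apply: le_trans (ltW hm); apply: lerXn2r; rewrite ?nnegrE//; first exact: ltW.
  by rewrite /t le_max lexx.
have alm : a ^+ m.+1 <= d ^+ 2 * l' ^+ m.+1.
  rewrite -ler_pdivrMr ?exprn_gt0// -expr_div_n.
  apply: le_trans (ltW hm); apply: lerXn2r; rewrite ?nnegrE ?divr_ge0//; try exact: ltW.
  by rewrite /t le_max lexx orbT.
have [L LE] : exists L, L = l' ^+ m.+1 by exists (l' ^+ m.+1).
have L0 : 0 < L by rewrite LE exprn_gt0.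
rewrite -LE in alm.
pose k := (Num.truncn (d * L)^-1).+1.
have kL : 1 <= k%:R * (d * L).
  rewrite -ler_pdivrMr ?mulr_gt0// mul1r; apply: ltW.
  exact: truncnS_gt.
have ka : k%:R * a ^+ m.+1 <= 2 * d.
  have hk : k%:R <= (d * L)^-1 + 1.
    by rewrite /k -natr1 lerD2r truncn_le invr_ge0 ltW// mulr_gt0.
  have A0 : 0 <= a ^+ m.+1 by rewrite exprn_ge0// ltW.
  apply: (@le_trans _ _ (((d * L)^-1 + 1) * a ^+ m.+1)); first exact: ler_wpM2r.
  rewrite mulrDl mul1r.
  have : (d * L)^-1 * a ^+ m.+1 <= d.
    rewrite mulrC ler_pdivrMr ?mulr_gt0// mulrA -expr2; exact: alm.
  have : d ^+ 2 <= d by rewrite expr2 -[leRHS]mulr1; apply: ler_wpM2l; lra.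
  lra.
exists ((1 - 'X^(m.+1)) ^+ k + (2 * d)%:P) => s /andP[s0 s1].
rewrite !hornerE.
have sm : 0 <= s ^+ m.+1 <= 1 by rewrite exprn_ge0// exprn_ile1.
set x := s ^+ m.+1 in sm *.
have q1 : (1 - x) ^+ k <= 1 by rewrite exprn_ile1//; lra.
have q0 : 0 <= (1 - x) ^+ k by rewrite exprn_ge0//; lra.
split; [lra|lra| |] => hs.
- have := bernoulli_ge k sm.
  have : k%:R * x <= k%:R * a ^+ m.+1.
    by apply: ler_wpM2l => //; apply: lerXn2r; rewrite ?nnegrE//; lra.
  lra.
- have := bernoulli_le k sm.
  have Lx : L <= x by rewrite LE; apply: lerXn2r; rewrite ?nnegrE//; lra.
  have kx : d^-1 <= 1 + k%:R * x.
    have : k%:R * L <= k%:R * x by exact: ler_wpM2l.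
    have : d^-1 <= k%:R * L.
      by rewrite -[d^-1]mulr1 ler_pdivrMl// mulrCA.
    by lra.
  move=> h; have : (1 - x) ^+ k * d^-1 <= 1.
    by apply: le_trans h; exact: ler_wpM2l.
  rewrite ler_pdivrMr// mul1r; lra.
Qed.
End StepPolynomials.

(** * Density of polynomials in L2 of a finite measure on [0, 1] *)

Section SquareIntegral.
Context {R : realType}.
Notation MR := (measurableTypeR R).
Implicit Types (nu : {measure set MR -> \bar R}) (f g : R -> R) (p : {poly R}).

Definition unit_itv : set R := `[0, 1]%classic.

Lemma unit_itvP s : unit_itv s <-> 0 <= s <= 1.
Proof. by rewrite /unit_itv /= in_itv. Qed.

Lemma measurable_unit_itv : measurable (unit_itv : set MR).
Proof. exact: measurable_itv. Qed.

Lemma measurable_horner p : measurable_fun setT (fun s : MR => p.[s]).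
Proof.
elim/poly_ind: p => [|p c IH].
  by under eq_fun do rewrite horner0; exact: measurable_cst.
under eq_fun do rewrite hornerMXaddC.
by apply: measurable_funD => //; exact: measurable_funM.
Qed.

Lemma horner_bounded p : exists2 M, 0 < M & forall s, 0 <= s <= 1 -> `|p.[s]| <= M.
Proof.
elim/poly_ind: p => [|p c [M M0 hM]].
  by exists 1 => // s _; rewrite horner0 normr0.
exists (M + `|c|) => [|s /[dup] hs /hM h]; first by rewrite ltr_pwDl.
rewrite hornerMXaddC (le_trans (ler_normD _ _))// lerD2r normrM.
case/andP: hs => s0 s1; rewrite (ger0_norm s0).
by rewrite -[leRHS]mulr1; apply: ler_pM.
Qed.

(** An inequality in the extended reals, so that it asserts finiteness of the integral along with
    its bound. *)
Definition sqint nu f (e : R) : Prop :=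
  (\int[nu]_(s in unit_itv) ((f s) ^+ 2)%:E <= e%:E)%E.

Lemma measurable_sqr f : measurable_fun setT (f : MR -> R) ->
  measurable_fun (unit_itv : set MR) (fun s : MR => ((f s) ^+ 2)%:E).
Proof.
move=> mf; apply/measurable_EFinP; apply: measurable_funX.
by apply: measurable_funTS.
Qed.

Lemma sqint_le nu f g (k e : R) :
  measurable_fun setT (f : MR -> R) -> measurable_fun setT (g : MR -> R) -> 0 <= k ->
  (forall s, 0 <= s <= 1 -> f s ^+ 2 <= k * g s ^+ 2) ->
  sqint nu g e -> sqint nu f (k * e).
Proof.
move=> mf mg k0 fg ge; rewrite /sqint EFinM.
apply: (@le_trans _ _ (\int[nu]_(s in unit_itv) (k%:E * ((g s) ^+ 2)%:E))%E).
  apply: ge0_le_integral; first exact: measurable_unit_itv.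
  - by move=> s _; rewrite lee_fin sqr_ge0.
  - exact: measurable_sqr.
  - by apply: measurable_funeM; exact: measurable_sqr.
  - by move=> s /unit_itvP hs; rewrite -EFinM lee_fin fg.
rewrite ge0_integralZl_EFin//; last 3 first.
- exact: measurable_unit_itv.
- by move=> s _; rewrite lee_fin sqr_ge0.
- exact: measurable_sqr.
by apply: lee_wpmul2l => //; rewrite lee_fin.
Qed.

Lemma sqintD nu f g (a b : R) :
  measurable_fun setT (f : MR -> R) -> measurable_fun setT (g : MR -> R) ->
  sqint nu f a -> sqint nu g b -> sqint nu (fun s => f s + g s) (2 * a + 2 * b).
Proof.
move=> mf mg fa gb; rewrite /sqint.
have m2 (h : R -> R) : measurable_fun setT (h : MR -> R) ->
    measurable_fun (unit_itv : set MR) (fun s : MR => (2%:E * ((h s) ^+ 2)%:E)%E).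
  by move=> mh; apply: measurable_funeM; exact: measurable_sqr.
apply: (@le_trans _ _ (\int[nu]_(s in unit_itv)
    (2%:E * ((f s) ^+ 2)%:E + 2%:E * ((g s) ^+ 2)%:E))%E).
  apply: ge0_le_integral; first exact: measurable_unit_itv.
  - by move=> s _; rewrite lee_fin sqr_ge0.
  - by apply: (@measurable_sqr (fun s => f s + g s)); exact: measurable_funD.
  - by apply: emeasurable_funD; exact: m2.
  - move=> s _; rewrite -!EFinM -EFinD lee_fin.
    by have := sqr_ge0 (f s - g s); lra.
rewrite ge0_integralD//; last first.
- exact: m2.
- by move=> s _; rewrite -EFinM lee_fin mulr_ge0// sqr_ge0.
- exact: m2.
- by move=> s _; rewrite -EFinM lee_fin mulr_ge0// sqr_ge0.
- exact: measurable_unit_itv.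
rewrite !ge0_integralZl_EFin//; try exact: measurable_sqr;
  try exact: measurable_unit_itv; try by move=> s _; rewrite lee_fin sqr_ge0.
have -> : (2 * a + 2 * b)%:E = (2%:E * a%:E + 2%:E * b%:E)%E by [].
by apply: leeD; apply: lee_wpmul2l.
Qed.

Lemma sqint_trans nu f (a b : R) : a <= b -> sqint nu f a -> sqint nu f b.
Proof. by move=> ab /le_trans; apply; rewrite lee_fin. Qed.

Definition poly_dense nu f : Prop :=
  forall e : R, 0 < e -> exists p, sqint nu (fun s => f s - p.[s]) e.

Lemma poly_denseD nu f g :
  measurable_fun setT (f : MR -> R) -> measurable_fun setT (g : MR -> R) ->
  poly_dense nu f -> poly_dense nu g -> poly_dense nu (fun s => f s + g s).
Proof.
move=> mf mg df dg e e0; have e4 : 0 < e / 4 by lra.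
have [p hp] := df _ e4; have [q hq] := dg _ e4; exists (p + q).
have := sqintD (measurable_funB mf (measurable_horner p))
  (measurable_funB mg (measurable_horner q)) hp hq.
have -> : 2 * (e / 4) + 2 * (e / 4) = e by lra.
rewrite /sqint => h; apply: le_trans h; rewrite le_eqVlt; apply/orP; left.
apply/eqP; apply: eq_integral => s _ /=; rewrite hornerD; congr (_ ^+ 2)%:E.
by ring.
Qed.

Lemma poly_dense_closed nu f : measurable_fun setT (f : MR -> R) ->
  (forall e : R, 0 < e -> exists g, [/\ measurable_fun setT (g : MR -> R),
     poly_dense nu g & sqint nu (fun s => f s - g s) e]) -> poly_dense nu f.
Proof.
move=> mf h e e0; have e4 : 0 < e / 4 by lra.
have [g [mg dg fg]] := h _ e4; have [p hp] := dg _ e4; exists p.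
have := sqintD (measurable_funB mf mg)
  (measurable_funB mg (measurable_horner p)) fg hp.
have -> : 2 * (e / 4) + 2 * (e / 4) = e by lra.
by rewrite /sqint; under eq_integral do rewrite addrA subrK.
Qed.

Lemma poly_denseZ nu f (k : R) : measurable_fun setT (f : MR -> R) ->
  poly_dense nu f -> poly_dense nu (fun s => k * f s).
Proof.
move=> mf df e e0; have k1 : 0 < k ^+ 2 + 1 by rewrite ltr_wpDl ?sqr_ge0.
have [|p hp] := df (e / (k ^+ 2 + 1)); first exact: divr_gt0.
exists (k *: p).
apply: (@sqint_trans _ _ (k ^+ 2 * (e / (k ^+ 2 + 1)))).
  rewrite mulrCA -[leRHS]mulr1; apply: ler_wpM2l; first exact: ltW.
  by rewrite ler_pdivrMr// mul1r lerDl.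
apply: (sqint_le _ (measurable_funB mf (measurable_horner p)) _ _ hp).
- apply: measurable_funB; last exact: measurable_horner.
  by apply: measurable_funM.
- exact: sqr_ge0.
- by move=> s _; rewrite hornerZ -mulrBr exprMn.
Qed.

Lemma poly_dense_poly nu p : poly_dense nu (fun s => p.[s]).
Proof.
move=> e e0; exists p; rewrite /sqint; under eq_integral do rewrite subrr expr0n.
by rewrite integral0 lee_fin ltW.
Qed.

Section Finite.
Variable nu : {measure set MR -> \bar R}.
Hypothesis nufin : (nu setT < +oo)%E.

Lemma measure_fin (A : set MR) : measurable A -> nu A \is a fin_num.
Proof.
move=> mA; rewrite ge0_fin_numE//.
by apply: le_lt_trans nufin; apply: le_measure; rewrite ?inE.
Qed.

Lemma sqint_indic (A : set MR) (k : R) : measurable A ->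
  (nu A <= k%:E)%E -> sqint nu (\1_A) k.
Proof.
move=> mA Ak; rewrite /sqint.
have -> : (\int[nu]_(s in unit_itv) ((\1_A s : R) ^+ 2)%:E =
           \int[nu]_(s in unit_itv) (\1_A s : R)%:E)%E.
  by apply: eq_integral => s _; rewrite indicE; case: (s \in A); rewrite ?expr1n ?expr0n.
rewrite integral_indic//; last exact: measurable_unit_itv.
apply: le_trans Ak; apply: le_measure; rewrite ?inE//.
by apply: measurableI => //; exact: measurable_unit_itv.
Qed.

Lemma sqint_cst (k : R) : sqint nu (fun=> k) (k ^+ 2 * fine (nu setT)).
Proof.
have fT := measure_fin measurableT.
apply: (@sqint_le _ _ (\1_(setT : set MR))) => //; rewrite ?sqr_ge0//.
- by move=> s _; rewrite indicT /= expr1n mulr1.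
- by apply: sqint_indic => //; rewrite fineK.
Qed.

Lemma cvg_small_measure (F : (set MR)^nat) (e : R) : 0 < e ->
  (forall n, measurable (F n)) -> (forall n m, (n <= m)%N -> F m `<=` F n) ->
  \bigcap_n F n = set0 -> exists N, forall n, (N <= n)%N -> (nu (F n) <= e%:E)%E.
Proof.
move=> e0 mF Fd F0.
have : (nu \o F) x @[x --> \oo] --> nu (\bigcap_n F n).
  apply: nonincreasing_cvg_mu => //.
  - by rewrite -ge0_fin_numE//; exact: measure_fin.
  - by rewrite F0.
  - by move=> n m nm; apply/subsetPset; exact: Fd.
rewrite F0 measure0 => h.
have := h [set y | (y < e%:E)%E]; case.
  by apply: open_nbhs_nbhs; split; [exact: open_ereal_lt_ereal|rewrite /= lte_fin].
by move=> N _ hN; exists N => n Nn; apply/ltW; exact: hN.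
Qed.

(** By continuity of [nu] from above, ]l, l'] has small measure for l' close to l. A polynomial
    stepping down between l and l' is off by at most 2 + d there and by at most [d] elsewhere on
    [0, 1]. *)
Lemma poly_dense_ray (l : R) : poly_dense nu (\1_(`]-oo, l]%classic : set MR)).
Proof.
move=> e e0.
pose F n : set MR := `]l, l + n.+1%:R^-1]%classic.
have [|n|n m nm x||N hN] := @cvg_small_measure F (e / 64).
- by lra.
- exact: measurable_itv.
- rewrite /F /= !in_itv /= => /andP[-> h]; apply: le_trans h _.
  by rewrite lerD2l lef_pV2 ?posrE// ler_nat.
- apply/seteqP; split => // x h; have : l < x.
    by have := h 0%N Logic.I; rewrite /F /= in_itv => /andP[].
  rewrite -subr_gt0 => /invS_lt[M hM].
  have := h M Logic.I; rewrite /F /= in_itv /= => /andP[_].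
  have := hM M (leqnn M); rewrite ltrBrDl => h1 h2.
  by have := lt_le_trans h1 h2; rewrite ltxx.
have {hN} := hN N (leqnn N).
have [l' l'E] : exists l', l' = l + N.+1%:R^-1 by eexists.
move=> hN; have ll' : l < l' by rewrite l'E ltrDl invr_gt0.
set c := fine (nu setT).
have c0 : 0 <= c by exact: fine_ge0.
pose d := Num.min 1 (e / (8 * (c + 1))).
have d0 : 0 < d by rewrite /d lt_min ltr01 divr_gt0// mulr_gt0//; lra.
have d1 : d <= 1 by rewrite /d ge_min lexx.
have dc : 2 * (d ^+ 2 * c) <= e / 4.
  have : d * (8 * (c + 1)) <= e by rewrite -ler_pdivlMr ?mulr_gt0 ?ge_min ?lexx ?orbT//; lra.
  have : d ^+ 2 * c <= d * c by rewrite expr2; apply: ler_wpM2r => //; rewrite -[leRHS]mulr1 ler_pM2l.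
  nra.
have [p hp] := step_poly ll' d0; exists p.
have mF : measurable (F N) by exact: measurable_itv.
apply: (@sqint_trans _ _ (1 * (2 * (4 * (e / 64)) + 2 * (d ^+ 2 * c)))); first lra.
apply: (@sqint_le _ _ (fun s => 2 * \1_(F N) s + d)).
- by apply: measurable_funB; [exact: measurable_indic|exact: measurable_horner].
- by apply: measurable_funD => //; apply: measurable_funM.
- by [].
- move=> s /[dup] hs /hp [p0 p1 pl pl']; rewrite mul1r !indicE.
  have : `|(s \in (`]-oo, l]%classic : set MR))%:R - p.[s]| <= 2 * (s \in F N)%:R + d.
    rewrite mem_setE in_itv /=; case: (boolP (s <= l)).
      by move=> /pl ?; rewrite ler_norml; case: (s \in F N) => /=; apply/andP; split; lra.
    rewrite -ltNge => ls.
    case: (leP s l') => sl.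
      have -> : s \in F N by rewrite inE /F /= in_itv /= ls -l'E.
      by rewrite ler_norml; apply/andP; split => /=; lra.
    have {}pl' := pl' (ltW sl).
    by rewrite ler_norml; case: (s \in F N) => /=; apply/andP; split; lra.
  move=> h; rewrite -real_normK ?num_real//; apply: lerXn2r; rewrite ?nnegrE//.
  exact: le_trans (normr_ge0 _) h.
- apply: sqintD => //; last exact: sqint_cst.
    by apply: measurable_funM.
  apply: (@sqint_le _ _ (\1_(F N))) => //; first by apply: measurable_funM.
    by move=> s _; rewrite exprMn; lra.
  exact: sqint_indic.
Qed.

Lemma sqintN f g (e : R) : sqint nu (fun s => f s - g s) e ->
  sqint nu (fun s => g s - f s) e.
Proof.
rewrite /sqint => h; apply: le_trans h; rewrite le_eqVlt; apply/orP; left.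
by apply/eqP; apply: eq_integral => s _ /=; congr (_ %:E); ring.
Qed.

(** Dynkin's argument on half-open intervals, which are differences of rays. Complements preserve
    approximability, and so do countable disjoint unions because their tails have small measure. *)
Lemma poly_dense_indic (A : set MR) : measurable A -> poly_dense nu (\1_A).
Proof.
move=> mA; have := mA; move: A mA.
suff H (A : set MR) : <<s R.-ocitv.-measurable >> A -> poly_dense nu (\1_A).
  by move=> A _ mA; exact: H.
apply: (@dynkin_induction _ MR (R.-ocitv.-measurable) (fun A => poly_dense nu (\1_A))).
- by [].
- by move=> B C mB mC; exact: measurableI.
- move=> e e0; exists 1; rewrite /sqint.
  under eq_integral do rewrite indicT hornerE subrr expr0n.
  by rewrite integral0 lee_fin ltW.
- move=> B [[a b] _ <-] /=.
  case: (leP a b) => ab; last first.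
    rewrite set_itv_ge ?bnd_simp -?leNgt ?ltW// => e e0; exists 0; rewrite /sqint.
    under eq_integral do rewrite indic0 horner0 subrr expr0n.
    by rewrite integral0 lee_fin ltW.
  have -> : (\1_(`]a, b]%classic) : R -> R) =
      (fun s => \1_(`]-oo, b]%classic) s + (-1) * \1_(`]-oo, a]%classic) s).
    apply/funext => s; rewrite !indicE !mem_setE !in_itv /=.
    case: (leP s b) => sb; case: (ltP a s) => sa /=; rewrite ?mulr0 ?addr0 ?mulN1r ?subrr//.
    by have := le_trans sa ab; rewrite leNgt sb.
  apply: poly_denseD.
  + by apply: measurable_indic; exact: measurable_itv.
  + by apply: measurable_funM => //; apply: measurable_indic; exact: measurable_itv.
  + exact: poly_dense_ray.
  + apply: poly_denseZ; last exact: poly_dense_ray.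
    by apply: measurable_indic; exact: measurable_itv.
- move=> B mB dB.
  have -> : (\1_(~` B) : R -> R) = (fun s => \1_(setT : set MR) s + (-1) * \1_B s).
    apply/funext => s; rewrite indicT indicE in_setC indicE mulN1r.
    by case: (s \in B); rewrite ?subr0 ?subrr.
  apply: poly_denseD => //.
  + by apply: measurable_funM => //; exact: measurable_indic.
  + move=> e e0; exists 1; rewrite /sqint.
    under eq_integral do rewrite indicT hornerE subrr expr0n.
    by rewrite integral0 lee_fin ltW.
  + by apply: poly_denseZ => //; exact: measurable_indic.
- move=> F mF tF dF.
  have mU n : measurable (\big[setU/set0]_(k < n) F k) by exact: bigsetU_measurable.
  have dU n : poly_dense nu (\1_(\big[setU/set0]_(k < n) F k)).
    elim: n => [|n IH].
      rewrite big_ord0 => e e0; exists 0; rewrite /sqint.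
      under eq_integral do rewrite indic0 horner0 subrr expr0n.
      by rewrite integral0 lee_fin ltW.
    have -> : (\1_(\big[setU/set0]_(k < n.+1) F k) : R -> R) =
        (fun s => \1_(\big[setU/set0]_(k < n) F k) s + \1_(F n) s).
      apply/funext => s; rewrite big_ord_recr /= !indicE in_setU.
      case: (boolP (s \in F n)) => sn; last by rewrite orbF addr0.
      rewrite orbT; case: (boolP (s \in _)) => [|_]; last by rewrite add0r.
      rewrite inE -bigcup_mkord => -[k /= kn Fks].
      have := tF k n Logic.I Logic.I (ex_intro _ s (conj Fks (set_mem sn))).
      by move=> e; rewrite e ltnn in kn.
    by apply: poly_denseD => //; exact: measurable_indic.
  apply: poly_dense_closed; first by apply: measurable_indic; exact: bigcup_measurable.
  move=> e e0.
  pose T n := (\bigcup_k F k) `\` \big[setU/set0]_(k < n) F k.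
  have mT n : measurable (T n) by apply: measurableD => //; exact: bigcup_measurable.
  have [//|n m nm x [Ux nx]||N hN] := @cvg_small_measure T e e0.
  + split=> //; apply: contra_not nx; rewrite -!bigcup_mkord => -[k /= kn Fk].
    by exists k => //=; exact: leq_trans kn nm.
  + apply/seteqP; split=> // x h; have [[k _ Fk] _] := h 0%N Logic.I.
    have [_] := h k.+1 Logic.I; apply; rewrite -bigcup_mkord.
    by exists k => //=.
  exists (\1_(\big[setU/set0]_(k < N) F k)); split => //.
  have := @sqint_indic (T N) e (mT N) (hN N (leqnn N)).
  rewrite /sqint => h; apply: le_trans h; rewrite le_eqVlt; apply/orP; left.
  apply/eqP; apply: eq_integral => s _; congr ((_ ^+ 2)%:E).
  rewrite !indicE; case: (boolP (s \in T N)) => sT.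
    have [h1 h2] := set_mem sT.
    by rewrite (mem_set h1) memNset// subr0.
  case: (boolP (s \in \big[setU/set0]_(k < N) F k)) => sN.
    rewrite mem_set ?subrr//; have := set_mem sN; rewrite -bigcup_mkord.
    by move=> -[k _ Fk]; exists k.
  rewrite memNset ?subr0// => h; move/negP: sT; apply; rewrite inE; split => //.
  by move/negP: sN => sN h'; apply: sN; rewrite inE.
Qed.

Lemma poly_dense_sum (I : Type) (r : seq I) (f : I -> R -> R) :
  (forall i, measurable_fun setT (f i : MR -> R)) -> (forall i, poly_dense nu (f i)) ->
  poly_dense nu (fun s => \sum_(i <- r) f i s).
Proof.
move=> mf df; elim: r => [|i r IH].
  have -> : (fun s => \sum_(i <- [::]) f i s) = (fun s => (0 : {poly R}).[s]).
    by apply/funext => s; rewrite horner0 big_nil.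
  exact: poly_dense_poly.
have -> : (fun s => \sum_(j <- i :: r) f j s) = (fun s => f i s + \sum_(j <- r) f j s).
  by apply/funext => s; rewrite big_cons.
by apply: poly_denseD => //; exact: measurable_sum.
Qed.

(** Simple functions increase to [f]; dominated convergence with majorant f^2 makes the squared
    error vanish, and each simple function is a finite combination of indicators. *)
Lemma poly_dense_nonneg f : measurable_fun setT (f : MR -> R) ->
  (forall s, 0 <= f s) -> (\int[nu]_(s in unit_itv) ((f s) ^+ 2)%:E < +oo)%E ->
  poly_dense nu f.
Proof.
move=> mf f0 f2; apply: poly_dense_closed => // e e0.
have mEf : measurable_fun setT (fun s : MR => (f s)%:E) by exact/measurable_EFinP.
have [g [gnd gcvg]] := @approximation _ MR R setT measurableT _ mEf
   (fun s _ => f0 s : (0 <= (f s)%:E)%E).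
have gc s : (g n s) @[n --> \oo] --> f s.
  by have /fine_cvgP[_] := gcvg s Logic.I; exact.
have gf n s : g n s <= f s.
  rewrite -(cvg_lim _ (gc s))//; apply: nondecreasing_cvgn_le.
    by move=> a b ab; have /lefP := gnd _ _ ab; exact.
  by apply/cvg_ex; exists (f s).
have mfg n : measurable_fun setT (fun s : MR => f s - g n s).
  by apply: measurable_funB => //; exact: measurable_funPT.
have h2 s : (((f s - g n s) ^+ 2)%:E) @[n --> \oo] --> (0 : \bar R).
  apply: cvg_EFin; first by near=> n.
  have -> : (0 : R) = (f s - f s) ^+ 2 by rewrite subrr expr0n.
  rewrite /=; under eq_fun do rewrite /= expr2.
  by rewrite expr2; apply: cvgM; apply: cvgB => //; exact: cvg_cst.
have [|||||_ _] := @dominated_convergence _ MR R nu unit_itv measurable_unit_itv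
  (fun n s => ((f s - g n s) ^+ 2)%:E) (fun=> 0%E) (fun s => ((f s) ^+ 2)%:E).
- by move=> n; exact: (@measurable_sqr (fun s => f s - g n s)).
- exact: measurable_cst.
- by apply: aeW => s _; exact: h2.
- apply/integrableP; split; first exact: measurable_sqr.
  apply: le_lt_trans f2; rewrite le_eqVlt; apply/orP; left; apply/eqP.
  by apply: eq_integral => s _; rewrite /= ger0_norm// sqr_ge0.
- apply: aeW => s n _ /=; rewrite lee_fin ger0_norm ?sqr_ge0//.
  have gn0 : 0 <= g n s by [].
  by have := gf n s; have := f0 s; nra.
rewrite integral0 => h.
have [|N _ hN] := h [set y | (y < e%:E)%E].
  by apply: open_nbhs_nbhs; split; [exact: open_ereal_lt_ereal|rewrite /= lte_fin].
exists (g N); split.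
- exact: measurable_funPT.
- have -> : (g N : R -> R) = (fun s => \sum_(y <- finmap.enum_fset (fset_set (range (g N)))) y * \1_(g N @^-1` [set y]) s).
    by apply/funext => s; rewrite fimfunE fsbig_finite.
  apply: poly_dense_sum => y.
    by apply: measurable_funM => //; exact: measurable_indic.
  by apply: poly_denseZ; [exact: measurable_indic|exact: poly_dense_indic].
- exact/ltW/(hN N (leqnn N)).
Unshelve. all: by end_near. Qed.

End Finite.
End SquareIntegral.

(** * Polynomials in a symmetric operator between 0 and 1 *)

Section OperatorPolynomials.
Context {R : realType} {H : hilbertType R} (T : H -> H).
Implicit Types (p q : {poly R[i]}) (x y : H).

Definition opoly p x : H := \sum_(i < size p) p`_i *: iter i T x.

Lemma opoly_wide n p x : (size p <= n)%N ->
  opoly p x = \sum_(i < n) p`_i *: iter i T x.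
Proof.
move=> pn; rewrite /opoly.
rewrite (big_ord_widen n (fun i => p`_i *: iter i T x) pn) big_mkcond/=.
apply: eq_bigr => i _; case: ltnP => // h.
by rewrite nth_default// scale0r.
Qed.

Lemma opolyD p q x : opoly (p + q) x = opoly p x + opoly q x.
Proof.
pose n := maxn (size p) (size q).
rewrite (@opoly_wide n) ?size_polyD// (@opoly_wide n p) ?leq_maxl//.
rewrite (@opoly_wide n q) ?leq_maxr// -big_split/=.
by apply: eq_bigr => i _; rewrite coefD scalerDl.
Qed.

Lemma opolyZ c p x : opoly (c *: p) x = c *: opoly p x.
Proof.
rewrite (@opoly_wide (size p)) ?size_scale_leq// /opoly scaler_sumr.
by apply: eq_bigr => i _; rewrite coefZ scalerA.
Qed.

Lemma opolyC c x : opoly c%:P x = c *: x.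
Proof.
rewrite (@opoly_wide 1) ?size_polyC_leq1// big_ord1.
by rewrite coefC eqxx.
Qed.

Hypothesis T_lin : forall (c : R[i]) x y, T (c *: x + y) = c *: T x + T y.

Lemma opT0 : T 0 = 0.
Proof. by have := T_lin (-1) 0 0; rewrite !scaler0 addr0 scaleN1r addNr. Qed.
Lemma opTD x y : T (x + y) = T x + T y.
Proof. by have := T_lin 1 x y; rewrite !scale1r. Qed.
Lemma opTZ c x : T (c *: x) = c *: T x.
Proof. by have := T_lin c x 0; rewrite opT0 !addr0. Qed.
Lemma opTB x y : T (x - y) = T x - T y.
Proof. by rewrite opTD -scaleN1r opTZ scaleN1r. Qed.
Lemma opT_sum (I : Type) (r : seq I) (P : pred I) (F : I -> H) :
  T (\sum_(i <- r | P i) F i) = \sum_(i <- r | P i) T (F i).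
Proof. exact: (big_morph T opTD opT0). Qed.

Lemma opolyMXaddC p c x : opoly (p * 'X + c%:P) x = T (opoly p x) + c *: x.
Proof.
rewrite opolyD opolyC; congr (_ + _).
rewrite (@opoly_wide (size p).+1).
  rewrite big_ord_recl coefMX /= scale0r add0r /opoly opT_sum.
  by apply: eq_bigr => i _; rewrite coefMX /= opTZ.
apply: leq_trans (size_polyMleq _ _) _.
by rewrite size_polyX addn2.
Qed.

Lemma opoly_lin p (c : R[i]) x y :
  opoly p (c *: x + y) = c *: opoly p x + opoly p y.
Proof.
elim/poly_ind: p => [|p d IH].
  by rewrite -polyC0 !opolyC !scale0r scaler0 addr0.
rewrite !opolyMXaddC IH T_lin !scalerDr !scalerA (mulrC d c).
by rewrite addrACA.
Qed.

Lemma opolyM p q x : opoly (p * q) x = opoly p (opoly q x).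
Proof.
elim/poly_ind: p => [|p c IH].
  by rewrite mul0r -polyC0 !opolyC !scale0r.
have -> : (p * 'X + c%:P) * q = (p * q) * 'X + 0%:P + c *: q.
  by rewrite mulrDl mulrAC mul_polyC polyC0 addr0.
by rewrite opolyD opolyMXaddC scale0r addr0 opolyZ IH opolyMXaddC.
Qed.

Hypothesis T_sym : forall x y, '[T x, y] = '[x, T y].

Lemma opoly_sym p x y :
  '[opoly p x, y] = '[x, opoly (map_poly Num.conj p) y].
Proof.
elim/poly_ind: p x y => [|p c IH] x y.
  by rewrite rmorph0 -polyC0 !opolyC !scale0r inner0l inner0r.
rewrite rmorphD rmorphM /= map_polyX map_polyC /= !opolyMXaddC innerDl innerDr.
rewrite T_sym IH innerZl innerZr conjCK; congr ('[_, _] + _).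
have -> : opoly (map_poly Num.conj p) (T y) = opoly (map_poly Num.conj p * 'X) y.
  rewrite opolyM; congr opoly.
  by rewrite -['X]mul1r -[1 * 'X]addr0 -polyC0 opolyMXaddC opolyC scale0r addr0 scale1r.
by rewrite -[_ * 'X]addr0 -polyC0 opolyMXaddC scale0r addr0.
Qed.

Hypothesis T_pos : forall x, 0 <= complex.Re '[T x, x] <= nsq x.

Lemma opT_form : hermitian_on [set: H] (fun x y => '[T x, y]).
Proof.
split; first exact: subspT.
  by move=> c x y z _ _ _; rewrite T_lin innerDl innerZl.
by move=> x y _ _; rewrite T_sym innerC.
Qed.

(** Cauchy-Schwarz for the form <T x, y> at x and T x: |T x|^4 <= <T x, x> <T T x, T x> <= |x|^2 |T
    x|^2. *)
Lemma opT_bounded x : nsq (T x) <= nsq x.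
Proof.
have pos : nonneg_on [set: H] (fun x y => '[T x, y]).
  by move=> y _; case/andP: (T_pos y).
have := form_CS opT_form pos (I : [set: H] x) (I : [set: H] (T x)).
rewrite -/(nsq (T x)).
case/andP: (T_pos x) => _ h1; case/andP: (T_pos (T x)) => h2 h3.
have n0 := nsq_ge0 (T x); have m0 := nsq_ge0 x => h.
have : nsq (T x) ^+ 2 <= nsq x * nsq (T x).
  by apply: le_trans h _; apply: ler_pM => //; case/andP: (T_pos x).
move: n0; rewrite le_eqVlt => /orP[/eqP <-//|n0].
by rewrite expr2 ler_pM2r.
Qed.

Lemma opoly_bounded p : exists2 C, 0 < C & forall x, nsq (opoly p x) <= C * nsq x.
Proof.
elim/poly_ind: p => [|p c [C C0 IH]].
  by exists 1 => // x; rewrite -polyC0 opolyC scale0r nsq0 mul1r nsq_ge0.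
pose N := complex.Re c ^+ 2 + complex.Im c ^+ 2.
have N0 : 0 <= N by rewrite /N addr_ge0 ?sqr_ge0.
exists (2 * C + 2 * N) => [|x]; first by lra.
rewrite opolyMXaddC; apply: le_trans (nsqD_le _ _) _.
rewrite nsqZ -/N; have := opT_bounded (opoly p x); have := IH x; lra.
Qed.

(* The approximate eigenvalues of a polynomial in [T] are its values at
   approximate eigenvalues of [T], which lie in [0, 1]. *)
Lemma opT_shift_below (z : R[i]) :
  (forall d : R, 0 < d -> exists x, nsq (T x - z *: x) < d * nsq x) ->
  exists2 s : R, 0 <= s <= 1 & z = s%:C.
Proof.
move=> h; case: z h => a b h.
have key x : nsq (T x - Complex a b *: x) = nsq (T x - a%:C *: x) + b ^+ 2 * nsq x.
  have -> : T x - Complex a b *: x = (T x - a%:C *: x) + Complex 0 (- b) *: x.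
    rewrite -addrA; congr (_ + _); rewrite -!scaleNr -scalerDl; congr (_ *: _).
    by rewrite /real_complex_def; apply/eqP; rewrite eq_complex /= addr0 oppr0 add0r !eqxx.
  rewrite {1}/nsq (Re_formD inner_hermitian)// -!/(nsq _) nsqZ /=.
  have -> : complex.Re '[T x - a%:C *: x, Complex 0 (- b) *: x] = 0.
    rewrite innerZr innerBl innerZl nsqE.
    have -> : '[T x, x] = (complex.Re '[T x, x])%:C.
      exact: (form_diag_real opT_form).
    by rewrite conjCE /=; ring.
  by ring.
have b0 : b = 0.
  apply/eqP/negP => /negP b0; have [|x] := h (b ^+ 2).
    by rewrite lt_neqAle sqr_ge0 andbT eq_sym sqrf_eq0.
  by rewrite key; have := nsq_ge0 (T x - a%:C *: x); lra.
subst b; exists a => //.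
have CS x (c : R) : 0 < c -> c * nsq x <= `|complex.Re '[T x - a%:C *: x, x]| ->
    c ^+ 2 * nsq x <= nsq (T x - a%:C *: x).
  move=> c0 hc; have := inner_CS (T x - a%:C *: x) x => h1.
  have n0 := nsq_ge0 x; have n1 := nsq_ge0 (T x - a%:C *: x).
  have : (c * nsq x) ^+ 2 <= complex.Re '[T x - a%:C *: x, x] ^+ 2.
    rewrite -[leRHS]real_normK ?num_real//; apply: lerXn2r; rewrite ?nnegrE//.
    by rewrite mulr_ge0// ltW.
  move=> h2; move: n0; rewrite le_eqVlt => /orP[/eqP <-|n0]; first by rewrite mulr0.
  rewrite -(ler_pM2r n0); apply: le_trans h1; apply: le_trans h2.
  by rewrite exprMn expr2 expr2 !mulrA.
have ReE x : complex.Re '[T x - a%:C *: x, x] = complex.Re '[T x, x] - a * nsq x.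
  by rewrite innerBl innerZl ReD ReN ReZ.
have aE x : nsq (T x - Complex a 0 *: x) = nsq (T x - a%:C *: x) by [].
apply/andP; split; rewrite leNgt; apply/negP => lt.
- have [|x] := h ((- a) ^+ 2); first by rewrite exprn_gt0// oppr_gt0.
  rewrite ltNge => /negP; apply; rewrite aE; apply: CS; first by rewrite oppr_gt0.
  rewrite ReE; case/andP: (T_pos x) => h1 _.
  rewrite ger0_norm; first lra.
  by have := nsq_ge0 x; nra.
- have [|x] := h ((a - 1) ^+ 2); first by rewrite exprn_gt0// subr_gt0.
  rewrite ltNge => /negP; apply; rewrite aE; apply: CS; first by rewrite subr_gt0.
  rewrite ReE; case/andP: (T_pos x) => _ h1.
  rewrite ler0_norm; first lra.
  by have := nsq_ge0 x; nra.
Qed.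

(** Lower bounds multiply: if the first factor is bounded below by [d0], vectors almost annihilated
    by the whole product are almost annihilated by the remaining factors, and induction applies. *)
Lemma prod_shift_below (s : seq R[i]) :
  (forall d : R, 0 < d -> exists x,
     nsq (opoly (\prod_(z <- s) ('X - z%:P)) x) < d * nsq x) ->
  exists2 z, z \in s & forall d : R, 0 < d -> exists x, nsq (T x - z *: x) < d * nsq x.
Proof.
elim: s => [|z s IH] h.
  have [//|x] := h 1 _.
  by rewrite big_nil -polyC1 opolyC scale1r mul1r ltxx.
have [hz|] := pselect (forall d : R, 0 < d -> exists x, nsq (T x - z *: x) < d * nsq x).
  by exists z => //; rewrite mem_head.
move=> /existsNP[d0 /not_implyP[d00 nd0]].
have [|z' z's hz'] := IH; last by exists z' => //; rewrite in_cons z's orbT.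
move=> d dpos; have [|x] := h (d0 * d); first exact: mulr_gt0.
rewrite big_cons opolyM => hx; exists x.
set y := opoly _ x in hx *.
have e : opoly ('X - z%:P) y = T y - z *: y.
  have -> : 'X - z%:P = 1 * 'X + (- z)%:P by rewrite mul1r polyCN.
  by rewrite opolyMXaddC -polyC1 opolyC scale1r scaleNr.
rewrite e in hx.
have : d0 * nsq y <= nsq (T y - z *: y).
  by rewrite leNgt; apply/negP => lt; apply: nd0; exists y.
move=> /le_lt_trans/(_ hx); rewrite -mulrA ltr_pM2l//.
Qed.

Definition rpoly (p : {poly R}) x := opoly (map_poly (real_complex R) p) x.

Lemma rpolyD (p q : {poly R}) x : rpoly (p + q) x = rpoly p x + rpoly q x.
Proof. by rewrite /rpoly rmorphD opolyD. Qed.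
Lemma rpolyM (p q : {poly R}) x : rpoly (p * q) x = rpoly p (rpoly q x).
Proof. by rewrite /rpoly rmorphM opolyM. Qed.
Lemma rpolyZ (c : R) (p : {poly R}) x : rpoly (c *: p) x = c%:C *: rpoly p x.
Proof. by rewrite /rpoly map_polyZ opolyZ. Qed.
Lemma rpolyB (p q : {poly R}) x : rpoly (p - q) x = rpoly p x - rpoly q x.
Proof.
rewrite rpolyD -scaleN1r rpolyZ; congr (_ + _).
by rewrite rmorphN1 scaleN1r.
Qed.
Lemma rpolyC (c : R) x : rpoly c%:P x = c%:C *: x.
Proof. by rewrite /rpoly map_polyC opolyC. Qed.
Lemma rpolyX x : rpoly 'X x = T x.
Proof.
rewrite /rpoly map_polyX -['X]mul1r -[1 * 'X]addr0 -polyC0 opolyMXaddC scale0r addr0.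
by rewrite -polyC1 opolyC scale1r.
Qed.
Lemma rpoly_lin (p : {poly R}) (c : R[i]) x y :
  rpoly p (c *: x + y) = c *: rpoly p x + rpoly p y.
Proof. exact: opoly_lin. Qed.
Lemma rpoly_sym (p : {poly R}) x y : '[rpoly p x, y] = '[x, rpoly p y].
Proof.
rewrite /rpoly opoly_sym; congr '[_, opoly _ _]; apply/polyP => i.
by rewrite !coef_map /= conj_real.
Qed.
Lemma rpoly_bounded (p : {poly R}) : exists2 C, 0 < C & forall x, nsq (rpoly p x) <= C * nsq x.
Proof. exact: opoly_bounded. Qed.
Lemma rpoly_form (p : {poly R}) : hermitian_on [set: H] (fun x y => '[rpoly p x, y]).
Proof.
split; first exact: subspT.
  by move=> c x y z _ _ _; rewrite rpoly_lin innerDl innerZl.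
by move=> x y _ _; rewrite rpoly_sym innerC.
Qed.

Definition pval (p : {poly R}) x : R := complex.Re '[rpoly p x, x].

Lemma pvalD (p q : {poly R}) x : pval (p + q) x = pval p x + pval q x.
Proof. by rewrite /pval rpolyD innerDl ReD. Qed.
Lemma pvalZ c (p : {poly R}) x : pval (c *: p) x = c * pval p x.
Proof. by rewrite /pval rpolyZ innerZl ReZ. Qed.
Lemma pvalB (p q : {poly R}) x : pval (p - q) x = pval p x - pval q x.
Proof. by rewrite pvalD -scaleN1r pvalZ mulN1r. Qed.
Lemma pvalC c x : pval c%:P x = c * nsq x.
Proof. by rewrite /pval rpolyC innerZl ReZ. Qed.
Lemma pval_sqr (p : {poly R}) x : pval (p ^+ 2) x = nsq (rpoly p x).
Proof. by rewrite /pval expr2 rpolyM rpoly_sym. Qed.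
Lemma pval_sum (I : Type) (r : seq I) (F : I -> {poly R}) x :
  pval (\sum_(i <- r) F i) x = \sum_(i <- r) pval (F i) x.
Proof.
elim: r => [|a r IH]; last by rewrite !big_cons pvalD IH.
by rewrite !big_nil -polyC0 pvalC mul0r.
Qed.

Lemma pval_bounded (p : {poly R}) :
  exists2 C, 0 < C & forall x, `|pval p x| <= C * nsq x.
Proof.
have [C C0 hC] := rpoly_bounded p; exists (C + 1) => [|y]; first by lra.
have := inner_CS (rpoly p y) y; rewrite -/(pval p y).
have := hC y; have n0 := nsq_ge0 y => h1 h2.
have h3 : pval p y ^+ 2 <= C * nsq y ^+ 2.
  by apply: le_trans h2 _; rewrite expr2 mulrA; apply: ler_wpM2r.
have C1 : 0 <= (C + 1) * nsq y by rewrite mulr_ge0//; lra.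
rewrite -(ler_pXn2r (n := 2)) ?nnegrE//.
rewrite real_normK ?num_real// exprMn; apply: le_trans h3 _.
by apply: ler_wpM2r; [exact: sqr_ge0|have := sqr_ge0 C; lra].
Qed.

(** Let [m] be the infimum of the numerical range of p(T), supposed negative, and q = p - m. Vectors
    nearly attaining [m] are nearly annihilated by q(T), so some complex root of [q] is an
    approximate eigenvalue of [T] and thus lies in [0, 1]; there p would equal m < 0. *)
Lemma pval_ge0 (p : {poly R}) x : (forall s, 0 <= s <= 1 -> 0 <= p.[s]) -> 0 <= pval p x.
Proof.
move=> p0; rewrite leNgt; apply/negP => lt.
pose S := [set pval p y / nsq y | y in [set y | y != 0]].
have x0 : x != 0.
  apply: contraTneq lt => ->; rewrite /pval inner0r.
  by rewrite ltxx.
have [C C0 hC] := pval_bounded p.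
have hS : has_inf S.
  split; first by exists (pval p x / nsq x), x.
  exists (- C) => _ [y /= y0 <-].
  by rewrite ler_pdivlMr ?nsq_gt0//; have := hC y; rewrite ler_norml => /andP[]; rewrite mulNr.
pose m := inf S.
have mle y : m * nsq y <= pval p y.
  case: (eqVneq y 0) => [->|y0]; first by rewrite nsq0 mulr0 /pval inner0r.
  rewrite -ler_pdivlMr ?nsq_gt0//; apply: ge_inf; first by case: hS.
  by exists y.
have m0 : m < 0.
  apply: (@le_lt_trans _ _ (pval p x / nsq x)).
    by apply: ge_inf; [case: hS|exists x].
  by rewrite pmulr_llt0 ?invr_gt0 ?nsq_gt0.
pose q := p - m%:P.
have q0 y : 0 <= pval q y by rewrite /q pvalB pvalC subr_ge0.
have [D D0 hD] := pval_bounded q.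
(* Cauchy-Schwarz for the nonnegative form of q(T) gives |q(T) y|^4 <= <q(T) y, y> D |q(T) y|^2, so
   near-minimisers of the form have small image. *)
have small (d : R) : 0 < d -> exists y, nsq (rpoly q y) < d * nsq y.
  move=> d0; pose e := d / D.
  have e0 : 0 < e by exact: divr_gt0.
  have [_ [y /= y0 <-] hy] := inf_adherent e0 hS.
  have {}hy : pval q y < e * nsq y.
    have : pval p y < (m + e) * nsq y by rewrite -ltr_pdivrMr ?nsq_gt0.
    by rewrite /q pvalB pvalC mulrDl; lra.
  exists y; have pos : nonneg_on [set: H] (fun x y => '[rpoly q x, y]).
    by move=> z _; exact: q0.
  have := form_CS (rpoly_form q) pos (I : [set: H] y) (I : [set: H] (rpoly q y)).
  rewrite -/(nsq (rpoly q y)) -/(pval q y) -/(pval q (rpoly q y)) => h1.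
  have h2 : pval q (rpoly q y) <= D * nsq (rpoly q y).
    by apply: le_trans (hD _); exact: ler_norm.
  have := nsq_ge0 (rpoly q y); rewrite le_eqVlt => /orP[/eqP <-|n0].
    by rewrite mulr_gt0 ?nsq_gt0.
  have h3 : nsq (rpoly q y) ^+ 2 <= pval q y * (D * nsq (rpoly q y)).
    by apply: le_trans h1 _; apply: ler_wpM2l.
  have h4 : nsq (rpoly q y) <= pval q y * D.
    by rewrite -(ler_pM2r n0) -mulrA -expr2.
  by apply: le_lt_trans h4 _; rewrite -ltr_pdivlMr// mulrAC.
pose Q := map_poly (real_complex R) q.
have Qz : Q != 0.
  rewrite map_poly_eq0; apply: contraTneq lt => q00.
  have := p0 0; rewrite lexx ler01 => /(_ isT).
  have -> : p = m%:P by apply/eqP; rewrite -subr_eq0 -/q q00.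
  by rewrite hornerC leNgt m0.
have [s Qs] := closed_field_poly_normal Q.
have l0 : lead_coef Q != 0 by rewrite lead_coef_eq0.
pose N := complex.Re (lead_coef Q) ^+ 2 + complex.Im (lead_coef Q) ^+ 2.
have N0 : 0 < N.
  rewrite lt_neqAle addr_ge0 ?sqr_ge0// andbT eq_sym paddr_eq0 ?sqr_ge0// !sqrf_eq0.
  by move: l0; rewrite eq_complex.
have [d d0|z zs hz] := @prod_shift_below s.
  have [|y hy] := small (N * d); first exact: mulr_gt0.
  exists y; rewrite -(ltr_pM2l N0) mulrA -nsqZ -opolyZ -Qs.
  exact: hy.
have [t t01 zt] := opT_shift_below hz.
have : root Q z.
  by rewrite Qs rootZ// root_prod_XsubC.
rewrite zt /root horner_map eq_complex /= eqxx andbT => /eqP.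
rewrite /q hornerD hornerN hornerC => e; have := p0 t t01.
by lra.
Qed.

End OperatorPolynomials.

(** * Scalar spectral measures as Lebesgue-Stieltjes measures *)

Lemma lebesgue_stieltjes_itvoc (R : realType) (c : cumulative R R) a b : a <= b ->
  lebesgue_stieltjes_measure c `]a, b]%classic = (c b - c a)%:E.
Proof.
move=> ab; rewrite /lebesgue_stieltjes_measure/= /measure_extension/= measurable_mu_extE/=.
  by rewrite (@wlength_itv_bnd R c a b false false).
exact: is_ocitv.
Qed.

Lemma cumulative_measure (R : realType) (F : R -> R) :
  {homo F : x y / x <= y} ->
  (forall a e, 0 < e -> exists2 d, 0 < d & F (a + d) <= F a + e) ->
  exists mu : {measure set (measurableTypeR R) -> \bar R},
    forall a b, a <= b -> mu `]a, b]%classic = (F b - F a)%:E.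
Proof.
move=> nd rc.
have rc' : right_continuous F.
  move=> a; apply/cvgrPdist_le => e e0; have [d d0 hd] := rc a e e0.
  near=> x.
  have ax : a <= x by near: x; exact: nbhs_right_ge.
  have xd : x <= a + d by near: x; apply: nbhs_right_le; rewrite ltrDl.
  rewrite ler0_norm ?subr_le0 ?nd// opprB lerBlDl.
  by apply: le_trans hd; exact: nd.
pose c : cumulative R R := HB.pack F (isCumulative.Build R _ R F nd rc').
by exists (lebesgue_stieltjes_measure c) => a b ab; exact: lebesgue_stieltjes_itvoc.
Unshelve. all: by end_near. Qed.

Lemma horner_lipschitz (R : realType) (p : {poly R}) :
  exists2 L, 0 < L & forall s t, 0 <= s <= 1 -> 0 <= t <= 1 ->
    `|p.[s] - p.[t]| <= L * `|s - t|.
Proof.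
elim/poly_ind: p => [|p c [L L0 hL]].
  by exists 1 => // s t _ _; rewrite !horner0 subrr normr0 mul1r.
have [M M0 hM] := horner_bounded p.
exists (L + M) => [|s t hs ht]; first exact: addr_gt0.
rewrite !hornerMXaddC.
have -> : p.[s] * s + c - (p.[t] * t + c) = (p.[s] - p.[t]) * s + p.[t] * (s - t) by ring.
apply: le_trans (ler_normD _ _) _; rewrite [leRHS]mulrDl; apply: lerD; rewrite normrM.
  case/andP: (hs) => s0 s1; rewrite (ger0_norm s0) -[leRHS]mulr1.
  by apply: ler_pM => //; exact: hL.
by apply: ler_wpM2r => //; exact: hM.
Qed.

Section SpectralMeasure.
Context {R : realType} {H : hilbertType R} (T : H -> H).
Notation MR := (measurableTypeR R).
Hypothesis T_lin : forall (c : R[i]) x y, T (c *: x + y) = c *: T x + T y.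
Hypothesis T_sym : forall x y, '[T x, y] = '[x, T y].
Hypothesis T_pos : forall x, 0 <= complex.Re '[T x, x] <= nsq x.
Variable x : H.
Local Notation L p := (pval T p x).

Lemma pval_le (p q : {poly R}) : (forall s, 0 <= s <= 1 -> p.[s] <= q.[s]) -> L p <= L q.
Proof.
move=> pq; rewrite -subr_ge0 -pvalB; apply: pval_ge0 => // s hs.
by rewrite hornerD hornerN subr_ge0 pq.
Qed.

(** [F], defined from these polynomials, is to be the distribution function of the measure: the
    infimum of <p(T) x, x> over all [p] that dominate the indicator of ]-oo, l] on [0, 1]. *)
Let adm (l : R) : set {poly R} :=
  [set p | forall s, 0 <= s <= 1 -> (s <= l)%R%:R <= p.[s]].
Let F (l : R) : R := inf [set L p | p in adm l].

Let adm1 l : adm l 1.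
Proof. by move=> s _; rewrite hornerE lern1; case: (s <= l). Qed.

Let adm_ge0 l p : adm l p -> 0 <= L p.
Proof. by move=> h; apply: pval_ge0 => // s /h; apply: le_trans. Qed.

Let adm_inf l : has_inf [set L p | p in adm l].
Proof.
split; first by exists (L 1), 1 => //; exact: adm1.
by exists 0 => _ [p hp <-]; exact: adm_ge0 hp.
Qed.

Let F_le l p : adm l p -> F l <= L p.
Proof. by move=> hp; apply: ge_inf; [case: (adm_inf l)|exists p]. Qed.

Let F_adherent l e : 0 < e -> exists2 p, adm l p & L p < F l + e.
Proof. by move=> e0; have [_ [p hp <-] lt] := inf_adherent e0 (adm_inf l); exists p. Qed.

Let F_ge0 l : 0 <= F l.
Proof.
apply: lb_le_inf; first by exists (L 1), 1 => //; exact: adm1.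
by move=> _ [p hp <-]; exact: adm_ge0 hp.
Qed.

Let F_homo : {homo F : l l' / l <= l'}.
Proof.
move=> l l' ll'; apply: lb_le_inf.
  by exists (L 1), 1 => //; exact: adm1.
move=> _ [p hp <-]; apply: F_le => s hs; apply: le_trans (hp s hs).
by rewrite ler_nat; case: (leP s l) => // sl; rewrite (le_trans sl ll').
Qed.

Let F_neg l : l < 0 -> F l = 0.
Proof.
move=> l0; apply/eqP; rewrite eq_le F_ge0 andbT.
apply: le_trans (F_le (p := 0) _) _ => [s /andP[s0 _]|].
  have -> : (s <= l) = false by apply/negbTE; rewrite -ltNge (lt_le_trans l0 s0).
  by rewrite horner0.
by rewrite -polyC0 pvalC// mul0r.
Qed.

Let F_one l : 1 <= l -> F l = nsq x.
Proof.
move=> l1; apply/eqP; rewrite eq_le; apply/andP; split.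
  by apply: le_trans (F_le (adm1 l)) _; rewrite -polyC1 pvalC// mul1r.
apply: lb_le_inf; first by exists (L 1), 1 => //; exact: adm1.
move=> _ [p hp <-]; rewrite -[leLHS]mul1r -(pvalC T 1 x) polyC1; apply: pval_le => s hs.
rewrite hornerE; apply: le_trans (hp s hs).
by case/andP: hs => _ s1; rewrite (le_trans s1 l1).
Qed.

(** A near-optimal polynomial at [a], raised by a small constant, stays admissible slightly to the
    right because it is Lipschitz on [0, 1]. For [a < 0] both values are 0. *)
Let F_rc a e : 0 < e -> exists2 d, 0 < d & F (a + d) <= F a + e.
Proof.
move=> e0; case: (ltP a 0) => a0.
  exists (- a / 2); first by lra.
  by rewrite !F_neg//; lra.
have e2 : 0 < e / 2 by lra.
have [p hp pF] := F_adherent a e2.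
have [K K0 hK] := horner_lipschitz p.
have [eta eta0 etae] : exists2 eta, 0 < eta & eta * nsq x <= e / 2.
  have n1 : 0 < nsq x + 1 by rewrite ltr_wpDl ?nsq_ge0.
  exists (e / 2 / (nsq x + 1)); first exact: divr_gt0.
  rewrite mulrAC ler_pdivrMr// ler_pM2l//; lra.
exists (eta / K); first exact: divr_gt0.
apply: (@le_trans _ _ (L (p + eta%:P))).
  apply: F_le => s /[dup] hs /andP[s0 s1]; rewrite hornerD hornerC.
  case: (leP s (a + eta / K)) => sa.
    case: (leP s a) => sa'; last first.
      have a1 : 0 <= a <= 1 by rewrite a0 (le_trans (ltW sa') s1).
      have h1 := hK s a hs a1; have h2 := hp a a1; rewrite lexx /= in h2.
      have h3 : K * `|s - a| <= eta.
        rewrite ger0_norm; last by rewrite subr_ge0 ltW.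
        have h3 : s - a <= eta / K by rewrite lerBlDl.
        have := ler_wpM2l (ltW K0) h3.
        by rewrite mulrCA divff ?mulr1 ?gt_eqF//.
      by move: (le_trans h1 h3); rewrite ler_norml => /andP[h4 _] /=; lra.
    by have := hp s hs; rewrite sa' /=; lra.
  have := hp s hs; rewrite /=; have : 0 <= (s <= a)%R%:R :> R by [].
  lra.
by rewrite pvalD// pvalC//; lra.
Qed.

(** The measure is that of [F]. Integrals of monotone polynomials are obtained by comparison with
    step functions; the powers of 1 - X are monotone on [0, 1] and span all polynomials. *)
Lemma spectral_measure_exists :
  exists mu : {measure set MR -> \bar R},
   mu setT = (nsq x)%:E /\ forall p : {poly R},
     mu.-integrable unit_itv (fun s => (p.[s])%:E) /\
     (\int[mu]_(s in unit_itv) (p.[s])%:E = (L p)%:E)%E.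
Proof.
have [mu hmu] := cumulative_measure F_homo F_rc; exists mu.
have muT : mu setT = (nsq x)%:E.
  have cup : \bigcup_n (`](- n.+1%:R), n.+1%:R]%classic : set R) = setT.
    apply/seteqP; split=> // s _; exists (Num.bound `|s|) => //=.
    rewrite in_itv /=; have := archi_boundP (normr_ge0 s) => h.
    have h' : `|s| < (Num.bound `|s|).+1%:R by apply: lt_le_trans h _; rewrite ler_nat.
    by move: (h'); rewrite ltr_norml => /andP[-> /ltW ->].
  have : (mu \o (fun n => `](- n.+1%:R), n.+1%:R]%classic : set MR)) n @[n --> \oo] --> mu setT.
    rewrite -cup; apply: nondecreasing_cvg_mu.
    - by move=> n; exact: measurable_itv.
    - by rewrite cup; exact: measurableT.
    - move=> n m nm; apply/subsetPset => s /=; rewrite !in_itv /= => /andP[h1 h2].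
      have nm' : n.+1%:R <= m.+1%:R :> R by rewrite ler_nat.
      by rewrite (le_trans h2 nm') andbT (le_lt_trans _ h1)// lerN2.
  move=> /(cvg_lim (@ereal_hausdorff R)) <-.
  rewrite (_ : _ \o _ = fun=> (nsq x)%:E); first by rewrite lim_cst.
  apply/funext => n /=; rewrite hmu; last by rewrite (@le_trans _ _ 0)// oppr_le0.
  by rewrite F_one ?ler1n// F_neg ?subr0// oppr_lt0.
(* [F] vanishes on negative reals, so every interval from -1/(n+1) to [l] has mass [F l]; their
   intersection contains 0, so a possible atom there is kept. *)
have muD (l : R) : 0 <= l <= 1 -> mu (`]-oo, l]%classic `&` unit_itv) = (F l)%:E.
  move=> /andP[l0 l1].
  have cap : \bigcap_n (`](- n.+1%:R^-1), l]%classic : set R) = `]-oo, l]%classic `&` unit_itv.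
    apply/seteqP; split=> [s h|s [/=]].
      have sl : s <= l by have := h 0%N I; rewrite /= in_itv => /andP[].
      have s0 : 0 <= s.
        rewrite leNgt; apply/negP; rewrite -oppr_gt0 => /invS_lt[N hN].
        have := h N I; rewrite /= in_itv /= => /andP[h1 _].
        by have := hN N (leqnn N); rewrite ltNge => /negP; apply; rewrite ltW// ltrNl.
      by split; rewrite /unit_itv /= in_itv //= s0 (le_trans sl l1).
    rewrite in_itv /= => sl; rewrite /unit_itv /= in_itv /= => /andP[s0 _] n _ /=.
    by rewrite in_itv /= sl andbT (lt_le_trans _ s0)// oppr_lt0 invr_gt0.
  have : (mu \o (fun n => `](- n.+1%:R^-1), l]%classic : set MR)) n @[n --> \oo] -->
     mu (`]-oo, l]%classic `&` unit_itv).
    rewrite -cap; apply: nonincreasing_cvg_mu.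
    - apply: le_lt_trans (ltry (nsq x)); rewrite -muT.
      by apply: le_measure; rewrite ?inE//; exact: measurable_itv.
    - by move=> n; exact: measurable_itv.
    - by rewrite cap; apply: measurableI; [exact: measurable_itv|exact: measurable_unit_itv].
    - move=> n m nm; apply/subsetPset => s /=; rewrite !in_itv /= => /andP[h1 ->].
      by rewrite andbT (le_lt_trans _ h1)// lerN2 lef_pV2 ?posrE// ler_nat.
  move=> /(cvg_lim (@ereal_hausdorff R)) <-.
  rewrite (_ : _ \o _ = fun=> (F l)%:E); first by rewrite lim_cst.
  apply/funext => n /=; rewrite hmu; last by rewrite (@le_trans _ _ 0)// oppr_le0.
  by rewrite [X in _ - X]F_neg ?subr0// oppr_lt0 invr_gt0.
have muU : mu unit_itv = (nsq x)%:E.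
  rewrite -(F_one (lexx 1)) -muD ?ler01 ?lexx//; congr (mu _).
  apply/seteqP; split=> [s us|s []//]; split=> //; move: us.
  by rewrite /unit_itv /= !in_itv /= => /andP[_ ->].
have ufin : (mu unit_itv < +oo)%E by rewrite muU ltry.
have integ p : mu.-integrable unit_itv (fun s => (p.[s])%:E).
  apply: measurable_bounded_integrable => //; first exact: measurable_unit_itv.
    by apply: measurable_funTS; exact: measurable_horner.
  have [M M0 hM] := horner_bounded p; exists M; split; first exact: num_real.
  move=> y My s /unit_itvP hs; apply: le_trans (hM s hs) (ltW My).
split => // p; split => //.
have steps N (c l : 'I_N -> R) : (forall i, 0 <= c i) -> (forall i, 0 <= l i <= 1) ->
    (\int[mu]_(s in unit_itv) (\sum_i c i * (s <= l i)%R%:R)%:E = (\sum_i c i * F (l i))%:E)%E.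
  move=> c0 l01.
  have e1 s : (\sum_i c i * (s <= l i)%R%:R)%:E = (\sum_i ((c i)%:E * (\1_(`]-oo, l i]%classic) s)%:E))%E.
    rewrite -sumEFin; apply: eq_bigr => i _.
    by rewrite indicE mem_setE in_itv.
  under eq_integral do rewrite e1.
  rewrite ge0_integral_sum//; last 3 first.
  - exact: measurable_unit_itv.
  - move=> i; apply: measurable_funeM; apply/measurable_EFinP; apply: measurable_indic.
    exact: measurable_itv.
  - by move=> i s _; rewrite -EFinM lee_fin mulr_ge0// indicE.
  rewrite -sumEFin; apply: eq_bigr => i _.
  rewrite ge0_integralZl_EFin//; last 2 first.
  - exact: measurable_unit_itv.
  - apply/measurable_EFinP; apply: measurable_indic; exact: measurable_itv.
  by rewrite integral_indic ?muD//; (exact: measurable_unit_itv || exact: measurable_itv).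
have intE (f g : R -> R) (e : R) : measurable_fun setT (f : MR -> R) -> measurable_fun setT (g : MR -> R) ->
    0 <= e -> (forall s, 0 <= s <= 1 -> 0 <= f s <= g s + e) -> (forall s, 0 <= s <= 1 -> 0 <= g s) ->
    (\int[mu]_(s in unit_itv) (f s)%:E <= \int[mu]_(s in unit_itv) (g s)%:E + (e * nsq x)%:E)%E.
  move=> mf mg e0 fg g0.
  have mE (h : R -> R) : measurable_fun setT (h : MR -> R) ->
     measurable_fun (unit_itv : set MR) (fun s : MR => (h s)%:E).
    by move=> mh; apply/measurable_EFinP; exact: measurable_funTS.
  apply: (@le_trans _ _ (\int[mu]_(s in unit_itv) ((g s)%:E + e%:E))%E).
    apply: ge0_le_integral => //; first exact: measurable_unit_itv.
    - by move=> s /unit_itvP /fg /andP[]; rewrite lee_fin.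
    - exact: mE.
    - by apply: emeasurable_funD; exact: mE.
    - by move=> s /unit_itvP /fg /andP[]; rewrite -EFinD lee_fin.
  rewrite ge0_integralD//; try solve [exact: measurable_unit_itv | exact: mE
    | by move=> s /unit_itvP /g0; rewrite lee_fin].
  by rewrite integral_cst ?muU//; exact: measurable_unit_itv.
have mstep N (c l : 'I_N -> R) : measurable_fun setT (fun s : MR => \sum_i c i * (s <= l i)%R%:R).
  apply: measurable_sum => i; apply: measurable_funM => //.
  rewrite (_ : (fun _ => _) = \1_(`]-oo, l i]%classic : set MR)).
    by apply: measurable_indic; exact: measurable_itv.
  by apply/funext => s; rewrite indicE mem_setE in_itv.
(* A decreasing Lipschitz polynomial lies between two step functions that are
   uniformly close to it. *)
have decr (P : {poly R}) (K : R) : 0 <= K -> P.[1] = 0 ->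
    (forall s t, 0 <= s -> s <= t -> t <= 1 -> P.[t] <= P.[s] <= P.[t] + K * (t - s)) ->
    (\int[mu]_(s in unit_itv) (P.[s])%:E = (L P)%:E)%E.
  move=> K0 P1 Pd.
  have P0 s : 0 <= s <= 1 -> 0 <= P.[s].
    by case/andP=> s0 s1; have := Pd s 1 s0 s1 (lexx _); rewrite P1 => /andP[].
  have key (e : R) : 0 < e ->
      (\int[mu]_(s in unit_itv) (P.[s])%:E <= (L P + e * (3 * nsq x + P.[0] * nsq x))%:E)%E /\
      ((L P)%:E <= \int[mu]_(s in unit_itv) (P.[s])%:E + (e * (nsq x + P.[0]))%:E)%E.
    move=> e0.
    have [N hN] : exists N : nat, K / N.+1%:R <= e.
      have [|N hN] := @invS_lt R (e / (K + 1)); first by rewrite divr_gt0//; lra.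
      exists N; have := hN N (leqnn N) => h.
      apply: (@le_trans _ _ (K * (e / (K + 1)))); first by apply: ler_wpM2l => //; exact: ltW.
      by rewrite mulrA ler_pdivrMr; [nra|lra].
    pose l (i : nat) : R := i%:R / N.+1%:R.
    have N0 : 0 < N.+1%:R :> R by [].
    have l01 (i : nat) : (i <= N.+1)%N -> 0 <= l i <= 1.
      by move=> iN; rewrite /l divr_ge0//= ler_pdivrMr// mul1r ler_nat.
    have lS i : l i <= l i.+1 by rewrite /l ler_pM2r ?invr_gt0// ler_nat.
    have lSlt i : l i < l i.+1 by rewrite /l ltr_pM2r ?invr_gt0// ltr_nat.
    have lSd i : l i.+1 - l i = N.+1%:R^-1.
      by rewrite /l -mulrBl -natrB// subSnn mul1r.
    pose c (i : nat) := P.[l i] - P.[l i.+1].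
    have c0 (i : 'I_N.+1) : 0 <= c i.
      have /andP[h1 _] := l01 i (ltnW (ltn_ord i)).
      have /andP[_ h2] := l01 i.+1 (ltn_ord i).
      by have /andP[] := Pd _ _ h1 (lS i) h2; rewrite /c subr_ge0.
    have ce (i : 'I_N.+1) : c i <= e.
      have /andP[h1 _] := l01 i (ltnW (ltn_ord i)).
      have /andP[_ h2] := l01 i.+1 (ltn_ord i).
      have /andP[_] := Pd _ _ h1 (lS i) h2; rewrite lSd /c => h.
      by apply: le_trans hN; rewrite lerBlDl.
    have sumc : \sum_(i < N.+1) c i = P.[0].
      rewrite -(big_mkord xpredT c) /c.
      rewrite (eq_bigr (fun i => - P.[l i.+1] - - P.[l i])) => [|i _]; last by rewrite opprK addrC.
      rewrite telescope_sumr// /l mul0r divff ?P1 ?pnatr_eq0//.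
      by rewrite oppr0 add0r opprK.
    pose sg (s : R) := \sum_(i < N.+1) c i * (s <= l i)%R%:R.
    pose sg' (s : R) := \sum_(i < N.+1) c i * (s <= l i.+1)%R%:R.
    (* With the cut-offs max(s, l i) the sum telescopes from P(s) to P(1) = 0, which lets both step
       functions be compared with [P] term by term. *)
    have tel s : 0 <= s <= 1 -> \sum_(i < N.+1) (P.[Num.max s (l i)] - P.[Num.max s (l i.+1)]) = P.[s].
      move=> /andP[s0 s1].
      rewrite -(big_mkord xpredT (fun i => P.[Num.max s (l i)] - P.[Num.max s (l i.+1)])).
      rewrite (eq_bigr (fun i => - P.[Num.max s (l i.+1)] - - P.[Num.max s (l i)])) => [|i _]; last by rewrite opprK addrC.
      rewrite telescope_sumr// /l mul0r divff ?pnatr_eq0//.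
      by rewrite max_r// P1 max_l// oppr0 add0r opprK.
    have sgP s : 0 <= s <= 1 -> sg s <= P.[s].
      move=> hs; rewrite -tel// /sg; apply: ler_sum => i _.
      have /andP[h1 _] := l01 i (ltnW (ltn_ord i)).
      have /andP[h3 h2] := l01 i.+1 (ltn_ord i).
      case/andP: (hs) => s0 s1.
      case: (leP s (l i)) => /= si.
        by rewrite mulr1 max_r// (le_trans si (lS i)).
      rewrite mulr0 subr_ge0; case: (leP s (l i.+1)) => // si'.
      by have /andP[] := Pd s (l i.+1) s0 si' h2.
    have Psg' s : 0 <= s <= 1 -> P.[s] <= sg' s.
      move=> hs; rewrite -tel// /sg'; apply: ler_sum => i _.
      have /andP[h1 h4] := l01 i (ltnW (ltn_ord i)).
      have /andP[h3 h2] := l01 i.+1 (ltn_ord i).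
      case/andP: (hs) => s0 s1.
      case: (leP s (l i.+1)) => /= si.
        rewrite mulr1 /c lerD2r; case: (leP s (l i)) => // si'.
        by have /andP[] := Pd (l i) s h1 (ltW si') s1.
      by rewrite mulr0 max_l ?subrr// (le_trans (lS i) (ltW si)).
    have sgd s : 0 <= s <= 1 -> sg' s <= sg s + e.
      move=> hs; rewrite -lerBlDl /sg /sg' -sumrB.
      apply: (@le_trans _ _ (\sum_(i < N.+1) e * ((s <= l i.+1)%R%:R - (s <= l i)%R%:R))).
        apply: ler_sum => i _; rewrite -mulrBr; apply: ler_wpM2r => //.
        rewrite subr_ge0 ler_nat; case: (leP s (l i)) => // si.
        by rewrite (le_trans si (lS i)).
      rewrite -mulr_sumr -(big_mkord xpredT (fun i => (s <= l i.+1)%R%:R - (s <= l i)%R%:R)).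
      rewrite telescope_sumr// -[leRHS]mulr1; apply: ler_wpM2l; first exact: ltW.
      by case: (s <= l N.+1); case: (s <= l 0%N); rewrite /=; lra.
    have sg0 s : 0 <= s <= 1 -> 0 <= sg s.
      by move=> _; apply: sumr_ge0 => i _; rewrite mulr_ge0.
    have P00 : 0 <= P.[0] by apply: P0; rewrite lexx ler01.
    have nx := nsq_ge0 x.
    split.
      apply: (@le_trans _ _ (\int[mu]_(s in unit_itv) (sg s)%:E + (e * nsq x)%:E)%E).
        apply: intE => //; [exact: measurable_horner|exact: mstep|exact: ltW|].
        move=> s hs; rewrite P0//=.
        by apply: le_trans (Psg' s hs) _; exact: sgd.
      rewrite /sg steps//; last by move=> i; apply: l01; exact: ltnW.
      rewrite -EFinD lee_fin.
      (* [r i] is admissible at [l i] and at most [e] beyond [l i.+1]; the weighted sum of the [r i]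
         exceeds the upper step function by at most e P(0). *)
      have /boolp.choice[r hr] (i : 'I_N.+1) := step_poly (lSlt i) e0.
      have : \sum_(i < N.+1) c i * F (l i) <= L (\sum_(i < N.+1) c i *: r i).
        rewrite pval_sum//; apply: ler_sum => i _; rewrite pvalZ//.
        apply: ler_wpM2l => //; apply: F_le => s hs.
        have [h1 _ h2 _] := hr i s hs.
        by case: (leP s (l i)) => // /h2.
      have : L (\sum_(i < N.+1) c i *: r i) <= L (P + (e + e * P.[0])%:P).
        apply: pval_le => s hs; rewrite horner_sum hornerD hornerC.
        apply: (@le_trans _ _ (sg' s + e * P.[0])).
          rewrite -sumc mulr_sumr -big_split/=; apply: ler_sum => i _.
          rewrite hornerZ [e * _]mulrC -mulrDr; apply: ler_wpM2l => //.
          have [h1 h3 h2 h4] := hr i s hs.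
          case: (leP s (l i.+1)) => //= /ltW /h4; lra.
        have := sgd s hs; have := sgP s hs; lra.
      by rewrite pvalD// pvalC//; have := mulr_ge0 (ltW e0) nx; lra.
    apply: (@le_trans _ _ (\sum_(i < N.+1) c i * F (l i.+1) + e * P.[0])%:E).
      (* For the other inequality: the weighted sum of nearly optimal admissible polynomials
         dominates the upper step function, hence [P]. *)
      have /boolp.choice[q hq] (i : 'I_N.+1) : exists q, adm (l i.+1) q /\ L q < F (l i.+1) + e.
        by have [q ? ?] := F_adherent (l i.+1) e0; exists q.
      rewrite lee_fin; apply: (@le_trans _ _ (L (\sum_(i < N.+1) c i *: q i))).
        apply: pval_le => s hs; rewrite horner_sum; apply: le_trans (Psg' s hs) _.
        apply: ler_sum => i _; rewrite hornerZ; apply: ler_wpM2l => //.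
        by have [h _] := hq i; exact: h.
      rewrite pval_sum// -sumc mulr_sumr -big_split/=; apply: ler_sum => i _.
      rewrite pvalZ// [e * _]mulrC -mulrDr; apply: ler_wpM2l => //.
      by have [_ /ltW] := hq i.
    have [_ st] := (I, steps N.+1 (fun i => c i) (fun i => l i.+1) c0 (fun i => l01 i.+1 (ltn_ord i))).
    have h : (\int[mu]_(s in unit_itv) (sg' s)%:E <= \int[mu]_(s in unit_itv) (P.[s])%:E + (e * nsq x)%:E)%E.
      apply: intE => //; [exact: mstep|exact: measurable_horner|exact: ltW|].
      move=> s hs; apply/andP; split; first by apply: le_trans (Psg' s hs); exact: P0.
      by apply: le_trans (sgd s hs) _; rewrite lerD2r sgP.
    rewrite /sg' st in h.
    rewrite mulrDr !EFinD addeA; exact: leeD.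
  have Jfin : (\int[mu]_(s in unit_itv) (P.[s])%:E)%E \is a fin_num.
    by apply: integrable_fin_num; [exact: measurable_unit_itv|exact: integ].
  move: key; rewrite -(fineK Jfin); set J := fine _ => key.
  congr (_ %:E); apply/eqP; rewrite eq_le; apply/andP; split; rewrite -subr_le0.
    apply: (@le0_eps _ _ (3 * nsq x + P.[0] * nsq x)) => e /key[+ _].
    by rewrite lee_fin; lra.
  apply: (@le0_eps _ _ (nsq x + P.[0])) => e /key[_].
  by rewrite -EFinD lee_fin; lra.
have pow k : (\int[mu]_(s in unit_itv) (((1 - 'X) ^+ k).[s])%:E = (L ((1 - 'X) ^+ k))%:E)%E.
  case: k => [|k].
    under eq_integral do rewrite expr0 hornerE.
    rewrite integral_cst ?muU; last exact: measurable_unit_itv.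
    by rewrite mul1e expr0 -polyC1 pvalC// mul1r.
  apply: (@decr _ k.+1%:R) => //.
    by rewrite !hornerE subrr expr0n.
  move=> s t s0 st t1; rewrite !hornerE.
  have h1 : 0 <= 1 - t by lra.
  have h2 : 1 - t <= 1 - s by lra.
  have h3 : 1 - s <= 1 by lra.
  rewrite lerXn2r ?nnegrE//=; last by apply: le_trans h2.
  rewrite -lerBlDl subrXX.
  have -> : 1 - s - (1 - t) = t - s by ring.
  rewrite mulrC; apply: ler_wpM2r; first by lra.
  rewrite -[X in _ <= X%:R]card_ord -sumr_const; apply: ler_sum => i _.
  by rewrite -[leRHS]mulr1; apply: ler_pM; rewrite ?exprn_ge0 ?exprn_ile1//; lra.
have sumP (s0 : seq nat) (a : nat -> R) :
  (\int[mu]_(s in unit_itv) ((\sum_(k <- s0) a k *: (1 - 'X) ^+ k).[s])%:E =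
   (L (\sum_(k <- s0) a k *: (1 - 'X) ^+ k))%:E)%E.
  elim: s0 => [|k s0 IH].
    rewrite !big_nil; under eq_integral do rewrite horner0.
    by rewrite integral0 -polyC0 pvalC// mul0r.
  rewrite !big_cons; under eq_integral do rewrite hornerD EFinD hornerZ EFinM.
  rewrite integralD//; try solve [exact: measurable_unit_itv | exact: integ
    | by apply: integrableZl; [exact: measurable_unit_itv|exact: integ]].
  rewrite integralZl//; try solve [exact: measurable_unit_itv | exact: integ].
  by rewrite IH pow -EFinM -EFinD pvalD// pvalZ.
(* The substitution X -> 1 - X is an involution, so the coefficients of p o (1 - X) expand p in
   powers of 1 - X. *)
have -> : p = \sum_(k <- iota 0 (size (p \Po (1 - 'X)))) (p \Po (1 - 'X))`_k *: (1 - 'X) ^+ k.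
  have -> : iota 0 (size (p \Po (1 - 'X))) = index_iota 0 (size (p \Po (1 - 'X))).
    by rewrite /index_iota subn0.
  rewrite big_mkord -comp_polyE -comp_polyA comp_polyB comp_polyX comp_polyC.
  by rewrite opprB addrC subrK comp_polyXr.
exact: sumP.
Qed.

End SpectralMeasure.

(** * Functional calculus for square-integrable functions *)

Lemma ler_eps1 (R : realType) (a b K : R) :
  (forall e, 0 < e -> e <= 1 -> a <= b + e * K) -> a <= b.
Proof.
move=> h; rewrite -subr_le0; apply: (@le0_eps _ _ (Num.max K 0)) => e e0.
have m0 : 0 < Num.min e 1 by rewrite lt_min e0 ltr01.
have m1 : Num.min e 1 <= 1 by rewrite ge_min lexx orbT.
have me : Num.min e 1 <= e by rewrite ge_min lexx.
rewrite lerBlDl; apply: le_trans (h _ m0 m1) _; rewrite lerD2l.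
apply: (@le_trans _ _ (Num.min e 1 * Num.max K 0)).
  by apply: ler_wpM2l; rewrite ?le_max ?lexx// ltW.
by apply: ler_wpM2r => //; rewrite le_max lexx orbT.
Qed.

Section SquareIntegralExtra.
Context {R : realType}.
Notation MR := (measurableTypeR R).
Implicit Types (nu : {measure set MR -> \bar R}) (f g : R -> R).

(** The weight keeps the factor of the first term close to 1; with both factors equal to 2 the
    isometry between [f] and the vector it represents would be lost. *)
Lemma sqintD_weighted nu f g (a b k : R) : 0 < k ->
  measurable_fun setT (f : MR -> R) -> measurable_fun setT (g : MR -> R) ->
  sqint nu f a -> sqint nu g b ->
  sqint nu (fun s => f s + g s) ((1 + k) * a + (1 + k^-1) * b).
Proof.
move=> k0 mf mg fa gb; rewrite /sqint.
have k10 : 0 <= 1 + k by lra.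
have ki : 0 < k^-1 by rewrite invr_gt0.
have k20 : 0 <= 1 + k^-1 by lra.
have m2 (r : R) (h : R -> R) : measurable_fun setT (h : MR -> R) ->
    measurable_fun (unit_itv : set MR) (fun s : MR => (r%:E * ((h s) ^+ 2)%:E)%E).
  by move=> mh; apply: measurable_funeM; exact: measurable_sqr.
have sq0 (h : R -> R) s : (0 <= ((h s) ^+ 2)%:E)%E by rewrite lee_fin sqr_ge0.
apply: (@le_trans _ _ (\int[nu]_(s in unit_itv)
    ((1 + k)%:E * ((f s) ^+ 2)%:E + (1 + k^-1)%:E * ((g s) ^+ 2)%:E))%E).
  apply: ge0_le_integral; first exact: measurable_unit_itv.
  - by move=> s _; rewrite lee_fin sqr_ge0.
  - by apply: (@measurable_sqr _ (fun s => f s + g s)); exact: measurable_funD.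
  - by apply: emeasurable_funD; exact: m2.
  - move=> s _; rewrite -!EFinM -EFinD lee_fin.
    have : 0 <= k^-1 * (k * f s - g s) ^+ 2 by rewrite mulr_ge0 ?sqr_ge0// ltW.
    have -> : k^-1 * (k * f s - g s) ^+ 2 = k * f s ^+ 2 - 2 * (f s * g s) + k^-1 * g s ^+ 2.
      by field; rewrite gt_eqF.
    lra.
rewrite ge0_integralD//; try solve [exact: measurable_unit_itv | exact: m2
  | by move=> s _; rewrite -EFinM lee_fin mulr_ge0 ?sqr_ge0].
rewrite !ge0_integralZl_EFin//; try solve [exact: measurable_sqr
  | exact: measurable_unit_itv].
have -> : ((1 + k) * a + (1 + k^-1) * b)%:E = ((1 + k)%:E * a%:E + (1 + k^-1)%:E * b%:E)%E by [].
by apply: leeD; apply: lee_wpmul2l.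
Qed.

Lemma sqint_add (m1 m2 : {measure set MR -> \bar R}) f e :
  measurable_fun setT (f : MR -> R) -> sqint (measure_add m1 m2) f e ->
  sqint m1 f e /\ sqint m2 f e.
Proof.
move=> mf; rewrite /sqint ge0_integral_measure_add//; last 3 first.
- exact: measurable_unit_itv.
- by move=> s _; rewrite lee_fin sqr_ge0.
- exact: measurable_sqr.
have i0 (m : {measure set MR -> \bar R}) : (0 <= \int[m]_(s in unit_itv) ((f s) ^+ 2)%:E)%E.
  by apply: integral_ge0 => s _; rewrite lee_fin sqr_ge0.
move=> h; split; apply: le_trans h; first by rewrite leeDl.
by rewrite leeDr.
Qed.

Lemma sqint_add_lt (m1 m2 : {measure set MR -> \bar R}) f a b :
  measurable_fun setT (f : MR -> R) -> sqint m1 f a -> sqint m2 f b ->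
  sqint (measure_add m1 m2) f (a + b).
Proof.
move=> mf h1 h2; rewrite /sqint ge0_integral_measure_add//; last 3 first.
- exact: measurable_unit_itv.
- by move=> s _; rewrite lee_fin sqr_ge0.
- exact: measurable_sqr.
by rewrite EFinD; exact: leeD.
Qed.

Lemma sqint_eq nu f g e : (forall s, 0 <= s <= 1 -> f s = g s) -> sqint nu f e -> sqint nu g e.
Proof.
move=> fg; rewrite /sqint => h; apply: le_trans h; rewrite le_eqVlt; apply/orP; left.
by apply/eqP; apply: eq_integral => s /set_mem/unit_itvP hs; rewrite fg.
Qed.

End SquareIntegralExtra.

Section FunctionalCalculus.
Context {R : realType} {H : hilbertType R} (T : H -> H).
Notation MR := (measurableTypeR R).
Hypothesis T_lin : forall (c : R[i]) x y, T (c *: x + y) = c *: T x + T y.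
Hypothesis T_sym : forall x y, '[T x, y] = '[x, T y].
Hypothesis T_pos : forall x, 0 <= complex.Re '[T x, x] <= nsq x.
Implicit Types (x y v w : H) (f g : R -> R) (p q : {poly R}).

Definition bmu x : {measure set MR -> \bar R} :=
  projT1 (cid (spectral_measure_exists T_lin T_sym T_pos x)).

Lemma bmuT x : bmu x setT = (nsq x)%:E.
Proof. by rewrite /bmu; case: cid => m []. Qed.

Lemma bmu_poly x p : (\int[bmu x]_(s in unit_itv) (p.[s])%:E = (pval T p x)%:E)%E.
Proof. by rewrite /bmu; case: cid => m /= [_ h]; case: (h p). Qed.

Lemma bmu_fin x : (bmu x setT < +oo)%E.
Proof. by rewrite bmuT ltry. Qed.

Lemma bmu_unit x : bmu x unit_itv = (nsq x)%:E.
Proof.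
have := bmu_poly x 1; under eq_integral do rewrite hornerE.
rewrite integral_cst; last exact: measurable_unit_itv.
by rewrite mul1e -polyC1 pvalC mul1r.
Qed.

Lemma bmu_out x : bmu x (~` unit_itv) = 0%E.
Proof.
have mU := @measurable_unit_itv R.
have := @measureU _ _ _ (bmu x) unit_itv (~` unit_itv) mU (measurableC mU) (setICr _).
rewrite setUv; rewrite [X in X = _](_ : _ = (nsq x)%:E); last by exact: bmuT.
rewrite [X in (X + _)%E](_ : _ = (nsq x)%:E); last by exact: bmu_unit.
have key (y : \bar R) : (nsq x)%:E = ((nsq x)%:E + y)%E -> y = 0%E.
  by case: y => [r||] //; rewrite -EFinD => -[] h; congr (_%:E); lra.
exact: key.
Qed.

Lemma bmu_setI x (A : set MR) : measurable A -> bmu x (A `&` unit_itv) = bmu x A.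
Proof.
move=> mA; have mU := @measurable_unit_itv R.
rewrite -[in RHS](setUIDK A unit_itv) measureU//; last 3 first.
- exact: measurableI.
- exact: measurableD.
- by apply/seteqP; split=> // s [[_ ?] [_ ?]].
rewrite [X in (_ + X)%E](_ : _ = 0%E) ?adde0//.
apply/eqP; rewrite eq_le measure_ge0 andbT -(bmu_out x).
apply: le_measure; rewrite ?inE; [exact: measurableD|exact: measurableC|].
by move=> s [].
Qed.

Lemma sqint_poly x p e : sqint (bmu x) (fun s => p.[s]) e <-> nsq (rpoly T p x) <= e.
Proof.
rewrite -(pval_sqr T_lin T_sym) -lee_fin -bmu_poly /sqint.
by under [in X in _ <-> X]eq_integral do rewrite hornerE.
Qed.

(** The graph of the calculus: [v] is f(T) x, the limit of p(T) x along polynomials tending to [f]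
    in L2 of [bmu x]. As a relation it covers unbounded functions such as 1/s without a prior
    description of the domain. *)
Definition frep f x v : Prop :=
  forall e : R, 0 < e -> exists2 p, sqint (bmu x) (fun s => f s - p.[s]) e &
    nsq (v - rpoly T p x) <= e.

Definition L2fun f x : Prop :=
  [/\ measurable_fun setT (f : MR -> R), (forall s, 0 <= f s)
    & exists a, sqint (bmu x) f a].

(** Density is applied to the sum of the three measures. Linearity, symmetry and multiplicativity of
    the calculus rest on one polynomial being good for several vectors at once. *)
Lemma L2_dense3 f x y z : L2fun f x -> L2fun f y -> L2fun f z ->
  forall e : R, 0 < e -> exists p, [/\ sqint (bmu x) (fun s => f s - p.[s]) e,
   sqint (bmu y) (fun s => f s - p.[s]) e & sqint (bmu z) (fun s => f s - p.[s]) e].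
Proof.
move=> [mf f0 [a1 h1]] [_ _ [a2 h2]] [_ _ [a3 h3]] e e0.
pose nu : {measure set MR -> \bar R} := measure_add (measure_add (bmu x) (bmu y)) (bmu z).
have nufin : (nu setT < +oo)%E.
  have e1 : nu setT = (measure_add (bmu x) (bmu y) setT + bmu z setT)%E.
    exact: measure_addE.
  have e2 : measure_add (bmu x) (bmu y) setT = (bmu x setT + bmu y setT)%E.
    exact: measure_addE.
  by rewrite e1 e2 !bmuT -!EFinD ltry.
have h : sqint nu f (a1 + a2 + a3) by do 2 apply: sqint_add_lt => //.
have [p hp] := poly_dense_nonneg nufin mf f0 (le_lt_trans h (ltry _)) e0.
have mp : measurable_fun setT (fun s : MR => f s - p.[s]).
  by apply: measurable_funB => //; exact: measurable_horner.
have [hxy hz] := sqint_add mp hp; have [hx hy] := sqint_add mp hxy.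
by exists p.
Qed.

Lemma L2_dense f x : L2fun f x ->
  forall e : R, 0 < e -> exists p, sqint (bmu x) (fun s => f s - p.[s]) e.
Proof. by move=> h e e0; have [p []] := L2_dense3 h h h e0; exists p. Qed.

Lemma mfp f p : measurable_fun setT (f : MR -> R) ->
  measurable_fun setT (fun s : MR => f s - p.[s]).
Proof. by move=> mf; apply: measurable_funB => //; exact: measurable_horner. Qed.

Lemma sqint_polyB f x p q a b : measurable_fun setT (f : MR -> R) ->
  sqint (bmu x) (fun s => f s - p.[s]) a -> sqint (bmu x) (fun s => f s - q.[s]) b ->
  nsq (rpoly T p x - rpoly T q x) <= 2 * a + 2 * b.
Proof.
move=> mf hp hq; rewrite -rpolyB; apply/sqint_poly.
have h : sqint (bmu x) (fun s => p.[s] - f s) a.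
  exact: (sqintN (f := f) (g := fun s => p.[s])).
have mpf : measurable_fun setT (fun s : MR => p.[s] - f s).
  by apply: measurable_funB => //; exact: measurable_horner.
have := sqintD mpf (mfp q mf) h hq.
by apply: sqint_eq => s _; rewrite addrA subrK hornerD hornerN.
Qed.

Lemma frep_exists f x : L2fun f x -> exists v, frep f x v.
Proof.
move=> hf; have [mf _ _] := hf.
have /boolp.choice[P hP] (n : nat) : exists p, sqint (bmu x) (fun s => f s - p.[s]) n.+1%:R^-1.
  by apply: L2_dense => //; rewrite invr_gt0.
have [//|e e0|v _ hv] := @hilbert_complete R H (fun n => rpoly T (P n) x).
  have [|N hN] := @invS_lt R (e / 8); first by lra.
  exists N => m n Nm Nn.
  have := sqint_polyB mf (hP m) (hP n); rewrite /nsq => h.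
  apply: le_lt_trans h _; move: (hN m Nm) (hN n Nn).
  by move: (m.+1%:R^-1) (n.+1%:R^-1) => r1 r2; lra.
exists v => e e0; have [N hN] := hv e e0; have [M hM] := invS_lt e0.
pose n := maxn N M; exists (P n).
  by apply: sqint_trans (hP n); apply: ltW; apply: hM; rewrite leq_maxr.
by rewrite nsqC; apply: ltW; apply: hN; rewrite leq_maxl.
Qed.

Lemma frep_close f x v p e : measurable_fun setT (f : MR -> R) ->
  frep f x v -> sqint (bmu x) (fun s => f s - p.[s]) e ->
  nsq (v - rpoly T p x) <= 4 * e.
Proof.
move=> mf hv hp; rewrite -subr_le0; apply: (@le0_eps _ _ 6) => d d0.
have [q hq vq] := hv d d0.
have := nsqD_le (v - rpoly T q x) (rpoly T q x - rpoly T p x).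
rewrite addrA subrK; have := sqint_polyB mf hq hp; lra.
Qed.

Lemma nsq_eq (u w : H) K : (forall e, 0 < e -> nsq (u - w) <= e * K) -> u = w.
Proof.
move=> h; apply/eqP; rewrite -subr_eq0; apply/eqP/nsq_eq0/eqP.
by rewrite eq_le nsq_ge0 andbT; exact: (le0_eps h).
Qed.

Lemma frep_uniq f x v w : measurable_fun setT (f : MR -> R) ->
  frep f x v -> frep f x w -> v = w.
Proof.
move=> mf hv hw; apply: (@nsq_eq _ _ 10) => e e0.
have [p hp vp] := hv e e0; have := frep_close mf hw hp.
have := nsqD_le (v - rpoly T p x) (rpoly T p x - w).
by rewrite addrA subrK (nsqC (rpoly T p x) w); lra.
Qed.

Lemma frep_lin f (c : R[i]) x y v w u :
  L2fun f x -> L2fun f y -> L2fun f (c *: x + y) ->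
  frep f x v -> frep f y w -> frep f (c *: x + y) u -> u = c *: v + w.
Proof.
move=> fx fy fz hv hw hu; have [mf _ _] := fx.
pose N := complex.Re c ^+ 2 + complex.Im c ^+ 2.
have N0 : 0 <= N by rewrite /N addr_ge0 ?sqr_ge0.
apply: (@nsq_eq _ _ (16 + 8 * (2 * N + 2))) => e e0.
have [p [px py pz]] := L2_dense3 fx fy fz e0.
have h1 := frep_close mf hv px; have h2 := frep_close mf hw py.
have h3 := frep_close mf hu pz; rewrite rpoly_lin// in h3.
have := nsqD_le (u - (c *: rpoly T p x + rpoly T p y))
  ((c *: rpoly T p x + rpoly T p y) - (c *: v + w)).
rewrite addrA subrK.
have -> : c *: rpoly T p x + rpoly T p y - (c *: v + w) =
   c *: (rpoly T p x - v) + (rpoly T p y - w).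
  by rewrite scalerBr opprD addrACA.
have := nsqD_le (c *: (rpoly T p x - v)) (rpoly T p y - w).
rewrite nsqZ -/N (nsqC _ v) (nsqC _ w) => h4 h5.
have h6 : N * nsq (v - rpoly T p x) <= N * (4 * e) by apply: ler_wpM2l.
lra.
Qed.

Lemma frep_sym f x y v w : L2fun f x -> L2fun f y ->
  frep f x v -> frep f y w -> '[v, y] = '[x, w].
Proof.
move=> fx fy hv hw; have [mf _ _] := fx.
have sq (z : R[i]) : (forall e, 0 < e -> complex.Re z ^+ 2 + complex.Im z ^+ 2 <= e * (64 * (nsq x + nsq y))) -> z = 0.
  move=> h; have := le0_eps h => h0; have h1 := sqr_ge0 (complex.Re z).
  have h2 := sqr_ge0 (complex.Im z); rewrite [z]complexE.
  have /eqP : complex.Re z ^+ 2 = 0 by lra.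
  have /eqP : complex.Im z ^+ 2 = 0 by lra.
  by rewrite !sqrf_eq0 => /eqP -> /eqP ->.
apply/eqP; rewrite -subr_eq0; apply/eqP/sq => e e0.
have [p [px py _]] := L2_dense3 fx fy fy e0.
have h1 := frep_close mf hv px; have h2 := frep_close mf hw py.
have -> : '[v, y] - '[x, w] = '[v - rpoly T p x, y] + '[x, rpoly T p y - w].
  by rewrite innerBl innerBr rpoly_sym// addrA subrK.
set a := '[_, y]; set b := '[x, _].
have A : complex.Re a ^+ 2 <= 4 * e * nsq y.
  by apply: le_trans (inner_CS _ _) _; apply: ler_wpM2r => //; exact: nsq_ge0.
have nI (z : H) : nsq (Complex 0 1 *: z) = nsq z by rewrite nsqZ /=; ring.
have B : complex.Im a ^+ 2 <= 4 * e * nsq y.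
  rewrite /a (form_Im inner_hermitian)//; apply: le_trans (inner_CS _ _) _.
  by rewrite nI; apply: ler_wpM2r => //; exact: nsq_ge0.
rewrite nsqC in h2.
have C : complex.Re b ^+ 2 <= nsq x * (4 * e).
  by apply: le_trans (inner_CS _ _) _; apply: ler_wpM2l => //; exact: nsq_ge0.
have D : complex.Im b ^+ 2 <= nsq x * (4 * e).
  rewrite /b (form_Im inner_hermitian)//; apply: le_trans (inner_CS _ _) _.
  by rewrite nI; apply: ler_wpM2l => //; exact: nsq_ge0.
rewrite ReD ImD; have := sqr_ge0 (complex.Re a - complex.Re b).
have := sqr_ge0 (complex.Im a - complex.Im b).
have := mulr_ge0 (ltW e0) (nsq_ge0 x); have := mulr_ge0 (ltW e0) (nsq_ge0 y); lra.
Qed.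

Lemma nsqD_weighted (u w : H) k : 0 < k ->
  nsq (u + w) <= (1 + k) * nsq u + (1 + k^-1) * nsq w.
Proof.
move=> k0; rewrite {1}/nsq (Re_formD inner_hermitian)// -!/(nsq _).
have := nsq_ge0 (u + (- k^-1)%:C *: w).
rewrite {1}/nsq (Re_form_expand inner_hermitian)// -!/(nsq _) => h.
have : 0 <= k * (nsq u + 2 * - k^-1 * complex.Re '[u, w] + (- k^-1) ^+ 2 * nsq w).
  by rewrite mulr_ge0// ltW.
have -> : k * (nsq u + 2 * - k^-1 * complex.Re '[u, w] + (- k^-1) ^+ 2 * nsq w) =
   k * nsq u - 2 * complex.Re '[u, w] + k^-1 * nsq w by field; rewrite gt_eqF.
lra.
Qed.

(** One half of the isometry |f(T) x|^2 = integral of f^2; the next lemma is the other. The weight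
    [k] is paired with an approximation of order k^2, so that all errors are of order k. *)
Lemma frep_sqint f x v : measurable_fun setT (f : MR -> R) -> frep f x v ->
  sqint (bmu x) f (nsq v).
Proof.
move=> mf hv; rewrite /sqint; apply/lee_addgt0Pr => e e0; rewrite -EFinD.
have n0 := nsq_ge0 v.
suff [a ha hae] : exists2 a, sqint (bmu x) f a & a <= nsq v + e.
  by apply: le_trans ha _; rewrite lee_fin.
pose k := Num.min 1 (e / (3 * nsq v + 6)).
have d0 : 0 < 3 * nsq v + 6 by lra.
have k0 : 0 < k by rewrite lt_min ltr01 divr_gt0.
have k1 : k <= 1 by rewrite ge_min lexx.
have ke : k * (3 * nsq v + 6) <= e by rewrite -ler_pdivlMr// ge_min lexx orbT.
have k20 : 0 < k ^+ 2 by rewrite exprn_gt0.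
have [p hp vp] := hv _ k20.
have h1 : nsq (rpoly T p x) <= (1 + k) * nsq v + (1 + k^-1) * k ^+ 2.
  have := nsqD_weighted v (rpoly T p x - v) k0; rewrite addrC subrK nsqC => /le_trans; apply.
  by rewrite lerD2l ler_wpM2l// addr_ge0// invr_ge0 ltW.
have := sqintD_weighted k0 (measurable_horner p) (mfp p mf) (proj2 (sqint_poly _ _ _) h1) hp.
move=> h; exists ((1 + k) * ((1 + k) * nsq v + (1 + k^-1) * k ^+ 2) + (1 + k^-1) * k ^+ 2).
  by apply: sqint_eq h => s _; rewrite addrC subrK.
have -> : (1 + k^-1) * k ^+ 2 = k ^+ 2 + k by field; rewrite gt_eqF.
nra.
Qed.

Lemma frep_nsq_le f x v a : measurable_fun setT (f : MR -> R) -> frep f x v ->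
  sqint (bmu x) f a -> nsq v <= a.
Proof.
move=> mf hv fa.
apply: (@ler_eps1 _ _ _ (3 * `|a| + 6)) => k k0 k1.
have k20 : 0 < k ^+ 2 by rewrite exprn_gt0.
have [p hp vp] := hv _ k20.
have h0 : sqint (bmu x) (fun s => p.[s] - f s) (k ^+ 2).
  exact: (sqintN (f := f) (g := fun s => p.[s])).
have mpf : measurable_fun setT (fun s : MR => p.[s] - f s).
  by apply: measurable_funB => //; exact: measurable_horner.
have h := sqintD_weighted k0 mf mpf fa h0.
have h1 : nsq (rpoly T p x) <= (1 + k) * a + (1 + k^-1) * k ^+ 2.
  by apply/sqint_poly; apply: sqint_eq h => s _; rewrite addrC subrK.
have := nsqD_weighted (rpoly T p x) (v - rpoly T p x) k0; rewrite addrC subrK => h2.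
have h3 : (1 + k^-1) * nsq (v - rpoly T p x) <= k ^+ 2 + k.
  have -> : k ^+ 2 + k = (1 + k^-1) * k ^+ 2 by field; rewrite gt_eqF.
  by rewrite ler_wpM2l// addr_ge0// invr_ge0 ltW.
have h4 : (1 + k^-1) * k ^+ 2 = k ^+ 2 + k by field; rewrite gt_eqF.
rewrite h4 in h1.
have h5 : (1 + k) * nsq (rpoly T p x) <= (1 + k) * ((1 + k) * a + (k ^+ 2 + k)).
  by apply: ler_wpM2l => //; lra.
have kk : k ^+ 2 <= k by rewrite expr2 -[leRHS]mulr1 ler_pM2l.
have a0 := normr_ge0 a.
have h6 : (2 * k + k ^+ 2) * a <= (2 * k + k ^+ 2) * `|a|.
  by apply: ler_wpM2l; [lra|exact: ler_norm].
have h7 : (2 * k + k ^+ 2) * `|a| <= (3 * k) * `|a| by apply: ler_wpM2r => //; lra.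
have h8 : (1 + k) * (k ^+ 2 + k) <= 2 * (2 * k) by apply: ler_pM; lra.
lra.
Qed.

Lemma frep_mulX f x v : measurable_fun setT (f : MR -> R) ->
  frep f x v -> frep (fun s => s * f s) x (T v).
Proof.
move=> mf hv e e0; have [p hp vp] := hv e e0; exists ('X * p).
  rewrite -[e]mul1r; apply: sqint_le hp => //.
  - apply: measurable_funB; last exact: measurable_horner.
    by apply: measurable_funM.
  - exact: mfp.
  - move=> s /andP[s0 s1]; rewrite hornerM hornerX -mulrBr exprMn.
    by apply: ler_wpM2r; [exact: sqr_ge0|rewrite exprn_ile1].
rewrite rpolyM// rpolyX// -opTB//.
by apply: le_trans vp; exact: opT_bounded.
Qed.

Lemma L2_bounded f x M : measurable_fun setT (f : MR -> R) -> (forall s, 0 <= f s <= M) ->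
  L2fun f x.
Proof.
move=> mf fM; split => //; first by move=> s; case/andP: (fM s).
exists (1 * (M ^+ 2 * fine (bmu x setT))).
apply: (@sqint_le _ _ _ (fun=> M)) => //; last exact: (sqint_cst (bmu_fin x)).
move=> s _; rewrite mul1r; case/andP: (fM s) => h1 h2.
by apply: lerXn2r; rewrite ?nnegrE// (le_trans h1).
Qed.

Lemma L2_indic (A : set MR) x : measurable A -> L2fun (\1_A) x.
Proof.
move=> mA; apply: (@L2_bounded _ _ 1); first exact: measurable_indic.
by move=> s; rewrite indicE; case: (s \in A) => /=; rewrite ?lexx ?ler01.
Qed.

Definition bproj (A : set R) x : H := xget 0 [set v | frep (\1_A) x v].

Lemma bprojP (A : set MR) x : measurable A -> frep (\1_A) x (bproj A x).
Proof.
move=> mA; rewrite /bproj; case: xgetP => //.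
by have [v hv] := frep_exists (L2_indic x mA) => /(_ v).
Qed.

Lemma bproj_lin (A : set MR) : measurable A -> forall (c : R[i]) x y,
  bproj A (c *: x + y) = c *: bproj A x + bproj A y.
Proof.
move=> mA c x y.
by apply: frep_lin (bprojP x mA) (bprojP y mA) (bprojP _ mA); exact: L2_indic.
Qed.

Lemma bproj_sym (A : set MR) : measurable A -> forall x y,
  '[bproj A x, y] = '[x, bproj A y].
Proof.
move=> mA x y; apply: frep_sym (bprojP x mA) (bprojP y mA); exact: L2_indic.
Qed.

Lemma bprojT x : bproj setT x = x.
Proof.
have mT := @measurable_indic _ MR R setT setT measurableT.
apply: (frep_uniq mT (bprojP x measurableT)) => e e0.
exists 1; last by rewrite -polyC1 rpolyC scale1r subrr nsq0 ltW.
rewrite /sqint; under eq_integral do rewrite indicT hornerE subrr expr0n.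
by rewrite integral0 lee_fin ltW.
Qed.

Lemma bprojI (A B : set MR) : measurable A -> measurable B -> forall x,
  bproj (A `&` B) x = bproj A (bproj B x).
Proof.
move=> mA mB x.
have mi (E : set MR) : measurable E -> measurable_fun setT (\1_E : MR -> R).
  by move=> mE; exact: measurable_indic.
have mAB := measurableI _ _ mA mB.
apply: (@nsq_eq _ _ 100) => e e0.
have [q [q1 q2 _]] := L2_dense3 (L2_indic (bproj B x) mA) (L2_indic x mA) (L2_indic x mA) e0.
have h1 := frep_close (mi _ mA) (bprojP (bproj B x) mA) q1.
have [C C0 hC] := rpoly_bounded T_lin T_sym T_pos q.
have [M M0 hM] := horner_bounded q.
(* The polynomial [p] for the indicator of [B] is chosen after [q], fine enough to survive both the
   bound [C] of q(T) and the bound [M] of [q] on [0, 1]. *)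
pose d := e / (C + M ^+ 2 + 1).
have D0 : 0 < C + M ^+ 2 + 1 by rewrite addr_gt0// addr_gt0// exprn_gt0.
have d0 : 0 < d by exact: divr_gt0.
have CM : M ^+ 2 >= 0 by exact: sqr_ge0.
have Cd : C * d <= e.
  by rewrite /d mulrCA -[leRHS]mulr1 ler_pM2l// ler_pdivrMr// mul1r; lra.
have Md : M ^+ 2 * d <= e.
  by rewrite /d mulrCA -[leRHS]mulr1 ler_pM2l// ler_pdivrMr// mul1r; lra.
have [p hp xp] := bprojP x mB d0.
have h2 : nsq (rpoly T q (bproj B x) - rpoly T (q * p) x) <= e.
  rewrite rpolyM//.
  have -> : rpoly T q (bproj B x) - rpoly T q (rpoly T p x) = rpoly T q (bproj B x - rpoly T p x).
    have := rpoly_lin T_lin q (-1) (rpoly T p x) (bproj B x).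
    by rewrite !scaleN1r addrC => ->; rewrite addrC.
  by apply: le_trans (hC _) _; apply: le_trans Cd; apply: ler_wpM2l => //; exact: ltW.
have h3 : sqint (bmu x) (fun s => \1_(A `&` B) s - (q * p).[s]) (4 * e).
  have s1 : sqint (bmu x) (fun s => \1_B s * (\1_A s - q.[s])) (1 * e).
    apply: sqint_le q2 => //.
    - by apply: measurable_funM; [exact: mi|exact: mfp (mi _ mA)].
    - exact: mfp (mi _ mA).
    - move=> s _; rewrite exprMn; apply: ler_wpM2r; first exact: sqr_ge0.
      by rewrite indicE; case: (s \in B); rewrite ?expr1n ?expr0n.
  have s2 : sqint (bmu x) (fun s => q.[s] * (\1_B s - p.[s])) (M ^+ 2 * d).
    apply: sqint_le hp => //.
    - by apply: measurable_funM; [exact: measurable_horner|exact: mfp (mi _ mB)].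
    - exact: mfp (mi _ mB).
    - move=> s hs; rewrite exprMn; apply: ler_wpM2r; first exact: sqr_ge0.
      rewrite -real_normK ?num_real//; apply: lerXn2r; rewrite ?nnegrE//.
        exact: ltW.
      exact: hM.
  have := sqintD _ _ s1 s2.
  move=> /(_ _)/(_ _) s3.
  apply: (@sqint_trans _ _ _ (2 * (1 * e) + 2 * (M ^+ 2 * d))); first lra.
  have -> : (fun s => \1_(A `&` B) s - (q * p).[s]) =
     (fun s => \1_B s * (\1_A s - q.[s]) + q.[s] * (\1_B s - p.[s])).
    apply/funext => s; rewrite hornerM indicI /=; ring.
  apply: s3.
  - by apply: measurable_funM; [exact: mi|exact: mfp (mi _ mA)].
  - by apply: measurable_funM; [exact: measurable_horner|exact: mfp (mi _ mB)].
have h4 := frep_close (mi _ mAB) (bprojP x mAB) h3.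
have := nsqD_le (bproj (A `&` B) x - rpoly T (q * p) x) (rpoly T (q * p) x - bproj A (bproj B x)).
rewrite addrA subrK.
have := nsqD_le (rpoly T (q * p) x - rpoly T q (bproj B x)) (rpoly T q (bproj B x) - bproj A (bproj B x)).
rewrite addrA subrK (nsqC _ (rpoly T q (bproj B x))) (nsqC _ (bproj A _)); lra.
Qed.

Lemma bmuE (A : set MR) : measurable A -> forall x,
  bmu x A = (complex.Re '[bproj A x, x])%:E.
Proof.
move=> mA x.
have mi : measurable_fun setT (\1_A : MR -> R) by exact: measurable_indic.
have -> : complex.Re '[bproj A x, x] = nsq (bproj A x).
  rewrite -{1}(setIid A) bprojI// bproj_sym//.
rewrite -bmu_setI//.
have e1 : (\int[bmu x]_(s in unit_itv) ((\1_A s : R) ^+ 2)%:E = bmu x (A `&` unit_itv))%E.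
  rewrite -integral_indic//; last exact: measurable_unit_itv.
  by apply: eq_integral => s _; rewrite indicE; case: (s \in A); rewrite ?expr1n ?expr0n.
have f1 : bmu x (A `&` unit_itv) \is a fin_num.
  by rewrite bmu_setI//; apply: measure_fin => //; exact: bmu_fin.
apply/eqP; rewrite eq_le; apply/andP; split.
  by have := frep_sqint mi (bprojP x mA); rewrite /sqint e1.
rewrite -(fineK f1) lee_fin; apply: (frep_nsq_le mi (bprojP x mA)).
by rewrite /sqint e1 fineK.
Qed.

End FunctionalCalculus.

(** * The inverse of an injective operator through the calculus *)

Section InverseFunction.
Context {R : realType} {H : hilbertType R} (T : H -> H).
Notation MR := (measurableTypeR R).
Hypothesis T_lin : forall (c : R[i]) x y, T (c *: x + y) = c *: T x + T y.
Hypothesis T_sym : forall x y, '[T x, y] = '[x, T y].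
Hypothesis T_pos : forall x, 0 <= complex.Re '[T x, x] <= nsq x.
Hypothesis T_inj : forall x, T x = 0 -> x = 0.
Local Notation mu := (bmu T_lin T_sym T_pos).
Local Notation rep := (frep T_lin T_sym T_pos).
Local Notation proj := (bproj T_lin T_sym T_pos).
Local Notation L2 := (L2fun T_lin T_sym T_pos).
Implicit Types (x y v : H).

Lemma frep_eq f g x v : (forall s, 0 <= s <= 1 -> f s = g s) -> rep f x v -> rep g x v.
Proof.
move=> fg h e e0; have [p hp vp] := h e e0; exists p => //.
by apply: sqint_eq hp => s hs; rewrite fg.
Qed.

Lemma frep_int2 f x v : measurable_fun setT (f : MR -> R) -> rep f x v ->
  (\int[mu x]_(s in unit_itv) ((f s) ^+ 2)%:E = (nsq v)%:E)%E.
Proof.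
move=> mf hv; have h1 := frep_sqint mf hv.
have f1 : (\int[mu x]_(s in unit_itv) ((f s) ^+ 2)%:E)%E \is a fin_num.
  rewrite ge0_fin_numE; first exact: le_lt_trans h1 (ltry _).
  by apply: integral_ge0 => s _; rewrite lee_fin sqr_ge0.
apply/eqP; rewrite eq_le; apply/andP; split => //.
rewrite -(fineK f1) lee_fin; apply: (frep_nsq_le mf hv).
by rewrite /sqint fineK.
Qed.

Lemma frep_addc f x v c : measurable_fun setT (f : MR -> R) -> rep f x v ->
  rep (fun s => f s + c) x (v + c%:C *: x).
Proof.
move=> mf hv e e0; have [p hp vp] := hv e e0; exists (p + c%:P).
  by apply: sqint_eq hp => s _; rewrite hornerD hornerC; ring.
by rewrite rpolyD rpolyC opprD addrACA subrr addr0.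
Qed.

Lemma integrable_L2 f x a : measurable_fun setT (f : MR -> R) ->
  sqint (mu x) f a -> (mu x).-integrable unit_itv (fun s => (f s)%:E).
Proof.
move=> mf fa; have mU := @measurable_unit_itv R.
have mE (h : R -> R) : measurable_fun setT (h : MR -> R) ->
     measurable_fun (unit_itv : set MR) (fun s : MR => (h s)%:E).
  by move=> mh; apply/measurable_EFinP; exact: measurable_funTS.
apply/integrableP; split; first exact: mE.
apply: (@le_lt_trans _ _ (\int[mu x]_(s in unit_itv) (((f s) ^+ 2)%:E + 1%:E))%E).
  apply: ge0_le_integral => //.
  - by apply: measurableT_comp => //; exact: mE.
  - by apply: emeasurable_funD => //; exact: measurable_sqr.
  - have key (r : R) : `|r| <= r ^+ 2 + 1.
      by rewrite -real_normK ?num_real//; have := sqr_ge0 (`|r| - 2^-1); nra.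
    by move=> s _; rewrite -EFinD lee_fin; exact: key.
rewrite ge0_integralD//; try solve [exact: measurable_sqr | by move=> s _; rewrite lee_fin sqr_ge0].
rewrite integral_cst// bmu_unit mul1e lte_add_pinfty ?ltry//.
exact: le_lt_trans fa (ltry _).
Qed.

(** The isometry is quadratic; comparing it for [f] and f + 1 isolates twice the integral of [f]. *)
Lemma frep_int f x v : L2 f x -> rep f x v ->
  (\int[mu x]_(s in unit_itv) (f s)%:E = (complex.Re '[v, x])%:E)%E.
Proof.
move=> [mf f0 [a fa]] hv; have mU := @measurable_unit_itv R.
have mf1 : measurable_fun setT (fun s : MR => f s + 1) by exact: measurable_funD.
have h1 := frep_int2 mf hv; have h2 := frep_int2 mf1 (frep_addc 1 mf hv).
have mE (h : R -> R) : measurable_fun setT (h : MR -> R) ->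
     measurable_fun (unit_itv : set MR) (fun s : MR => (h s)%:E).
  by move=> mh; apply/measurable_EFinP; exact: measurable_funTS.
have i0 : (\int[mu x]_(s in unit_itv) (f s)%:E)%E \is a fin_num.
  by apply: integrable_fin_num => //; exact: integrable_L2 fa.
move: h2; have -> : (\int[mu x]_(s in unit_itv) ((f s + 1) ^+ 2)%:E =
   \int[mu x]_(s in unit_itv) (((f s) ^+ 2)%:E + (2%:E * (f s)%:E + 1%:E)))%E.
  by apply: eq_integral => s _; rewrite -EFinM -!EFinD; congr (_%:E); ring.
have m2 : measurable_fun (unit_itv : set MR) (fun s : MR => (2%:E * (f s)%:E)%E).
  by apply: measurable_funeM; exact: mE.
rewrite ge0_integralD//; try solve [exact: measurable_sqr | by move=> s _; rewrite lee_fin sqr_ge0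
  | by apply: emeasurable_funD | by move=> s _; rewrite -EFinM -EFinD lee_fin addr_ge0// mulr_ge0].
rewrite ge0_integralD//; try solve [by move=> s _; rewrite -EFinM lee_fin mulr_ge0].
rewrite ge0_integralZl_EFin//; try solve [exact: mE | by move=> s _; rewrite lee_fin].
rewrite integral_cst// bmu_unit mul1e h1 -(fineK i0) -EFinM -!EFinD => -[].
rewrite scale1r [in RHS]/nsq (Re_formD inner_hermitian)// -!/(nsq _) => h.
by congr (_%:E); lra.
Qed.

(** [T] maps this vector to the one represented by s times the indicator of {0}, which is zero; [T]
    is injective. *)
Lemma bproj_atom0 x : proj [set 0] x = 0.
Proof.
have m0 : measurable ([set 0] : set MR) by exact: measurable_set1.
have mi : measurable_fun setT (\1_[set 0] : MR -> R) by exact: measurable_indic.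
apply: T_inj; have h := frep_mulX mi (bprojP T_lin T_sym T_pos x m0).
apply: (frep_uniq _ h); first by apply: measurable_funM.
move=> e e0; exists 0; last by rewrite -polyC0 rpolyC scale0r subrr nsq0 ltW.
rewrite /sqint (_ : (\int[mu x]_(s in _) _)%E = 0%E) ?lee_fin ?ltW//.
rewrite -(integral0 (mu x) unit_itv); apply: eq_integral => s _.
rewrite horner0 subr0 indicE; case: (boolP (s \in [set 0])) => [|_].
  by rewrite inE => ->; rewrite mul0r expr0n.
by rewrite mulr0 expr0n.
Qed.

Lemma frep_ne0 x : rep (\1_(~` [set 0])) x x.
Proof.
have m0 : measurable ([set 0] : set MR) by exact: measurable_set1.
have mi : measurable_fun setT (\1_[set 0] : MR -> R) by exact: measurable_indic.
move=> e e0; have [p hp vp] := bprojP T_lin T_sym T_pos x m0 e0.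
exists (1 - p).
  have := sqintN (f := \1_[set 0]) (g := fun s => p.[s]) hp.
  apply: sqint_eq => s _; rewrite !hornerE !indicE in_setC.
  by case: (s \in [set 0]) => /=; ring.
rewrite bproj_atom0 sub0r in vp.
rewrite rpolyB -polyC1 rpolyC scale1r opprB addrC subrK.
by rewrite -nsqN.
Qed.

(** 1/s for s > 0 and 0 at 0, hence total and measurable. The value at 0 is harmless because {0}
    carries no spectral mass. *)
Definition pinv (s : R) : R := s `^ (-1).
Lemma pinv_ge0 s : 0 <= pinv s. Proof. exact: powR_ge0. Qed.
Lemma pinvE s : 0 < s -> pinv s = s^-1.
Proof. by move=> s0; rewrite /pinv powR_inv1// ltW. Qed.
Lemma pinv0 : pinv 0 = 0.
Proof. by rewrite /pinv powR0// oppr_eq0 oner_neq0. Qed.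
Lemma measurable_pinv : measurable_fun setT (pinv : MR -> R).
Proof. exact: measurable_powR. Qed.

(** [T] acts on represented vectors as multiplication by s, and s times 1/s is 1 off 0, which
    represents [x] itself. *)
Lemma pinv_preimage x a : sqint (mu x) pinv a -> exists2 y, rep pinv x y & T y = x.
Proof.
move=> ha; have h2 : L2 pinv x.
  by split; [exact: measurable_pinv|exact: pinv_ge0|exists a].
have [y hy] := frep_exists h2; exists y => //.
have m0 : measurable ([set 0] : set MR) by exact: measurable_set1.
have mi : measurable_fun setT (\1_(~` [set 0]) : MR -> R).
  by apply: measurable_indic; exact: measurableC.
apply: (frep_uniq mi _ (frep_ne0 x)).
apply: frep_eq (frep_mulX measurable_pinv hy) => s /andP[s0 _].
rewrite indicE in_setC; case: (eqVneq s 0) => [->|sn].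
  by rewrite mul0r mem_set.
have s1 : 0 < s by rewrite lt_neqAle eq_sym sn.
by rewrite memNset /= ?pinvE ?mulfV// => h; rewrite h eqxx in sn.
Qed.

(** Cutting 1/s off below 1/(n+1) gives bounded g_n with g_n(T) T y = E(A_n) y, of norm at most |y|.
    Monotone convergence transfers the bound to 1/s. *)
Lemma pinv_image y : sqint (mu (T y)) pinv (nsq y).
Proof.
pose A (n : nat) : set MR := `[n.+1%:R^-1, +oo[%classic.
have mA n : measurable (A n) by exact: measurable_itv.
pose g (n : nat) (s : R) : R := pinv s * \1_(A n) s.
have mg n : measurable_fun setT (g n : MR -> R).
  by apply: measurable_funM; [exact: measurable_pinv|exact: measurable_indic].
have i0 (n : nat) : 0 < n.+1%:R^-1 :> R by rewrite invr_gt0.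
have gb n s : 0 <= g n s <= n.+1%:R.
  rewrite /g indicE mem_setE in_itv /= andbT; case: (leP n.+1%:R^-1 s) => h /=; last by rewrite mulr0 lexx ler0n.
  have s0 : 0 < s by apply: lt_le_trans h.
  by rewrite mulr1 pinv_ge0 pinvE// -[leRHS]invrK lef_pV2 ?posrE.
have gE n s : s * g n s = \1_(A n) s.
  rewrite /g indicE mem_setE in_itv /= andbT; case: (leP n.+1%:R^-1 s) => h /=; last by rewrite !mulr0.
  have s0 : 0 < s by apply: lt_le_trans h.
  by rewrite mulr1 pinvE// mulfV// gt_eqF.
have gint n : sqint (mu (T y)) (g n) (nsq y).
  have L2g z : L2 (g n) z by apply: (@L2_bounded _ _ _ _ _ _ _ _ n.+1%:R).
  have [v hv] := frep_exists (L2g (T y)).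
  have mi : measurable_fun setT (\1_(A n) : MR -> R) by exact: measurable_indic.
  have vE : v = proj (A n) y.
    apply: (@nsq_eq _ _ _ _ 16) => e e0.
    have [p [p1 p2 _]] := L2_dense3 (L2g (T y)) (L2g y) (L2g y) e0.
    have h1 := frep_close (mg n) hv p1.
    have h2 : sqint (mu y) (fun s => \1_(A n) s - ('X * p).[s]) e.
      rewrite -[e]mul1r; apply: sqint_le p2 => //.
      - exact: mfp.
      - exact: mfp.
      - move=> s /andP[s0 s1]; rewrite hornerM hornerX -gE -mulrBr exprMn.
        by apply: ler_wpM2r; [exact: sqr_ge0|rewrite exprn_ile1].
    have h3 := frep_close mi (bprojP T_lin T_sym T_pos y (mA n)) h2.
    rewrite mulrC rpolyM// rpolyX// in h3.
    have := nsqD_le (v - rpoly T p (T y)) (rpoly T p (T y) - proj (A n) y).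
    by rewrite addrA subrK (nsqC _ (proj _ _)); lra.
  apply: sqint_trans (frep_sqint (mg n) hv); rewrite vE.
  apply: (frep_nsq_le mi (bprojP T_lin T_sym T_pos y (mA n))).
  apply: sqint_indic => //; rewrite -(bmuT T_lin T_sym T_pos).
  by apply: le_measure; rewrite ?inE.
have mU := @measurable_unit_itv R.
have lim1 s : unit_itv s -> limn (fun n => ((g n s) ^+ 2)%:E) = ((pinv s) ^+ 2)%:E.
  move=> /unit_itvP /andP[s0 _]; apply: lim_near_cst => //.
  case: (eqVneq s 0) => [->|sn].
    by near=> n; rewrite /g pinv0 mul0r.
  have s1 : 0 < s by rewrite lt_neqAle eq_sym sn.
  have [N hN] := invS_lt s1; exists N => // n /= Nn.
  rewrite /g indicE mem_setE in_itv /= andbT ltW ?mulr1//.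
  exact: hN.
rewrite /sqint.
have -> : (\int[mu (T y)]_(s in unit_itv) ((pinv s) ^+ 2)%:E =
   \int[mu (T y)]_(s in unit_itv) (fun s => limn (fun n => ((g n s) ^+ 2)%:E)) s)%E.
  by apply: eq_integral => s /set_mem hs; rewrite lim1.
have nd s : {homo (fun n => ((g n s) ^+ 2)%:E) : n m / (n <= m)%N >-> (n <= m)%E}.
  move=> n m nm; rewrite lee_fin; apply: lerXn2r; rewrite ?nnegrE;
    [by case/andP: (gb n s)|by case/andP: (gb m s)|].
  rewrite /g; apply: ler_wpM2l; first exact: pinv_ge0.
  rewrite !indicE !mem_setE !in_itv /= !andbT ler_nat.
  case: (leP n.+1%:R^-1 s) => //= h.
  by rewrite (le_trans _ h)// lef_pV2 ?posrE// ler_nat.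
rewrite monotone_convergence//.
- apply: lime_le; last by near=> n; exact: gint.
  apply: ereal_nondecreasing_is_cvgn => n m nm; apply: ge0_le_integral => //.
  + by move=> s _; rewrite lee_fin sqr_ge0.
  + exact: measurable_sqr.
  + exact: measurable_sqr.
  + by move=> s _; exact: nd.
- by move=> n; exact: measurable_sqr.
- by move=> n s _; rewrite lee_fin sqr_ge0.
Unshelve. all: by end_near. Qed.

Lemma frep_pinv y : rep pinv (T y) y.
Proof.
have [z hz Tz] := pinv_preimage (pinv_image y).
suff e : y = z by rewrite [X in frep _ _ _ _ _ X]e.
apply/eqP; rewrite -subr_eq0; apply/eqP/T_inj.
by rewrite opTB// Tz subrr.
Qed.

Lemma bmu_integral_unit x (f : R -> \bar R) : measurable_fun setT (f : MR -> \bar R) ->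
  (forall s, (0 <= f s)%E) -> (\int[mu x]_s f s = \int[mu x]_(s in unit_itv) f s)%E.
Proof.
move=> mf f0; have mC : measurable (~` unit_itv : set MR).
  by apply: measurableC; exact: measurable_unit_itv.
have := @ge0_negligible_integral _ MR R (mu x) setT (~` unit_itv) f mC measurableT mf
  (fun s _ => f0 s) (bmu_out _ _ _ x).
by rewrite setTD setCK.
Qed.

End InverseFunction.

(** * Spectral theorem for the operator of a closed form *)

Section ClosedForms.
Context {R : realType} {H : hilbertType R}.
Notation MR := (measurableTypeR R).

(** The shift by 1 - c makes the form at least the squared norm; completeness in the shifted form is
    closedness, and the last clause is density of the domain. *)
Definition closed_form (t : form H) (c : R) : Prop :=
  [/\ hermitian_on (fdom t) t,
      (forall x, fdom t x -> c * nsq x <= complex.Re (t x x)),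
      complete_on (fdom t) (fun x y => t x y + (1 - c)%:C * '[x, y])
    & forall x (e : R), 0 < e -> exists2 y, fdom t y & nsq (x - y) < e].

Variables (t : form H) (c : R).
Hypothesis tc : closed_form t c.
Local Notation X := (fdom t).
Local Notation k := (1 - c).

Definition shifted_form (x y : H) : R[i] := t x y + k%:C * '[x, y].
Local Notation h := shifted_form.

Lemma shifted_hermitian : hermitian_on X h.
Proof.
case: tc => -[sX lin sym] _ _ _; split => //.
  by move=> a x y z Xx Xy Xz; rewrite /h lin// innerDl innerZl; ring.
move=> x y Xx Xy; rewrite /h sym// innerC; case: (t x y) => a b.
by case: '[x, y] => p q; rewrite !conjCE /=; congr Complex; ring.
Qed.

Lemma shifted_ge x : X x -> nsq x <= complex.Re (h x x).
Proof.
by case: tc => _ lb _ _ Xx; rewrite /h ReD ReZ -/(nsq x); have := lb x Xx; lra.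
Qed.

Lemma shifted_nonneg : nonneg_on X h.
Proof. by move=> x Xx; apply: le_trans (shifted_ge Xx); exact: nsq_ge0. Qed.

Lemma shifted_complete : complete_on X h.
Proof. by case: tc. Qed.

Lemma form_subsp : subsp X.
Proof. by case: shifted_hermitian. Qed.

Lemma form_dense x : (forall z, X z -> '[x, z] = 0) -> x = 0.
Proof.
move=> hx; apply: nsq_eq0; apply/eqP; rewrite eq_le nsq_ge0 andbT.
apply: (@le0_eps _ _ 1) => e e0; rewrite mulr1.
case: tc => _ _ _ dn; have [z Xz xz] := dn x e e0.
have := inner_CS x (x - z); rewrite innerBr (hx z Xz) subr0 -/(nsq x) expr2.
have := nsq_ge0 x; rewrite le_eqVlt => /orP[/eqP <- _|n0]; first exact: ltW.
by rewrite ler_pM2l// => /le_trans; apply; exact: ltW.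
Qed.

Lemma riesz_resolvent (u : H) : exists x, X x /\ forall z, X z -> h x z = '[u, z].
Proof.
have [||x Xx hx] := riesz shifted_hermitian shifted_nonneg
    (f := fun z => '[u, z]) (C := nsq u) shifted_complete.
- by move=> a x y _ _; rewrite innerDr innerZr.
- move=> z Xz; apply: le_trans (inner_CS u z) _.
  by apply: ler_wpM2l; [exact: nsq_ge0|exact: shifted_ge].
- by exists x.
Qed.

(** The resolvent (S + 1 - c)^-1 of the operator S of [t]; the shift places it between 0 and 1,
    where the bounded calculus was built. *)
Definition fres (u : H) : H := projT1 (cid (riesz_resolvent u)).

Lemma fres_dom u : X (fres u).
Proof. by rewrite /fres; case: cid => x []. Qed.

Lemma fresE u z : X z -> h (fres u) z = '[u, z].
Proof. by move=> Xz; rewrite /fres; case: cid => x /= [_ hx]; exact: hx. Qed.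

Lemma fres_uniq x u : X x -> (forall z, X z -> h x z = '[u, z]) -> x = fres u.
Proof.
move=> Xx hx; have hh := shifted_hermitian.
have Xd : X (x - fres u) by apply: subspB => //; [exact: form_subsp|exact: fres_dom].
apply/eqP; rewrite -subr_eq0; apply/eqP/nsq_eq0/eqP; rewrite eq_le nsq_ge0 andbT.
apply: le_trans (shifted_ge Xd) _.
rewrite (formBl hh)//; last exact: fres_dom.
by rewrite hx// fresE// subrr.
Qed.

Lemma fres_lin (a : R[i]) x y : fres (a *: x + y) = a *: fres x + fres y.
Proof.
have hh := shifted_hermitian; have D := fres_dom.
apply/esym/fres_uniq; first by apply: subspP => //; exact: form_subsp.
by move=> z Xz; rewrite (formPl hh)// !fresE// innerDl innerZl.
Qed.

Lemma fres_sym x y : '[fres x, y] = '[x, fres y].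
Proof.
have hh := shifted_hermitian; have D := fres_dom.
rewrite innerC -(fresE y (D x)) -(formC hh)//.
by rewrite fresE.
Qed.

Lemma fres_form u : '[fres u, u] = h (fres u) (fres u).
Proof. by rewrite fresE ?fres_sym//; exact: fres_dom. Qed.

Lemma fres_pos x : 0 <= complex.Re '[fres x, x] <= nsq x.
Proof.
rewrite fres_form; have D := fres_dom x; rewrite shifted_nonneg//=.
have h1 := shifted_ge D; set q := complex.Re _ in h1 *.
have : q ^+ 2 <= nsq (fres x) * nsq x by rewrite /q -fres_form; exact: inner_CS.
have := nsq_ge0 x; have := nsq_ge0 (fres x) => n1 n2 h2.
have : q ^+ 2 <= q * nsq x by apply: le_trans h2 _; exact: ler_wpM2r.
have : 0 <= q by apply: le_trans h1.
rewrite le_eqVlt => /orP[/eqP <-//|q0].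
by rewrite expr2 ler_pM2l.
Qed.

Lemma fres_inj x : fres x = 0 -> x = 0.
Proof.
move=> e; apply: form_dense => z Xz; rewrite -fresE// e.
by rewrite (form0l shifted_hermitian).
Qed.

Lemma form_operatorP x w : form_operator t (x, w) <-> x = fres (w + k%:C *: x).
Proof.
split=> [[/= Xx hx]|e].
  by apply: fres_uniq => // z Xz; rewrite /h hx// innerDl innerZl.
have Xx : X x by rewrite e; exact: fres_dom.
split=> //= z Xz; have := fresE (w + k%:C *: x) Xz; rewrite -e /h innerDl innerZl.
by move=> /addIr.
Qed.

Lemma dom_form_operator x : dom (form_operator t) x <-> exists y, x = fres y.
Proof.
split=> [[w /form_operatorP e]|[y e]]; first by exists (w + k%:C *: x).
by exists (y - k%:C *: x); apply/form_operatorP; rewrite subrK.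
Qed.

(* The spectral measure of the operator is the image of that of its resolvent
   [fres] under [s |-> s^-1 - k]. *)
Theorem closed_form_spectral : exists E : pvm H, is_spectral_measure E (form_operator t).
Proof.
pose phi (s : R) : R := pinv s - k.
have mphi : measurable_fun setT (phi : MR -> MR).
  by apply: measurable_funB => //; exact: measurable_pinv.
have mpre (A : set MR) : measurable A -> measurable (phi @^-1` A : set MR).
  by move=> mA; rewrite -[X in measurable X]setTI; exact: mphi.
pose mu := bmu fres_lin fres_sym fres_pos.
pose P := bproj fres_lin fres_sym fres_pos.
pose dg x : {measure set MR -> \bar R} :=
  measure_function_pushforward__canonical__measure_function_Measure (mu x) mphi.
have E1 (A : set MR) : measurable A -> forall (a : R[i]) x y,
   P (phi @^-1` A) (a *: x + y) = a *: P (phi @^-1` A) x + P (phi @^-1` A) y.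
  by move=> mA a x y; apply: bproj_lin; exact: mpre.
have E2 (A : set MR) : measurable A -> forall x y,
   '[P (phi @^-1` A) x, y] = '[x, P (phi @^-1` A) y].
  by move=> mA x y; apply: bproj_sym; exact: mpre.
have E3 (A B : set MR) : measurable A -> measurable B -> forall x,
   P (phi @^-1` (A `&` B)) x = P (phi @^-1` A) (P (phi @^-1` B) x).
  by move=> mA mB x; rewrite preimage_setI; apply: bprojI; exact: mpre.
have E4 x : P (phi @^-1` setT) x = x by rewrite preimage_setT; exact: bprojT.
have E5 (A : set MR) : measurable A -> forall x,
    dg x A = (complex.Re '[P (phi @^-1` A) x, x])%:E.
  by move=> mA x; rewrite -bmuE//; exact: mpre.
exists (Pvm E1 E2 E3 E4 E5).
have mE (f : R -> R) : measurable_fun setT (f : MR -> R) ->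
   measurable_fun setT (fun s : MR => (f s)%:E).
  by move=> mf; exact/measurable_EFinP.
have mphi' : measurable_fun setT (phi : MR -> R) by exact: mphi.
have dgint (f : R -> \bar R) x : measurable_fun setT (f : MR -> \bar R) -> (forall s, (0 <= f s)%E) ->
   (\int[dg x]_r f r = \int[mu x]_(s in unit_itv) f (phi s))%E.
  move=> mf f0.
  have := @ge0_integral_pushforward _ _ _ _ R _ mphi (mu x) setT f measurableT mf (fun s _ => f0 s).
  rewrite preimage_setT => h1; apply: (etrans h1); apply: bmu_integral_unit => //.
    by apply: measurableT_comp mf mphi.
  by move=> s; exact: f0.
have mid : measurable_fun setT (fun s : MR => s : R) by exact: measurable_id.
have sq x : (\int[dg x]_r (r ^+ 2)%:E = \int[mu x]_(s in unit_itv) ((phi s) ^+ 2)%:E)%E.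
  apply: (dgint (fun r => (r ^+ 2)%:E)); first by apply: mE; exact: measurable_funX.
  by move=> s; rewrite lee_fin sqr_ge0.
have mc (r : R) : measurable_fun setT (fun _ : MR => r) by exact: measurable_cst.
(* Over a finite measure the constant [k] does not affect square-integrability, so the domain
   condition is that for 1/s, which characterises the range of the resolvent. *)
have sqP x : (\int[dg x]_r (r ^+ 2)%:E < +oo)%E <-> exists a, sqint (mu x) pinv a.
  rewrite sq; split=> [lt|[a ha]].
    have f1 : (\int[mu x]_(s in unit_itv) ((phi s) ^+ 2)%:E)%E \is a fin_num.
      rewrite ge0_fin_numE//; apply: integral_ge0 => s _.
      by rewrite lee_fin sqr_ge0.
    have h1 : sqint (mu x) phi (fine (\int[mu x]_(s in unit_itv) ((phi s) ^+ 2)%:E)%E).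
      by rewrite /sqint fineK.
    have := sqintD mphi' (mc k) h1 (sqint_cst (bmu_fin _ _ _ x) k).
    move=> h2; eexists; apply: sqint_eq h2 => s _ /=.
    by rewrite /phi subrK.
  have := sqintD measurable_pinv (mc (- k)) ha (sqint_cst (bmu_fin _ _ _ x) (- k)).
  by move=> h1; apply: le_lt_trans h1 (ltry _).
split=> [x|x w xw].
  rewrite dom_form_operator sqP; split=> [[y ->]|[a ha]].
    by exists (nsq y); apply: pinv_image; exact: fres_inj.
  have [y _ <-] := pinv_preimage fres_inj ha; by exists y.
have e := (form_operatorP x w).1 xw.
set y := w + k%:C *: x in e.
have hrep := frep_pinv fres_lin fres_sym fres_pos fres_inj y; rewrite -e in hrep.
have hsq := pinv_image fres_lin fres_sym fres_pos y; rewrite -e in hsq.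
have Xx : X x by rewrite e; exact: fres_dom.
have wx : '[w, x] = (complex.Re '[w, x])%:C.
  have [_ /(_ x Xx) <-] := xw.
  by case: tc => ht _ _ _; exact: (form_diag_real ht Xx).
have i1 : (\int[mu x]_(s in unit_itv) (phi s)%:E = (complex.Re '[w, x])%:E)%E.
  have mU := @measurable_unit_itv R.
  have -> : (\int[mu x]_(s in unit_itv) (phi s)%:E =
     \int[mu x]_(s in unit_itv) ((pinv s)%:E + (- k)%:E))%E by [].
  have ip : (mu x).-integrable unit_itv (fun s => (pinv s)%:E).
    by apply: integrable_L2 hsq; exact: measurable_pinv.
  rewrite integralD//; last first.
    exact: integrable_L2 (mc (- k)) (sqint_cst (bmu_fin _ _ _ x) (- k)).
  rewrite (frep_int _ hrep); last by split; [exact: measurable_pinv|exact: pinv_ge0|exists (nsq y)].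
  rewrite integral_cst// bmu_unit -EFinM -EFinD; congr (_%:E).
  by rewrite /y innerDl innerZl ReD ReZ -/(nsq x); ring.
have iphi : (mu x).-integrable setT (fun s => (phi s)%:E).
  apply/integrableP; split; first exact: mE.
  rewrite bmu_integral_unit//; last by apply: measurableT_comp => //; exact: mE.
  have : exists a, sqint (mu x) phi a.
    have := sqintD measurable_pinv (mc (- k)) hsq (sqint_cst (bmu_fin _ _ _ x) (- k)).
    by move=> h1; eexists; exact: h1.
  move=> [a ha]; have /integrableP[_] := integrable_L2 mphi' ha; exact.
rewrite wx; congr (_%:C); rewrite /Rintegral.
have mC : measurable (~` unit_itv : set MR).
  by apply: measurableC; exact: measurable_unit_itv.
have := @integral_pushforward _ _ _ _ R _ mphi (mu x) setT (fun r => r%:E) (mE _ mid).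
rewrite preimage_setT => /(_ iphi measurableT) h1.
have := @negligible_integral _ MR R (mu x) setT (~` unit_itv) _ mC measurableT iphi (bmu_out _ _ _ x).
rewrite setTD setCK i1 => h2.
by rewrite [X in fine X](etrans h1 h2).
Qed.

End ClosedForms.

(** * Means with respect to finite measures *)

Section FiniteMeasureIntegrals.
Context {R : realType}.
Notation MR := (measurableTypeR R).
Variables (nu : {measure set MR -> \bar R}) (m : R).
Hypothesis nuT : nu setT = m%:E.
Implicit Types (B : set MR) (f : R -> R).

Lemma fin_integrable_cst B k : measurable B -> nu.-integrable B (fun=> k%:E).
Proof.
move=> mB; apply/integrableP; split; first exact: measurable_cst.
rewrite integral_cst// -(@fineK _ (nu B)); first by rewrite -EFinM ltry.
rewrite ge0_fin_numE//; apply: le_lt_trans (ltry m); rewrite -nuT.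
by apply: le_measure; rewrite ?inE.
Qed.

Lemma measurable_EFin f : measurable_fun setT (f : MR -> R) ->
  measurable_fun setT (fun s : MR => (f s)%:E).
Proof. by move=> mf; exact/measurable_EFinP. Qed.

Lemma integrable_of_sq f : measurable_fun setT (f : MR -> R) ->
  (\int[nu]_s ((f s) ^+ 2)%:E < +oo)%E -> nu.-integrable setT (fun s => (f s)%:E).
Proof.
move=> mf f2; apply/integrableP; split; first exact: measurable_EFin.
have m2 : measurable_fun setT (fun s : MR => ((f s) ^+ 2)%:E).
  by apply: (measurable_EFin (f := fun s => f s ^+ 2)); exact: measurable_funX.
apply: (@le_lt_trans _ _ (\int[nu]_s (((f s) ^+ 2)%:E + 1%:E))%E).
  apply: ge0_le_integral => //.
  - by apply: measurableT_comp => //; exact: measurable_EFin.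
  - by apply: emeasurable_funD.
  - have key (r : R) : `|r| <= r ^+ 2 + 1.
      by rewrite -real_normK ?num_real//; have := sqr_ge0 (`|r| - 2^-1); nra.
    by move=> s _; rewrite -EFinD lee_fin; exact: key.
rewrite ge0_integralD//; last by move=> s _; rewrite lee_fin sqr_ge0.
by rewrite integral_cst// nuT mul1e lte_add_pinfty ?ltry.
Qed.

Lemma negligible_compl B (f : R -> \bar R) : measurable B -> nu (~` B) = 0%E ->
  nu.-integrable setT f -> (\int[nu]_s f s = \int[nu]_(s in B) f s)%E.
Proof.
move=> mB B0 fi; have := negligible_integral (measurableC mB) measurableT fi B0.
by rewrite setTD setCK.
Qed.

Lemma mean_le B b : measurable B -> nu (~` B) = 0%E ->
  nu.-integrable setT (fun s : MR => (s : R)%:E) ->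
  (forall s, B s -> s <= b) -> (\int[nu]_s (s : R))%R <= b * m.
Proof.
move=> mB B0 i1 hB.
have i2 : nu.-integrable B (fun s : MR => (s : R)%:E).
  by apply: integrableS i1.
have i3 := fin_integrable_cst b mB.
have nB : nu B = m%:E.
  rewrite -nuT -(setUv B) measureU ?setICr//; last exact: measurableC.
  by rewrite [X in (_ + X)%E]B0 adde0.
rewrite /Rintegral (negligible_compl mB B0 i1).
have f1 := integrable_fin_num mB i2.
rewrite -lee_fin fineK// EFinM -nB -integral_cst//.
by apply: le_integral => // s /set_mem /hB; rewrite lee_fin.
Qed.

Lemma mean_ge B b : measurable B -> nu (~` B) = 0%E ->
  nu.-integrable setT (fun s : MR => (s : R)%:E) ->
  (forall s, B s -> b <= s) -> b * m <= (\int[nu]_s (s : R))%R.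
Proof.
move=> mB B0 i1 hB.
have i2 : nu.-integrable B (fun s : MR => (s : R)%:E).
  by apply: integrableS i1.
have i3 := fin_integrable_cst b mB.
have nB : nu B = m%:E.
  rewrite -nuT -(setUv B) measureU ?setICr//; last exact: measurableC.
  by rewrite [X in (_ + X)%E]B0 adde0.
rewrite /Rintegral (negligible_compl mB B0 i1).
have f1 := integrable_fin_num mB i2.
rewrite -lee_fin fineK// EFinM -nB -integral_cst//.
by apply: le_integral => // s /set_mem /hB; rewrite lee_fin.
Qed.

Lemma measure_cup_le (F : (set MR)^nat) (A : set MR) (K : R) :
  (forall n, measurable (F n)) -> (forall n p, (n <= p)%N -> F n `<=` F p) ->
  \bigcup_n F n = A -> (forall n, (nu (F n) <= K%:E)%E) -> (nu A <= K%:E)%E.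
Proof.
move=> mF ndF <- hF.
have h : (nu \o F) n @[n --> \oo] --> nu (\bigcup_n F n).
  apply: nondecreasing_cvg_mu => //; first exact: bigcup_measurable.
  by move=> n p np; apply/subsetPset; exact: ndF.
rewrite -(cvg_lim (@ereal_hausdorff R) h); apply: lime_le.
  by apply/cvg_ex; exists (nu (\bigcup_n F n)).
by near=> n; exact: hF.
Unshelve. all: by end_near. Qed.
End FiniteMeasureIntegrals.

(** * Spectral subspaces *)

Section ProjectionMeasures.
Context {R : realType} {H : hilbertType R} (E : pvm H).
Notation MR := (measurableTypeR R).
Implicit Types (A B : set MR) (x y : H).

Lemma proj_lin0 A : measurable A -> E A 0 = 0.
Proof.
move=> mA; have := proj_linear E mA (-1) 0 0.
by rewrite !scaler0 addr0 scaleN1r addNr.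
Qed.
Lemma projB A x y : measurable A -> E A (x - y) = E A x - E A y.
Proof.
by move=> mA; have := proj_linear E mA (-1) y x; rewrite !scaleN1r ![- _ + _]addrC.
Qed.
Lemma projZ A (c : R[i]) x : measurable A -> E A (c *: x) = c *: E A x.
Proof.
by move=> mA; have := proj_linear E mA c x 0; rewrite proj_lin0// !addr0.
Qed.
Lemma projD A x y : measurable A -> E A (x + y) = E A x + E A y.
Proof. by move=> mA; have := proj_linear E mA 1 x y; rewrite !scale1r. Qed.

Lemma proj_idem A x : measurable A -> E A (E A x) = E A x.
Proof. by move=> mA; rewrite -projI// setIid. Qed.

Lemma diag_nsq A x : measurable A -> diag E x A = (nsq (E A x))%:E.
Proof.
move=> mA; rewrite diagE//; congr (_%:E).
by rewrite -{1}(proj_idem x mA) proj_sym.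
Qed.

Lemma diagT x : diag E x setT = (nsq x)%:E.
Proof. by rewrite diag_nsq// projT. Qed.

Lemma diag_proj A B x : measurable A -> measurable B ->
  diag E (E B x) A = diag E x (A `&` B).
Proof.
by move=> mA mB; rewrite !diag_nsq ?projI//; exact: measurableI.
Qed.

Lemma nsq_proj_le A x : measurable A -> nsq (E A x) <= nsq x.
Proof.
move=> mA; rewrite -lee_fin -diag_nsq// -diagT.
by apply: le_measure; rewrite ?inE.
Qed.

Lemma proj0 x : E set0 x = 0.
Proof.
by apply: nsq_eq0; have := diag_nsq x measurable0; rewrite measure0 => -[].
Qed.

Lemma proj_disjoint A B x : measurable A -> measurable B -> A `&` B = set0 ->
  E A (E B x) = 0.
Proof. by move=> mA mB AB; rewrite -projI// AB proj0. Qed.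

Lemma inner_proj A x : measurable A -> complex.Re '[x, E A x] = nsq (E A x).
Proof.
by move=> mA; rewrite /nsq proj_sym// proj_idem.
Qed.

(** Additivity is given for the scalar measures only. The squared norm of the difference of both
    sides is expanded; multiplicativity evaluates every mixed term. *)
Lemma projU A B x : measurable A -> measurable B -> A `&` B = set0 ->
  E (A `|` B) x = E A x + E B x.
Proof.
move=> mA mB AB; have mU := measurableU _ _ mA mB.
apply/eqP; rewrite -subr_eq0; apply/eqP/nsq_eq0.
have hm : nsq (E (A `|` B) x) = nsq (E A x) + nsq (E B x).
  have : diag E x (A `|` B) = (diag E x A + diag E x B)%E by exact: measureU.
  by rewrite (diag_nsq x mU) (diag_nsq x mA) (diag_nsq x mB) -EFinD => -[].
rewrite /nsq (Re_formB inner_hermitian)// -!/(nsq _).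
have -> : nsq (E A x + E B x) = nsq (E A x) + 2 * complex.Re '[E A x, E B x] + nsq (E B x).
  by rewrite /nsq (Re_formD inner_hermitian).
rewrite innerDr ReD.
have -> : complex.Re '[E A x, E B x] = 0.
  by rewrite proj_sym// proj_disjoint// inner0r.
have -> : complex.Re '[E (A `|` B) x, E A x] = nsq (E A x).
  rewrite proj_sym// -projI// (_ : _ `&` A = A) ?inner_proj//.
  by rewrite setIC setIUr setIid AB setU0.
have -> : complex.Re '[E (A `|` B) x, E B x] = nsq (E B x).
  rewrite proj_sym// -projI// (_ : _ `&` B = B) ?inner_proj//.
  by rewrite setIUl AB set0U setIid.
by rewrite hm; lra.
Qed.

Lemma projC A x : measurable A -> E (~` A) x = x - E A x.
Proof.
move=> mA; have := projU x mA (measurableC mA) (setICr A).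
by rewrite setUv projT => {2}->; rewrite addrC addKr.
Qed.

Lemma diag_proj_C A x : measurable A -> E A x = x -> diag E x (~` A) = 0%E.
Proof.
move=> mA Ax; rewrite diag_nsq; last exact: measurableC.
by rewrite projC// Ax subrr nsq0.
Qed.

Lemma proj_sub A B x : measurable A -> measurable B -> A `<=` B -> E A x = x -> E B x = x.
Proof.
by move=> mA mB AB Ax; rewrite -Ax -projI// (_ : B `&` A = A)//; apply/setIidPr.
Qed.

(** Continuity from below. It reduces statements on open or unbounded sets to exhausting sequences
    on which the operator is bounded or its spectrum stays away from a critical value. *)
Lemma proj_cup0 (F : (set MR)^nat) A x :
  (forall n, measurable (F n)) -> (forall n p, (n <= p)%N -> F n `<=` F p) ->
  \bigcup_n F n = A -> (forall n, E (F n) x = 0) -> E A x = 0.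
Proof.
move=> mF ndF cF hF; apply: nsq_eq0.
have mA : measurable A by rewrite -cF; exact: bigcup_measurable.
apply/eqP; rewrite eq_le nsq_ge0 andbT -lee_fin -diag_nsq//.
apply: (measure_cup_le (nu := diag E x) mF ndF cF) => n.
by rewrite diag_nsq// hF nsq0.
Qed.

Lemma int_diag_proj B (f : R -> \bar R) x : measurable B ->
  measurable_fun setT (f : MR -> \bar R) -> (forall s, (0 <= f s)%E) ->
  (\int[diag E (E B x)]_s f s = \int[diag E x]_(s in B) f s)%E.
Proof.
move=> mB mf f0; have BC : diag E (E B x) (~` B) = 0%E.
  by apply: diag_proj_C => //; exact: proj_idem.
have := @ge0_negligible_integral _ MR R (diag E (E B x)) setT (~` B) f
  (measurableC mB) measurableT mf (fun s _ => f0 s) BC.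
rewrite setTD setCK => ->; apply: eq_measure_integral => A mA AB.
by rewrite diag_proj// (_ : A `&` B = A)//; apply/setIidPl.
Qed.

End ProjectionMeasures.

Section SymmetricIntervals.
Context {R : realType}.
Notation MR := (measurableTypeR R).

Definition sitv (n : nat) : set MR := `[- n%:R, n%:R]%classic.
Lemma measurable_sitv n : measurable (sitv n). Proof. exact: measurable_itv. Qed.
Lemma sitv_nd n p : (n <= p)%N -> sitv n `<=` sitv p.
Proof.
move=> np s; rewrite /sitv /= !in_itv /= => /andP[h1 h2].
have np' : n%:R <= p%:R :> R by rewrite ler_nat.
by rewrite (le_trans h2 np') andbT (le_trans _ h1)// lerN2.
Qed.
Lemma sitv_cup : \bigcup_n sitv n = setT.
Proof.
apply/seteqP; split=> // s _; exists (Num.bound `|s|) => //=.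
rewrite /sitv /= in_itv /=; have := archi_boundP (normr_ge0 (s : R)) => h.
by move: (ltW h); rewrite ler_norml.
Qed.
Lemma sitv_abs n s : sitv n s -> `|s| <= n%:R.
Proof. by rewrite /sitv /= in_itv /= ler_norml. Qed.
End SymmetricIntervals.

Section SpectralMeasureFacts.
Context {R : realType} {H : hilbertType R} (E : pvm H) (S : op H H).
Notation MR := (measurableTypeR R).
Hypothesis sm : is_spectral_measure E S.
Hypothesis S_lin : forall (c : R[i]) p q, S p -> S q -> S (c *: p + q).
Hypothesis S_sym : forall p q, S p -> S q -> '[p.2, q.1] = '[p.1, q.2].
Implicit Types (A B : set MR) (x y : H).

Let mid : measurable_fun setT (fun s : MR => (s : R)).
Proof. exact: measurable_id. Qed.

Let msq : measurable_fun setT (fun s : MR => ((s : R) ^+ 2)%:E).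
Proof. by apply: (measurable_EFin (f := fun s => s ^+ 2)); exact: measurable_funX. Qed.

Lemma dom_integrable x : dom S x -> (diag E x).-integrable setT (fun s : MR => (s : R)%:E).
Proof.
move=> /sm.1 h; exact: (integrable_of_sq (diagT E x) mid h).
Qed.

Lemma proj_bounded_dom B (M : R) x : measurable B -> (forall s, B s -> `|s| <= M) ->
  dom S (E B x).
Proof.
move=> mB hB; apply/sm.1; rewrite int_diag_proj//; last by move=> s; rewrite lee_fin sqr_ge0.
apply: (@le_lt_trans _ _ (\int[diag E x]_(s in B) (M ^+ 2)%:E)%E).
  apply: ge0_le_integral => //.
  - by move=> s _; rewrite lee_fin sqr_ge0.
  - by apply: measurable_funTS.
  - move=> s /hB h; rewrite lee_fin -[leLHS]real_normK ?num_real//.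
    by apply: lerXn2r; rewrite ?nnegrE// (le_trans _ h).
by rewrite integral_cst// diag_nsq// -EFinM ltry.
Qed.

Lemma spectral_le B b x y : measurable B -> S (x, y) -> E B x = x ->
  (forall s, B s -> s <= b) -> complex.Re '[y, x] <= b * nsq x.
Proof.
move=> mB xy Bx hB; rewrite (sm.2 _ _ xy) /=.
apply: (mean_le (diagT E x) mB _ _ hB); first exact: diag_proj_C.
by apply: dom_integrable; exists y.
Qed.

Lemma spectral_ge B b x y : measurable B -> S (x, y) -> E B x = x ->
  (forall s, B s -> b <= s) -> b * nsq x <= complex.Re '[y, x].
Proof.
move=> mB xy Bx hB; rewrite (sm.2 _ _ xy) /=.
apply: (mean_ge (diagT E x) mB _ _ hB); first exact: diag_proj_C.
by apply: dom_integrable; exists y.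
Qed.

(** The scalar measure of y + z agrees with that of [y] on [B] and with that of [z] off [B]. *)
Lemma mean_split B x y z : measurable B -> dom S (y + z) -> dom S y -> dom S z ->
  E B y = y -> E B z = 0 ->
  (\int[diag E (y + z)]_s (s : R))%R =
  (\int[diag E y]_s (s : R))%R + (\int[diag E z]_s (s : R))%R :> R.
Proof.
move=> mB dw dy dz By Bz; have mC := measurableC mB.
have Cz : E (~` B) z = z by rewrite projC// Bz subr0.
have Cy : E (~` B) y = 0 by rewrite projC// By subrr.
have [iw iy iz] := And3 (dom_integrable dw) (dom_integrable dy) (dom_integrable dz).
have e1 : (\int[diag E (y + z)%R]_s (s : R)%:E = \int[diag E y]_s (s : R)%:E + \int[diag E z]_s (s : R)%:E)%E.
  rewrite -[in LHS](setUv B) integral_setU//; last by apply/disj_setPS; rewrite setICr.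
  congr (_ + _)%E.
    rewrite (negligible_compl mB _ iy); last exact: diag_proj_C.
    apply: eq_measure_integral => A mA AB; rewrite -{2}By diag_proj// !diag_nsq//.
      rewrite (_ : A `&` B = A); last exact/setIidPl.
      rewrite projD// (_ : E A z = 0) ?addr0//.
      by rewrite -Cz proj_disjoint//; apply/seteqP; split=> // s [/AB].
    exact: measurableI.
  rewrite (negligible_compl mC _ iz); last by exact: diag_proj_C.
  apply: eq_measure_integral => A mA AB; rewrite !diag_nsq//.
  rewrite projD// (_ : E A y = 0) ?add0r//.
  by rewrite -By proj_disjoint//; apply/seteqP; split=> // s [/AB].
by rewrite /Rintegral e1 fineD//; [exact: integrable_fin_num iy|exact: integrable_fin_num iz].
Qed.

(* The means over the spectral parts of [y + z] add up, so the mixed terms of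
   the quadratic form vanish. *)
Lemma spectral_orth B y y' z z' : measurable B -> S (y, y') -> S (z, z') ->
  E B y = y -> E B z = 0 -> '[y', z] = 0.
Proof.
move=> mB yy' zz' By Bz.
have key w w' : S (w, w') -> E B w = 0 -> complex.Re '[y', w] = 0.
  move=> ww' Bw.
  have s1 : S (y + w, y' + w').
    have := S_lin 1 yy' ww'; rewrite scale1r; exact.
  have := @mean_split B y y w mB (ex_intro _ _ s1) (ex_intro _ _ yy') (ex_intro _ _ ww') By Bw.
  have e1 := sm.2 _ _ s1; have e2 := sm.2 _ _ yy'; have e3 := sm.2 _ _ ww'.
  move=> h; move: e1; rewrite h rmorphD/= -e2 -e3 innerDl !innerDr.
  move=> /(congr1 (@complex.Re R)); rewrite !ReD.
  have := S_sym ww' yy' => /= ->; rewrite (Re_innerC y' w); lra.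
rewrite [LHS]complexE (key z z')// (form_Im inner_hermitian)//.
rewrite (key (Complex 0 1 *: z) (Complex 0 1 *: z'))//.
  have S0 : S (0, 0).
    by have := S_lin (-1) yy' yy'; rewrite scaleN1r addNr; exact.
  have := S_lin (Complex 0 1) zz' S0.
  by rewrite addr0; exact.
by rewrite projZ// Bz scaler0.
Qed.

(** The part of y' outside [B] is tested against truncations supported off [B]; these lie in the
    domain and are orthogonal to y' because mixed terms vanish. *)
Lemma proj_reduce B y y' : measurable B -> S (y, y') -> E B y = y -> E B y' = y'.
Proof.
move=> mB yy' By; have mC := measurableC mB.
suff h : E (~` B) y' = 0 by have := projC E y' mB; rewrite h => /eqP; rewrite eq_sym subr_eq0 => /eqP.
apply: (@proj_cup0 _ _ _ (fun n => ~` B `&` sitv n)).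
- by move=> n; apply: measurableI => //; exact: measurable_sitv.
- by move=> n p np; apply: setIS; exact: sitv_nd.
- by rewrite -setI_bigcupr sitv_cup setIT.
move=> n; have mn : measurable (~` B `&` sitv n).
  by apply: measurableI => //; exact: measurable_sitv.
have orth u : '[E (~` B `&` sitv n) y', u] = 0.
  rewrite proj_sym//.
  have [z' zz'] : dom S (E (~` B `&` sitv n) u).
    by apply: (@proj_bounded_dom _ n%:R) => // s [_ /sitv_abs].
  apply: (spectral_orth mB yy' zz' By).
  by rewrite proj_disjoint//; apply/seteqP; split=> // s [? []].
exact: inner_eq0.
Qed.

Variable c : R.
Hypothesis S_below : forall x y, S (x, y) -> c * nsq x <= complex.Re '[y, x].

(** A spectral vector x of [-n, c - 1/(n+1)] has mean at most (c - 1/(n+1)) |x|^2, in conflict with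
    the lower bound [c] unless it is zero; these intervals exhaust ]-oo, c[. *)
Lemma proj_below x : E `]-oo, c[%classic x = 0.
Proof.
apply: (@proj_cup0 _ _ _ (fun n => `[- n%:R, c - n.+1%:R^-1]%classic)).
- by move=> n; exact: measurable_itv.
- move=> n p np s; rewrite /= !in_itv /= => /andP[h1 h2].
  have np' : n%:R <= p%:R :> R by rewrite ler_nat.
  rewrite (le_trans _ h1) ?lerN2//= (le_trans h2)//.
  by rewrite lerD2l lerN2 lef_pV2 ?posrE// ler_nat.
- apply/seteqP; split=> [s [n _] /=|s /=]; rewrite !in_itv /=.
    by move=> /andP[_ h]; apply: le_lt_trans h _; rewrite ltrBlDr ltrDl invr_gt0.
  rewrite -subr_gt0 => /invS_lt[N hN].
  have [M hM] : exists M : nat, - (s : R) <= M%:R.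
    exists (Num.bound `|s|); apply: le_trans (ler_norm _) _.
    by rewrite normrN; exact/ltW/archi_boundP.
  exists (maxn N M) => //=; rewrite in_itv /=; apply/andP; split.
    by rewrite lerNl; apply: le_trans hM _; rewrite ler_nat leq_maxr.
  by have := hN (maxn N M) (leq_maxl _ _); rewrite ltrBrDr -ltrBrDl => /ltW.
move=> n; set B := `[_, _]%classic.
have mB : measurable (B : set MR) by exact: measurable_itv.
have [y xy] : dom S (E B x).
  apply: (@proj_bounded_dom _ (n%:R + `|c|)) => // s.
  rewrite /B /= in_itv /= => /andP[].
  have key (r q i : R) : 0 < i -> 0 <= q -> - q <= r -> r <= c - i -> `|r| <= q + `|c|.
    have := ler_norm c; have := normr_ge0 c; rewrite ler_norml.
    by move=> ? ? ? ? ? ?; apply/andP; split; lra.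
  by apply: key; rewrite ?invr_gt0.
have h1 := S_below xy.
have h2 := @spectral_le B (c - n.+1%:R^-1) _ _ mB xy (proj_idem E x mB).
have {}h2 : complex.Re '[y, E B x] <= (c - n.+1%:R^-1) * nsq (E B x).
  by apply: h2 => s; rewrite /B /= in_itv /= => /andP[].
apply: nsq_eq0; apply/eqP; rewrite eq_le nsq_ge0 andbT.
have i0 : 0 < n.+1%:R^-1 :> R by rewrite invr_gt0.
have h3 := le_trans h1 h2; rewrite mulrBl in h3.
by move: h3; rewrite lerBrDr gerDl pmulr_rle0.
Qed.

Lemma proj_upper_dom B b x : measurable B -> (forall s, B s -> s <= b) -> dom S (E B x).
Proof.
move=> mB hB; have mc : measurable (`]-oo, c[%classic : set MR) by exact: measurable_itv.
have -> : E B x = E (B `\` `]-oo, c[%classic) x.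
  rewrite -[in LHS](setUIDK B `]-oo, c[%classic) projU//; last 3 first.
  - exact: measurableI.
  - exact: measurableD.
  - by apply/seteqP; split=> // s [[_ ?] [_ ?]].
  by rewrite projI// proj_below proj_lin0// add0r.
apply: (@proj_bounded_dom _ (`|b| + `|c|)); first exact: measurableD.
move=> s [/hB h1 /=]; rewrite in_itv /= => /negP; rewrite -leNgt => h2.
have key (r : R) : r <= b -> c <= r -> `|r| <= `|b| + `|c|.
  have := ler_norm b; have := ler_norm (- c); rewrite normrN ler_norml.
  have := normr_ge0 b; have := normr_ge0 c.
  by move=> ? ? ? ? ? ?; apply/andP; split; lra.
exact: key.
Qed.

End SpectralMeasureFacts.

Section FormSpectrum.
Context {R : realType} {H : hilbertType R} (t : form H) (c : R).
Notation MR := (measurableTypeR R).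
Hypothesis tc : closed_form t c.
Variable E : pvm H.
Hypothesis sm : is_spectral_measure E (form_operator t).
Local Notation S := (form_operator t).

Lemma form_operator_lin (a : R[i]) p q : S p -> S q -> S (a *: p + q).
Proof.
move=> [/= Xp hp] [Xq hq]; case: tc => -[sX lin _] _ _ _; split; first exact: subspP.
by move=> y Xy /=; rewrite lin// hp// hq// innerDl innerZl.
Qed.

Lemma form_operator_sym p q : S p -> S q -> '[p.2, q.1] = '[p.1, q.2].
Proof.
move=> [/= Xp hp] [Xq hq]; case: tc => ht _ _ _.
by rewrite -hp// innerC -hq// -(formC ht).
Qed.

Lemma form_operator_below x y : S (x, y) -> c * nsq x <= complex.Re '[y, x].
Proof.
by move=> [/= Xx hx]; rewrite -hx//; case: tc => _ + _ _; apply.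
Qed.

Lemma spectral_upper_dom B b x : measurable (B : set MR) -> (forall s, B s -> s <= b) ->
  dom S (E B x).
Proof. exact: (proj_upper_dom sm form_operator_below). Qed.

Lemma spectral_reduce B y y' : measurable (B : set MR) -> S (y, y') -> E B y = y -> E B y' = y'.
Proof. exact: (proj_reduce sm form_operator_lin form_operator_sym). Qed.

Lemma form_operatorE x y : S (x, y) -> complex.Re (t x x) = complex.Re '[y, x].
Proof. by move=> [/= Xx hx]; rewrite hx. Qed.

Lemma spectral_form_le B b x : measurable (B : set MR) -> (forall s, B s -> s <= b) ->
  E B x = x -> fdom t x /\ complex.Re (t x x) <= b * nsq x.
Proof.
move=> mB hB Bx; have [y xy] := spectral_upper_dom x mB hB; rewrite Bx in xy.
split; first by case: xy.
by rewrite (form_operatorE xy); exact: (spectral_le sm mB xy Bx hB).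
Qed.

(* Testing the form against [u = (S + k) y] with [y] a spectral truncation of
   [x] gives [|<u, x>|^2 <= <y, u> h(x, x)] by Cauchy-Schwarz. *)
Lemma spectral_form_ge b x : fdom t x -> E `]-oo, b[%classic x = 0 ->
  b * nsq x <= complex.Re (t x x).
Proof.
(* If b <= c - 1, the lower bound [c] of the form is already larger; otherwise b + 1 - c is positive
   and may be divided by. *)
move=> Xx bx; case: (leP (b + (1 - c)) 0) => bk.
  case: tc => _ + _ _ => /(_ x Xx) h; have := nsq_ge0 x; nra.
pose B (n : nat) : set MR := `[b, n%:R]%classic.
have mB n : measurable (B n) by exact: measurable_itv.
have hh := shifted_hermitian tc.
set K := complex.Re (shifted_form t c x x).
suff hK : (diag E x `[b, +oo[%classic <= (K / (b + (1 - c)))%:E)%E.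
  have e1 : diag E x `[b, +oo[%classic = (nsq x)%:E.
    have mb : measurable (`]-oo, b[%classic : set MR) by exact: measurable_itv.
    rewrite -setCitvl diag_nsq; last exact: measurableC.
    by rewrite projC// bx subr0.
  move: hK; rewrite e1 lee_fin ler_pdivlMr// /K /shifted_form ReD ReZ -/(nsq x); lra.
apply: (measure_cup_le (nu := diag E x) (F := B)) => //.
- move=> n p np s; rewrite /B /= !in_itv /= => /andP[-> h] /=.
  by apply: le_trans h _; rewrite ler_nat.
- apply/seteqP; split=> [s [n _]|s]; rewrite /B /= !in_itv /=; first by move=> /andP[->].
  move=> /andP[bs _]; exists (Num.bound `|s|) => //=; rewrite in_itv /= bs /=.
  by apply: le_trans (ler_norm _) _; exact/ltW/archi_boundP.
move=> n; rewrite diag_nsq// lee_fin ler_pdivlMr//.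
have [w yw] : dom S (E (B n) x).
  by apply: (spectral_upper_dom x (mB n) (b := n%:R)) => s; rewrite /B /= in_itv /= => /andP[].
set y := E (B n) x in yw *.
have By : E (B n) y = y by exact: proj_idem.
have [Xy _] := yw; rewrite /= in Xy.
have wge := spectral_ge sm (mB n) yw By (b := b).
have {}wge : b * nsq y <= complex.Re '[w, y].
  by apply: wge => s; rewrite /B /= in_itv /= => /andP[].
have Bw := spectral_reduce (mB n) yw By.
have wx : '[w, x] = '[w, y] by rewrite -{1}Bw proj_sym// -/y.
have yx : complex.Re '[y, x] = nsq y by rewrite Re_innerC inner_proj.
have hyx : complex.Re (shifted_form t c y x) = complex.Re '[w, y] + (1 - c) * nsq y.
  rewrite /shifted_form; case: yw => /= _ ->//.
  by rewrite wx ReD ReZ yx.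
have hyy : complex.Re (shifted_form t c y y) = complex.Re '[w, y] + (1 - c) * nsq y.
  by rewrite /shifted_form; case: yw => /= _ ->//; rewrite ReD ReZ.
have := form_CS hh (shifted_nonneg tc) Xy Xx; rewrite hyx hyy -/K.
set Q := _ + _ => hQ.
have Qge : nsq y * (b + (1 - c)) <= Q by rewrite /Q; lra.
have Q0 : 0 <= Q by apply: le_trans Qge; rewrite mulr_ge0 ?nsq_ge0// ltW.
have K0 : 0 <= K by exact: shifted_nonneg.
apply: le_trans Qge _; move: Q0; rewrite le_eqVlt => /orP[/eqP <-//|Q0].
by move: hQ; rewrite expr2 ler_pM2l.
Qed.

End FormSpectrum.

(** * Forms of self-adjoint operators *)

Section Operators.
Context {K : numFieldType} {V W : normedModType K}.
Implicit Types T : op V W.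

Definition functional T : Prop := forall x y y', T (x, y) -> T (x, y') -> y = y'.

Lemma appE T x y : functional T -> T (x, y) -> app T x = y.
Proof. by move=> fT Txy; apply: (fT x _ y) => //; exact: (@xgetPex _ 0 [set y | T (x, y)]) (ex_intro _ y Txy). Qed.

Lemma app_in T x : dom T x -> T (x, app T x).
Proof. exact: (@xgetPex _ 0 [set y | T (x, y)]). Qed.

Lemma linear_functional T : linear_operator T -> functional T.
Proof.
move=> [_ lin sv] x y y' h h'; apply/eqP; rewrite -subr_eq0; apply/eqP/sv.
have := lin (-1) _ _ h' h; rewrite (_ : _ + _ = (0, y - y'))//.
by congr pair; rewrite /= scaleN1r ?addNr// addrC.
Qed.

Lemma app_lin T (c : K) x y : linear_operator T -> dom T x -> dom T y ->
  app T (c *: x + y) = c *: app T x + app T y.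
Proof.
move=> lT dx dy; apply: appE; first exact: linear_functional.
by case: lT => _ lin _; exact: (lin c _ _ (app_in dx) (app_in dy)).
Qed.

Lemma dom_subsp T : linear_operator T -> subsp (dom T).
Proof.
move=> [T0 lin _]; split; first by exists 0.
move=> c x y [x' hx] [y' hy]; exists (c *: x' + y'); exact: (lin c _ _ hx hy).
Qed.

End Operators.

Section SelfAdjoint.
Context {R : realType}.
Implicit Types H : hilbertType R.

Lemma dense_orth H (X : set H) y : dense X -> (forall x, X x -> '[x, y] = 0) -> y = 0.
Proof.
move=> dX hy; apply: nsq_eq0; apply/eqP; rewrite eq_le nsq_ge0 andbT.
apply: (@le0_eps _ _ 1) => e e0; rewrite mulr1.
have [z [zb Xz]] : exists z, ball y (Num.sqrt e)%:C z /\ X z.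
  have [||z [? ?]] := dX (ball y (Num.sqrt e)%:C).
  - by exists y; apply: ballxx; rewrite ltcR sqrtr_gt0.
  - exact: ball_open.
  by exists z.
have {}zb : nsq (y - z) < e.
  by rewrite -[ltRHS](sqr_sqrtr (ltW e0)); apply/ball_nsq => //; rewrite sqrtr_gt0.
have : nsq y = complex.Re '[y - z, y] by rewrite innerBl (hy z)// subr0.
have := inner_CS (y - z) y; have := nsq_ge0 y; have := nsq_ge0 (y - z); nra.
Qed.

Lemma adjoint_linear H H' (T : op H H') : densely_defined T -> linear_operator (adjoint T).
Proof.
move=> dT; split.
- by move=> q _ /=; rewrite !inner0r.
- by move=> c p q hp hq r Tr /=; rewrite !innerDr !innerZr hp// hq.
- move=> y h; apply: (dense_orth dT) => x [x' Txx'].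
  by have := h _ Txx'; rewrite /= inner0r.
Qed.

Context {H : hilbertType R} {A : op H H}.
Hypothesis sa : self_adjoint A.

Lemma sa_sym p q : A p -> A q -> '[p.2, q.1] = '[p.1, q.2].
Proof. by case: sa => _ e Ap; rewrite {1}e => hq; exact: hq. Qed.

Lemma sa_max p : (forall q, A q -> '[q.2, p.1] = '[q.1, p.2]) -> A p.
Proof. by case: sa => _ e hp; rewrite e. Qed.

Lemma sa_linear : linear_operator A.
Proof. by case: sa => dA e; rewrite e; exact: adjoint_linear. Qed.

Lemma sa_lin (a : R[i]) p q : A p -> A q -> A (a *: p + q).
Proof. by case: sa_linear => _ lin _; exact: lin. Qed.

Lemma sa_functional : functional A.
Proof. exact: linear_functional sa_linear. Qed.

Lemma bounded_from_belowP : bounded_from_below A ->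
  exists c : R, forall x y, A (x, y) -> c * nsq x <= complex.Re '[y, x].
Proof.
move=> [c hc]; exists c => x y /hc; rewrite nsqE -rmorphM/= lecE /=.
by move=> /andP[].
Qed.

End SelfAdjoint.

Section ShiftedMeans.
Context {R : realType}.
Notation MR := (measurableTypeR R).
Variables (nu : {measure set MR -> \bar R}) (m : R).
Hypothesis nuT : nu setT = m%:E.

Lemma measurable_abs_shift (c : R) D :
  measurable_fun D (fun s : MR => (`|(s : R) - c|)%:E).
Proof.
apply: measurable_funTS; apply: (measurable_EFin (f := fun s => `|s - c|)).
by apply: measurableT_comp => //; exact: measurable_funB.
Qed.

Lemma abs_shift_lty (c d : R) : (\int[nu]_s (`|s - c|)%:E < +oo)%E ->
  (\int[nu]_s (`|s - d|)%:E < +oo)%E.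
Proof.
move=> h; apply: (@le_lt_trans _ _ (\int[nu]_s ((`|s - c|)%:E + (`|c - d|)%:E))%E).
  apply: ge0_le_integral => //.
  - exact: measurable_abs_shift.
  - by apply: emeasurable_funD => //; exact: measurable_abs_shift.
  - have key (r : R) : `|r - d| <= `|r - c| + `|c - d|.
      by rewrite (le_trans _ (ler_normD _ _))// addrA subrK.
    by move=> s _; rewrite -EFinD lee_fin; exact: key.
rewrite ge0_integralD//; last exact: measurable_abs_shift.
by rewrite integral_cst// nuT -EFinM lte_add_pinfty ?ltry.
Qed.

(** Without mass below [c], |s - c| is s - c almost everywhere. Form values thus become integrals of
    a nonnegative function, open to monotone convergence. *)
Lemma mean_shift (c : R) : nu (~` `[c, +oo[%classic) = 0%E ->
  nu.-integrable setT (fun s : MR => (s : R)%:E) ->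
  (\int[nu]_s (`|s - c|)%:E = ((\int[nu]_s (s : R))%R - c * m)%:E)%E.
Proof.
move=> B0 i1; set B := `[c, +oo[%classic in B0.
have mB : measurable (B : set MR) by exact: measurable_itv.
have nB : nu B = m%:E.
  rewrite -nuT -(setUv B) measureU ?setICr//; last exact: measurableC.
  by rewrite [X in (_ + X)%E]B0 adde0.
have i2 : nu.-integrable B (fun s : MR => (s : R)%:E).
  by apply: integrableS i1.
have i3 := fin_integrable_cst nuT c mB.
have f1 := integrable_fin_num mB i2.
have -> : (\int[nu]_s (`|s - c|)%:E = \int[nu]_(s in B) (`|s - c|)%:E)%E.
  have := @ge0_negligible_integral _ MR R nu setT (~` B) (fun s => (`|s - c|)%:E)
    (measurableC mB) measurableT (@measurable_abs_shift c setT).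
  by rewrite setTD setCK; apply.
rewrite EFinB EFinM /Rintegral (negligible_compl mB B0 i1) fineK//.
rewrite -nB -integral_cst// -integralB//; apply: eq_integral => s.
rewrite /B inE /= in_itv /= andbT => cs.
by rewrite -EFinB; congr (_%:E); rewrite ger0_norm// subr_ge0.
Qed.

End ShiftedMeans.

(** * The form of a semibounded operator as a limit of truncations *)

Section FormOfOperator.
Context {R : realType} {H : hilbertType R} (A : op H H) (t : form H) (E : pvm H) (c : R).
Notation MR := (measurableTypeR R).
Hypothesis sa : self_adjoint A.
Hypothesis sm : is_spectral_measure E A.
Hypothesis A_below : forall x y, A (x, y) -> c * nsq x <= complex.Re '[y, x].
Hypothesis t_dom : fdom t = [set x | (\int[diag E x]_r `|r|%:E < +oo)%E].
Hypothesis t_lin : sesquilinear_on (fdom t) t.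
Hypothesis t_diag : forall x, fdom t x -> t x x = (\int[diag E x]_r r)%R%:C.
Local Notation X := (fdom t).
Local Notation En n := (E (sitv n)).

(** The form of A - c on the spectral part |s| <= n. These forms are bounded, defined on all of [H],
    nonnegative, and increase to t - c, so limits taken in [H] become accessible. *)
Definition trunc_form n (x y : H) : R[i] :=
  '[app A (En n x), y] - c%:C * '[En n x, y].
Local Notation h := trunc_form.
Local Notation g x := (complex.Re (t x x) - c * nsq x).

Lemma trunc_dom n x : A (En n x, app A (En n x)).
Proof.
apply: app_in; apply: (proj_bounded_dom sm x (M := n%:R)); first exact: measurable_sitv.
by move=> s; exact: sitv_abs.
Qed.

Lemma trunc_app n x : En n (app A (En n x)) = app A (En n x).
Proof.
apply: (proj_reduce sm (sa_lin sa) (sa_sym sa) (measurable_sitv n) (trunc_dom n x)).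
by apply: proj_idem; exact: measurable_sitv.
Qed.

Lemma trunc_hermitian n : hermitian_on [set: H] (h n).
Proof.
have mn := @measurable_sitv R n; split; first exact: subspT.
  move=> a x y z _ _ _; rewrite /h proj_linear//.
  rewrite (app_lin _ (sa_linear sa)); try by eexists; exact: trunc_dom.
  by rewrite !innerDl !innerZl; ring.
move=> x y _ _; rewrite /h.
have -> : '[app A (En n y), x] = '[app A (En n x), y]^*.
  rewrite -{1}trunc_app proj_sym// -[in RHS]trunc_app proj_sym// -innerC.
  exact: (sa_sym sa (trunc_dom n y) (trunc_dom n x)).
rewrite rmorphB rmorphM/= conj_real; congr (_ - _ * _).
by rewrite proj_sym// innerC.
Qed.

Lemma trunc_int n x :
  ((complex.Re (h n x x))%:E = \int[diag E x]_(s in sitv n) (`|s - c|)%:E)%E.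
Proof.
have mn := @measurable_sitv R n.
rewrite -int_diag_proj//; last exact: measurable_abs_shift.
rewrite (mean_shift (diagT E (En n x))).
- congr (_%:E); rewrite /h ReD ReN ReZ; congr (_ - _ * _).
    by rewrite -trunc_app proj_sym// (sm.2 _ _ (trunc_dom n x)).
  by rewrite -(inner_proj E x mn) Re_innerC.
- rewrite setCitvr diag_nsq; last exact: measurable_itv.
  by rewrite (proj_below sm A_below) nsq0.
- by apply: (dom_integrable sm); eexists; exact: trunc_dom.
Qed.

Lemma form_domP x : X x <-> (\int[diag E x]_s (`|s - c|)%:E < +oo)%E.
Proof.
rewrite t_dom /=.
have -> : (\int[diag E x]_r `|r|%:E = \int[diag E x]_r `|r - 0|%:E)%E.
  by apply: eq_integral => r _; rewrite subr0.
by split; exact: (abs_shift_lty (diagT E x)).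
Qed.

Lemma form_mean x : X x -> ((g x)%:E = \int[diag E x]_s (`|s - c|)%:E)%E.
Proof.
move=> Xx; rewrite (mean_shift (diagT E x)).
- by rewrite t_diag.
- rewrite setCitvr diag_nsq; last exact: measurable_itv.
  by rewrite (proj_below sm A_below) nsq0.
- apply/integrableP; split; first exact: measurable_EFin.
  by move: Xx; rewrite t_dom.
Qed.

Lemma trunc_le_form n x : X x -> complex.Re (h n x x) <= g x.
Proof.
move=> Xx; rewrite -lee_fin trunc_int form_mean//.
by apply: ge0_subset_integral => //; [exact: measurable_sitv|exact: measurable_abs_shift].
Qed.

Lemma trunc_nd n p x : (n <= p)%N -> complex.Re (h n x x) <= complex.Re (h p x x).
Proof.
move=> np; rewrite -lee_fin !trunc_int.
apply: ge0_subset_integral => //; try exact: measurable_sitv; last exact: sitv_nd.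
exact: measurable_abs_shift.
Qed.

(** Monotone convergence. Linearity of the form domain, closedness and convergence of the tails all
    reduce to uniform estimates on the bounded forms through this. *)
Lemma trunc_bounded K x : (forall n, complex.Re (h n x x) <= K) -> X x /\ g x <= K.
Proof.
move=> hK; have h1 : (\int[diag E x]_s (`|s - c|)%:E <= K%:E)%E.
  have h2 := @ge0_nondecreasing_set_cvg_integral _ MR R (@sitv R) (fun s => (`|s - c|)%:E) (diag E x)
    (fun n p np => introT (subsetPset _ _) (@sitv_nd R n p np)) (@measurable_sitv R)
    (fun n => @measurable_abs_shift R c _) (fun _ _ _ => normr_ge0 _).
  rewrite sitv_cup in h2.
  rewrite -(cvg_lim (@ereal_hausdorff R) h2); apply: lime_le.
    by apply/cvg_ex; eexists; exact: h2.
  by near=> n; rewrite -trunc_int lee_fin.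
have Xx : X x by apply/form_domP; apply: le_lt_trans h1 (ltry _).
by split=> //; rewrite -lee_fin form_mean.
Unshelve. all: by end_near. Qed.

Lemma trunc_nonneg n : nonneg_on [set: H] (h n).
Proof. by move=> x _; rewrite -lee_fin trunc_int; exact: integral_ge0. Qed.

Lemma trunc_approx x (e : R) : X x -> 0 < e ->
  exists N, forall n, (N <= n)%N -> g x - e < complex.Re (h n x x).
Proof.
move=> Xx e0; apply: contrapT => no; have [n|_] := @trunc_bounded (g x - e) x; last lra.
rewrite leNgt; apply/negP => hn; apply: no; exists n => p np.
exact: lt_le_trans hn (trunc_nd x np).
Qed.

Lemma form_of_subsp : subsp X.
Proof.
have dh n := trunc_hermitian n.
split.
  apply: (proj1 (@trunc_bounded 0 0 _)) => n.
  by rewrite (form0l (dh n)).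
move=> a x y Xx Xy.
apply: (proj1 (@trunc_bounded (2 * ((complex.Re a ^+ 2 + complex.Im a ^+ 2) * g x) + 2 * g y) _ _)) => n.
apply: le_trans (form_le2 (dh n) (@trunc_nonneg n) _ _) _ => //.
rewrite (Re_form_scale (dh n))//.
have := trunc_le_form n Xx; have := trunc_le_form n Xy.
have := sqr_ge0 (complex.Re a); have := sqr_ge0 (complex.Im a).
set p := _ ^+ 2; set q := _ ^+ 2 => ? ? ? ?.
have : (q + p) * complex.Re (h n x x) <= (q + p) * g x by apply: ler_wpM2l => //; lra.
lra.
Qed.

(** A sesquilinear form with real diagonal is symmetric: evaluation at a x + y for a = 1 and a = i
    relates the imaginary and the real parts of t x y and t y x. *)
Lemma form_of_hermitian : hermitian_on X t.
Proof.
have sX := form_of_subsp; split => //.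
  by move=> a x y z Xx Xy Xz; case: (t_lin a Xx Xy Xz).
move=> x y Xx Xy.
have r z : X z -> complex.Im (t z z) = 0 by move=> Xz; rewrite t_diag.
have key (a : R[i]) : complex.Im (a * t x y + a^* * t y x) = 0.
  have Xw : X (a *: x + y) by exact: subspP.
  have [e1 _] := t_lin a Xx Xy Xw; have [_ e2] := t_lin a Xx Xy Xx; have [_ e3] := t_lin a Xx Xy Xy.
  have := r _ Xw; rewrite e1 e2 e3 !mulrDr !ImD (r y Xy).
  have -> : complex.Im (a * (a^* * t x x)) = 0.
    rewrite mulrA; have := r x Xx; case: (t x x) => u v /= ->.
    by case: a {e1 e2 e3 Xw} => p q /=; ring.
  by rewrite addr0 add0r.
have := key 1; have := key (Complex 0 1).
case: (t x y) => u v; case: (t y x) => u' v' /= => e1 e2.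
by congr Complex; lra.
Qed.

Lemma form_of_dom x y : A (x, y) -> X x.
Proof.
move=> xy; rewrite t_dom /=.
by have /integrableP[] := dom_integrable sm (ex_intro _ y xy).
Qed.

Lemma trunc_tail n x : X x -> X (x - En n x) /\ g (x - En n x) <= g x - complex.Re (h n x x).
Proof.
move=> Xx; have mn := @measurable_sitv R n; apply: trunc_bounded => p.
have [np|pn] := leqP n p; last first.
  have -> : h p (x - En n x) (x - En n x) = 0.
    rewrite /h (_ : En p (x - En n x) = 0).
      have -> : app A 0 = 0.
        by apply: appE (sa_functional sa) _; case: (sa_linear sa).
      by rewrite !inner0l mulr0 subr0.
    have mp := @measurable_sitv R p.
    rewrite projB// -(projI E mp mn) (_ : sitv p `&` sitv n = sitv p) ?subrr//.
    by apply/setIidPl; apply: sitv_nd; exact: ltnW.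
  by rewrite subr_ge0 trunc_le_form.
have -> : complex.Re (h p (x - En n x) (x - En n x)) = complex.Re (h p x x) - complex.Re (h n x x).
  have mp := @measurable_sitv R p.
  have e1 y : h p (En n y) x = h n y x.
    rewrite /h -projI// (_ : sitv p `&` sitv n = sitv n)//.
    by apply/setIidPr; exact: sitv_nd.
  have e2 : h p (En n x) (En n x) = h n x x.
    rewrite -e1 /h -projI// (_ : sitv p `&` sitv n = sitv n); last first.
      by apply/setIidPr; exact: sitv_nd.
    by rewrite -trunc_app !proj_sym// !proj_idem.
  rewrite (Re_formB (trunc_hermitian p))// e2 (Re_formC (trunc_hermitian p) (x := En n x))// e1.
  by lra.
by apply: lerB => //; exact: trunc_le_form.
Qed.

Lemma proj_sitv_cvg x (e : R) : 0 < e -> exists n, nsq (x - En n x) < e.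
Proof.
move=> e0; apply: contrapT => no.
have [M hM] : exists M, M = nsq x - e by eexists.
have h : (diag E x setT <= (nsq x - e)%:E)%E.
  apply: (measure_cup_le (nu := diag E x) (@measurable_sitv R) (@sitv_nd R) (@sitv_cup R)) => n.
  have mn := @measurable_sitv R n.
  rewrite diag_nsq// lee_fin leNgt; apply/negP => hn; apply: no; exists n.
  rewrite /nsq (Re_formB inner_hermitian)// inner_proj// -!/(nsq _); lra.
by move: h; rewrite diagT lee_fin; lra.
Qed.

Lemma form_of_ge x : X x -> 0 <= g x.
Proof. by move=> Xx; apply: le_trans (trunc_le_form 0 Xx); exact: trunc_nonneg. Qed.

Lemma trunc_bound n x : complex.Re (h n x x) <= (n%:R + `|c|) * nsq x.
Proof.
have mn := @measurable_sitv R n.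
rewrite -lee_fin trunc_int EFinM -(diagT E x).
apply: (@le_trans _ _ (\int[diag E x]_(s in sitv n) (n%:R + `|c|)%:E)%E).
  apply: ge0_le_integral => //; first exact: measurable_abs_shift.
  move=> s /sitv_abs hs; rewrite lee_fin.
  by rewrite (le_trans (ler_normB _ _))// lerD2r.
rewrite integral_cst// lee_wpmul2l ?lee_fin ?addr_ge0//.
by apply: le_measure; rewrite ?inE.
Qed.

(** A Cauchy sequence for the form norm has a limit l in [H]. Each truncation is continuous on [H],
    so the bound on u n - u m passes to u n - l, and monotone convergence returns it to the form. *)
Lemma form_of_closed : closed_form t c.
Proof.
have ht := form_of_hermitian; have sX := form_of_subsp.
split => //.
- by move=> x /form_of_ge; rewrite subr_ge0.
- move=> u Xu uc0.
  have qE x : complex.Re (t x x + (1 - c)%:C * '[x, x]) = g x + nsq x.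
    by rewrite ReD ReZ -/(nsq x); ring.
  have uc (e : R) : 0 < e -> exists N : nat, forall m n, (N <= m)%N -> (N <= n)%N ->
      g (u m - u n) + nsq (u m - u n) < e.
    by move=> /uc0[N hN]; exists N => m n Nm Nn; rewrite -qE; exact: hN.
  have [|l _ hl] := @hilbert_complete _ H u (fun=> I).
    move=> e /uc[N hN]; exists N => m n Nm Nn; apply: le_lt_trans (hN m n Nm Nn).
    by rewrite -/(nsq _) lerDr; apply: form_of_ge; exact: subspB.
  have tail (e : R) : 0 < e -> exists N, forall n, (N <= n)%N -> X (u n - l) /\ g (u n - l) <= e.
    move=> e0; have [N hN] := uc (e / 2) ltac:(lra); exists N => n Nn.
    apply: trunc_bounded => p.
    suff : complex.Re (h p (u n - l) (u n - l)) - e <= 0 by lra.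
    apply: (@le0_eps _ _ (2 * (p%:R + `|c|))) => r r0.
    have [N' hN'] := hl r r0; pose m := maxn N N'.
    have h1 : complex.Re (h p (u n - u m) (u n - u m)) <= e / 2.
      have Xnm : X (u n - u m) by exact: subspB.
      apply: le_trans (trunc_le_form p Xnm) _.
      have := hN n m Nn (leq_maxl _ _).
      have := nsq_ge0 (u n - u m); lra.
    have h2 : complex.Re (h p (u m - l) (u m - l)) <= (p%:R + `|c|) * r.
      apply: le_trans (trunc_bound p _) _; apply: ler_wpM2l.
        by rewrite addr_ge0.
      by apply/ltW; exact: (hN' m (leq_maxr _ _)).
    have := form_le2 (trunc_hermitian p) (@trunc_nonneg p) (x := u n - u m) (y := u m - l) I I.
    rewrite addrA subrK; nra.
  have Xl : X l.
    have [N hN] := tail 1 ltr01; have [Xd _] := hN N (leqnn N).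
    by rewrite (_ : l = u N - (u N - l)); [exact: subspB|rewrite opprB addrC subrK].
  exists l => // e e0.
  have [N1 h1] := tail (e / 2) ltac:(lra); have [N2 h2] := hl (e / 2) ltac:(lra).
  exists (maxn N1 N2) => n; rewrite geq_max => /andP[n1 n2].
  have [_ e1] := h1 n n1; have := h2 n n2; rewrite qE -/(nsq _); lra.
- move=> x e e0; have [n hn] := proj_sitv_cvg x e0; exists (En n x) => //.
  by apply: form_of_dom; exact: trunc_dom.
Qed.

(** For test vectors in the domain of [A] this is polarisation of the mean formula. Truncations of
    an arbitrary test vector converge to it in the form norm, which extends the identity to the form
    domain. *)
Lemma form_of_operator p : A p -> form_operator t p.
Proof.
case: p => x w xw; have ht := form_of_hermitian.
have Xx := form_of_dom xw; split=> //= y Xy.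
have dE z z' : A (z, z') -> complex.Re (t z z) = complex.Re '[z', z].
  move=> zz'; rewrite t_diag; last exact: form_of_dom zz'.
  by rewrite (sm.2 _ _ zz').
have AE z z' : A (z, z') -> complex.Re (t x z) = complex.Re '[w, z].
  move=> zz'; have Xz := form_of_dom zz'.
  have := dE _ _ (sa_lin sa 1 xw zz'); rewrite !scale1r /= (Re_formD ht)//.
  rewrite (dE _ _ xw) (dE _ _ zz') innerDl !innerDr !ReD.
  have := sa_sym sa zz' xw => /= ->; rewrite (Re_innerC w z); lra.
have key y' : X y' -> complex.Re (t x y') = complex.Re '[w, y'].
  move=> Xy'; have K0 : 0 <= nsq w + g x + c ^+ 2 * nsq x + 1.
    have := nsq_ge0 w; have := form_of_ge Xx; have := nsq_ge0 x; have := sqr_ge0 c; nra.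
  have hs := shifted_hermitian form_of_closed; have ns := shifted_nonneg form_of_closed.
  have small (e : R) : 0 < e -> exists n, complex.Re (shifted_form t c (y' - En n y') (y' - En n y')) < e
      /\ nsq (y' - En n y') < e.
    move=> e0; have [n1 h1] := proj_sitv_cvg y' (e := e / 2) ltac:(lra).
    have [n2 h2] := trunc_approx Xy' (e := e / 2) ltac:(lra).
    pose n := maxn n1 n2; exists n.
    have h3 : nsq (y' - En n y') <= nsq (y' - En n1 y').
      have m1 := @measurable_sitv R n1; have mn := @measurable_sitv R n.
      rewrite -!projC//; have -> : E (~` sitv n) y' = E (~` sitv n) (E (~` sitv n1) y').
        rewrite -projI//; try exact: measurableC.
        congr (E _ y'); apply/esym/setIidPl/subsetC; exact: sitv_nd (leq_maxl _ _).
      by apply: nsq_proj_le; exact: measurableC.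
    split; last lra.
    have [Xd hd] := trunc_tail n Xy'.
    have := h2 n (leq_maxr _ _).
    have -> z : complex.Re (shifted_form t c z z) = complex.Re (t z z) + (1 - c) * nsq z.
      by rewrite /shifted_form ReD ReZ.
    lra.
  apply/eqP; rewrite -subr_eq0; apply/eqP.
  have zero (r a : R) : 0 <= a -> (forall e : R, 0 < e -> r ^+ 2 <= e * a) -> r = 0.
    move=> a0 hr; apply/eqP; rewrite -sqrf_eq0 eq_le sqr_ge0 andbT.
    exact: (le0_eps hr).
  pose a := 2 * complex.Re (shifted_form t c x x) + 2 * nsq (w + (1 - c)%:C *: x).
  apply: (zero _ a) => [|e e0]; first by rewrite addr_ge0// mulr_ge0 ?nsq_ge0//; exact: ns.
  have [n [s1 s2]] := small e e0; set d := y' - En n y' in s1 s2.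
  have [Xd _] := trunc_tail n Xy'; rewrite -/d in Xd.
  have Xn : X (En n y') by apply: form_of_dom; exact: trunc_dom.
  have e1 : complex.Re (t x y') - complex.Re '[w, y'] =
      complex.Re (shifted_form t c x d) - complex.Re '[w + (1 - c)%:C *: x, d].
    have := AE _ _ (trunc_dom n y'); rewrite /d /shifted_form (formBr ht)//.
    rewrite innerDl innerZl !innerBr !ReD !ReZ !ReD !ReN => ->; ring.
  have c1 := form_CS hs ns Xx Xd; have c2 := inner_CS (w + (1 - c)%:C *: x) d.
  have p0 := ns x Xx; have p1 := nsq_ge0 (w + (1 - c)%:C *: x).
  rewrite e1 /a; set u := complex.Re _ in c1 *; set v := complex.Re _ in c2 *.
  set P := complex.Re _ in c1 p0 *; set Q := nsq _ in c2 p1 *.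
  have k1 : u ^+ 2 <= e * P by apply: le_trans c1 _; rewrite mulrC ler_wpM2r// ltW.
  have k2 : v ^+ 2 <= e * Q by apply: le_trans c2 _; rewrite mulrC ler_wpM2r// ltW.
  have := sqr_ge0 (u + v); nra.
rewrite [LHS]complexE [RHS]complexE (form_Im ht)// (form_Im inner_hermitian)//.
by rewrite !key//; apply: subspZ => //; exact: form_of_subsp.
Qed.

End FormOfOperator.

Lemma form_of_dom_sub (R : realType) (H : hilbertType R) (A : op H H) (t : form H) :
  is_form_of A t -> dom A `<=` fdom t.
Proof.
move=> [E sm [-> _ _]] x dx /=.
by have /integrableP[] := dom_integrable sm dx.
Qed.

Theorem is_form_of_closed (R : realType) (H : hilbertType R) (A : op H H) (t : form H) :
  self_adjoint A -> bounded_from_below A -> is_form_of A t ->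
  exists2 c, closed_form t c & A `<=` form_operator t.
Proof.
move=> sa /bounded_from_belowP[c hc] [E sm [td tl tq]]; exists c.
  exact: (form_of_closed sa sm hc td tl tq).
by move=> p Ap; exact: (form_of_operator sa sm hc td tl tq Ap).
Qed.

Lemma complete_equiv (R : realType) (V : lmodType R[i]) (X : set V)
    (h h' : V -> V -> R[i]) (K K' : R) : subsp X -> 0 <= K -> 0 <= K' ->
  (forall x, X x -> complex.Re (h x x) <= K * complex.Re (h' x x)) ->
  (forall x, X x -> complex.Re (h' x x) <= K' * complex.Re (h x x)) ->
  complete_on X h -> complete_on X h'.
Proof.
move=> sX K0 K'0 hh' h'h hc u Xu uc.
have small (k e : R) : 0 <= k -> 0 < e -> 0 < e / (k + 1) /\ k * (e / (k + 1)) < e.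
  move=> k0 e0; have k1 : 0 < k + 1 by lra.
  split; first exact: divr_gt0.
  by rewrite mulrA ltr_pdivrMr//; lra.
have [|l Xl hl] := hc u Xu.
  move=> e e0; have [e1 e2] := small K e K0 e0; have [N hN] := uc _ e1.
  exists N => m n Nm Nn; have := hN m n Nm Nn; have := hh' _ (subspB sX (Xu m) (Xu n)).
  set p := complex.Re _; set q := complex.Re _ => pq /ltW qe.
  by apply: le_lt_trans pq (le_lt_trans _ e2); rewrite ler_wpM2l.
exists l => // e e0; have [e1 e2] := small K' e K'0 e0; have [N hN] := hl _ e1.
exists N => n Nn; have := hN n Nn; have := h'h _ (subspB sX (Xu n) Xl).
set p := complex.Re _; set q := complex.Re _ => pq /ltW qe.
by apply: le_lt_trans pq (le_lt_trans _ e2); rewrite ler_wpM2l.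
Qed.

Lemma continuous_bounded (R : realType) (H H' : hilbertType R) (Q : H -> H') :
  (forall (c : R[i]) x y, Q (c *: x + y) = c *: Q x + Q y) -> continuous Q ->
  exists2 C, 0 < C & forall y, nsq (Q y) <= C * nsq y.
Proof.
move=> Qlin cQ; have Q0 : Q 0 = 0.
  by have := Qlin (-1) 0 0; rewrite !scaler0 addr0 scaleN1r addNr.
have [d d0 hd] := continuous_ball 0 cQ (@ltr01 R).
exists (4 / d ^+ 2) => [|y]; first by rewrite divr_gt0// exprn_gt0.
have d2 : 0 < d ^+ 2 by rewrite exprn_gt0.
have [->|y0] := eqVneq y 0; first by rewrite Q0 !nsq0 mulr0.
have m0 := nsq_gt0 y0; set m := nsq y in m0 *.
(* [k] scales [y] to norm d / 2, inside the ball that [Q] maps into the unit ball. *)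
pose k := d / (2 * Num.sqrt m).
have k2 : k ^+ 2 = d ^+ 2 / (4 * m).
  rewrite /k expr_div_n exprMn sqr_sqrtr ?ltW//.
  by congr (_ / (_ * _)); ring.
have nk (L : hilbertType R) (z : L) : nsq (k%:C *: z) = k ^+ 2 * nsq z by rewrite nsqZ /= expr0n/= addr0.
have := hd (k%:C *: y); rewrite !ball_nsq// !sub0r Q0 !sub0r !nsqN expr1n.
have -> : Q (k%:C *: y) = k%:C *: Q y by rewrite -[k%:C *: y]addr0 Qlin Q0 addr0.
rewrite !nk -/m k2 => /(_ _)/wrap[].
  by rewrite mulrAC ltr_pdivrMr ?mulr_gt0//; nra.
rewrite mulrAC ltr_pdivrMr ?mulr_gt0// mul1r => h.
by rewrite mulrAC ler_pdivlMr// mulrC ltW.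
Qed.

Lemma inner_le_half (R : realType) (H : hilbertType R) (x y : H) :
  `|complex.Re '[x, y]| <= (nsq x + nsq y) / 2.
Proof.
have := nsq_ge0 (x + y); have := nsq_ge0 (x - y); rewrite /nsq.
rewrite (Re_formB inner_hermitian)// (Re_formD inner_hermitian)//.
by rewrite ler_norml => ? ?; apply/andP; split; lra.
Qed.

Lemma shifted_diag (R : realType) (H : hilbertType R) (t : form H) (c : R) x :
  complex.Re (shifted_form t c x x) = complex.Re (t x x) + (1 - c) * nsq x.
Proof. by rewrite /shifted_form ReD ReZ. Qed.

(** * Schur complements *)

Section UpperBoundedOperator.
Context {R : realType} {H : hilbertType R} (D : op H H) (delta : R).
Hypothesis sa : self_adjoint D.
Hypothesis D_above : bounded_from_above D.
Hypothesis spec_le : forall z, spectrum D z -> z <= delta%:C.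

Lemma resolvent_real l : delta < l -> resolvent_set D l%:C.
Proof.
move=> dl; apply: contrapT => /spec_le; rewrite lecR => ld.
by have := lt_le_trans dl ld; rewrite ltxx.
Qed.

(** The sign makes this (l - D)^-1, a positive operator for [l] above the spectrum of [D]. *)
Definition res (l : R) (w : H) : H := - app (inverse (shift D l%:C)) w.

Lemma resP l x w : delta < l -> D (x, l%:C *: x - w) <-> x = res l w.
Proof.
move=> /resolvent_real[Q _ hQ].
have e1 v : app (inverse (shift D l%:C)) v = Q v.
  apply: appE => [y z z' /= h h'|]; last exact/hQ.
  by rewrite (proj1 (hQ z y) h) (proj1 (hQ z' y) h').
rewrite /res e1.
have hN z y : D (z, y) -> D (- z, - y).
  move=> Dzy; have := sa_lin sa (-1) Dzy (let: And3 h _ _ := sa_linear sa in h).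
  by rewrite addr0 scaleN1r.
split=> [h|->].
  apply/eqP; rewrite -eqr_oppLR; apply/eqP/hQ; rewrite /shift /=.
  by have := hN _ _ h; rewrite opprB scalerN.
have /hQ := erefl (Q w); rewrite /shift /= => /hN.
by rewrite opprD scalerN addrC.
Qed.

Lemma resE l w : delta < l -> D (res l w, l%:C *: res l w - w).
Proof. by move=> dl; apply/(resP _ _ dl). Qed.

Lemma res_lin l (c : R[i]) x y : delta < l -> res l (c *: x + y) = c *: res l x + res l y.
Proof.
move=> dl; apply/esym/(resP _ _ dl).
have := sa_lin sa c (resE x dl) (resE y dl).
rewrite (_ : _ + _ = (c *: res l x + res l y, l%:C *: (c *: res l x + res l y) - (c *: x + y)))//.
congr pair; rewrite /= scalerBr scalerDr !scalerA (mulrC c) opprD.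
by rewrite addrACA.
Qed.

Lemma res_bounded l : delta < l -> exists2 C, 0 < C & forall w, nsq (res l w) <= C * nsq w.
Proof.
move=> dl; have [Q cQ hQ] := resolvent_real dl.
have e w : res l w = - Q w.
  apply/esym/(resP _ _ dl).
  have h : D (Q w, w + l%:C *: Q w) by exact/hQ.
  have := sa_lin sa (-1) h (let: And3 h _ _ := sa_linear sa in h).
  by rewrite addr0 scaleN1r scalerN -opprD addrC.
have [c x y|C C0 hC] := continuous_bounded _ cQ.
  apply/oppr_inj; rewrite opprD -scalerN -!e; exact: res_lin.
by exists C => // w; rewrite e nsqN.
Qed.

Lemma res_sym l x y : delta < l -> '[res l x, y] = '[x, res l y].
Proof.
move=> dl; have := sa_sym sa (resE x dl) (resE y dl) => /=.
rewrite innerBl innerBr innerZl innerZr conj_real.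
by move=> /eqP; rewrite (inj_eq (addrI _)) eqr_opp eq_sym => /eqP.
Qed.

(* If the supremum of the numerical range exceeded [delta], it would lie in
   the resolvent set, and Cauchy-Schwarz for the form of [c0 - D] would
   give it distance from the numerical range. *)
Lemma above_spectrum x y : D (x, y) -> complex.Re '[y, x] <= delta * nsq x.
Proof.
move=> xy; rewrite leNgt; apply/negP => hlt.
have x0 : x != 0.
  by apply/eqP => e; move: hlt; rewrite e nsq0 mulr0 inner0r ltxx.
pose num : set R := [set r | exists u v, [/\ D (u, v), u != 0 & r = complex.Re '[v, u] / nsq u]].
have [c hc] := D_above.
have numc : ubound num c.
  move=> r [u [v [uv u0 ->]]]; rewrite ler_pdivrMr ?nsq_gt0//.
  by have := hc _ _ uv; rewrite nsqE -rmorphM lecE /= => /andP[].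
have num0 : num (complex.Re '[y, x] / nsq x) by exists x, y.
have hs : has_sup num by split; [exists (complex.Re '[y, x] / nsq x)|exists c].
pose c0 := sup num.
have dc : delta < c0.
  apply: (@lt_le_trans _ _ (complex.Re '[y, x] / nsq x)); last exact: (sup_upper_bound hs).
  by rewrite ltr_pdivlMr ?nsq_gt0.
have le0 u v : D (u, v) -> 0 <= c0 * nsq u - complex.Re '[v, u].
  move=> uv; have [->|u0] := eqVneq u 0; first by rewrite nsq0 inner0r mulr0 subr0.
  rewrite subr_ge0 -ler_pdivrMr ?nsq_gt0//; apply: (sup_upper_bound hs).
  by exists u, v.
have [C C0 hC] := res_bounded dc.
pose h u v := c0%:C * '[u, v] - '[app D u, v].
have hE u : dom D u -> complex.Re (h u u) = c0 * nsq u - complex.Re '[app D u, u].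
  by move=> _; rewrite /h ReD ReN ReZ.
have hh : hermitian_on (dom D) h.
  split; first exact: dom_subsp (sa_linear sa).
    move=> k u v w du dv dw; rewrite /h (app_lin _ (sa_linear sa))//.
    by rewrite !innerDl !innerZl; ring.
  move=> u v du dv; rewrite /h rmorphB rmorphM/= conj_real -!innerC.
  by congr (_ - _); have := sa_sym sa (app_in dv) (app_in du) => /= ->.
have hn : nonneg_on (dom D) h by move=> u du; rewrite hE//; exact: le0 (app_in du).
(* With r = (c0 - D)^-1 u one has h(u, r) = |u|^2 and h(r, r) = Re <u, r> <= sqrt(C) |u|^2;
   Cauchy-Schwarz bounds h(u, u) from below by |u|^2 / sqrt(C). *)
have gap u v : D (u, v) -> nsq u <= Num.sqrt C * (c0 * nsq u - complex.Re '[v, u]).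
  move=> uv; have du : dom D u by exists v.
  have ev := appE (sa_functional sa) uv.
  have Dr := resE u dc; set r := res c0 u in Dr *.
  have dr : dom D r by eexists; exact: Dr.
  have er := appE (sa_functional sa) Dr.
  have := form_CS hh hn du dr; rewrite !hE// ev er.
  have -> : complex.Re (h u r) = nsq u.
    rewrite (Re_formC hh dr du) /h er innerBl innerZl opprB addrCA subrr addr0 //.
  have -> : c0 * nsq r - complex.Re '[c0%:C *: r - u, r] = complex.Re '[u, r].
    by rewrite innerBl innerZl ReD ReN ReZ -/(nsq r); ring.
  have q0 := le0 _ _ uv; set q := c0 * nsq u - _ in q0 *.
  have cs := inner_CS u r; have hr := hC u; rewrite -/r in hr.
  set p := complex.Re _ in cs * => h1.
  have u0 := nsq_ge0 u.
  have [->|un0] := eqVneq (nsq u) 0; first by rewrite mulr_ge0 ?sqrtr_ge0.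
  have up : 0 < nsq u by rewrite lt_neqAle eq_sym un0.
  have hp : p <= Num.sqrt C * nsq u.
    rewrite (le_trans (ler_norm p))// -(@ler_pXn2r _ 2)// ?nnegrE ?mulr_ge0 ?sqrtr_ge0//.
    rewrite real_normK ?num_real// exprMn sqr_sqrtr; last exact: ltW.
    by apply: le_trans cs _; rewrite expr2 mulrCA ler_wpM2l// mulrC.
  have : nsq u * nsq u <= (Num.sqrt C * q) * nsq u.
    have := ler_wpM2l q0 hp; move: h1; rewrite expr2; lra.
  
  by rewrite ler_pM2r.
have s0 := sqrtr_gt0 C; rewrite C0 in s0.
have [|r [u [v [uv u0 ->]]]] := sup_adherent (eps := (2 * Num.sqrt C)^-1) _ hs.
  by rewrite invr_gt0 mulr_gt0.
rewrite -/c0 ltr_pdivlMr ?nsq_gt0// => h1.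
have := gap _ _ uv; have up := nsq_gt0 u0.
have h2 : c0 * nsq u - complex.Re '[v, u] < (2 * Num.sqrt C)^-1 * nsq u by lra.
have : Num.sqrt C * (c0 * nsq u - complex.Re '[v, u]) < nsq u / 2.
  apply: lt_le_trans (_ : Num.sqrt C * ((2 * Num.sqrt C)^-1 * nsq u) <= _).
    by rewrite ltr_pM2l.
  by rewrite invfM mulrA mulrCA divff ?gt_eqF// mulr1 mulrC.
lra.
Qed.

Lemma res_lower l w : delta < l -> (l - delta) * nsq (res l w) <= complex.Re '[res l w, w].
Proof.
move=> dl; have := above_spectrum (resE w dl).
rewrite innerBl innerZl ReD ReN ReZ -/(nsq _) (Re_innerC (res l w) w); lra.
Qed.

Lemma res_ge0 l w : delta < l -> 0 <= complex.Re '[res l w, w].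
Proof.
move=> dl; apply: le_trans (res_lower w dl); rewrite mulr_ge0 ?nsq_ge0//; lra.
Qed.

(** With r = (l - D)^-1 w, combine <r, w>^2 <= |r|^2 |w|^2 with (l - delta) |r|^2 <= <r, w>. *)
Lemma res_le l w : delta < l -> (l - delta) * complex.Re '[res l w, w] <= nsq w.
Proof.
move=> dl; have := res_lower w dl; have := inner_CS (res l w) w.
have := res_ge0 w dl; have := nsq_ge0 w; have := nsq_ge0 (res l w).
set p := complex.Re _; set q := nsq (res l w); set m := nsq w => q0 m0 p0 cs lo.
have t0 : 0 < l - delta by lra.
move: p0; rewrite le_eqVlt => /orP[/eqP <-|p0]; first by rewrite mulr0.
rewrite -(ler_pM2r p0); set t := l - delta in t0 lo *.
have : t * p ^+ 2 <= t * (q * m) by rewrite ler_pM2l.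
have : t * q * m <= p * m by rewrite ler_wpM2r.
rewrite expr2; lra.
Qed.

Lemma res_nsq l w : delta < l -> (l - delta) ^+ 2 * nsq (res l w) <= nsq w.
Proof.
move=> dl; have h1 := res_lower w dl; have h2 := res_le w dl.
apply: le_trans h2; rewrite expr2 -mulrA ler_wpM2l//; lra.
Qed.

Lemma res_identity l l' w : delta < l -> delta < l' ->
  res l w - res l' w = (l' - l)%:C *: res l (res l' w).
Proof.
move=> dl dl'; have h : res l' w = res l (w - (l' - l)%:C *: res l' w).
  apply/(resP _ _ dl); have := resE w dl'; congr (D (_, _)).
  by rewrite opprB addrA -scalerDl -rmorphD/= addrCA subrr addr0.
have := res_lin (- (l' - l)%:C) (res l' w) w dl.
rewrite !scaleNr (addrC _ w) -h => e; rewrite {1}e opprD opprK addrCA subrr addr0 //.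
Qed.

End UpperBoundedOperator.

Section SchurFamily.
Context {R : realType} {H1 H2 : hilbertType R}.
Variables (B : op H2 H1) (D : op H2 H2) (fa : form H1) (a b delta c0 : R).
Hypothesis sa : self_adjoint D.
Hypothesis D_above : bounded_from_above D.
Hypothesis spec_le : forall z, spectrum D z -> z <= delta%:C.
Hypothesis fac : closed_form fa c0.
Local Notation X := (fdom fa).
Local Notation bs := (app (adjoint B)).
Hypothesis bs_lin : forall (c : R[i]) x y, X x -> X y -> bs (c *: x + y) = c *: bs x + bs y.
Hypothesis b_ge0 : 0 <= b.
Hypothesis ab : forall x, X x -> nsq (bs x) <= a * nsq x + b * complex.Re (fa x x).
Local Notation mu := (delta + b + Num.sqrt (Num.max (b * delta + b ^+ 2 + a) 0)).
Local Notation s l := (schur_form B D fa l).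
Local Notation q l x := (complex.Re '[res D l (bs x), bs x]).
Local Notation f x := (complex.Re (fa x x)).
Implicit Types (l : R) (x : H1).

(** With t = l - delta the last inequality reads (t - b)^2 > b delta + b^2 + a. So [mu] is delta
    plus the larger root in t, or delta + b if there is no real root. *)
Lemma mu_gt l : mu < l -> [/\ delta < l, b < l - delta &
  a + b * l < (l - delta) * (l - delta - b)].
Proof.
set m := Num.max _ _ => ml; have s0 := sqrtr_ge0 m.
have h1 : b < l - delta by lra.
have dl : delta < l by rewrite -subr_gt0; exact: le_lt_trans b_ge0 h1.
split=> //; have m0 : 0 <= m by rewrite le_max lexx orbT.
have hm : b * delta + b ^+ 2 + a <= m by rewrite le_max lexx.
have : Num.sqrt m ^+ 2 < (l - delta - b) ^+ 2.
  by rewrite ltr_pXn2r// ?nnegrE//; lra.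
rewrite sqr_sqrtr// => h2; nra.
Qed.

Lemma schurE l x y : s l x y = fa x y - l%:C * '[x, y] - '[res D l (bs x), bs y].
Proof. by rewrite /schur_form /= /res innerNl opprK. Qed.

Lemma schur_diag l x : complex.Re (s l x x) = f x - l * nsq x - q l x.
Proof. by rewrite schurE !ReD !ReN ReZ. Qed.

Lemma schur_hermitian l : delta < l -> hermitian_on X (s l).
Proof.
move=> dl; case: fac => -[sX lin sym] _ _ _; split=> //.
  move=> c x y z Xx Xy Xz; rewrite !schurE lin// bs_lin//.
  by rewrite (res_lin sa spec_le)// !innerDl !innerZl; ring.
move=> x y Xx Xy; rewrite !schurE !rmorphB rmorphM/= conj_real sym// -!innerC.
by congr (_ - _); rewrite (res_sym sa spec_le).
Qed.

(** The resolvent term is at most |bs x|^2 / (l - delta), hence at most (a |x|^2 + b fa[x]) / (l -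
    delta). What is left of fa[x] has the positive factor 1 - b / (l - delta), which makes the form
    norms of s(l) and [fa] equivalent. *)
Lemma schur_lower l x : mu < l -> X x ->
  (1 - b / (l - delta)) * (f x - c0 * nsq x) <=
  complex.Re (s l x x) - ((1 - b / (l - delta)) * c0 - l - a / (l - delta)) * nsq x.
Proof.
move=> /mu_gt[dl bl _] Xx; rewrite schur_diag.
have := res_le sa D_above spec_le (bs x) dl; have := ab Xx.
have t0 : 0 < l - delta by lra.
set t := l - delta in t0 *; set p := complex.Re '[_, _]; set w := nsq _ => h1 h2.
have : p <= (a * nsq x + b * f x) / t by rewrite ler_pdivlMr// mulrC (le_trans h2).
rewrite mulrDl; set u := t^-1; lra.
Qed.

Lemma schur_theta l : mu < l -> 0 < 1 - b / (l - delta) <= 1.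
Proof.
move=> /mu_gt[dl bl _]; have t0 : 0 < l - delta by lra.
rewrite subr_gt0 ltr_pdivrMr// mul1r bl/= gerBl.
by rewrite divr_ge0// ltW.
Qed.

Lemma form_below x : X x -> 0 <= f x - c0 * nsq x.
Proof. by case: fac => _ h _ _ /h; lra. Qed.

Lemma schur_le l x : delta < l -> complex.Re (s l x x) <= f x - l * nsq x.
Proof.
move=> dl; rewrite schur_diag; have := res_ge0 sa D_above spec_le (bs x) dl; lra.
Qed.

Lemma schur_closed l : mu < l ->
  closed_form (s l) ((1 - b / (l - delta)) * c0 - l - a / (l - delta)).
Proof.
move=> ml; have [dl bl _] := mu_gt ml; have hs := schur_hermitian dl.
have /andP[th0 th1] := schur_theta ml.
set th := 1 - b / _ in th0 th1 *; set c := _ - a / _.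
have lo x : X x -> th * (f x - c0 * nsq x) <= complex.Re (s l x x) - c * nsq x.
  by move=> Xx; exact: schur_lower.
have [hfa lb cf dn] := fac.
have g0 x : X x -> c * nsq x <= complex.Re (s l x x).
  by move=> Xx; have := lo x Xx; have := mulr_ge0 (ltW th0) (form_below Xx); lra.
split => //.
pose K := 1 + `|1 - c - l + c0|.
have K0 : 0 <= K by rewrite addr_ge0.
have dE (t : H1 -> H1 -> R[i]) k x : complex.Re (t x x + k%:C * '[x, x]) =
    complex.Re (t x x) + k * nsq x by rewrite ReD ReZ.
apply: (@complete_equiv _ _ _ _ _ th^-1 K _ _ _ _ _ cf) => //.
- by case: hfa.
- by rewrite invr_ge0 ltW.
- move=> x Xx; rewrite !dE [leRHS]mulrC ler_pdivlMr//.
  have := lo x Xx; have : th * nsq x <= nsq x by rewrite ler_piMl ?nsq_ge0.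
  lra.
- move=> x Xx; rewrite !dE; have h1 := schur_le x dl.
  have h2 := form_below Xx; have n0 := nsq_ge0 x.
  have h3 : (1 - c - l + c0) * nsq x <= `|1 - c - l + c0| * nsq x.
    by rewrite ler_wpM2r// ler_norm.
  have := mulr_ge0 (normr_ge0 (1 - c - l + c0)) h2; rewrite /K; lra.
Qed.

(** By the resolvent identity the resolvent terms differ by (l2 - l1) Re <u2, u1>, where u_i = (l_i
    - D)^-1 bs x, and this is at most (l2 - l1) |u1|^2. The relative bound of bs estimates |u1|^2 by
    |x|^2 and s(l1)[x], which yields both constants; be > 0 is the quadratic inequality valid beyond
    [mu]. *)
Lemma schur_mono l1 l2 : mu < l1 -> l1 < l2 -> exists al be,
  [/\ 1 <= al, 0 < be & forall x, X x ->
    complex.Re (s l2 x x) <= al * complex.Re (s l1 x x) - be * nsq x].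
Proof.
move=> m1 l12; have [d1 b1 e1] := mu_gt m1; have d2 : delta < l2 by lra.
pose t := l1 - delta; pose k := t * (t - b).
have t0 : 0 < t by rewrite /t; lra.
have tb : 0 < t - b by rewrite /t; lra.
have k0 : 0 < k by rewrite mulr_gt0.
exists (1 + (l2 - l1) * b / k), ((l2 - l1) * (1 - (a + b * l1) / k)).
have dp : 0 < l2 - l1 by lra.
split.
- by rewrite lerDl divr_ge0 ?mulr_ge0// ltW.
- by rewrite mulr_gt0// subr_gt0 ltr_pdivrMr// mul1r.
move=> x Xx; set w := bs x.
have r1 := res_identity sa spec_le w d1 d2.
set u1 := res D l1 w in r1; set u2 := res D l2 w in r1; set v := res D l1 u2 in r1.
have e : u1 = u2 + (l2 - l1)%:C *: v by rewrite -r1 addrC subrK.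
have h1 : nsq u2 + (l2 - l1) * complex.Re '[u2, v] <= nsq u1.
  rewrite {2}/nsq e (Re_form_expand inner_hermitian)// -!/(nsq _).
  have p1 : 0 <= complex.Re '[u2, v].
    by rewrite Re_innerC; exact: (res_ge0 sa D_above spec_le).
  have := mulr_ge0 (ltW dp) p1; have := mulr_ge0 (sqr_ge0 (l2 - l1)) (nsq_ge0 v); lra.
have h2 : complex.Re '[u1, w] - complex.Re '[u2, w] = (l2 - l1) * complex.Re '[u2, u1].
  rewrite -ReN -ReD -innerNl -innerDl r1 innerZl ReZ.
  by rewrite /v (res_sym sa spec_le).
have h3 : complex.Re '[u2, u1] <= nsq u1.
  have -> : complex.Re '[u2, u1] = nsq u2 + (l2 - l1) * complex.Re '[u2, v].
    rewrite e innerDr ReD innerZr conj_real ReZ //.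
  exact: h1.
have h4 := res_lower sa D_above spec_le w d1; rewrite -/u1 -/t in h4.
have h5 := res_le sa D_above spec_le w d1; rewrite -/u1 -/t in h5.
have h6 := ab Xx; rewrite -/w in h6.
rewrite !schur_diag -/w -/u1 -/u2; set q1 := complex.Re '[u1, w] in h2 h4 h5 *.
set q2 := complex.Re '[u2, w] in h2 *.
(* fa[x] is rewritten as s(l1)[x] + l1 |x|^2 + q1; moving b q1 to the left leaves the factor t - b >
   0. *)
have h7 : q1 * (t - b) <= (a + b * l1) * nsq x + b * (f x - l1 * nsq x - q1) by lra.
have h8 : nsq u1 <= q1 / t by rewrite ler_pdivlMr// mulrC.
have h9 : q1 / t <= ((a + b * l1) * nsq x + b * (f x - l1 * nsq x - q1)) / k.
  rewrite /k invfM mulrA mulrAC ler_wpM2r ?invr_ge0 ?(ltW t0)//.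
  by rewrite ler_pdivlMr.
have h10 : (l2 - l1) * complex.Re '[u2, u1] <=
    (l2 - l1) * (((a + b * l1) * nsq x + b * (f x - l1 * nsq x - q1)) / k).
  by rewrite ler_pM2l// (le_trans h3)// (le_trans h8).
rewrite -h2 in h10; move: h10; set i := k^-1; lra.
Qed.

Definition schur_bound l := (1 - b / (l - delta)) * c0 - l - a / (l - delta).

Lemma bs_bound l : mu < l -> exists2 K, 0 <= K & forall x, X x ->
  nsq (bs x) <= K * complex.Re (shifted_form (s l) (schur_bound l) x x).
Proof.
move=> ml; have /andP[th0 th1] := schur_theta ml.
have sc := schur_closed ml; rewrite -/(schur_bound l) in sc.
set th := 1 - _ in th0 th1.
exists (`|a| + b * `|c0| + b / th) => [|x Xx].
  by rewrite !addr_ge0 ?mulr_ge0 ?invr_ge0// ltW.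
have hge := shifted_ge sc Xx.
set h := complex.Re _ in hge *.
have hth : f x - c0 * nsq x <= h / th.
  rewrite ler_pdivlMr// mulrC; have := schur_lower ml Xx.
  rewrite /h shifted_diag -/(schur_bound l) -/th.
  have := nsq_ge0 x; lra.
have h0 : 0 <= h by apply: le_trans hge; exact: nsq_ge0.
have a1 : a * nsq x <= `|a| * h.
  by apply: le_trans (ler_norm _) _; rewrite normrM ler_wpM2l// ger0_norm ?nsq_ge0.
have c1 : c0 * nsq x <= `|c0| * h.
  by apply: le_trans (ler_norm _) _; rewrite normrM ler_wpM2l// ger0_norm ?nsq_ge0.
have h1 := ab Xx.
have b2 : b * (f x - c0 * nsq x) <= b * (h / th) by rewrite ler_wpM2l.
have b3 : b * (c0 * nsq x) <= b * (`|c0| * h) by rewrite ler_wpM2l.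
move: b2; set i := th^-1; lra.
Qed.

(** The resolvent identity again. For |l' - l| < (l - delta) / 2 the operator (l' - D)^-1 is bounded
    by 2 / (l - delta), uniformly in l'; the factor 3 rounds up (1 + 4) / 2. *)
Lemma schur_cont l : mu < l -> exists C r, [/\ 0 <= C, 0 < r & forall l', mu < l' ->
  `|l' - l| < r -> forall x, X x ->
   `|complex.Re (s l' x x) - complex.Re (s l x x)| <=
   `|l' - l| * (C * complex.Re (shifted_form (s l) (schur_bound l) x x))].
Proof.
move=> ml; have [d1 b1 _] := mu_gt ml.
have sc := schur_closed ml; rewrite -/(schur_bound l) in sc.
pose t := l - delta; have t0 : 0 < t by rewrite /t; lra.
have [K K0 hK] := bs_bound ml.
exists (1 + 3 * K / t ^+ 2), (t / 2); split.
- by apply: addr_ge0 => //; apply: divr_ge0; [exact: mulr_ge0|exact: sqr_ge0].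
- by rewrite divr_gt0.
move=> l' ml' dl x Xx; have [d1' b1' _] := mu_gt ml'; set w := bs x.
have tt : t / 2 <= l' - delta.
  by move: dl; rewrite ltr_norml /t => /andP[h1 h2]; lra.
have r1 := res_identity sa spec_le w d1 d1'.
have h2 : complex.Re '[res D l w, w] - complex.Re '[res D l' w, w] =
    (l' - l) * complex.Re '[res D l' w, res D l w].
  rewrite -ReN -ReD -innerNl -innerDl r1 innerZl ReZ.
  by rewrite (res_sym sa spec_le).
have n1 := res_nsq sa D_above spec_le w d1.
have n2 := res_nsq sa D_above spec_le w d1'.
rewrite -/t in n1; set u := res D l w in h2 n1; set u' := res D l' w in h2 n2.
have n3 : (t / 2) ^+ 2 * nsq u' <= nsq w.
  apply: le_trans n2; rewrite ler_wpM2r ?nsq_ge0// lerXn2r// ?nnegrE; lra.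
have cs : `|complex.Re '[u', u]| * (t ^+ 2) <= 3 * nsq w.
  have h6 := inner_le_half u' u.
  have := ler_wpM2r (sqr_ge0 t) h6; move: n3; rewrite expr_div_n.
  have -> : 2 ^+ 2 = 4 :> R by ring.
  have := nsq_ge0 w; set T := t ^+ 2 in n1 *; lra.
have nw := hK x Xx; rewrite -/w in nw.
set h := complex.Re _ in nw *.
have hge : nsq x <= h by exact: (shifted_ge sc Xx).
rewrite !schur_diag -/w -/u -/u'.
have -> : f x - l' * nsq x - complex.Re '[u', w] - (f x - l * nsq x - complex.Re '[u, w]) =
   (l' - l) * (complex.Re '[u', u] - nsq x) by rewrite mulrBr -h2; ring.
rewrite normrM ler_wpM2l//; apply: le_trans (ler_normB _ _) _.
rewrite mulrDl mul1r addrC (ger0_norm (nsq_ge0 x)) lerD//.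
rewrite mulrAC ler_pdivlMr ?exprn_gt0//; apply: le_trans cs _; lra.
Qed.

End SchurFamily.

Lemma linear_kernel (K : numFieldType) (V W : normedModType K) (P : V -> W) L M n k :
  (forall c x y, P (c *: x + y) = c *: P x + P y) ->
  has_dim L n -> has_dim M k -> (k < n)%N -> (forall x, L x -> M (P x)) ->
  exists2 x, L x & x != 0 /\ P x = 0.
Proof.
move=> Plin [v [iv ->]] [w [iw ->]] kn LM.
have P0 : P 0 = 0 by have := Plin (-1) 0 0; rewrite !scaler0 addr0 scaleN1r addNr.
have PD x y : P (x + y) = P x + P y by rewrite -{1}[x]scale1r Plin scale1r.
have Psum (c : 'I_n -> K) : P (\sum_i c i *: v i) = \sum_i c i *: P (v i).
  elim/big_ind2 : _ => [//|x x' y y' e1 e2|i _]; last first.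
    by rewrite -[c i *: v i]addr0 Plin P0 addr0.
  by rewrite PD e1 e2.
have /boolp.choice[A hA] (i : 'I_n) : exists c : 'I_k -> K, P (v i) = \sum_j c j *: w j.
  by have [c _ <-] := LM _ (mem_span v i); exists c.
have [c [i ci] hc] := nontrivial_relation A kn.
exists (\sum_i c i *: v i); first by exists c.
split; first by apply/eqP => /iv/(_ i)/eqP; apply/negP.
rewrite Psum; under eq_bigr do rewrite hA scaler_sumr.
rewrite exchange_big/= big1// => j _.
by under eq_bigr do rewrite scalerA; rewrite -scaler_suml hc scale0r.
Qed.

Lemma orthogonal_vector (R : realType) (H : hilbertType R) (L M : set H) n k :
  has_dim L n -> has_dim M k -> (k < n)%N ->
  exists2 x, L x & x != 0 /\ forall y, M y -> '[x, y] = 0.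
Proof.
move=> [v [iv ->]] [w [iw ->]] kn.
have [c [i ci] hc] := nontrivial_relation (fun i j => '[v i, w j]) kn.
exists (\sum_i c i *: v i); first by exists c.
split; first by apply/eqP => /iv/(_ i)/eqP; apply/negP.
move=> _ [d _ <-]; rewrite (form_sumr inner_hermitian)// big1// => j _.
rewrite innerZr (form_suml inner_hermitian)//.
under eq_bigr do rewrite innerZl.
by rewrite hc mulr0.
Qed.

Section ProjectionRange.
Context {R : realType} {H : hilbertType R} (E : pvm H).
Notation MR := (measurableTypeR R).
Implicit Types (A B : set MR) (x : H).

Lemma proj_rangeP B x : measurable B -> range (E B) x <-> E B x = x.
Proof.
by move=> mB; split=> [[y _ <-]|<-]; [exact: proj_idem|exists x].
Qed.

Lemma proj_range B x : range (E B) (E B x).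
Proof. by exists x. Qed.

Lemma proj_range_subsp B : measurable B -> subsp (range (E B)).
Proof.
move=> mB; split; first by apply/proj_rangeP => //; exact: proj_lin0.
move=> c x y /(proj_rangeP _ mB) ex /(proj_rangeP _ mB) ey; apply/proj_rangeP => //.
by rewrite proj_linear// ex ey.
Qed.

End ProjectionRange.

Definition negative (R : realType) (H : hilbertType R) (t : form H) (L : set H) : Prop :=
  L `<=` fdom t /\ forall x, L x -> x != 0 -> complex.Re (t x x) < 0.

(** The dimension is attained and maximal, so the relation includes finiteness of the index. *)
Definition form_index (R : realType) (H : hilbertType R) (t : form H) (k : nat) : Prop :=
  (exists2 L, has_dim L k & negative t L) /\
  forall L n, has_dim L n -> negative t L -> (n <= k)%N.

Lemma form_index_uniq (R : realType) (H : hilbertType R) (t : form H) k k' :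
  form_index t k -> form_index t k' -> k = k'.
Proof.
move=> [[L hL nL] h] [[L' hL' nL'] h']; apply/eqP; rewrite eqn_leq.
by rewrite (h' _ _ hL nL) (h _ _ hL' nL').
Qed.

(** * Negative index and spectral gaps *)

Section NegativeIndex.
Context {R : realType} {H : hilbertType R} (t : form H) (c : R).
Notation MR := (measurableTypeR R).
Hypothesis tc : closed_form t c.
Variable E : pvm H.
Hypothesis sm : is_spectral_measure E (form_operator t).
Local Notation S := (form_operator t).
Local Notation X := (fdom t).
Local Notation neg := (`]-oo, 0[%classic : set MR).
Local Notation nonpos := (`]-oo, 0]%classic : set MR).

Lemma measurable_neg : measurable neg. Proof. exact: measurable_itv. Qed.
Lemma measurable_nonpos : measurable nonpos. Proof. exact: measurable_itv. Qed.

Lemma ker_proj_neg (B : set MR) (b : R) x : measurable B -> (forall s, B s -> s <= b) -> b < 0 ->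
  S (x, 0) -> E B x = 0.
Proof.
move=> mB hB b0 Sx; have [w yw] := spectral_upper_dom tc sm x mB hB.
have Bw := spectral_reduce tc sm mB yw (proj_idem E x mB).
have := spectral_le sm mB yw (proj_idem E x mB) hB.
have := form_operator_sym tc yw Sx; rewrite /= inner0r -{1}Bw proj_sym// => ->.
rewrite /= => h; apply: nsq_eq0; apply/eqP; rewrite eq_le nsq_ge0 andbT.
by move: h; rewrite nmulr_rge0.
Qed.

Lemma ker_proj_pos (B : set MR) (b M : R) x : measurable B ->
  (forall s, B s -> b <= s <= M) -> 0 < b -> S (x, 0) -> E B x = 0.
Proof.
move=> mB hB b0 Sx.
have [w yw] : dom S (E B x) by apply: (spectral_upper_dom tc sm x mB (b := M)) => s /hB/andP[].
have Bw := spectral_reduce tc sm mB yw (proj_idem E x mB).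
have := spectral_ge sm mB yw (proj_idem E x mB) (b := b) (fun s hs => proj1 (andP (hB s hs))).
have := form_operator_sym tc yw Sx; rewrite /= inner0r -{1}Bw proj_sym// => ->.
rewrite /= => h; apply: nsq_eq0; apply/eqP; rewrite eq_le nsq_ge0 andbT.
by move: h; rewrite pmulr_rle0.
Qed.

(** Let y be the part of x in ]-oo, -1/(n+1)]. Then <S y, y> = <S y, x> = <y, S x> = 0, while it is
    at most -|y|^2 / (n+1). *)
Lemma ker_neg x : S (x, 0) -> E neg x = 0.
Proof.
move=> Sx; apply: (@proj_cup0 _ _ _ (fun n => `]-oo, - n.+1%:R^-1]%classic)).
- by move=> n; exact: measurable_itv.
- move=> n p np s; rewrite /= !in_itv /= => h; apply: le_trans h _.
  by rewrite lerN2 lef_pV2 ?posrE// ler_nat.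
- apply/seteqP; split=> [s [n _] /=|s /=]; rewrite !in_itv /=.
    by move=> h; apply: le_lt_trans h _; rewrite oppr_lt0 invr_gt0.
  rewrite -oppr_gt0 => /invS_lt[N hN]; exists N => //=; rewrite in_itv /= lerNr.
  by apply/ltW; exact: hN.
move=> n; apply: (@ker_proj_neg _ (- n.+1%:R^-1)) => //.
Qed.

Lemma ker_pos x : S (x, 0) -> E `]0, +oo[%classic x = 0.
Proof.
move=> Sx; apply: (@proj_cup0 _ _ _ (fun n => `[n.+1%:R^-1, n%:R]%classic)).
- by move=> n; exact: measurable_itv.
- move=> n p np s; rewrite /= !in_itv /= => /andP[h h']; apply/andP; split.
    by apply: le_trans h; rewrite lef_pV2 ?posrE// ler_nat.
  by apply: le_trans h' _; rewrite ler_nat.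
- apply/seteqP; split=> [s [n _] /=|s /=]; rewrite !in_itv /= andbT.
    by move=> /andP[h _]; apply: lt_le_trans h; rewrite invr_gt0.
  move=> s0; have [N hN] := invS_lt s0; have hb := archi_boundP (ltW s0).
  exists (maxn N (Num.bound s)) => //=; rewrite in_itv /=; apply/andP; split.
    by apply/ltW/hN; exact: leq_maxl.
  by apply: le_trans (ltW hb) _; rewrite ler_nat leq_maxr.
move=> n; apply: (@ker_proj_pos _ n.+1%:R^-1 n%:R) => //; exact: measurable_itv.
Qed.

(** The form vanishes on the range of the projection at 0, which also contains S x; Cauchy-Schwarz
    gives |S x|^2 = t(x, S x) = 0. *)
Lemma ker_zero x : E [set 0] x = x -> S (x, 0).
Proof.
move=> Ex; have m0 : measurable ([set 0] : set MR) by exact: measurable_set1.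
have h0 (s : MR) : [set 0] s -> s <= 0 by move=> ->.
have [w xw] := spectral_upper_dom tc sm x m0 h0; rewrite Ex in xw.
have Ew := spectral_reduce tc sm m0 xw Ex.
pose Y := range (E [set 0]).
have YX y : Y y -> X y.
  by move=> /(proj_rangeP _ _ m0) /(spectral_form_le tc sm m0 h0) [].
have hY : hermitian_on Y (fun u v => t u v).
  case: tc => -[_ l sy] _ _ _; split; first exact: proj_range_subsp.
    by move=> a u v z /YX ? /YX ? /YX ?; rewrite l.
  by move=> u v /YX ? /YX ?; rewrite sy.
have Y0 y : Y y -> complex.Re (t y y) = 0.
  move=> /(proj_rangeP _ _ m0) Ey; apply/eqP; rewrite eq_le; apply/andP; split.
    by have [_] := spectral_form_le tc sm m0 h0 Ey; rewrite mul0r.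
  have [v yv] := spectral_upper_dom tc sm y m0 h0; rewrite Ey in yv.
  rewrite (form_operatorE yv); rewrite -[leLHS](mul0r (nsq y)).
  by apply: (spectral_ge sm m0 yv Ey) => s ->.
have Yx : Y x by apply/proj_rangeP.
have Yw : Y w by apply/proj_rangeP.
have : t x w = 0.
  by apply: (form_CS0 hY) => //; [move=> y /Y0 ->|exact: Y0].
case: xw => /= Xx hx; rewrite hx; last exact: YX.
by move=> /inner_eq0 w0; split=> //= y Xy; rewrite hx// w0.
Qed.

(** Only strictness needs an argument: if t(x, x) = 0, Cauchy-Schwarz for -t gives t(x, S x) = 0, so
    S x = 0, and kernel vectors have no negative part. *)
Lemma neg_part_negative : negative t (range (E neg)).
Proof.
have mN := measurable_neg; have hN (s : MR) : neg s -> s <= 0.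
  by rewrite /= in_itv /= => /ltW.
have le0 y : range (E neg) y -> X y /\ complex.Re (t y y) <= 0.
  by move=> /(proj_rangeP _ _ mN) /(spectral_form_le tc sm mN hN); rewrite mul0r.
split=> [x /le0[]//|x Vx x0]; have [Xx tx] := le0 x Vx.
rewrite lt_neqAle tx andbT; apply: contraNN x0 => /eqP tx0; apply/eqP.
have [w xw] := spectral_upper_dom tc sm x mN hN.
have Ex := proj1 (proj_rangeP _ _ mN) Vx; rewrite Ex in xw.
have Vw : range (E neg) w by apply/proj_rangeP => //; exact: (spectral_reduce tc sm mN xw Ex).
have hY : hermitian_on (range (E neg)) (fun u v => - t u v).
  case: tc => -[_ l sy] _ _ _; split; first exact: proj_range_subsp.
    by move=> a u v z /le0[? _] /le0[? _] /le0[? _]; rewrite l//; ring.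
  by move=> u v /le0[? _] /le0[? _]; rewrite sy// rmorphN.
have w0 : w = 0.
  apply: inner_eq0; case: (xw) => /= _ <-; last by case: (le0 w Vw).
  apply: oppr_inj; rewrite oppr0; apply: (form_CS0 hY) => //.
    by move=> y /le0[_]; rewrite ReN oppr_ge0.
  by rewrite ReN tx0 oppr0.
by rewrite -Ex ker_neg// -w0.
Qed.

Lemma off_neg_ge0 x : X x -> E neg x = 0 -> 0 <= complex.Re (t x x).
Proof. by move=> Xx /(spectral_form_ge tc sm Xx); rewrite mul0r. Qed.

Lemma neg_part_max k L n : has_dim (range (E neg)) k -> has_dim L n -> negative t L -> (n <= k)%N.
Proof.
move=> hk hL [LX nL]; rewrite leqNgt; apply/negP => kn.
have [|x Lx [x0 Ex]] := linear_kernel (P := E neg) _ hL hk kn (fun x _ => proj_range E neg x).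
  by move=> a x y; rewrite proj_linear//; exact: measurable_neg.
by have := off_neg_ge0 (LX _ Lx) Ex; rewrite leNgt nL.
Qed.

(** The bridge between the spectral and the variational index, valid for every spectral measure of
    the operator. *)
Lemma neg_part_dim k : has_dim (range (E neg)) k <-> form_index t k.
Proof.
have dir m : has_dim (range (E neg)) m -> form_index t m.
  move=> hm; split; first by exists (range (E neg)) => //; exact: neg_part_negative.
  by move=> L n hL nL; exact: neg_part_max hm hL nL.
split=> [/dir//|ik].
have [m mk hm] : exists2 m, (m <= k)%N & has_dim (range (E neg)) m.
  apply: finite_dim_bound => [|n w iw wN]; first exact: (proj_range_subsp E measurable_neg).
  have [_ mx] := ik; apply: (mx _ _ (has_dim_span iw)).
  have sub : span w `<=` range (E neg).
    by apply: span_sub => //; exact: (proj_range_subsp E measurable_neg).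
  have [NX nN] := neg_part_negative.
  by split=> [x /sub/NX//|x /sub/nN].
by rewrite (form_index_uniq ik (dir _ hm)).
Qed.

(** The neighbourhood of 0 is punctured: 0 may still be an eigenvalue. *)
Definition spectral_gap (e : R) : Prop :=
  forall x, E (`]- e, 0[%classic : set MR) x = 0 /\ E (`]0, e[%classic : set MR) x = 0.

Lemma nonposE x : E nonpos x = E neg x + E [set 0] x.
Proof.
have m0 : measurable ([set 0] : set MR) by exact: measurable_set1.
rewrite -(projU E x measurable_neg m0); last first.
  by apply/seteqP; split=> // s [/=]; rewrite in_itv /= => s0 e; rewrite e ltxx in s0.
congr (E _ x); apply/seteqP; split=> s /=; rewrite !in_itv /=.
  by rewrite le_eqVlt => /orP[/eqP->|]; [right|left].
by move=> [/ltW//|->].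
Qed.

Lemma gap_neg e x : 0 < e -> spectral_gap e -> E neg x = E `]-oo, - e]%classic x.
Proof.
move=> e0 g; have [h _] := g x.
have -> : neg = `]-oo, - e]%classic `|` `]- e, 0[%classic.
  apply/seteqP; split=> s /=; rewrite !in_itv /=.
    by move=> s0; case: (leP s (- e)) => h1; [left|right].
  by move=> [|/andP[]//] h1; apply: le_lt_trans h1 _; rewrite oppr_lt0.
rewrite projU ?h ?addr0//; try exact: measurable_itv.
by apply/seteqP; split=> // s [/=]; rewrite !in_itv /= => h1 /andP[/lt_le_trans/(_ h1)]; rewrite ltxx.
Qed.

Lemma gap_nonpos e x : 0 < e -> spectral_gap e -> E nonpos x = E `]-oo, e[%classic x.
Proof.
move=> e0 g; have [_ h] := g x.
have -> : `]-oo, e[%classic = nonpos `|` `]0, e[%classic.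
  apply/seteqP; split=> s /=; rewrite !in_itv /=.
    by move=> se; case: (leP s 0) => h1; [left|right].
  by move=> [|/andP[]//] h1; apply: le_lt_trans h1 _.
rewrite projU ?h ?addr0//; try exact: measurable_itv.
by apply/seteqP; split=> // s [/=]; rewrite !in_itv /= => h1 /andP[/lt_le_trans/(_ h1)]; rewrite ltxx.
Qed.

Lemma gap_off e x : 0 < e -> spectral_gap e -> X x -> E nonpos x = 0 ->
  e * nsq x <= complex.Re (t x x).
Proof.
by move=> e0 g Xx h; apply: (spectral_form_ge tc sm Xx); rewrite -gap_nonpos.
Qed.

Lemma gap_neg_le e x : 0 < e -> spectral_gap e -> range (E neg) x ->
  X x /\ complex.Re (t x x) <= - e * nsq x.
Proof.
move=> e0 g /(proj_rangeP _ _ measurable_neg) Ex.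
have m : measurable (`]-oo, - e]%classic : set MR) by exact: measurable_itv.
apply: (spectral_form_le tc sm m); first by move=> s /=; rewrite in_itv.
by rewrite -gap_neg.
Qed.

Lemma nonpos_le x : range (E nonpos) x -> X x /\ complex.Re (t x x) <= 0.
Proof.
move=> /(proj_rangeP _ _ measurable_nonpos) Ex; rewrite -[X in _ <= X](mul0r (nsq x)).
apply: (spectral_form_le tc sm measurable_nonpos _ Ex) => s /=.
by rewrite in_itv.
Qed.

Lemma ker_subsp : subsp (ker S).
Proof.
split.
  split=> [|y Xy] /=; first exact: subsp0 (form_subsp tc).
  by case: tc => ht _ _ _; rewrite (form0l ht)// inner0l.
move=> a x y Sx Sy; have := form_operator_lin tc a Sx Sy.
by rewrite /ker /= (_ : a *: (x, 0) + (y, 0) = (a *: x + y, 0))// -[RHS]/(_, _); congr pair; rewrite /= scaler0 addr0.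
Qed.

Lemma ker_nonpos x : S (x, 0) -> E [set 0] x = x.
Proof.
move=> Sx; have h1 := ker_neg Sx; have h2 := ker_pos Sx.
have m0 : measurable (`]0, +oo[%classic : set MR) by exact: measurable_itv.
have := projC E x m0; rewrite setCitvr h2 subr0 nonposE h1 add0r //.
Qed.

Lemma nonpos_dim n m : has_dim (range (E neg)) n -> has_dim (ker S) m ->
  has_dim (range (E nonpos)) (n + m).
Proof.
move=> hn hm; have [|L hL [_ Ldec Lsum]] := has_dim_direct hn hm _ (leqnn m).
  by move=> x /(proj_rangeP _ _ measurable_neg) {2}<- Sx; exact: ker_neg.
suff -> : range (E nonpos) = L by [].
have m0 : measurable ([set 0] : set MR) by exact: measurable_set1.
have sN := proj_range_subsp E measurable_nonpos.
apply/seteqP; split=> x.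
  move=> /(proj_rangeP _ _ measurable_nonpos) <-; rewrite nonposE.
  by apply: Lsum => //; apply: ker_zero; exact: proj_idem.
move=> /Ldec[y [z [/(proj_rangeP _ _ measurable_neg) Ny Sz ->]]]; apply: subspD => //.
  apply/(proj_rangeP _ _ measurable_nonpos).
  by apply: (proj_sub measurable_neg measurable_nonpos _ Ny) => s /=; rewrite !in_itv /= => /ltW.
apply/(proj_rangeP _ _ measurable_nonpos).
by apply: (proj_sub m0 measurable_nonpos _ (ker_nonpos Sz)) => s /= ->; rewrite in_itv /= lexx.
Qed.

(** [E B u] and the image of [E B x] both lie in the range of [E B]. Symmetry of the operator gives
    them the same inner product with their difference, which belongs to that range too. *)
Lemma proj_commute (B : set MR) (M : R) x u : measurable B -> (forall s, B s -> `|s| <= M) ->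
  S (x, u) -> S (E B x, E B u).
Proof.
move=> mB hB xu; have dB z : dom S (E B z) by exact: (proj_bounded_dom sm z mB hB).
have [w xw] := dB x; have Ew := spectral_reduce tc sm mB xw (proj_idem E x mB).
suff -> : E B u = w by [].
apply/eqP; rewrite -subr_eq0; apply/eqP/inner_eq0.
set z := _ - _; have [z' zz'] := dB z.
have h1 := form_operator_sym tc xw zz'; have h2 := form_operator_sym tc xu zz'.
have Ez := spectral_reduce tc sm mB zz' (proj_idem E z mB).
have e1 : '[w, z] = '[E B u, z].
  rewrite -{1}Ew proj_sym// h1 /= proj_sym// Ez.
  by rewrite [RHS]proj_sym// h2.
by rewrite {1}/z innerBl e1 subrr.
Qed.

(** Cauchy-Schwarz for the nonnegative form t + e on this spectral subspace, applied to x and S x.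
    The sharp factor is 1, but any constant lets a series of such images converge. *)
Lemma range_bound (B : set MR) (e : R) x w : 0 <= e -> measurable B -> (forall s, B s -> `|s| <= e) ->
  S (x, w) -> E B x = x -> nsq w <= 6 * e ^+ 2 * nsq x.
Proof.
move=> e00 mB hB xw Ex; have Ew := spectral_reduce tc sm mB xw Ex.
have dB z : dom S (E B z) by exact: (proj_bounded_dom sm z mB hB).
have le1 (s : MR) : B s -> - e <= s by move=> /hB; rewrite ler_norml => /andP[].
have le2 (s : MR) : B s -> s <= e by move=> /hB; rewrite ler_norml => /andP[].
have bd y : range (E B) y -> X y /\ - e * nsq y <= complex.Re (t y y) <= e * nsq y.
  move=> /(proj_rangeP _ _ mB) Ey; have [v yv] := dB y; rewrite Ey in yv.
  split; first by case: yv.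
  rewrite (form_operatorE yv) (spectral_le sm mB yv Ey le2) andbT.
  exact: (spectral_ge sm mB yv Ey le1).
have hY : hermitian_on (range (E B)) (fun u v => t u v + e%:C * '[u, v]).
  case: tc => -[_ l sy] _ _ _; split; first exact: proj_range_subsp.
    by move=> a u v z /bd[? _] /bd[? _] /bd[? _]; rewrite l// innerDl innerZl; ring.
  move=> u v /bd[? _] /bd[? _]; rewrite sy// rmorphD rmorphM/= conj_real.
  by rewrite -innerC.
have hN : nonneg_on (range (E B)) (fun u v => t u v + e%:C * '[u, v]).
  by move=> y /bd[_ /andP[h _]]; rewrite ReD ReZ -/(nsq y); lra.
have Rx : range (E B) x by apply/proj_rangeP.
have Rw : range (E B) w by apply/proj_rangeP.
have [Xx /andP[lx ux]] := bd x Rx; have [Xw /andP[lw uw]] := bd w Rw.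
have := form_CS hY hN Rx Rw; rewrite !ReD !ReZ -!/(nsq _).
have -> : complex.Re (t x w) = nsq w by case: xw => /= _ ->.
have e0 : complex.Re (t x x) = complex.Re '[x, w].
  by rewrite (form_operatorE xw) Re_innerC.
rewrite e0 in lx ux *; set r := complex.Re '[x, w] in lx ux *.
set T := complex.Re _ in lw uw *; have x0 := nsq_ge0 x; have w0 := nsq_ge0 w.
set p := nsq x in x0 lx ux *; set q := nsq w in w0 lw uw *.
move=> cs; case: (leP q (e ^+ 2 * p)) => [h|h].
  have := mulr_ge0 (sqr_ge0 e) x0; lra.
have h1 : (r + e * p) * (T + e * q) <= (2 * e * p) * (2 * e * q).
  by apply: ler_pM; lra.
have h2 : (q - e ^+ 2 * p) ^+ 2 <= (q + e * r) ^+ 2.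
  have h2' := ler_wpM2l e00 lx.
  by rewrite ler_pXn2r// ?nnegrE; rewrite expr2 in h *; lra.
have q0 : 0 < q by apply: le_lt_trans h; rewrite mulr_ge0 ?sqr_ge0.
have h3 : (q - e ^+ 2 * p) ^+ 2 <= 4 * (e ^+ 2 * p) * q.
  by apply: le_trans h2 (le_trans cs (le_trans h1 _)); lra.
rewrite -mulrA; set k := e ^+ 2 * p in h h3 *.
have : q * (q - 6 * k) <= 0 by have := sqr_ge0 k; nra.
by rewrite pmulr_rle0// subr_le0.
Qed.

Definition annulus (a b : R) : set MR := `]- b, - a]%classic `|` `[a, b[%classic.

Lemma measurable_annulus a b : measurable (annulus a b).
Proof. by apply: measurableU; exact: measurable_itv. Qed.

Lemma annulus_norm a b s : 0 < a -> annulus a b s -> a <= `|s| < b.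
Proof.
move=> a0; rewrite /annulus /= !in_itv /= => -[] /andP[h1 h2].
  by rewrite ltr0_norm; [apply/andP; split; lra|lra].
by rewrite ger0_norm; [apply/andP; split|lra].
Qed.

(** Annuli of outer radius [e] and inner radius e / (n+1) exhaust the punctured interval, so if all
    their projections vanished there would be a gap. *)
Lemma no_gap_annulus e : 0 < e -> ~ spectral_gap e ->
  exists a x, [/\ 0 < a, a <= e, E (annulus a e) x = x & nsq x = 1].
Proof.
move=> e0 ng.
have [n [x hx]] : exists n x, E (annulus (e / n.+1%:R) e) x != 0.
  apply: contrapT => no; apply: ng => x.
  have {}no n : E (annulus (e / n.+1%:R) e) x = 0.
    by apply/eqP; apply: contrapT => h; apply: no; exists n, x; exact/negP.
  have sub n (B : set MR) : measurable B -> B `<=` annulus (e / n.+1%:R) e -> E B x = 0.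
    move=> mB BA; have mA := @measurable_annulus (e / n.+1%:R) e.
    by have := no n => /(congr1 (E B)); rewrite -projI// setIidl// proj_lin0.
  have nd n p : (n <= p)%N -> e / p.+1%:R <= e / n.+1%:R.
    by move=> np; rewrite ler_pM2l// lef_pV2 ?posrE// ler_nat.
  have small s : 0 < s -> exists n, e / n.+1%:R <= s.
    move=> s0; have [N hN] := invS_lt (divr_gt0 s0 e0); exists N.
    by rewrite mulrC -ler_pdivlMr//; exact/ltW/hN.
  split.
    apply: (@proj_cup0 _ _ _ (fun n => `]- e, - (e / n.+1%:R)]%classic)).
    - by move=> n; exact: measurable_itv.
    - move=> n p np s; rewrite /= !in_itv /= => /andP[-> h] /=.
      by apply: le_trans h _; rewrite lerN2 nd.
    - apply/seteqP; split=> [s [n _] /=|s /=]; rewrite !in_itv /=.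
        by move=> /andP[-> h] /=; apply: le_lt_trans h _; rewrite oppr_lt0 divr_gt0.
      move=> /andP[h1 h2]; have [|n hn] := small (- s); first by rewrite oppr_gt0.
      by exists n => //=; rewrite in_itv /= h1 lerNr.
    by move=> n; apply: (sub n) => [|s]; [exact: measurable_itv|left].
  apply: (@proj_cup0 _ _ _ (fun n => `[e / n.+1%:R, e[%classic)).
  - by move=> n; exact: measurable_itv.
  - move=> n p np s; rewrite /= !in_itv /= => /andP[h ->]; rewrite andbT.
    by apply: le_trans h; exact: nd.
  - apply/seteqP; split=> [s [n _] /=|s /=]; rewrite !in_itv /=.
      by move=> /andP[h ->]; rewrite andbT; apply: lt_le_trans h; rewrite divr_gt0.
    move=> /andP[h1 h2]; have [n hn] := small s h1.
    by exists n => //=; rewrite in_itv /= h2 hn.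
  by move=> n; apply: (sub n) => [|s]; [exact: measurable_itv|right].
have mA := @measurable_annulus (e / n.+1%:R) e.
set y := E _ x in hx; have y0 := nsq_gt0 hx.
exists (e / n.+1%:R), ((Num.sqrt (nsq y))^-1%:C *: y); split.
- by rewrite divr_gt0.
- by rewrite ler_pdivrMr// ler_peMr ?ler1n// ltW.
- by rewrite projZ// proj_idem.
- by rewrite nsqZ /= expr0n/= addr0 exprVn sqr_sqrtr ?ltW// mulVf// gt_eqF.
Qed.

(* Otherwise there are unit vectors [x n] in disjoint spectral annuli shrinking
   to 0; the sum of the [S (x n)] lies in the range, and its preimage has the
   [x n] as components. *)
Lemma closed_range_gap : closed (ran S) -> exists2 e, 0 < e & spectral_gap e.
Proof.
move=> cS; apply: contrapT => ng.
have /boolp.choice[f hf] (e : R) : exists p : R * H, 0 < e ->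
    [/\ 0 < p.1, p.1 <= e, E (annulus p.1 e) p.2 = p.2 & nsq p.2 = 1].
  have [e0|] := ltP 0 e; last by move=> h; exists (0, 0).
  have [|a [x [? ? ? ?]]] := no_gap_annulus e0; last by exists (a, x).
  by move=> g; apply: ng; exists e.
(* The next outer radius is half the previous inner radius: the annuli are disjoint and the radii
   decay geometrically. *)
pose ep := fix ep n : R := if n is m.+1 then (f (ep m)).1 / 2 else 1.
have ep0 n : 0 < ep n.
  by elim: n => [//|n IH] /=; rewrite divr_gt0//; case: (hf _ IH).
pose a n := (f (ep n)).1; pose x n := (f (ep n)).2.
have [a0 ae Ex x1] := And4 (fun n => let: And4 h _ _ _ := hf _ (ep0 n) in h : 0 < a n)
  (fun n => let: And4 _ h _ _ := hf _ (ep0 n) in h : a n <= ep n)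
  (fun n => let: And4 _ _ h _ := hf _ (ep0 n) in h : E (annulus (a n) (ep n)) (x n) = x n)
  (fun n => let: And4 _ _ _ h := hf _ (ep0 n) in h : nsq (x n) = 1).
pose B n := annulus (a n) (ep n).
have mB n : measurable (B n) by exact: measurable_annulus.
have epS n : ep n.+1 <= ep n / 2 by rewrite /= ler_pM2r// ae.
have epa n k : ep (n + k.+1)%N < a n.
  elim: k => [|k IH]; first by rewrite addn1 /= -/(a n); have := a0 n; lra.
  by rewrite addnS; apply: le_lt_trans (epS _) _; have := ep0 (n + k.+1)%N; lra.
have disj n m : (n < m)%N -> B n `&` B m = set0.
  move=> nm; apply/seteqP; split=> // s [/(annulus_norm (a0 n))/andP[h1 _]].
  move=> /(annulus_norm (a0 m))/andP[_ h2].
  have := epa n (m - n).-1; rewrite prednK ?subn_gt0// subnKC 1?ltnW// => h3.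
  by have := lt_trans (le_lt_trans h1 h2) h3; rewrite ltxx.
have disj' n m : n != m -> B n `&` B m = set0.
  by rewrite neq_ltn => /orP[/disj//|/disj]; rewrite setIC.
have hB n s : B n s -> `|s| <= ep n by move=> /(annulus_norm (a0 n))/andP[_ /ltW].
have /boolp.choice[y hy] n : exists y, S (x n, y).
  by have := proj_bounded_dom sm (x n) (mB n) (@hB n); rewrite Ex.
have Ey n : E (B n) (y n) = y n by exact: (spectral_reduce tc sm (mB n) (hy n) (Ex n)).
(* 24 is the constant that reproduces itself: 2 times 6 ep(n)^2 plus 2 times 24 ep(n+1)^2, with
   ep(n+1) <= ep(n) / 2. *)
have tail k n : nsq (\sum_(n <= i < n + k) y i) <= 24 * ep n ^+ 2.
  elim: k n => [|k IH] n; first by rewrite addn0 big_geq// nsq0 mulr_ge0 ?sqr_ge0.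
  rewrite big_ltn ?addnS ?ltnS ?leq_addr//; apply: le_trans (nsqD_le _ _) _.
  have := IH n.+1; rewrite addSn => h1.
  have := range_bound (ltW (ep0 n)) (mB n) (@hB n) (hy n) (Ex n); rewrite x1 => h2.
  have : ep n.+1 ^+ 2 <= ep n ^+ 2 / 4.
    have := epS n; have := ep0 n.+1; have := ep0 n; set p := ep n; set q := ep n.+1; nra.
  lra.
pose v n := \sum_(0 <= i < n) y i.
have vsub n k : v (n + k)%N - v n = \sum_(n <= i < n + k) y i.
  by rewrite /v (big_cat_nat (n := n) (p := (n + k)%N))//= ?leq_addr// [X in X - _]addrC addrK.
have ep2 n : ep n <= (2 ^+ n)^-1.
  elim: n => [|n IH]; first by rewrite expr0 invr1.
  by apply: le_trans (epS n) _; rewrite exprS invfM mulrC ler_pM2l// invr_gt0.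
have epc (e : R) : 0 < e -> exists N, forall n, (N <= n)%N -> 24 * ep n ^+ 2 < e.
  move=> e0; have [N hN] := invS_lt (divr_gt0 e0 (ltr0n R 24)); exists N => n Nn.
  rewrite mulrC -ltr_pdivlMr//; apply: le_lt_trans (hN n Nn).
  have h1 : ep n <= n.+1%:R^-1.
    apply: le_trans (ep2 n) _; rewrite lef_pV2 ?posrE ?exprn_gt0//.
    by rewrite -natrX ler_nat; exact: ltn_expl.
  have : n.+1%:R^-1 <= 1 :> R by rewrite invf_le1// ler1n.
  by move=> i1; apply: le_trans (h1); rewrite expr2 ger_pMr// (le_trans h1 i1).
have [|u _ hu] := @hilbert_complete _ H v (fun=> I).
  move=> e e0; have [N hN] := epc e e0; exists N.
  have key m n : (N <= m)%N -> (m <= n)%N -> nsq (v n - v m) < e.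
    move=> Nm mn; rewrite -(subnKC mn) vsub; exact: le_lt_trans (tail _ _) (hN m Nm).
  move=> m n Nm Nn; have [mn|nm] := leqP m n; last exact: (key n m Nn (ltnW nm)).
  by rewrite -/(nsq _) nsqC; exact: key.
have S0 : S (0, 0) by exact: subsp0 ker_subsp.
have ranv n : ran S (v n).
  exists (\sum_(0 <= i < n) x i); rewrite /v; elim/big_ind2: _ => // p p' q q' hp hq.
  by have := form_operator_lin tc 1 hp hq; rewrite scale1r.
have [z zu] : ran S u.
  move/closure_id: cS => ->; apply/closure_nsqP => e /hu[N hN]; exists (v N) => //.
  by rewrite nsqC; exact: hN.
have Ev n m : (n < m)%N -> E (B n) (v m) = y n.
  move=> nm; have -> : v m = \sum_(0 <= i < n) y i + (y n + \sum_(n.+1 <= i < m) y i).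
    by rewrite /v (big_cat_nat (n := n) (p := m))//= ?(ltnW nm)//; congr (_ + _); exact: big_ltn.
  have z0 (P : pred nat) (r : seq nat) : (forall i, P i -> i != n) ->
      E (B n) (\sum_(i <- r | P i) y i) = 0.
    move=> hP; elim/big_rec: _ => [|i w Pi IH]; first exact: proj_lin0.
    by rewrite projD// IH addr0 -Ey proj_disjoint//; apply: disj'; rewrite eq_sym hP.
  have z1 : E (B n) (\sum_(0 <= i < n) y i) = 0.
    by rewrite big_nat; apply: z0 => i /andP[_ h]; rewrite neq_ltn h.
  have z2 : E (B n) (\sum_(n.+1 <= i < m) y i) = 0.
    by rewrite big_nat; apply: z0 => i /andP[h _]; rewrite neq_ltn h orbT.
  by rewrite !projD// z1 z2 Ey add0r addr0.
have Eu n : E (B n) u = y n.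
  apply/eqP; rewrite -subr_eq0; apply/eqP/nsq_eq0/eqP; rewrite eq_le nsq_ge0 andbT.
  apply: (@le0_eps _ _ 1) => e /hu[N hN]; rewrite mulr1.
  have h := hN (maxn N n.+1) (leq_maxl _ _).
  rewrite -(@Ev n (maxn N n.+1)) ?leq_maxr// -projB//.
  by apply: le_trans (nsq_proj_le E _ (mB n)) _; rewrite nsqC; exact: ltW h.
(* Both vectors have the image [y n], so they differ by a kernel vector; its spectral part sits at
   0, outside the annulus. *)
have Ez n : E (B n) z = x n.
  have h1 := proj_commute (mB n) (@hB n) zu; rewrite Eu in h1.
  have k1 : S (E (B n) z - x n, 0).
    have := form_operator_lin tc (-1) (hy n) h1.
    by rewrite scaleN1r (_ : - (x n, y n) + _ = (- x n + E (B n) z, - y n + y n))// addNr addrC.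
  have h2 := ker_nonpos k1.
  have m0 : measurable ([set 0] : set MR) by exact: measurable_set1.
  apply/eqP; rewrite -subr_eq0; apply/eqP.
  have : E (B n) (E (B n) z - x n) = E (B n) z - x n by rewrite projB// proj_idem// Ex.
  move=> <-; rewrite -h2 proj_disjoint//.
  apply/seteqP; split=> // s [/(annulus_norm (a0 n))/andP[h _] s0].
  by move: h; rewrite s0 normr0 leNgt a0.
(* Bessel: removing [n] orthonormal components leaves |z|^2 - n, which cannot stay nonnegative. *)
pose r n := z - \sum_(0 <= i < n) x i.
have hr n : nsq (r n) = nsq z - n%:R /\ forall m, (n <= m)%N -> E (B m) (r n) = x m.
  elim: n => [|n [IH1 IH2]]; first by rewrite /r big_geq// !subr0; split=> // m _.
  have rS : r n.+1 = r n - x n by rewrite /r big_nat_recr//= opprD addrA.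
  split.
    rewrite rS -(IH2 n (leqnn n)) /nsq (Re_formB inner_hermitian)// inner_proj// IH2//.
    by rewrite -!/(nsq _) IH1 x1 -natr1; ring.
  move=> m nm; rewrite rS projB// IH2 1?ltnW// -(Ex n) (proj_disjoint E (x n) (mB m) (mB n)) ?subr0//.
  by apply: disj'; rewrite gt_eqF.
have := archi_boundP (nsq_ge0 z); have [h _] := hr (Num.bound (nsq z)).
have := nsq_ge0 (r (Num.bound (nsq z))); lra.
Qed.

Lemma gap_le e e' : e' <= e -> spectral_gap e -> spectral_gap e'.
Proof.
move=> ee g x; have [h1 h2] := g x; split.
  have := projI E (measurable_itv `]- e', 0[) (measurable_itv `]- e, 0[) x.
  rewrite h1 proj_lin0; last exact: measurable_itv.
  rewrite setIidl// => s; rewrite /= !in_itv /= => /andP[h ->]; rewrite andbT.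
  by apply: le_lt_trans h; rewrite lerN2.
have := projI E (measurable_itv `]0, e'[) (measurable_itv `]0, e[) x.
rewrite h2 proj_lin0; last exact: measurable_itv.
rewrite setIidl// => s; rewrite /= !in_itv /= => /andP[-> h] /=.
exact: lt_le_trans h ee.
Qed.

(* The weak equation [t x z = f z] is solved through the Riesz theorem for the
   positive form [t - 2 t(P., .) + <Q., .>], where [P] and [Q] are the spectral
   projections onto the negative part and onto the kernel. *)
Lemma gap_solvable e : 0 < e -> spectral_gap e -> exists2 C, 0 <= C &
  forall (f : H -> R[i]) (F : R), 0 <= F ->
    (forall a x y, X x -> X y -> f (a *: x + y) = a^* * f x + f y) ->
    (forall z, X z -> complex.Re (f z) ^+ 2 <= F * complex.Re (shifted_form t c z z)) ->
    (forall z, S (z, 0) -> f z = 0) ->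
  exists x, [/\ X x, forall z, X z -> t x z = f z & nsq x <= C * F].
Proof.
(* [e <= 1] serves the kernel component, where [h] is the squared norm and must dominate e |Q
   x|^2. *)
wlog e1 : e / e <= 1 => [hw e0 g|e0 g].
  apply: (hw (Num.min e 1)); first by rewrite ge_min lexx orbT.
    by rewrite lt_min e0 ltr01.
  by apply: gap_le g; rewrite ge_min lexx.
have [ht lb _ _] := tc; have sX := form_subsp tc.
have mN := measurable_neg; have m0 : measurable ([set 0] : set MR) by exact: measurable_set1.
have hN (s : MR) : neg s -> s <= 0 by rewrite /= in_itv /= => /ltW.
pose P x := E neg x; pose Q x := E [set 0] x.
have PX x : X (P x) by have [y []] := spectral_upper_dom tc sm x mN hN.
have QX x : S (Q x, 0) by apply: ker_zero; exact: proj_idem.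
have QX' x : X (Q x) by case: (QX x).
have NQ : neg `&` [set 0] = set0.
  by apply/seteqP; split=> // s [/=]; rewrite in_itv /= => s0 e'; rewrite e' ltxx in s0.
have tP x y : X y -> t (P x) y = t (P x) (P y).
  move=> Xy; have [w xw] := spectral_upper_dom tc sm x mN hN; rewrite -/(P x) in xw.
  have Pw := spectral_reduce tc sm mN xw (proj_idem E x mN).
  by case: xw => /= _ hw; rewrite !hw// -[in LHS]Pw proj_sym.
have tQ x y : X y -> t (Q x) y = 0.
  by move=> Xy; case: (QX x) => /= _ ->; rewrite ?inner0l.
have tQr x y : X y -> t y (Q x) = 0.
  by move=> Xy; rewrite (formC ht (x := Q x))// tQ// conjC0.
have Plin a x y : P (a *: x + y) = a *: P x + P y by rewrite /P proj_linear.
pose h x y := t x y - 2 * t (P x) y + '[Q x, y].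
have hh : hermitian_on X h.
  split => //.
    move=> a x y z Xx Xy Xz; rewrite /h Plin /Q proj_linear//.
    by rewrite !(formPl ht)// innerDl innerZl; ring.
  move=> x y Xx Xy; rewrite /h rmorphD rmorphB/= rmorphM/= -(formC ht)//.
  congr (_ - _ * _ + _).
  - by rewrite -[2]/(2%:R) conjC_nat.
  - by rewrite tP// [in RHS]tP// (formC ht).
  - by rewrite proj_sym// innerC.
have tPle x : complex.Re (t (P x) (P x)) <= - e * nsq (P x).
  by have [_] := gap_neg_le e0 g (proj_range E neg x).
have hE x : complex.Re (h x x) = complex.Re (t x x) - 2 * complex.Re (t (P x) x) + nsq (Q x).
  rewrite /h !ReD ReN (_ : (2 : R[i]) = 2%:C) ?ReZ; last by rewrite rmorph_nat.
  by rewrite Re_innerC inner_proj.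
(* x splits into P x, Q x and a remainder [z] without non-positive part. There [h] is -t, the
   squared norm and t, each at least [e] times the squared norm; the 4 comes from two uses of |u +
   v|^2 <= 2 |u|^2 + 2 |v|^2. *)
have hge x : X x -> e * nsq x <= 4 * complex.Re (h x x).
  move=> Xx; pose y := x - P x; pose z := y - Q x.
  have Xy : X y by exact: subspB.
  have Xz : X z by exact: subspB.
  have Pz : E nonpos z = 0.
    rewrite nonposE /z /y !projB// proj_idem// subrr sub0r.
    rewrite -/(P x) -/(Q x) /P /Q (proj_disjoint E x mN m0)// (proj_disjoint E x m0 mN); last by rewrite setIC.
    by rewrite subr0 proj_idem// oppr0 add0r subrr.
  have tz := gap_off e0 g Xz Pz.
  have tx : complex.Re (t x x) = complex.Re (t (P x) (P x)) + complex.Re (t z z).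
    have ex : x = P x + y by rewrite /y addrC subrK.
    have ty : complex.Re (t y y) = complex.Re (t z z).
      rewrite /z (Re_formB ht Xy (QX' x)) (tQ _ _ (QX' x)) (tQr _ _ Xy) /=; lra.
    rewrite {1 2}ex (Re_formD ht (PX x) Xy) (tP _ _ Xy) /y /P projB// proj_idem// subrr (form0r ht)//=.
    rewrite -/(P x) -/y ty; lra.
  rewrite hE tx (tP _ _ Xx).
  have ex : x = P x + (Q x + z) by rewrite /z [Q x + _]addrC subrK /y addrC subrK.
  have n1 := nsqD_le (P x) (Q x + z); have n2 := nsqD_le (Q x) z.
  rewrite -ex in n1; have := tPle x.
  have k1 : e * nsq (Q x) <= nsq (Q x) by rewrite ler_piMl ?nsq_ge0.
  have := ler_wpM2l (ltW e0) n1; have := ler_wpM2l (ltW e0) n2.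
  have := nsq_ge0 (P x); have := mulr_ge0 (ltW e0) (nsq_ge0 (P x)); lra.
have hn : nonneg_on X h.
  by move=> x Xx; have := hge x Xx; have := mulr_ge0 (ltW e0) (nsq_ge0 x); lra.
pose K := 1 + `|1 - c| * (4 / e).
have K0 : 0 <= K by rewrite addr_ge0// mulr_ge0// divr_ge0// ltW.
have gh x : X x -> complex.Re (shifted_form t c x x) <= K * complex.Re (h x x).
  move=> Xx; rewrite shifted_diag /K.
  have n1 : nsq x <= (4 / e) * complex.Re (h x x).
    by rewrite mulrAC ler_pdivlMr// mulrC; exact: hge.
  have n2 : (1 - c) * nsq x <= `|1 - c| * nsq x by rewrite ler_wpM2r ?nsq_ge0// ler_norm.
  have n3 := ler_wpM2l (normr_ge0 (1 - c)) n1.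
  have n4 : complex.Re (t x x) <= complex.Re (h x x).
    have p1 := tPle x; have p2 := mulr_ge0 (ltW e0) (nsq_ge0 (P x)).
    have -> : complex.Re (t x x) = complex.Re (h x x) + 2 * complex.Re (t (P x) x) - nsq (Q x).
      by rewrite hE; ring.
    rewrite tP//; have := nsq_ge0 (Q x); lra.
  lra.
have hc : complete_on X h.
  apply: (@complete_equiv _ _ _ (shifted_form t c) _ K (2 + `|1 - c| + 2 * `|c|)) => //.
  - move=> x Xx; rewrite hE tP//; have n1 := shifted_ge tc Xx.
    have n0 := nsq_ge0 x; set G := complex.Re (shifted_form _ _ _ _) in n1 *.
    have -> : complex.Re (t x x) = G - (1 - c) * nsq x by rewrite /G shifted_diag; ring.
    have b1 : - ((1 - c) * nsq x) <= `|1 - c| * G.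
      rewrite -mulNr; apply: le_trans (ler_wpM2r n0 (ler_norm _)) _.
      by rewrite normrN ler_wpM2l.
    have b2 : - complex.Re (t (P x) (P x)) <= `|c| * G.
      have l1 := lb _ (PX x); have l2 := nsq_proj_le E x mN; rewrite -/(P x) in l2.
      have : - c * nsq (P x) <= `|c| * nsq (P x).
        by rewrite -normrN ler_wpM2r ?nsq_ge0// ler_norm.
      have : `|c| * nsq (P x) <= `|c| * G by rewrite ler_wpM2l// (le_trans l2).
      lra.
    have b3 : nsq (Q x) <= G by apply: le_trans n1; exact: nsq_proj_le.
    lra.
  - exact: shifted_complete tc.
exists (10 * (4 / e) * K) => [|f F F0 flin fb fker].
  by rewrite !mulr_ge0// invr_ge0 ltW.
have [|x Xx hx] := riesz hh hn (f := f) (C := F * K) hc flin.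
  by move=> z Xz; apply: le_trans (fb z Xz) _; rewrite -mulrA ler_wpM2l// gh.
have Qx : Q x = 0.
  apply: inner_eq0; have := hx _ (QX' x); rewrite fker; last exact: QX.
  rewrite /h tQr// tP// /P /Q (proj_disjoint E x mN m0 NQ) (form0r ht)//.
  by rewrite mulr0 subr0 add0r.
have hxx : complex.Re (h x x) <= F * K.
  have : complex.Re (h x x) ^+ 2 <= F * K * complex.Re (h x x).
    rewrite {1}hx//; apply: le_trans (fb x Xx) _.
    by rewrite -mulrA ler_wpM2l// gh.
  have := hn x Xx; rewrite le_eqVlt => /orP[/eqP <- _|p]; first exact: mulr_ge0.
  by rewrite expr2 ler_pM2r.
(* [h] flips the sign of [t] on the negative part, and this vector undoes it. The constant 10 comes
   from |x - 2 P x|^2 <= 2 |x|^2 + 8 |P x|^2. *)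
exists (x - 2%:C *: P x); split.
- by apply: subspB => //; apply: subspZ.
- move=> z Xz; rewrite (formBl ht)// ?(formZl ht)//; last exact: subspZ.
  by rewrite -hx// /h Qx inner0l addr0 rmorph_nat.
have n1 := nsqD_le x (- (2%:C *: P x)); rewrite nsqN nsqZ /= in n1.
have n2 := nsq_proj_le E x mN; rewrite -/(P x) in n2.
have n3 : nsq x <= (4 / e) * complex.Re (h x x).
  by rewrite mulrAC ler_pdivlMr// mulrC; exact: hge.
have n4 : (4 / e) * complex.Re (h x x) <= (4 / e) * (F * K).
  by rewrite ler_wpM2l// divr_ge0// ltW.
have := n1; rewrite expr0n/= addr0 => {}n1.
have -> : 10 * (4 / e) * K * F = 10 * ((4 / e) * (F * K)) by ring.
lra.
Qed.

End NegativeIndex.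

Lemma hermitian_onN (R : realType) (V : lmodType R[i]) (X : set V) (h : V -> V -> R[i]) :
  hermitian_on X h -> hermitian_on X (fun x y => - h x y).
Proof.
move=> [sX l sy]; split => //.
  by move=> a x y z Xx Xy Xz; rewrite l//; ring.
by move=> x y Xx Xy; rewrite sy// rmorphN.
Qed.

Lemma has_dim0 (K : numFieldType) (V : normedModType K) : has_dim [set 0 : V] 0.
Proof.
exists (fun=> 0); split; first by move=> c _ [].
apply/seteqP; split=> x; first by move=> ->; exists (fun=> 0) => //; rewrite big_ord0.
by move=> [c _ <-]; rewrite big_ord0.
Qed.

Lemma index_exists (R : realType) (H : hilbertType R) (t : form H) N : fdom t 0 ->
  (forall L n, has_dim L n -> negative t L -> (n <= N)%N) -> exists k, form_index t k.
Proof.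
move=> X0 hN; pose P n : bool := `[< exists2 L, has_dim L n & negative t L >].
have exP : exists n, P n.
  exists 0; apply/asboolP; exists [set 0]; first exact: has_dim0.
  by split=> [x -> //|x ->]; rewrite eqxx.
have ubP n : P n -> (n <= N)%N by move=> /asboolP[L]; exact: hN.
exists (ex_maxn exP ubP); case: ex_maxnP => k /asboolP[L hL nL] mx; split; first by exists L.
by move=> L' n hL' nL'; apply: mx; apply/asboolP; exists L'.
Qed.

(** * Spectral gaps from finite-dimensional spectral subspaces *)

Section GapsFromFiniteDimension.
Context {R : realType} {H : hilbertType R} (t : form H) (c : R).
Notation MR := (measurableTypeR R).
Hypothesis tc : closed_form t c.
Variable E : pvm H.
Hypothesis sm : is_spectral_measure E (form_operator t).
Local Notation X := (fdom t).
Local Notation neg := (`]-oo, 0[%classic : set MR).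

(** On a finite-dimensional negative subspace |x|^2 <= -C t[x]. Vectors of the spectral part
    ]-1/(2C), 0[ satisfy -t[x] <= |x|^2 / (2C), so they are zero. *)
Lemma finite_neg_gap k : has_dim (range (E neg)) k ->
  exists2 e, 0 < e & forall x, E (`]- e, 0[%classic : set MR) x = 0.
Proof.
move=> hk; have [NX nN] := neg_part_negative tc sm.
have hneg : hermitian_on X (fun x y => - t x y) by case: tc => /hermitian_onN.
have hX : hermitian_on X (@inner R H).
  by split=> *; [exact: form_subsp tc|exact: (formPl inner_hermitian)|exact: innerC].
have [|C C0 hC] := finite_dim_form_bound hneg hX hk NX.
  by move=> x Nx x0; rewrite ReN oppr_gt0 nN.
exists (2 * C)^-1 => [|x]; first by rewrite invr_gt0 mulr_gt0.
set e := _^-1; have mB : measurable (`]- e, 0[%classic : set MR) by exact: measurable_itv.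
set y := E _ x; have Ey : E `]- e, 0[%classic y = y by exact: proj_idem.
have hB (s : MR) : `]- e, 0[%classic s -> - e <= s /\ s <= 0.
  by rewrite /= in_itv /= => /andP[/ltW ? /ltW].
have [w yw] := spectral_upper_dom tc sm y mB (fun s hs => proj2 (hB s hs)).
rewrite Ey in yw.
have := spectral_ge sm mB yw Ey (fun s hs => proj1 (hB s hs)).
rewrite -(form_operatorE yw) => ge.
have Ny : range (E neg) y.
  apply/(proj_rangeP _ _ measurable_neg); apply: (proj_sub mB measurable_neg _ Ey) => s.
  by rewrite /= !in_itv /= => /andP[].
have := hC y Ny; rewrite ReN -/(nsq y) => le.
apply: nsq_eq0; apply/eqP; rewrite eq_le nsq_ge0 andbT.
have : C * - complex.Re (t y y) <= C * (e * nsq y) by rewrite ler_pM2l// lerNl -mulNr.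
have -> : C * (e * nsq y) = nsq y / 2.
  by rewrite /e invfM mulrA mulrCA divff ?gt_eqF// mulr1 mulrC.
lra.
Qed.

(* The dimensions of the spectral subspaces of ]-oo, eta/(n+1)[ decrease, hence
   stabilise. *)
Lemma finite_pos_gap N (eta : R) : 0 < eta ->
  (forall k (w : 'I_k -> H), indep w ->
     (forall i, range (E (`]-oo, eta[%classic : set MR)) (w i)) -> (k <= N)%N) ->
  exists2 e, 0 < e & forall x, E (`]0, e[%classic : set MR) x = 0.
Proof.
move=> eta0 hN; pose r n := eta / n.+1%:R.
have r0 n : 0 < r n by rewrite divr_gt0.
have rd n p : (n <= p)%N -> r p <= r n.
  by move=> np; rewrite ler_pM2l// lef_pV2 ?posrE// ler_nat.
pose B n : set MR := `]-oo, r n[%classic.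
have mB n : measurable (B n) by exact: measurable_itv.
have Bd n p : (n <= p)%N -> B p `<=` B n.
  by move=> np s; rewrite /B /= !in_itv /= => /lt_le_trans; apply; exact: rd.
have rB n p x : (n <= p)%N -> range (E (B p)) x -> range (E (B n)) x.
  move=> np /(proj_rangeP _ _ (mB p)) Ex; apply/(proj_rangeP _ _ (mB n)).
  exact: (proj_sub (mB p) (mB n) (Bd _ _ np) Ex).
have /boolp.choice[d hd] n : exists d, has_dim (range (E (B n))) d.
  have [|m _ hm] := @finite_dim_bound _ _ (range (E (B n))) N (proj_range_subsp E (mB n)).
    move=> k w iw wB; apply: (hN _ _ iw) => i.
    have -> : `]-oo, eta[%classic = B 0%N by rewrite /B /r divr1.
    by apply: rB (wB i).
  by exists m.
pose P k : bool := `[< exists n, d n = k >].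
have exP : exists k, P k by exists (d 0%N); apply/asboolP; exists 0%N.
have [n0 hn0] : exists n0, forall n, (d n0 <= d n)%N.
  have [k /asboolP[n0 e0] mn] := ex_minnP exP.
  by exists n0 => n; rewrite e0; apply: mn; apply/asboolP; exists n.
have eqB n : (n0 <= n)%N -> range (E (B n)) = range (E (B n0)).
  move=> nn; have sub x := rB _ _ x nn.
  have e : d n = d n0 by apply/eqP; rewrite eqn_leq hn0 (has_dim_le (hd n) (hd n0) sub).
  by apply: (has_dim_eq (hd n)) => //; rewrite e.
exists (r n0) => // x; set A := `]0, r n0[%classic.
have mA : measurable (A : set MR) by exact: measurable_itv.
rewrite -(proj_idem E x mA); set y := E A x.
have Ay : E A y = y by exact: proj_idem.
have By n : (n0 <= n)%N -> E (B n) y = y.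
  move=> nn; apply/(proj_rangeP _ _ (mB n)); rewrite eqB//; apply/(proj_rangeP _ _ (mB n0)).
  by apply: (proj_sub mA (mB n0) _ Ay) => s; rewrite /A /B /= !in_itv /= => /andP[].
apply: (@proj_cup0 _ _ _ (fun n => `[r (n0 + n)%N, r n0[%classic)).
- by move=> n; exact: measurable_itv.
- move=> n p np s; rewrite /= !in_itv /= => /andP[h ->]; rewrite andbT.
  by apply: le_trans h; apply: rd; rewrite leq_add2l.
- apply/seteqP; split=> [s [n _]|s]; rewrite /A /= !in_itv /=.
    by move=> /andP[h ->]; rewrite andbT; exact: lt_le_trans h.
  move=> /andP[h1 h2]; have [M hM] := invS_lt (divr_gt0 h1 eta0).
  exists M => //=; rewrite in_itv /= h2 andbT /r.
  rewrite mulrC -ler_pdivlMr//; apply/ltW/hM; exact: leq_addl.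
move=> n; have mC : measurable (`[r (n0 + n)%N, r n0[%classic : set MR) by exact: measurable_itv.
rewrite -(By (n0 + n)%N (leq_addr _ _)) (proj_disjoint E y mC (mB _))//.
apply/seteqP; split=> // s; rewrite /B /= !in_itv /= => -[/andP[h _]].
by rewrite ltNge h.
Qed.

End GapsFromFiniteDimension.

(** * Monotone families of forms and min-max principles *)

Section FormFamily.
Context {R : realType} {H : hilbertType R}.
Variables (X : set H) (mu : R) (s : R -> H -> H -> R[i]) (cc : R -> R) (g : H -> H -> R[i]).
Notation MR := (measurableTypeR R).
Local Notation t l := (Form X (s l)).
Local Notation S l := (form_operator (t l)).
Local Notation q l x := (complex.Re (s l x x)).
Hypothesis scl : forall l, mu < l -> closed_form (t l) (cc l).
Hypothesis mono : forall l1 l2, mu < l1 -> l1 < l2 -> exists al be,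
  [/\ 1 <= al, 0 < be & forall x, X x -> q l2 x <= al * q l1 x - be * nsq x].
Hypothesis cont : forall l, mu < l -> exists C r, [/\ 0 <= C, 0 < r & forall l', mu < l' ->
  `|l' - l| < r -> forall x, X x ->
   `|q l' x - q l x| <= `|l' - l| * (C * complex.Re (shifted_form (t l) (cc l) x x))].
Hypothesis gh : hermitian_on X g.
Hypothesis decay : forall l x, mu < l -> X x -> q l x <= complex.Re (g x x) - l * nsq x.
Local Notation neg := (`]-oo, 0[%classic : set MR).
Local Notation nonpos := (`]-oo, 0]%classic : set MR).
Implicit Types (l : R) (x : H) (L : set H).

Lemma mono_lt l1 l2 x : mu < l1 -> l1 < l2 -> X x -> x != 0 -> q l1 x <= 0 -> q l2 x < 0.
Proof.
move=> m1 l12 Xx x0 h; have [al [be [al1 be0 hq]]] := mono m1 l12.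
have := hq x Xx; have := mulr_gt0 be0 (nsq_gt0 x0).
have : al * q l1 x <= 0 by rewrite mulr_ge0_le0//; lra.
lra.
Qed.

Lemma nonpos_negative l1 l2 L : mu < l1 -> l1 < l2 -> L `<=` X ->
  (forall x, L x -> q l1 x <= 0) -> negative (t l2) L.
Proof.
by move=> m1 l12 LX hL; split=> // x Lx x0; apply: (mono_lt m1 l12 (LX _ Lx) x0 (hL _ Lx)).
Qed.

Lemma negative_mono l1 l2 L : mu < l1 -> l1 < l2 -> negative (t l1) L -> negative (t l2) L.
Proof.
move=> m1 l12 [LX nL]; split=> // x Lx x0; apply: (mono_lt m1 l12 (LX _ Lx) x0).
by apply/ltW; exact: nL.
Qed.

(** The change of s is small relative to the form norm at [l], and on the finite-dimensional [L]
    that norm is bounded by a multiple of -s(l). *)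
Lemma negative_open l L n : mu < l -> has_dim L n -> negative (t l) L ->
  exists2 d, 0 < d & forall l', mu < l' -> `|l' - l| < d -> negative (t l') L.
Proof.
move=> ml hL [LX nL]; have tc := scl ml; have [C [r [C0 r0 hc]]] := cont ml.
have hneg : hermitian_on X (fun x y => - s l x y) by case: tc => /hermitian_onN.
have [|K K0 hK] := finite_dim_form_bound hneg (shifted_hermitian tc) hL LX.
  by move=> x Lx x0; rewrite ReN oppr_gt0; exact: nL.
have CK : 0 <= C * K by rewrite mulr_ge0// ltW.
exists (Num.min r (C * K + 1)^-1) => [|l' ml']; first by rewrite lt_min r0 invr_gt0; lra.
rewrite lt_min => /andP[h1 h2]; split=> // x Lx x0.
have := hc l' ml' h1 x (LX x Lx); have := nL x Lx x0; rewrite /=; have := hK x Lx; rewrite ReN.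
set G := complex.Re (shifted_form _ _ _ _); set Q := q l x => hG Q0.
have k1 : `|l' - l| * (C * G) <= `|l' - l| * (C * K) * - Q.
  by rewrite -!mulrA ler_wpM2l// ler_wpM2l.
have k2 : `|l' - l| * (C * K) < 1.
  apply: le_lt_trans (_ : `|l' - l| * (C * K + 1) < 1); first by rewrite ler_wpM2l//; lra.
  by rewrite -ltr_pdivlMr ?mul1r//; lra.
have k3 : `|l' - l| * (C * K) * - Q < - Q by rewrite gtr_pMl// oppr_gt0.
rewrite ler_norml => /andP[_ h]; lra.
Qed.

Definition fin l := exists k, form_index (t l) k.
(** 0 is a default for infinite index; statements about [nu] are made where finiteness is known. *)
Definition nu l : nat := xget 0%N [set k | form_index (t l) k].

Lemma nuP l : fin l -> form_index (t l) (nu l).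
Proof. by move=> [k hk]; exact: (xgetPex 0%N (ex_intro _ k hk)). Qed.

Lemma nuE l k : form_index (t l) k -> nu l = k.
Proof. by move=> hk; exact: form_index_uniq (nuP (ex_intro _ k hk)) hk. Qed.

Lemma X0 l : mu < l -> fdom (t l) 0.
Proof. by move=> /scl/form_subsp/subsp0. Qed.

Lemma fin_le l1 l2 : mu < l1 -> l1 < l2 -> fin l2 -> fin l1 /\ (nu l1 <= nu l2)%N.
Proof.
move=> m1 l12 f2; have [_ mx] := nuP f2.
have hN L n : has_dim L n -> negative (t l1) L -> (n <= nu l2)%N.
  by move=> hL /(negative_mono m1 l12); exact: mx.
have f1 : fin l1 by apply: (index_exists (X0 m1) hN).
by split=> //; have [[L hL nL] _] := nuP f1; exact: hN hL nL.
Qed.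

Lemma nu_le l1 l2 : mu < l1 -> l1 <= l2 -> fin l2 -> (nu l1 <= nu l2)%N.
Proof.
by move=> m1; rewrite le_eqVlt => /orP[/eqP->//|h] f2; case: (fin_le m1 h f2).
Qed.

Lemma nu_left l : mu < l -> fin l -> exists2 d, 0 < d &
  forall l', mu < l' -> l - d < l' -> l' <= l -> nu l' = nu l.
Proof.
move=> ml fl; have [[L hL nL] _] := nuP fl; have [d d0 hd] := negative_open ml hL nL.
exists d => // l' ml' dl'; rewrite le_eqVlt => /orP[/eqP -> //|ll].
have [fl' le1] := fin_le ml' ll fl; apply/eqP; rewrite eqn_leq le1/=.
have [_ mx] := nuP fl'; apply: (mx _ _ hL); apply: hd => //.
by rewrite ltr_norml; apply/andP; split; lra.
Qed.

Section IndexAtPoint.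
Variables (l : R) (E : pvm H).
Hypothesis ml : mu < l.
Hypothesis sm : is_spectral_measure E (S l).

(** Below 0 the negative part is finite-dimensional. Above 0, vectors of the spectral part ]-oo,
    eta[ satisfy s(l)[x] <= eta |x|^2 and are negative for s(l2) as soon as al eta < be, so that
    part is finite-dimensional too. *)
Lemma fin_gap l2 : l < l2 -> fin l2 -> exists2 e, 0 < e & spectral_gap E e.
Proof.
move=> ll f2; have tc := scl ml; have [fl _] := fin_le ml ll f2.
have hk := (neg_part_dim tc sm (nu l)).2 (nuP fl).
have [e1 e10 g1] := finite_neg_gap tc sm hk.
have [al [be [al1 be0 hq]]] := mono ml ll.
have al0 : 0 < al by lra.
pose eta := be / (2 * al); have eta0 : 0 < eta by rewrite divr_gt0// mulr_gt0.
have mB : measurable (`]-oo, eta[%classic : set MR) by exact: measurable_itv.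
have [|e2 e20 g2] := @finite_pos_gap _ _ E (nu l2) eta eta0.
  move=> k w iw wB; have [_ mx] := nuP f2; apply: (mx _ _ (has_dim_span iw)).
  have sub : span w `<=` range (E `]-oo, eta[%classic).
    by apply: span_sub => //; exact: proj_range_subsp.
  have hB x : span w x -> X x /\ q l x <= eta * nsq x.
    move=> /sub /(proj_rangeP _ _ mB) Ex.
    by apply: (spectral_form_le tc sm mB _ Ex) => r /=; rewrite in_itv /= => /ltW.
  split=> [x /hB[]//|x /hB[Xx h] x0]; apply: le_lt_trans (hq x Xx) _.
  have : al * q l x <= al * (eta * nsq x) by rewrite ler_pM2l.
  have -> : al * (eta * nsq x) = be * nsq x / 2.
    by rewrite /eta; field; rewrite gt_eqF.
  have := mulr_gt0 be0 (nsq_gt0 x0); lra.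
exists (Num.min e1 e2); first by rewrite lt_min e10.
have g3 : spectral_gap E (Num.min e1 e2) -> True by [].
move=> x; split.
  have := projI E (measurable_itv `]- (Num.min e1 e2), 0[) (measurable_itv `]- e1, 0[) x.
  rewrite g1 proj_lin0; last exact: measurable_itv.
  rewrite setIidl// => r; rewrite /= !in_itv /= => /andP[h ->]; rewrite andbT.
  by apply: le_lt_trans h; rewrite lerN2 ge_min lexx.
have := projI E (measurable_itv `]0, (Num.min e1 e2)[) (measurable_itv `]0, e2[) x.
rewrite g2 proj_lin0; last exact: measurable_itv.
rewrite setIidl// => r; rewrite /= !in_itv /= => /andP[-> h] /=.
by apply: lt_le_trans h _; rewrite ge_min lexx orbT.
Qed.

(** A subspace of dimension above [N] contains a vector without non-positive part. There s(l)[x] >=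
    e |x|^2 controls the form norm at [l], so s(l')[x] stays nonnegative for l' close to [l]. *)
Lemma gap_index_le e N : 0 < e -> spectral_gap E e -> has_dim (range (E nonpos)) N ->
  exists2 d, 0 < d & forall l', l < l' -> l' < l + d ->
    forall L n, has_dim L n -> negative (t l') L -> (n <= N)%N.
Proof.
move=> e0 ge hN; have tc := scl ml; have [C [r [C0 r0 hc]]] := cont ml.
pose K := 1 + `|1 - cc l| / e.
have K0 : 0 <= K by rewrite addr_ge0// divr_ge0// ltW.
have CK : 0 <= C * K by rewrite mulr_ge0.
exists (Num.min r (C * K + 1)^-1) => [|l' ll]; first by rewrite lt_min r0 invr_gt0; lra.
rewrite -ltrBlDl lt_min => /andP[h1 h2] L n hL [LX nL].
have ml' : mu < l' := lt_trans ml ll.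
rewrite leqNgt; apply/negP => Nn.
have [|x Lx [x0 Ex]] := linear_kernel (P := E nonpos) _ hL hN Nn (fun x _ => proj_range E nonpos x).
  by move=> a x y; rewrite proj_linear//; exact: measurable_nonpos.
have Xx := LX x Lx.
have h3 : e * nsq x <= q l x := gap_off tc sm e0 ge Xx Ex.
have d0 : `|l' - l| = l' - l by rewrite ger0_norm//; lra.
have := hc l' ml' _ x Xx; rewrite d0 => /(_ h1).
have := nL x Lx x0; rewrite shifted_diag /=; set Q := q l x in h3 *.
have hG : Q + (1 - cc l) * nsq x <= K * Q.
  have : (1 - cc l) * nsq x <= `|1 - cc l| * nsq x by rewrite ler_wpM2r ?nsq_ge0// ler_norm.
  have : `|1 - cc l| * nsq x <= `|1 - cc l| * (Q / e).
    by rewrite ler_wpM2l// ler_pdivlMr// mulrC.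
  rewrite /K; set i := e^-1; lra.
have Q0 : 0 <= Q by apply: le_trans h3; rewrite mulr_ge0 ?nsq_ge0// ltW.
set G := Q + _ in hG *.
have k1 : (l' - l) * (C * G) <= (l' - l) * (C * K) * Q.
  by rewrite -!mulrA ler_wpM2l; [|lra|rewrite ler_wpM2l].
have k2 : (l' - l) * (C * K) <= 1.
  apply: le_trans (_ : (l' - l) * (C * K + 1) <= 1); first by rewrite ler_wpM2l//; lra.
  by apply/ltW; rewrite -ltr_pdivlMr ?mul1r//; lra.
have k3 : (l' - l) * (C * K) * Q <= Q by rewrite ler_piMl.
rewrite ler_norml => q0 /andP[h _]; lra.
Qed.

Lemma fin_ker l2 : l < l2 -> fin l2 -> exists m, has_dim (ker (S l)) m.
Proof.
move=> ll f2; have tc := scl ml; have [_ mx] := nuP f2.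
have [|m _ hm] := finite_dim_bound (n := nu l2) (ker_subsp tc); last by exists m.
move=> k w iw wS; apply: (mx _ _ (has_dim_span iw)).
have sub : span w `<=` ker (S l) by apply: span_sub => //; exact: ker_subsp tc.
apply: (nonpos_negative ml ll) => x /sub; first by case.
by move=> Sx; rewrite (form_operatorE (t := t l) Sx) inner0l.
Qed.

End IndexAtPoint.

(** The non-positive spectral subspace at [l] becomes negative immediately to the right, which gives
    the lower bound; the gap at [l] gives the upper one. *)
Lemma nu_jump l l2 m : mu < l -> l < l2 -> fin l2 -> has_dim (ker (S l)) m ->
  exists2 d, 0 < d & forall l', l < l' -> l' < l + d -> fin l' /\ nu l' = (nu l + m)%N.
Proof.
move=> ml ll f2 hm; have tc := scl ml; have [E sm] := closed_form_spectral tc.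
have [fl _] := fin_le ml ll f2.
have hk := (neg_part_dim tc sm (nu l)).2 (nuP fl).
have hN := nonpos_dim tc sm hk hm.
have [e e0 ge] := fin_gap ml sm ll f2.
have [d d0 hd] := gap_index_le ml sm e0 ge hN.
exists d => // l' ll' dl'; suff h : form_index (t l') (nu l + m) by split; [exists (nu l + m)%N|exact: nuE].
split=> [|L n]; last exact: hd.
exists (range (E nonpos)) => //.
apply: (nonpos_negative ml ll') => x; first by move=> /(nonpos_le tc sm)[].
by move=> /(nonpos_le tc sm)[].
Qed.

Lemma nu_ker_le l l2 m : mu < l -> l < l2 -> fin l2 -> has_dim (ker (S l)) m ->
  (nu l + m <= nu l2)%N.
Proof.
move=> ml ll f2 hm; have [d d0 hd] := nu_jump ml ll f2 hm.
pose l' := l + Num.min d (l2 - l) / 2.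
have e0 : 0 < Num.min d (l2 - l) by rewrite lt_min d0 subr_gt0.
have e1 : Num.min d (l2 - l) <= d by rewrite ge_min lexx.
have e2 : Num.min d (l2 - l) <= l2 - l by rewrite ge_min lexx orbT.
have h1 : l < l' by rewrite /l'; lra.
have h2 : l' < l + d by rewrite /l'; lra.
have [fl' <-] := hd l' h1 h2.
by apply: nu_le => //; [exact: lt_trans ml h1|rewrite /l'; lra].
Qed.

(* By the gap at [l] the negative spectral subspace is already negative for
   [s l'] with [l'] slightly below [l], so its dimension is finite. *)
Lemma closed_range_fin l m : mu < l -> (forall l', mu < l' -> l' < l -> fin l') ->
  closed (ran (S l)) -> has_dim (ker (S l)) m -> exists2 l', l < l' & fin l'.
Proof.
move=> ml hfin cS hm; have tc := scl ml; have [E sm] := closed_form_spectral tc.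
have [e e0 ge] := closed_range_gap tc sm cS.
have [C [r [C0 r0 hc]]] := cont ml.
pose K := `|1 - cc l| / e.
have K0 : 0 <= K by rewrite divr_ge0// ltW.
have CK : 0 <= C * K by rewrite mulr_ge0.
pose d := Num.min (Num.min r (C * K + 1)^-1) (l - mu).
have d0 : 0 < d by rewrite !lt_min r0 subr_gt0 ml andbT invr_gt0; lra.
have d1 : d <= r by rewrite !ge_min lexx.
have d2 : d <= (C * K + 1)^-1 by rewrite !ge_min lexx orbT.
have d3 : d <= l - mu by rewrite !ge_min lexx !orbT.
pose l' := l - d / 2; have ml' : mu < l' by rewrite /l'; lra.
have fl' : fin l' by apply: hfin => //; rewrite /l'; lra.
have nN x : range (E neg) x -> x != 0 -> q l' x < 0.
  move=> Nx x0; have [Xx h3] := gap_neg_le tc sm e0 ge Nx; rewrite /= in Xx h3.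
  have ll : `|l' - l| = d / 2 by rewrite /l' addrAC subrr add0r normrN ger0_norm//; lra.
  have := hc l' ml' _ x Xx; rewrite ll => /(_ ltac:(lra)); rewrite shifted_diag /=.
  set Q := q l x in h3 *; have n0 := nsq_gt0 x0.
  have Q0 : Q < 0 by have := mulr_gt0 e0 n0; lra.
  have hG : Q + (1 - cc l) * nsq x <= K * - Q.
    have : (1 - cc l) * nsq x <= `|1 - cc l| * nsq x by rewrite ler_wpM2r ?nsq_ge0// ler_norm.
    have : `|1 - cc l| * nsq x <= `|1 - cc l| * (- Q / e).
      by rewrite ler_wpM2l// ler_pdivlMr//; lra.
    rewrite /K; set i := e^-1; lra.
  set G := Q + _ in hG *; have D0 : 0 <= d / 2 by lra.
  have k1 : d / 2 * (C * G) <= d / 2 * (C * K) * - Q.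
    by rewrite -(mulrA (d / 2)) ler_wpM2l// -mulrA ler_wpM2l.
  have k2 : d / 2 * (C * K) < 1.
    apply: le_lt_trans (_ : d / 2 * (C * K + 1) < 1); first by rewrite ler_wpM2l//; lra.
    by rewrite -ltr_pdivlMr ?mul1r//; lra.
  have k3 : d / 2 * (C * K) * - Q < - Q by rewrite gtr_pMl// oppr_gt0.
  rewrite ler_norml => /andP[_ h]; lra.
have [_ mx] := nuP fl'; have mN := @measurable_neg R.
have [|k _ hk] := finite_dim_bound (n := nu l') (proj_range_subsp E mN).
  move=> k w iw wN; apply: (mx _ _ (has_dim_span iw)).
  have sub : span w `<=` range (E neg) by apply: span_sub => //; exact: proj_range_subsp.
  split=> x /sub; last exact: nN.
  by case: (neg_part_negative tc sm) => h _; exact: h.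
have hN := nonpos_dim tc sm hk hm.
have [d' d'0 hd] := gap_index_le ml sm e0 ge hN.
exists (l + d' / 2); first lra.
apply: (index_exists (N := (k + m)%N) (X0 _)); first lra.
by apply: hd; lra.
Qed.

(** Finiteness to the right is required because [nu] is left continuous and may be finite at the
    very point beyond which it is infinite. For the Schur family these turn out to be the points
    between [mu] and lambda_e. *)
Definition good l := mu < l /\ exists2 l2, l < l2 & fin l2.

Lemma good_fin l : good l -> fin l.
Proof. by move=> [ml [l2 ll f2]]; case: (fin_le ml ll f2). Qed.

Lemma good_le l l' : mu < l -> l <= l' -> good l' -> good l.
Proof. by move=> ml ll [_ [l2 ll2 f2]]; split=> //; exists l2 => //; exact: le_lt_trans ll ll2. Qed.

Lemma good_ker l : good l -> exists m, has_dim (ker (S l)) m.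
Proof. by move=> [ml [l2 ll f2]]; exact: (fin_ker ml ll f2). Qed.

(** [z] is the infimum of the points of [g0, l] where [nu] already has its value at [l]. Left
    continuity excludes this value at [z] itself, so the jump at [z] accounts for the whole
    difference. *)
Lemma last_jump g0 l : mu < g0 -> g0 <= l -> good l -> (nu g0 < nu l)%N ->
  exists z m, [/\ g0 <= z, z < l, (nu z < nu l)%N, has_dim (ker (S z)) m &
    nu l = (nu z + m)%N] /\
    forall (y : R) k, z < y -> y < l -> has_dim (ker (S y)) k -> k = 0%N.
Proof.
move=> mg gl gdl ng; have fl := good_fin gdl.
pose A : set R := [set x | g0 <= x /\ x <= l /\ nu x = nu l].
have A0 : A !=set0 by exists l.
have lbA : lbound A g0 by move=> x [].
pose z := inf A.
have gz : g0 <= z by exact: lb_le_inf.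
have zA (x : R) : A x -> z <= x by apply: ge_inf; exists g0.
have zl : z <= l by apply: zA.
have mz : mu < z by exact: lt_le_trans mg gz.
have above (x : R) : z < x -> x <= l -> nu x = nu l.
  move=> zx xl; have [y [gy [yl ny]] yx] := inf_lt A0 zx.
  have fx : fin x by exact: good_fin (good_le (lt_trans mz zx) xl gdl).
  apply/eqP; rewrite eqn_leq (nu_le (lt_trans mz zx) xl fl)/= -ny.
  by apply: nu_le => //; [exact: lt_le_trans mg gy|exact: ltW].
have gdz : good z := good_le mz zl gdl.
have nz : (nu z < nu l)%N.
  rewrite ltn_neqAle (nu_le mz zl fl) andbT; apply/eqP => nzl.
  have gz' : g0 < z.
    by rewrite lt_neqAle gz andbT; apply/eqP => e; rewrite e nzl ltnn in ng.
  have [d d0 hd] := nu_left mz (good_fin gdz).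
  pose z' := Num.max g0 (z - d / 2).
  have z'z : z' < z by rewrite gt_max gz'/=; lra.
  have z'g : g0 <= z' by rewrite le_max lexx.
  have : A z'.
    split=> //; split; first by apply/ltW; exact: lt_le_trans z'z zl.
    rewrite -nzl; apply: hd; last exact: ltW.
      exact: lt_le_trans mg z'g.
    by rewrite lt_max; apply/orP; right; lra.
  by move=> /zA; rewrite leNgt z'z.
have zl' : z < l by rewrite lt_neqAle zl andbT; apply/eqP => e; rewrite e ltnn in nz.
have [m hm] := good_ker gdz; exists z, m; split.
  split=> //; have [d d0 hd] := nu_jump mz zl' fl hm.
  have e0 : 0 < Num.min d (l - z) by rewrite lt_min d0 subr_gt0.
  have e1 : Num.min d (l - z) <= d by rewrite ge_min lexx.
  have e2 : Num.min d (l - z) <= l - z by rewrite ge_min lexx orbT.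
  have [||_ <-] := hd (z + Num.min d (l - z) / 2); [lra|lra|].
  by rewrite above//; lra.
move=> x k zx xl hk; have := nu_ker_le (lt_trans mz zx) xl fl hk.
by rewrite above ?(ltW xl)// -{2}(addn0 (nu l)) leq_add2l leqn0 => /eqP.
Qed.

(** [m] indices above [p], closed downwards, can only be p+1, ..., p+m. This turns the
    multiplicities in the list of eigenvalues into positions. *)
Lemma segment_card (J : set nat) p m : (forall j, J j -> (p < j)%N) ->
  (forall i j, (p < i)%N -> (i <= j)%N -> J j -> J i) -> (J #= `I_m)%card ->
  forall j, J j <-> (p < j)%N /\ (j <= p + m)%N.
Proof.
move=> Jp Jd Jm.
have img k : ([set (p + i.+1)%N | i in `I_k] #= `I_k)%card.
  by apply: inj_card_eq => i i' _ _ /addnI [].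
have le1 k : (forall i, (i < k)%N -> J (p + i.+1)%N) -> (k <= m)%N.
  move=> h; rewrite -card_le_II.
  have : ([set (p + i.+1)%N | i in `I_k] #<= J)%card.
    by apply: subset_card_le => _ [i /= ik <-]; exact: h.
  move: (img k) Jm; rewrite !card_eq_le => /andP[_ a1] /andP[a2 _] a3.
  exact: card_le_trans a1 (card_le_trans a3 a2).
have le2 k : (forall j, J j -> (j <= p + k)%N) -> (m <= k)%N.
  move=> h; rewrite -card_le_II.
  have : (J #<= [set (p + i.+1)%N | i in `I_k])%card.
    apply: subset_card_le => j Jj; have pj := Jp j Jj; have hj := h j Jj.
    exists (j - p.+1)%N; rewrite /=; first by rewrite ltn_subLR// ltnS addnC -ltnS.
    by rewrite addnS -addSn subnKC.
  move: (img k) Jm; rewrite !card_eq_le => /andP[a1 _] /andP[_ a2] a3.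
  exact: card_le_trans a2 (card_le_trans a3 a1).
move=> j; split=> [Jj|[pj jm]].
  split; first exact: Jp.
  rewrite leqNgt; apply/negP => h; have := le1 m.+1; rewrite ltnn => h'; apply: notF; apply: h' => i im.
  apply: (Jd _ j) => //; first by rewrite addnS ltnS leq_addr.
  by apply: leq_trans h; rewrite addnS ltnS leq_add2l -ltnS.
apply: contrapT => nJ; have : (m <= j.-1 - p)%N.
  apply: le2 => i Ji; rewrite subnKC; last by case: j pj {jm nJ}.
  rewrite leqNgt; apply/negP => ji; apply: nJ; apply: (Jd j i) => //.
  by case: j pj ji {jm}.
by case: j pj jm {nJ} => // j /=; rewrite ltnS => pj jm; rewrite leqNgt ltn_subLR ?jm.
Qed.

(** * Counting listed eigenvalues by jumps of the index *)

Section Counting.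
Variables (g0 : R) (N : option nat) (lam : nat -> R).
Hypothesis mg : mu < g0.
Hypothesis lamI : forall j, index_le N j -> g0 <= lam j /\ good (lam j).
Hypothesis lamM : forall i j, index_le N i -> index_le N j -> (i <= j)%N -> lam i <= lam j.
Hypothesis lamC : forall x : R, g0 <= x -> good x -> exists2 m, has_dim (ker (S x)) m
        & ([set j | index_le N j /\ lam j = x] #= `I_m)%card.

Lemma index_le_trans i j : (0 < i)%N -> (i <= j)%N -> index_le N j -> index_le N i.
Proof.
rewrite /index_le => -> /= ij /andP[_]; case: N => // m; exact: leq_trans.
Qed.

Lemma lam_ker j k : index_le N j -> has_dim (ker (S (lam j))) k -> (0 < k)%N.
Proof.
move=> ij hk; have [gj gdj] := lamI ij; have [m hm hJ] := lamC gj gdj.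
rewrite (has_dim_uniq hk hm) lt0n; apply/eqP => m0; move: hJ; rewrite m0 II0 card_eq0 => /eqP/seteqP[h _].
by have := h j; apply.
Qed.

(** Induction on [nu l]. At the last jump [z] before [l] the index is smaller, so the positions with
    lam < z are known; those with lam = z form the next block, of length dim ker S(z), and no listed
    value lies strictly between z and l. *)
Lemma counting l j : g0 <= l -> good l -> (0 < j)%N ->
  index_le N j /\ lam j < l <-> (nu g0 + j <= nu l)%N.
Proof.
have [n] := ubnP (nu l); elim: n l j => // n IH l j; rewrite ltnS => nl gl gdl j0.
have fl := good_fin gdl; have ml : mu < l by exact: lt_le_trans mg gl.
have [ng|ng] := leqP (nu l) (nu g0).
  split=> [[ij jl]|]; last by rewrite leqNgt; case/negP; rewrite (leq_ltn_trans ng)// -[X in (X < _)%N]addn0 ltn_add2l.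
  have [gj gdj] := lamI ij; have [m hm] := good_ker gdj.
  have m0 := lam_ker ij hm; have := nu_ker_le (lt_le_trans mg gj) jl fl hm.
  rewrite leqNgt (leq_ltn_trans ng)// -[X in (X < _)%N]addn0 -addnS leq_add//.
  by apply: nu_le => //; exact: good_fin.
have [z [m [[gz zl nz hm nlE] after]]] := last_jump mg gl gdl ng.
have gdz : good z := good_le (lt_le_trans mg gz) (ltW zl) gdl.
have IHz i : (0 < i)%N -> index_le N i /\ lam i < z <-> (nu g0 + i <= nu z)%N.
  by move=> i0; apply: IH => //; exact: leq_trans nz nl.
have gnz : (nu g0 <= nu z)%N by apply: nu_le => //; exact: good_fin.
have [m' hm' hJ] := lamC gz gdz; rewrite -(has_dim_uniq hm hm') {m' hm'} in hJ.
pose p := (nu z - nu g0)%N.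
have pE i : (nu g0 + i <= nu z)%N = (i <= p)%N by rewrite /p leq_subRL// addnC.
have seg : forall j, index_le N j /\ lam j = z <-> (p < j)%N /\ (j <= p + m)%N.
  apply: (segment_card (J := [set j | index_le N j /\ lam j = z]) _ _ hJ) => [i [ii iz]|i i' pi ii [ii' iz]].
    rewrite ltnNge -pE; apply/negP => h.
    have i0 : (0 < i)%N by case/andP: ii.
    by have [_] := (IHz i i0).2 h; rewrite iz ltxx.
  have i0 : (0 < i)%N by exact: leq_ltn_trans pi.
  have iN := index_le_trans i0 ii ii'; split=> //.
  apply/eqP; rewrite eq_le -{1}iz lamM//= leNgt; apply/negP => h.
  by have := (IHz i i0).1 (conj iN h); rewrite pE leqNgt pi.
have jE : (nu g0 + j <= nu l)%N = (j <= p + m)%N.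
  by rewrite nlE -leq_subRL ?(leq_trans gnz)// ?leq_addr// addnBAC.
rewrite jE; split=> [[ij jl]|jpm].
  have [jz|zj|jz] := ltgtP (lam j) z.
  - by have := (IHz j j0).1 (conj ij jz); rewrite pE => /leq_trans; apply; exact: leq_addr.
  - have [gj gdj] := lamI ij; have [k hk] := good_ker gdj.
    by have := lam_ker ij hk; rewrite (after _ _ zj jl hk).
  - by case: ((seg j).1 (conj ij jz)).
have [jp|pj] := leqP j p.
  by rewrite -pE in jp; have [ij jz] := (IHz j j0).2 jp; split=> //; exact: lt_trans jz zl.
by have [ij jz] := (seg j).2 (conj pj jpm); split=> //; rewrite jz.
Qed.

End Counting.

(** * The Rayleigh functional and its min-max values *)

Section Rayleigh.
(** For the Schur family this unfolds to [rayleigh]. *)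
Definition rayl x : \bar R := xget -oo%E [set l%:E | l in [set l : R | mu < l /\ s l x x = 0]].
Local Notation p := rayl.

Lemma s_real l x : mu < l -> X x -> s l x x = (q l x)%:C.
Proof. by move=> ml Xx; case: (scl ml) => ht _ _ _; exact: (form_diag_real ht). Qed.

Lemma rayl_cases x : p x = -oo%E \/ exists l, [/\ mu < l, q l x = 0 & p x = l%:E].
Proof.
rewrite /p; case: xgetP => [v -> [l [ml sl] <-]|]; last by left.
by right; exists l; rewrite sl.
Qed.

(** If s(l)[x] >= 0, the supremum of the y >= l with s(y)[x] >= 0 is finite by the decay in lambda,
    and by continuity it is a zero. The converse is strict monotonicity past a zero. *)
Lemma rayl_ge l x : mu < l -> X x -> x != 0 -> (l%:E <= p x)%E = (0 <= q l x).
Proof.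
move=> ml Xx x0; apply/idP/idP => [|ql].
  have [->//|[l0 [ml0 q0 ->]]] := rayl_cases x; rewrite lee_fin => ll.
  rewrite leNgt; apply/negP => ql; move: ll; rewrite le_eqVlt => /orP[/eqP e|ll].
    by rewrite e q0 ltxx in ql.
  by have := mono_lt ml ll Xx x0 (ltW ql); rewrite q0 ltxx.
pose A : set R := [set y | l <= y /\ 0 <= q y x].
have n0 := nsq_gt0 x0.
have A0 : A l by [].
have ubA : has_ubound A.
  exists (complex.Re (g x x) / nsq x) => y [ly qy].
  rewrite ler_pdivlMr//; have := decay (lt_le_trans ml ly) Xx; lra.
pose z := sup A; have lz : l <= z by apply: (ub_le_sup ubA).
have mz : mu < z by exact: lt_le_trans ml lz.
have [C [r [C0 r0 hc]]] := cont mz.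
set G := complex.Re (shifted_form (t z) (cc z) x x) in hc.
have G0 : 0 <= G by apply: le_trans (shifted_ge (scl mz) Xx); exact: nsq_ge0.
have cont' (e : R) : 0 < e -> exists2 d, 0 < d & forall y, mu < y -> `|y - z| < d -> `|q y x - q z x| < e.
  move=> e0; have CG : 0 <= C * G by exact: mulr_ge0.
  have CG1 : 0 < C * G + 1 by lra.
  exists (Num.min r (e / (C * G + 1))) => [|y my]; first by rewrite lt_min r0 divr_gt0.
  rewrite lt_min => /andP[h1 h2]; apply: le_lt_trans (hc y my h1 x Xx) _.
  apply: (@le_lt_trans _ _ (`|y - z| * (C * G + 1))); first by rewrite ler_wpM2l//; lra.
  by rewrite -ltr_pdivlMr.
have qz : q z x = 0.
  have [qz|qz|//] := ltgtP (q z x) 0.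
    have [|d d0 hd] := cont' (- q z x); first by rewrite oppr_gt0.
    have [y [ly qy] zy] := sup_adherent d0 (conj (ex_intro _ l A0) ubA).
    have yz : y <= z by apply: (ub_le_sup ubA).
    have := hd y (lt_le_trans ml ly); rewrite ler0_norm; last lra.
    rewrite -/z in zy; move=> /(_ ltac:(lra)); rewrite ltr_norml => /andP[_]; lra.
  have [d d0 hd] := cont' _ qz.
  have := hd (z + d / 2) ltac:(lra); rewrite addrAC subrr add0r ger0_norm; last lra.
  move=> /(_ ltac:(lra)); rewrite ltr_norml => /andP[h _].
  have : A (z + d / 2) by split; [lra|lra].
  by move=> /(ub_le_sup ubA); rewrite -/z => ?; exfalso; lra.
have ez : s z x x = 0 by rewrite s_real// qz.
have : (fun v => exists2 l0, mu < l0 /\ s l0 x x = 0 & l0%:E = v) (p x).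
  rewrite /p; apply: (@xgetPex _ -oo%E [set l%:E | l in [set l : R | mu < l /\ s l x x = 0]]).
  by exists z%:E, z.
move=> [l0 [ml0 sl0] <-]; rewrite lee_fin; apply: le_trans lz _.
rewrite leNgt; apply/negP => l0z.
by have := mono_lt ml0 l0z Xx x0; rewrite sl0 qz lexx ltxx => /(_ isT).
Qed.

Lemma rayl_lt l x : mu < l -> X x -> x != 0 -> (p x < l%:E)%E = (q l x < 0).
Proof. by move=> ml Xx x0; rewrite ltNge rayl_ge// -ltNge. Qed.

Lemma rayl_le l x : mu < l -> X x -> x != 0 -> q l x <= 0 -> (p x <= l%:E)%E.
Proof.
move=> ml Xx x0 ql; have [->|[l0 [ml0 q0 ->]]] := rayl_cases x; first exact: leNye.
rewrite lee_fin leNgt; apply/negP => ll.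
by have := mono_lt ml ll Xx x0 ql; rewrite q0 ltxx.
Qed.

(* Otherwise s(sup p) < 0 on L \ {0}, and by compactness of the unit sphere of L
   also slightly to the left of sup p. *)
Lemma sups_max k : (0 < k)%N -> sups_attained X p k.
Proof.
move=> k0 L [LX hL].
have [x0 Lx0 nx0] : exists2 x, L x & x != 0.
  by have [x Lx [nx _]] := orthogonal_vector hL (has_dim0 H) k0; exists x.
have vals x : L x -> x != 0 -> values_on p L (p x) by move=> Lx nx; exists x.
set sg := ereal_sup _.
have ub x : L x -> x != 0 -> (p x <= sg)%E by move=> Lx nx; exact: ereal_sup_ubound (vals x Lx nx).
have [hb|nb] := pselect (exists2 x, L x & x != 0 /\ p x != -oo%E); last first.
  have all x : L x -> x != 0 -> p x = -oo%E.
    by move=> Lx nx; apply/eqP; apply: contrapT => /negP h; apply: nb; exists x.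
  have -> : sg = p x0; last exact: vals.
  apply/eqP; rewrite eq_le ub// andbT; apply: ge_ereal_sup => _ [x [Lx nx] <-].
  by rewrite (all x Lx nx) leNye.
have [x1 Lx1 [nx1 px1]] := hb.
have [e|[l1 [ml1 _ pl1]]] := rayl_cases x1; first by rewrite e eqxx in px1.
have hI : hermitian_on X (@inner R H).
  by case: gh => sX _ _; split=> // *; [exact: (formPl inner_hermitian)|exact: innerC].
have [|C C0 hC] := finite_dim_form_bound hI gh hL LX.
  by move=> x Lx nx; exact: nsq_gt0.
pose u := Num.max (mu + 1) (C + 1).
have mu_u : mu < u by rewrite lt_max; apply/orP; left; lra.
have Cu : C < u by rewrite lt_max; apply/orP; right; lra.
have pu x : L x -> x != 0 -> (p x <= u%:E)%E.
  move=> Lx nx; apply: (rayl_le mu_u (LX _ Lx) nx).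
  apply: le_trans (decay mu_u (LX _ Lx)) _; have := hC x Lx; rewrite -/(nsq x).
  have := nsq_gt0 nx; nra.
have sgu : (sg <= u%:E)%E by apply: ge_ereal_sup => _ [x [Lx nx] <-]; exact: pu.
have sgl : (l1%:E <= sg)%E by rewrite -pl1; exact: ub.
have [r er] : exists r, sg = r%:E.
  move: sgu sgl; case: sg {ub} => [r _ _|//|//]; by exists r.
have mr : mu < r by move: sgl; rewrite er lee_fin; exact: lt_le_trans.
rewrite er.
have [[x Lx [nx qx]]|no] := pselect (exists2 x, L x & x != 0 /\ 0 <= q r x).
  suff <- : p x = r%:E by exact: vals.
  by apply/eqP; rewrite eq_le -{1}er ub//= rayl_ge//; exact: LX.
have nL : negative (t r) L.
  split=> // x Lx nx; rewrite ltNge; apply/negP => h; apply: no; by exists x.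
have [d d0 hd] := negative_open mr hL nL.
pose e := Num.min d (r - mu).
have e0 : 0 < e by rewrite lt_min d0 subr_gt0.
have e1 : e <= d by rewrite ge_min lexx.
have e2 : e <= r - mu by rewrite ge_min lexx orbT.
have [|_ nL'] := hd (r - e / 2) ltac:(lra).
  by rewrite addrAC subrr add0r normrN ger0_norm; lra.
have : (sg <= (r - e / 2)%:E)%E.
  apply: ge_ereal_sup => _ [x [Lx nx] <-]; apply: (rayl_le _ (LX _ Lx) nx); first lra.
  by apply/ltW; exact: nL'.
rewrite er lee_fin => ?; exfalso; lra.
Qed.

Lemma sups_ge l k y : mu < l -> fin l -> (nu l < k)%N -> sups X p k y -> (l%:E <= y)%E.
Proof.
move=> ml fl nk [L [LX hL] <-]; rewrite leNgt; apply/negP => h.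
suff nL : negative (t l) L by have [_ mx] := nuP fl; have := mx _ _ hL nL; rewrite leqNgt nk.
split=> // x Lx nx; rewrite -rayl_lt//; last exact: LX.
by apply: le_lt_trans h; apply: ereal_sup_ubound; exists x.
Qed.

Lemma negative_subspace l k : (exists2 L, has_dim L k & negative (t l) L) ->
  forall j, (j <= k)%N -> exists2 L, has_dim L j & negative (t l) L.
Proof.
move=> [L hL [LX nL]] j jk.
have [|L' hL' [_ Ldec _]] := has_dim_direct (has_dim0 H) hL _ jk.
  by move=> x ->.
exists L' => //; have sub x : L' x -> L x by move=> /Ldec[y [z [-> Lz ->]]]; rewrite add0r.
by split=> x /sub; [exact: LX|exact: nL].
Qed.

Lemma infs_le L k l : mu < l -> has_dim L k -> (exists2 M, has_dim M k.+1 & negative (t l) M) ->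
  (ereal_inf (values_on p [set x | X x /\ forall y, L y -> '[x, y] = 0%R]) <= l%:E)%E.
Proof.
move=> ml hL [M hM [MX nM]]; have [x Mx [nx ox]] := orthogonal_vector hM hL (ltnSn k).
apply: (@le_trans _ _ (p x)).
  by apply: ereal_inf_lbound; exists x => //; split=> //; split=> //; exact: MX.
by apply/ltW; rewrite rayl_lt//; [exact: nM|exact: MX].
Qed.

Lemma infs_ge L l : mu < l -> forall E, is_spectral_measure E (S l) -> range (E neg) `<=` L ->
  (l%:E <= ereal_inf (values_on p [set x | X x /\ forall y, L y -> '[x, y] = 0%R]))%E.
Proof.
move=> ml E sm NL; apply: le_ereal_inf_tmp => _ [x [[Xx ox] nx] <-].
rewrite rayl_ge//; apply: (off_neg_ge0 (scl ml) sm Xx).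
have mN := @measurable_neg R; apply: inner_eq0.
by rewrite {1}proj_sym// proj_idem// ox//; apply: NL; exact: proj_range.
Qed.

(** No subspace of dimension above [nu l] is negative, which bounds the suprema from below; a
    subspace of the non-positive spectral subspace attains [l]. Dually, each [L] of dimension k - 1
    has a non-positive vector orthogonal to it, and an [L] containing the negative spectral subspace
    attains [l]. *)
Lemma minmax_eigenvalue l m k : good l -> has_dim (ker (S l)) m ->
  (nu l < k)%N -> (k <= nu l + m)%N ->
  [/\ sups_attained X p k, is_min (sups X p k) l%:E & is_max (infs X p (k - 1)) l%:E].
Proof.
move=> gdl hm nk kn; have [ml [l2 ll f2]] := gdl; have fl := good_fin gdl.
have tc := scl ml; have [E sm] := closed_form_spectral tc.
have hV := (neg_part_dim tc sm (nu l)).2 (nuP fl).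
have Nker x : range (E neg) x -> ker (S l) x -> x = 0.
  by move=> /(proj_rangeP _ _ (@measurable_neg R)) {2}<- Sx; exact: (ker_neg tc sm).
have hW := nonpos_dim tc sm hV hm.
have k0 : (0 < k)%N by exact: leq_ltn_trans nk.
have Wsub L : has_dim L k -> L `<=` X -> (forall x, L x -> q l x <= 0) ->
    (ereal_sup (values_on p L) <= l%:E)%E.
  move=> hL LX qL; apply: ge_ereal_sup => _ [x [Lx nx] <-].
  by apply: rayl_le; [|exact: LX| |exact: qL].
split; first exact: sups_max.
  split; last by move=> y; exact: sups_ge.
  have [|L' hL' [_ Ldec _]] := has_dim_direct (has_dim0 H) hW _ kn; first by move=> x ->.
  have sub x : L' x -> range (E nonpos) x by move=> /Ldec[y [z [-> ? ->]]]; rewrite add0r.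
  have L'X : L' `<=` X by move=> x /sub /(nonpos_le tc sm)[].
  exists L'; first by split.
  apply/eqP; rewrite eq_le Wsub//=; last by move=> x /sub /(nonpos_le tc sm)[].
  by apply: (sups_ge ml fl nk); exists L'.
have upper L : has_dim L (k - 1) ->
    (ereal_inf (values_on p [set x | X x /\ forall y, L y -> '[x, y] = 0%R]) <= l%:E)%E.
  move=> hL; have [|x Wx [nx ox]] := orthogonal_vector hW hL.
    by apply: leq_trans kn; rewrite subn1 prednK.
  have [Xx qx] := nonpos_le tc sm Wx.
  apply: (@le_trans _ _ (p x)); first by apply: ereal_inf_lbound; exists x.
  exact: rayl_le.
split; last by move=> _ [L hL <-]; exact: upper.
(* The optimal [L] is the negative spectral subspace with k - 1 - nu(l) kernel vectors adjoined;
   nu(l) < k makes this count exact in the natural numbers. *)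
have kk : (k - 1 - nu l <= m)%N by rewrite leq_subLR (leq_trans _ kn)// leq_subr.
have [L hL [NL _ _]] := has_dim_direct hV hm Nker kk.
rewrite subnKC in hL; last by rewrite subn1 -ltnS prednK.
exists L => //; apply/eqP; rewrite eq_le upper//=; exact: (infs_ge ml sm NL).
Qed.

(** On a finite-dimensional part of the form domain [g] is at most C |x|^2, so s(u) is negative
    there for u > C. The form domain is infinite-dimensional because it is dense. *)
Lemma index_infinite : ~ finite_dim [set: H] -> forall n, exists l, mu < l /\
  exists2 L, has_dim L n & negative (t l) L.
Proof.
move=> infH n; have ml : mu < mu + 1 by lra.
have Xinf : ~ finite_dim X.
  move=> [m hX]; apply: infH; exists m; suff -> : [set: H] = X by [].
  apply/seteqP; split=> // x _; apply: contrapT => nX.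
  have [v [iv eX]] := hX; have iw : indep (vcons x v) by apply: indep_vcons => //; rewrite -/(span v) in eX; rewrite -eX.
  have [z Lz [nz oz]] := orthogonal_vector (has_dim_span iw) hX (ltnSn m).
  have : z = 0 by apply: (form_dense (scl ml)) => y Xy; exact: oz.
  by move/eqP; rewrite (negPf nz).
have [v iv vX] := not_finite_dim_indep (form_subsp (scl ml)) Xinf n.
have LX : span v `<=` X by apply: span_sub => //; exact: form_subsp (scl ml).
have hI : hermitian_on X (@inner R H).
  by case: gh => sX _ _; split=> // *; [exact: (formPl inner_hermitian)|exact: innerC].
have [|C C0 hC] := finite_dim_form_bound hI gh (has_dim_span iv) LX.
  by move=> x Lx nx; exact: nsq_gt0.
pose u := Num.max (mu + 1) (C + 1).
have mu_u : mu < u by rewrite lt_max; apply/orP; left; lra.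
have Cu : C < u by rewrite lt_max; apply/orP; right; lra.
exists u; split=> //; exists (span v); first exact: has_dim_span.
split=> // x Lx nx; apply: le_lt_trans (decay mu_u (LX _ Lx)) _.
have := hC x Lx; rewrite -/(nsq x); have := nsq_gt0 nx; nra.
Qed.

Lemma not_fin_negative l n : mu < l -> ~ fin l -> exists2 L, has_dim L n & negative (t l) L.
Proof.
move=> ml nf; apply: contrapT => no; apply: nf; apply: (index_exists (N := n) (X0 ml)).
move=> L m hL nL; rewrite leqNgt; apply/negP => nm; apply: no.
by apply: (negative_subspace (k := m)) (ltnW nm); exists L.
Qed.

(** Negative subspaces of dimension [k] do not exist below [Lam] and exist in every dimension above
    it, so both values are squeezed between Lam - e and Lam + e. The midpoint of [mu] and [Lam]
    keeps the lower comparison point beyond [mu]. *)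
Lemma minmax_threshold Lam k : mu < Lam -> (forall l, mu < l -> l < Lam -> fin l /\ (nu l < k)%N) ->
  (forall l, Lam < l -> ~ fin l) -> ~ finite_dim [set: H] ->
  [/\ sups_attained X p k, Lam%:E = ereal_inf (sups X p k) & Lam%:E = ereal_sup (infs X p (k - 1))].
Proof.
move=> mL below above infH.
have [k0] : (0 < k)%N /\ True.
  by split=> //; have [|_] := below ((mu + Lam) / 2) ltac:(lra) _; [lra|exact: leq_ltn_trans].
move=> _; split; first exact: sups_max.
  apply/eqP; rewrite eq_le; apply/andP; split.
    apply: le_ereal_inf_tmp => y hy; apply/lee_subgt0Pr => e e0.
    rewrite -EFinB; pose l := Num.max (Lam - e) ((mu + Lam) / 2).
    have lL : l < Lam by rewrite gt_max; apply/andP; split; lra.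
    have ml : mu < l by rewrite lt_max; apply/orP; right; lra.
    have [fl nk] := below l ml lL.
    apply: le_trans (sups_ge ml fl nk hy); by rewrite lee_fin le_max lexx.
  apply/lee_addgt0Pr => e e0; rewrite -EFinD.
  have ml : mu < Lam + e by lra.
  have [L hL nL] := not_fin_negative k ml (above (Lam + e) ltac:(lra)).
  apply: (@le_trans _ _ (ereal_sup (values_on p L))).
    by apply: ereal_inf_lbound; exists L => //; split=> //; case: nL.
  apply: ge_ereal_sup => _ [x [Lx nx] <-]; apply/ltW.
  by case: nL => LX nL; rewrite rayl_lt//; [exact: nL|exact: LX].
apply/eqP; rewrite eq_le; apply/andP; split.
  apply/lee_subgt0Pr => e e0; rewrite -EFinB; pose l := Num.max (Lam - e) ((mu + Lam) / 2).
  have lL : l < Lam by rewrite gt_max; apply/andP; split; lra.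
  have ml : mu < l by rewrite lt_max; apply/orP; right; lra.
  have [fl nk] := below l ml lL.
  have tc := scl ml; have [E sm] := closed_form_spectral tc.
  have hV := (neg_part_dim tc sm (nu l)).2 (nuP fl).
  have [L NL hL] := has_dim_extend (k - 1 - nu l) hV infH.
  rewrite subnKC in hL; last by rewrite subn1 -ltnS prednK.
  apply: (@le_trans _ _ l%:E); first by rewrite lee_fin le_max lexx.
  apply: le_trans (infs_ge ml sm NL) _; apply: ereal_sup_ubound; by exists L.
apply: ge_ereal_sup => _ [L hL <-]; apply/lee_addgt0Pr => e e0; rewrite -EFinD.
have ml : mu < Lam + e by lra.
apply: (infs_le ml hL); exact: (not_fin_negative _ ml (above (Lam + e) ltac:(lra))).
Qed.

End Rayleigh.

End FormFamily.

Lemma closed_form_le (R : realType) (H : hilbertType R) (t : form H) c c' :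
  c' <= c -> closed_form t c -> closed_form t c'.
Proof.
move=> cc tc; have [ht lb hc dn] := tc; split => //.
  by move=> x Xx; apply: le_trans (lb x Xx); rewrite ler_wpM2r ?nsq_ge0.
have dE k x : complex.Re (t x x + k%:C * '[x, x]) = complex.Re (t x x) + k * nsq x.
  by rewrite ReD ReZ.
apply: (@complete_equiv _ _ _ _ _ 1 (1 + (c - c')) _ _ _ _ _ hc) => //.
- exact: form_subsp tc.
- lra.
- move=> x Xx; rewrite !dE mul1r lerD2l ler_wpM2r ?nsq_ge0//; lra.
- move=> x Xx; rewrite !dE; have := lb x Xx; have n0 := nsq_ge0 x => h.
  have : 0 <= (c - c') * (complex.Re (t x x) - c * nsq x) by rewrite mulr_ge0//; lra.
  lra.
Qed.

Lemma has_dim_iso (K : numFieldType) (V W : normedModType K) (psi : V -> W) L M m :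
  (forall c x y, psi (c *: x + y) = c *: psi x + psi y) -> subsp L -> subsp M ->
  (forall x, L x -> M (psi x)) -> (forall y, M y -> exists2 x, L x & psi x = y) ->
  (forall x, L x -> psi x = 0 -> x = 0) -> has_dim L m <-> has_dim M m.
Proof.
move=> lin sL sM LM ML inj.
have p0 : psi 0 = 0 by have := lin (-1) 0 0; rewrite !scaler0 addr0 scaleN1r addNr.
have pD x y : psi (x + y) = psi x + psi y by have := lin 1 x y; rewrite !scale1r.
have psum (v : 'I_m -> V) (c : 'I_m -> K) : psi (\sum_i c i *: v i) = \sum_i c i *: psi (v i).
  elim/big_ind2 : _ => [//|x x' y y' e1 e2|i _]; first by rewrite pD e1 e2.
  by rewrite -[c i *: v i]addr0 lin p0 addr0.
split=> [[v [iv eL]]|[w [iw eM]]].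
  have Lv i : L (v i) by rewrite eL; exact: mem_span.
  exists (fun i => psi (v i)); split.
    move=> c; rewrite -psum => /inj e; apply: iv; apply: e.
    by apply: subsp_sum => // i _; exact: subspZ.
  apply/seteqP; split=> [y /ML[x Lx <-]|_ [c _ <-]].
    by move: Lx; rewrite eL => -[c _ <-]; exists c => //; rewrite psum.
  by apply: subsp_sum => // i _; apply: subspZ => //; exact: LM.
have /boolp.choice[v hv] (i : 'I_m) : exists x, L x /\ psi x = w i.
  by have [|x] := ML (w i); [rewrite eM; exact: mem_span|exists x].
have Lv i : L (v i) by case: (hv i).
have Lsum (c : 'I_m -> K) : L (\sum_i c i *: v i).
  by apply: subsp_sum => // i _; exact: subspZ.
have psum' (c : 'I_m -> K) : psi (\sum_i c i *: v i) = \sum_i c i *: w i.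
  by rewrite psum; apply: eq_bigr => i _; case: (hv i) => _ ->.
exists v; split=> [c e|]; first by apply: iw; rewrite -psum' e.
apply/seteqP; split=> [x Lx|_ [c _ <-]//].
have := LM x Lx; rewrite eM => -[c _ e]; exists c => //; apply/eqP; rewrite -subr_eq0; apply/eqP.
apply: inj; first exact: subspB.
by have := lin (-1) x (\sum_i c i *: v i); rewrite !scaleN1r psum' e addNr [- x + _]addrC.
Qed.

(** * The block operator matrix *)

Section Product.
Context {R : realType} {H1 H2 : hilbertType R}.
Implicit Types (p : (H1 * H2)%type).

(** The inner product of the orthogonal sum, used as a hermitian form while the carrier keeps its
    product norm. *)
Definition inner2 (p q : H1 * H2) : R[i] := '[p.1, q.1] + '[p.2, q.2].

Lemma inner2_hermitian (X : set (H1 * H2)) : subsp X -> hermitian_on X inner2.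
Proof.
move=> sX; split=> // [c x y z _ _ _|x y _ _]; rewrite /inner2.
  by rewrite /= !innerDl !innerZl; ring.
by rewrite rmorphD/= -!innerC.
Qed.

Lemma inner2_diag p : complex.Re (inner2 p p) = nsq p.1 + nsq p.2.
Proof. by rewrite /inner2 ReD. Qed.

Lemma inner2_complete : complete_on [set: H1 * H2] inner2.
Proof.
move=> u _ uc.
have [|l1 _ h1] := @hilbert_complete _ H1 (fun n => (u n).1) (fun=> I).
  move=> e /uc[N hN]; exists N => m n Nm Nn; apply: le_lt_trans (hN m n Nm Nn).
  by rewrite inner2_diag -/(nsq _) lerDl nsq_ge0.
have [|l2 _ h2] := @hilbert_complete _ H2 (fun n => (u n).2) (fun=> I).
  move=> e /uc[N hN]; exists N => m n Nm Nn; apply: le_lt_trans (hN m n Nm Nn).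
  by rewrite inner2_diag -/(nsq _) lerDr nsq_ge0.
exists (l1, l2) => // e e0; have [N1 n1] := h1 (e / 2) ltac:(lra).
have [N2 n2] := h2 (e / 2) ltac:(lra); exists (maxn N1 N2) => n; rewrite geq_max => /andP[a b].
rewrite inner2_diag; have := n1 n a; have := n2 n b; rewrite -!/(nsq _) /=; lra.
Qed.

(** The closure of [X] is complete for [inner2], so Riesz gives the projection of [w] onto it; the
    difference is orthogonal to [X], hence zero. *)
Lemma dense_pairs (X : set (H1 * H2)) : subsp X ->
  (forall u v, (forall p, X p -> '[p.1, u] + '[p.2, v] = 0) -> u = 0 /\ v = 0) ->
  forall w (e : R), 0 < e -> exists2 p, X p & nsq (w.1 - p.1) + nsq (w.2 - p.2) < e.
Proof.
move=> sX hX w.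
pose Y : set (H1 * H2) := [set w | forall e : R, 0 < e ->
  exists2 p, X p & nsq (w.1 - p.1) + nsq (w.2 - p.2) < e].
have XY p : X p -> Y p by move=> Xp e e0; exists p => //; rewrite !subrr !nsq0 addr0.
have sY : subsp Y.
  split; first exact: XY (subsp0 sX).
  move=> c p q Yp Yq e e0; pose k := complex.Re c ^+ 2 + complex.Im c ^+ 2.
  have k0 : 0 <= k by rewrite addr_ge0 ?sqr_ge0.
  have d0 : 0 < e / (4 * (k + 1)) by rewrite divr_gt0//; lra.
  have [p' Xp' hp] := Yp _ d0; have [q' Xq' hq] := Yq _ d0.
  exists (c *: p' + q'); first exact: subspP.
  have key (K : hilbertType R) (x x' y y' : K) :
     nsq (c *: x + y - (c *: x' + y')) <= 2 * k * nsq (x - x') + 2 * nsq (y - y').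
    rewrite opprD addrACA -scalerBr; apply: le_trans (nsqD_le _ _) _.
    by rewrite nsqZ -/k mulrA.
  have a1 := key _ p.1 p'.1 q.1 q'.1; have a2 := key _ p.2 p'.2 q.2 q'.2.
  apply: le_lt_trans (lerD a1 a2) _ => /=.
  move: hp hq; rewrite !ltr_pdivlMr; [|lra|lra] => hp hq.
  have n1 := addr_ge0 (nsq_ge0 (p.1 - p'.1)) (nsq_ge0 (p.2 - p'.2)).
  have n2 := addr_ge0 (nsq_ge0 (q.1 - q'.1)) (nsq_ge0 (q.2 - q'.2)).
  set P := _ + nsq _ in hp n1; set Q := _ + nsq _ in hq n2.
  have -> : 2 * k * nsq (p.1 - p'.1) + 2 * nsq (q.1 - q'.1) +
     (2 * k * nsq (p.2 - p'.2) + 2 * nsq (q.2 - q'.2)) = 2 * k * P + 2 * Q by rewrite /P /Q; ring.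
  have := mulr_ge0 k0 n1; have := mulr_ge0 k0 n2; lra.
have hY := inner2_hermitian sY.
have cY : complete_on Y inner2.
  move=> u Yu /(inner2_complete (fun n => I))[l _ hl]; exists l => // e e0.
  have [N hN] := hl (e / 4) ltac:(lra); have [p Xp hp] := Yu N (e / 4) ltac:(lra).
  exists p => //; have := hN N (leqnn N); rewrite inner2_diag /=.
  have key (K : hilbertType R) (x y z : K) : nsq (y - z) <= 2 * nsq (x - y) + 2 * nsq (x - z).
    by have := nsqD_le (y - x) (x - z); rewrite addrA subrK (nsqC y x).
  have := key _ (u N).1 l.1 p.1; have := key _ (u N).2 l.2 p.2; lra.
have nY : nonneg_on Y inner2 by move=> p _; rewrite inner2_diag addr_ge0 ?nsq_ge0.
have [||x Yx hx] := riesz hY nY (f := inner2 w) (C := complex.Re (inner2 w w)) cY.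
- move=> c p q _ _; have hT := inner2_hermitian (@subspT _ (H1 * H2)%type).
  by rewrite (formPr hT).
- move=> z _; have hT := inner2_hermitian (@subspT _ (H1 * H2)%type).
  by apply: (form_CS hT) => // p _; rewrite inner2_diag addr_ge0 ?nsq_ge0.
have [|e1 e2] := hX (w.1 - x.1) (w.2 - x.2).
  move=> p Xp; have := hx p (XY p Xp); rewrite /inner2 => e.
  have {}e : '[p.1, w.1] + '[p.2, w.2] = '[p.1, x.1] + '[p.2, x.2].
    by rewrite !(innerC _ p.1) !(innerC _ p.2) -!rmorphD/= e.
  by rewrite !innerBr addrACA -opprD e subrr.
have -> : w = x.
  by case: w x e1 e2 {hx Yx} => [w1 w2] [x1 x2] /= /eqP; rewrite subr_eq0 => /eqP -> /eqP; rewrite subr_eq0 => /eqP ->.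
by move=> e; exact: Yx.
Qed.

Lemma bounded_continuous2 (Q : H1 * H2 -> H1 * H2) (C : R) : 0 <= C ->
  (forall p q, nsq ((Q p).1 - (Q q).1) <= C * (nsq (p.1 - q.1) + nsq (p.2 - q.2))) ->
  (forall p q, nsq ((Q p).2 - (Q q).2) <= C * (nsq (p.1 - q.1) + nsq (p.2 - q.2))) ->
  continuous Q.
Proof.
move=> C0 h1 h2; apply: continuous_ballP => p e e0.
pose k := 2 * C + 1; have k0 : 0 < k by rewrite /k; lra.
have r0 : 0 < e ^+ 2 / k by rewrite divr_gt0// exprn_gt0.
exists (Num.sqrt (e ^+ 2 / k)) => [|q]; first by rewrite sqrtr_gt0.
have s0 : 0 < Num.sqrt (e ^+ 2 / k) by rewrite sqrtr_gt0.
move=> [/(ball_nsq _ _ s0) b1 /(ball_nsq _ _ s0) b2].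
rewrite !sqr_sqrtr in b1 b2; try exact: ltW.
have b3 : C * (nsq (p.1 - q.1) + nsq (p.2 - q.2)) < e ^+ 2.
  have : nsq (p.1 - q.1) + nsq (p.2 - q.2) < 2 * (e ^+ 2 / k) by lra.
  have e2 : 0 < e ^+ 2 by rewrite exprn_gt0.
  set r := e ^+ 2 / k in r0 *; move=> h.
  have := ler_wpM2l C0 (ltW h); have -> : e ^+ 2 = k * r by rewrite /r mulrCA divff ?mulr1// gt_eqF.
  rewrite /k; lra.
split; apply/ball_nsq => //; first exact: le_lt_trans (h1 p q) b3.
exact: le_lt_trans (h2 p q) b3.
Qed.

End Product.

Section BlockSchur.
Context {R : realType} {H1 H2 : hilbertType R}.
Variables (A : op H1 H1) (B : op H2 H1) (D : op H2 H2) (fa : form H1) (a b delta c0 : R).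
Hypothesis A_sa : self_adjoint A.
Hypothesis A_form : A `<=` form_operator fa.
Hypothesis B_lin : linear_operator B.
Hypothesis B_dense : densely_defined B.
Hypothesis sa : self_adjoint D.
Hypothesis D_above : bounded_from_above D.
Hypothesis spec_le : forall z, spectrum D z -> z <= delta%:C.
Hypothesis fac : closed_form fa c0.
Local Notation X := (fdom fa).
Local Notation bs := (app (adjoint B)).
Hypothesis fa_B : X `<=` dom (adjoint B).
Hypothesis b_ge0 : 0 <= b.
Hypothesis ab : forall x, X x -> nsq (bs x) <= a * nsq x + b * complex.Re (fa x x).
(** The common consequence of (I) and (II): the vectors of dom(D) that lie in dom(B) form a core for
    [D]. *)
Hypothesis B_core : forall y v, D (y, v) -> forall e : R, 0 < e ->
  exists y' v', [/\ dom B y', D (y', v'), nsq (y - y') < e & nsq (v - v') < e].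
Local Notation mu := (delta + b + Num.sqrt (Num.max (b * delta + b ^+ 2 + a) 0)).
Local Notation s l := (schur_form B D fa l).
Local Notation M := (block_operator A B D).

Lemma bs_lin (c : R[i]) x y : X x -> X y -> bs (c *: x + y) = c *: bs x + bs y.
Proof.
by move=> Xx Xy; apply: app_lin; [exact: adjoint_linear|exact: fa_B|exact: fa_B].
Qed.

Lemma bsE y y' z : B (y, y') -> X z -> '[y', z] = '[y, bs z].
Proof.
by move=> Byy' Xz; have h : adjoint B (z, bs z) := app_in (fa_B Xz); exact: (h _ Byy').
Qed.

Variable l : R.
Hypothesis ml : mu < l.
Local Notation res := (res D l).
Local Notation q x := (complex.Re (s l x x)).

Let dl : delta < l. Proof. by case: (mu_gt b_ge0 ml). Qed.
Let resL c x y : res (c *: x + y) = c *: res x + res y.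
Proof. exact: (res_lin sa spec_le). Qed.
Let sX : subsp X. Proof. exact: form_subsp fac. Qed.
Let sb := (1 - b / (l - delta)) * c0 - l - a / (l - delta).

Let res0 : res 0 = 0.
Proof. by have := resL (-1) 0 0; rewrite !scaler0 addr0 scaleN1r addNr. Qed.
Let resN x : res (- x) = - res x.
Proof. by have := resL (-1) x 0; rewrite res0 !addr0 !scaleN1r. Qed.
Let resD x y : res (x + y) = res x + res y.
Proof. by have := resL 1 x y; rewrite !scale1r. Qed.
Let bs0 : bs 0 = 0.
Proof.
by have := bs_lin (-1) (subsp0 sX) (subsp0 sX); rewrite !scaler0 addr0 scaleN1r addNr.
Qed.
Let bsD x y : X x -> X y -> bs (x + y) = bs x + bs y.
Proof. by move=> Xx Xy; have := bs_lin 1 Xx Xy; rewrite !scale1r. Qed.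
Let bsB x y : X x -> X y -> bs (x - y) = bs x - bs y.
Proof.
by move=> Xx Xy; have := bs_lin (-1) Xy Xx; rewrite !scaleN1r ![- _ + _]addrC.
Qed.

(* Large enough for both [a - l + k] and [s(l) + k] to dominate the norm. *)
Definition coercive_shift : R := Num.max (l + 1 - c0) (1 - sb).
Local Notation k := coercive_shift.

Lemma coercive_fa : closed_form fa (l + 1 - k).
Proof.
apply: closed_form_le fac; have : l + 1 - c0 <= k by rewrite le_max lexx.
lra.
Qed.

Lemma schur_sb : closed_form (s l) sb.
Proof. exact: (schur_closed sa D_above spec_le fac bs_lin b_ge0 ab ml). Qed.

Lemma coercive_schur : closed_form (s l) (1 - k).
Proof.
apply: closed_form_le schur_sb; have : 1 - sb <= k by rewrite le_max lexx orbT.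
lra.
Qed.

Local Notation h := (shifted_form (s l) (1 - k)).

Lemma hE x y : h x y = s l x y + k%:C * '[x, y].
Proof. by rewrite /shifted_form opprB addrCA subrr addr0. Qed.

Lemma bs_bounded : exists2 K, 0 <= K & forall z, X z -> nsq (bs z) <= K * complex.Re (h z z).
Proof.
have [K K0 hK] := bs_bound sa D_above spec_le fac bs_lin b_ge0 ab ml.
exists K => // z Xz; apply: le_trans (hK z Xz) _; rewrite ler_wpM2l// !shifted_diag lerD2l.
rewrite ler_wpM2r ?nsq_ge0//; have : 1 - sb <= k by rewrite le_max lexx orbT.
rewrite /sb /schur_bound; lra.
Qed.

(** The second row (D - l) y - bs x = v gives y = -res (v + bs x). Put into the first row, with
    right-hand side [w] and tested with [z], it leaves s(l)[x, z] equal to this functional. *)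
Definition functional_of (w : H1) (v : H2) (z : H1) : R[i] := '[w, z] + '[res v, bs z].
Local Notation f := functional_of.

Lemma functional_antilinear w v (c : R[i]) x y : X x -> X y ->
  f w v (c *: x + y) = c^* * f w v x + f w v y.
Proof. by move=> Xx Xy; rewrite /f bs_lin// !innerDr !innerZr; ring. Qed.

Lemma functional_bounded : exists2 C, 0 <= C & forall w v z, X z ->
  complex.Re (f w v z) ^+ 2 <= C * (nsq w + nsq v) * complex.Re (h z z).
Proof.
have [K K0 hK] := bs_bounded; have [C C0 hC] := res_bounded sa spec_le dl.
exists (2 + 2 * K * C) => [|w v z Xz]; first by rewrite addr_ge0// !mulr_ge0// ltW.
have := hK z Xz; have := shifted_ge coercive_schur Xz; set G := complex.Re _ => zG bG.
have c1 := inner_CS w z; have c2 := inner_CS (res v) (bs z); rewrite /f ReD.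
set p := complex.Re '[w, z] in c1 *; set r := complex.Re _ in c2 *.
have G0 : 0 <= G by apply: le_trans zG; exact: nsq_ge0.
have d1 : p ^+ 2 <= nsq w * G by apply: le_trans c1 _; rewrite ler_wpM2l ?nsq_ge0.
have d2 : r ^+ 2 <= C * nsq v * (K * G).
  by apply: le_trans c2 _; rewrite ler_pM ?nsq_ge0.
have e1 : (p + r) ^+ 2 <= 2 * p ^+ 2 + 2 * r ^+ 2 by have := sqr_ge0 (p - r); rewrite !expr2; lra.
have e2 : 0 <= nsq v * G by rewrite mulr_ge0 ?nsq_ge0.
have e3 : 0 <= K * C * (nsq w * G) by rewrite !mulr_ge0 ?nsq_ge0// ltW.
apply: le_trans e1 _; lra.
Qed.

Lemma weak_exists w v : exists x, X x /\ forall z, X z -> h x z = f w v z.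
Proof.
have [C C0 hC] := functional_bounded; have tc := coercive_schur.
have [||x Xx hx] := riesz (shifted_hermitian tc) (shifted_nonneg tc) (f := f w v)
   (C := C * (nsq w + nsq v)) (shifted_complete tc); last by exists x.
- by move=> c x y; exact: functional_antilinear.
- by move=> z; exact: hC.
Qed.

(** Solution operator of the weak equation with k <x, z> added on the left, which makes it uniquely
    solvable for all data. *)
Definition weak_sol w v : H1 := projT1 (cid (weak_exists w v)).
Local Notation T := weak_sol.

Lemma weak_dom w v : X (T w v).
Proof. by rewrite /weak_sol; case: cid => x []. Qed.
Lemma weakE w v z : X z -> h (T w v) z = f w v z.
Proof. by move=> Xz; rewrite /weak_sol; case: cid => x /= [_ hx]; exact: hx. Qed.

Lemma weak_uniq w v x : X x -> (forall z, X z -> h x z = f w v z) -> x = T w v.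
Proof.
move=> Xx hx; have tc := coercive_schur; have XT := weak_dom w v.
have Xd : X (x - T w v) by exact: subspB.
apply/eqP; rewrite -subr_eq0; apply/eqP/nsq_eq0/eqP; rewrite eq_le nsq_ge0 andbT.
apply: le_trans (shifted_ge tc Xd) _.
by rewrite (formBl (shifted_hermitian tc))// hx// weakE// subrr.
Qed.

Lemma weak_sub w v w' v' : T (w - w') (v - v') = T w v - T w' v'.
Proof.
have tc := coercive_schur; have D1 := weak_dom w v; have D2 := weak_dom w' v'.
apply/esym/weak_uniq => [|z Xz]; first exact: subspB.
rewrite (formBl (shifted_hermitian tc))// !weakE// /f resD resN !innerBl; ring.
Qed.

Lemma weak_bounded : exists2 C, 0 <= C & forall w v,
  nsq (T w v) <= C * (nsq w + nsq v) /\ nsq (res (v + bs (T w v))) <= C * (nsq w + nsq v).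
Proof.
have [K K0 hK] := bs_bounded; have [C' C'0 hC'] := res_bounded sa spec_le dl.
have [C C0 hC] := functional_bounded.
exists (C + C' * (2 + 2 * K * C)) => [|w v].
  by rewrite addr_ge0// mulr_ge0 ?(ltW C'0)// addr_ge0// !mulr_ge0.
have XT := weak_dom w v; have tc := coercive_schur.
set n := nsq w + nsq v; have n0 : 0 <= n by rewrite addr_ge0 ?nsq_ge0.
have g1 : complex.Re (h (T w v) (T w v)) <= C * n.
  have := hC w v _ XT; rewrite -weakE// -/n.
  have := shifted_nonneg tc XT; set G := complex.Re _.
  rewrite le_eqVlt => /orP[/eqP <- _|G0]; first by rewrite mulr_ge0.
  by rewrite expr2 ler_pM2r.
have g2 := shifted_ge tc XT; have g3 := hK _ XT.
have C'n : 0 <= C' * (2 + 2 * K * C) * n.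
  by rewrite !mulr_ge0 ?(ltW C'0)// addr_ge0// !mulr_ge0.
split; first by rewrite mulrDl; lra.
apply: le_trans (hC' _) _; rewrite mulrDl -!mulrA.
have h1 : nsq (v + bs (T w v)) <= (2 + 2 * K * C) * n.
  apply: le_trans (nsqD_le _ _) _; have := ler_wpM2l K0 g1.
  have : nsq v <= n by rewrite /n lerDr nsq_ge0.
  lra.
have := ler_wpM2l (ltW C'0) h1; have : 0 <= C * n by rewrite mulr_ge0.
lra.
Qed.

Definition weak_graph : set ((H1 * H2) * (H1 * H2)) := [set p | [/\ X p.1.1,
  p.1.2 = - res (p.2.2 + bs p.1.1) & forall z, X z -> s l p.1.1 z = f p.2.1 p.2.2 z]].

(** Adding k <x, z> to both sides gives a fixed-point relation for a bounded operator. Limits can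
    then be taken in it although s(l) itself need not be invertible. *)
Lemma weak_graphP p : weak_graph p <->
  p.1.1 = T (p.2.1 + k%:C *: p.1.1) p.2.2 /\ p.1.2 = - res (p.2.2 + bs p.1.1).
Proof.
split=> [[Xx e hx]|[e1 e2]].
  split=> //; apply: weak_uniq => // z Xz; rewrite hE hx// /f innerDl innerZl; ring.
have Xx : X p.1.1 by rewrite e1; exact: weak_dom.
split=> // z Xz; have := weakE (p.2.1 + k%:C *: p.1.1) p.2.2 Xz.
rewrite -e1 hE /f innerDl innerZl => /(congr1 (fun r => r - k%:C * '[p.1.1, z])).
by rewrite addrK => ->; ring.
Qed.

Lemma weak_graph_closed p : (forall e : R, 0 < e -> exists2 r, weak_graph r &
    [/\ nsq (p.1.1 - r.1.1) < e, nsq (p.1.2 - r.1.2) < e,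
      nsq (p.2.1 - r.2.1) < e & nsq (p.2.2 - r.2.2) < e]) -> weak_graph p.
Proof.
move=> hp; have [C C0 hC] := weak_bounded; have C1 : 0 <= 2 + 2 * k ^+ 2.
  by rewrite addr_ge0// mulr_ge0// sqr_ge0.
pose x := T (p.2.1 + k%:C *: p.1.1) p.2.2.
have est (e : R) : 0 < e -> nsq (p.1.1 - x) <= e * (2 + 2 * (C * (3 + 2 * k ^+ 2))) /\
    nsq (p.1.2 + res (p.2.2 + bs x)) <= e * (2 + 2 * (C * (3 + 2 * k ^+ 2))).
  move=> e0; have [r /weak_graphP[r1 r2] [e1 e2 e3 e4]] := hp e e0.
  set w := r.2.1 + _ in r1; set w' := p.2.1 + k%:C *: p.1.1.
  have ww : nsq (w - w') <= (2 + 2 * k ^+ 2) * e.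
    have -> : w - w' = (r.2.1 - p.2.1) + k%:C *: (r.1.1 - p.1.1).
      by rewrite /w /w' opprD addrACA -scalerBr.
    apply: le_trans (nsqD_le _ _) _; rewrite nsqZ /= expr0n/= addr0.
    rewrite (nsqC r.2.1) (nsqC r.1.1).
    have := ler_wpM2l (sqr_ge0 k) (ltW e1); lra.
  have [] := hC (w - w') (r.2.2 - p.2.2); rewrite weak_sub -r1 -/x (nsqC r.2.2).
  set n := nsq (w - w') + _ => t1 t2.
  have ne : C * n <= C * ((3 + 2 * k ^+ 2) * e) by rewrite ler_wpM2l// /n; lra.
  split.
    have := nsqD_le (p.1.1 - r.1.1) (r.1.1 - x); rewrite addrA subrK; lra.
  have Xr : X r.1.1 by rewrite r1; exact: weak_dom.
  have Xx : X x by exact: weak_dom.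
  set d := res _ in t2.
  have dE : d = - r.1.2 - res (p.2.2 + bs x).
    have e5 : r.2.2 - p.2.2 + bs (r.1.1 - x) = (r.2.2 + bs r.1.1) - (p.2.2 + bs x).
      by rewrite bsB// addrACA -opprD.
    by rewrite /d e5 (resD (r.2.2 + bs r.1.1)) resN r2 (opprK (res (r.2.2 + _))).
  have := nsqD_le (p.1.2 - r.1.2) (- d); rewrite nsqN {1}dE opprD (opprK r.1.2) (opprK (res _)) addrA subrK.
  lra.
have zero (H : hilbertType R) (y : H) C' : (forall e : R, 0 < e -> nsq y <= e * C') -> y = 0.
  by move=> /le0_eps y0; apply/nsq_eq0/eqP; rewrite eq_le y0 nsq_ge0.
have e1 : p.1.1 = x.
  by apply/eqP; rewrite -subr_eq0; apply/eqP/(zero _ _ _ (fun e e0 => proj1 (est e e0))).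
apply/weak_graphP; split=> //; rewrite [in bs _]e1; apply/eqP; rewrite -addr_eq0; apply/eqP.
exact: (zero _ _ _ (fun e e0 => proj2 (est e e0))).
Qed.

Lemma block0_weak p : block_operator0 A B D (p.1, p.2 + l%:C *: p.1) -> weak_graph p.
Proof.
case: p => [[x y] [u v]] [/= dA dBs dB dD e]; case: e => e1 e2.
have [Xx hx] := A_form (app_in dA); rewrite /= in Xx hx.
have yv : y = - res (v + bs x).
  rewrite -resN; apply/(resP sa spec_le _ _ dl); rewrite opprK addrCA addrA.
  have := app_in dD; congr (D (_, _)).
  by rewrite e2 addrAC addNr add0r.
split=> // z Xz; change (s l x z = f u v z); rewrite schurE hx// /f.
have -> : '[u, z] = '[app A x, z] + '[app B y, z] - l%:C * '[x, z].
  by rewrite -innerDl -e1 innerDl innerZl addrK.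
rewrite (bsE (app_in dB) Xz) {1}yv resD innerNl innerDl; ring.
Qed.

Let MB0 := [set p : (H1 * H2) * (H1 * H2) | block_operator0 A B D (p.1, p.2 + l%:C *: p.1)].

(** A pair (u, v) orthogonal to this range solves the adjoint equations. The first puts [u] into the
    form domain; the second, with self-adjointness of [D], gives v = res (bs u). Together they say
    (s(l) + k)[u] = 0, so u and v vanish. *)
Lemma block0_dense w (e : R) : 0 < e -> exists2 p, MB0 p &
  nsq (w.1 - (p.2.1 + k%:C *: p.1.1)) + nsq (w.2 - p.2.2) < e.
Proof.
move=> e0; pose Rg : set (H1 * H2) := [set r | exists2 p, MB0 p & r = (p.2.1 + k%:C *: p.1.1, p.2.2)].
have AL := sa_linear A_sa; have DL := sa_linear sa.
have BsL := adjoint_linear B_dense.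
pose val x y : H1 * H2 := (app A x + app B y + (k - l)%:C *: x, - bs x + app D y - l%:C *: y).
have mem x y : dom A x -> dom B y -> dom D y -> Rg (val x y).
  move=> dA dB dD; exists ((x, y), (app A x + app B y - l%:C *: x, - bs x + app D y - l%:C *: y)).
    have dBs : dom (adjoint B) x by apply: fa_B; case: (A_form (app_in dA)).
    split=> //=; rewrite (_ : _ + _ = (app A x + app B y - l%:C *: x + l%:C *: x,
       - bs x + app D y - l%:C *: y + l%:C *: y))// !subrK//.
  by rewrite /val /=; congr pair; rewrite rmorphB/= scalerBl [k%:C *: x - _]addrC addrA.
have memP r : Rg r -> exists x y, [/\ dom A x, dom B y, dom D y & r = val x y].
  move=> [[[x y] [u v]] [/= dA dBs dB dD [e1 e2]] ->]; exists x, y; split=> //=.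
  rewrite /val -e1 -e2 addrK; congr pair; rewrite rmorphB/= scalerBl.
  by rewrite [k%:C *: x - _]addrC addrA addrK.
have sR : subsp Rg.
  split.
    have -> : (0 : H1 * H2) = val 0 0.
      rewrite /val bs0 !scaler0 oppr0 !add0r !addr0.
      rewrite (appE (sa_functional A_sa) (y := 0)); last by case: AL.
      rewrite (appE (linear_functional B_lin) (y := 0)); last by case: B_lin.
      by rewrite (appE (sa_functional sa) (y := 0)) ?addr0//; case: DL.
    by apply: mem; exists 0; [case: AL|case: B_lin|case: DL].
  move=> c r r' /memP[x [y [dA dB dD ->]]] /memP[x' [y' [dA' dB' dD' ->]]].
  have Xx : X x by case: (A_form (app_in dA)).
  have Xx' : X x' by case: (A_form (app_in dA')).
  have -> : c *: val x y + val x' y' = val (c *: x + x') (c *: y + y').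
    rewrite /val (app_lin c AL dA dA') (app_lin c B_lin dB dB') (app_lin c DL dD dD') bs_lin//.
    congr pair => /=.
      rewrite scalerDr (scalerDr c (app A x)) addrACA [c *: app A x + _ + _]addrACA.
      by rewrite scalerDr !scalerA (mulrC c).
    rewrite scalerDr (scalerDr c (- bs x)) addrACA [c *: - bs x + _ + _]addrACA.
    by rewrite !scalerN scalerDr !scalerA (mulrC c) !opprD.
  by apply: mem; apply: subspP => //; exact: dom_subsp.
have [|p [r MBp ->]] := dense_pairs sR _ w e0; last by exists r.
move=> u v ort.
have ortA x : dom A x -> '[app A x + (k - l)%:C *: x, u] = '[bs x, v].
  move=> dA; have d0 : dom B 0 by exists 0; case: B_lin.
  have d0' : dom D 0 by exists 0; case: DL.
  have := ort _ (mem x 0 dA d0 d0'); rewrite /val /= scaler0 subr0.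
  rewrite (appE (linear_functional B_lin) (y := 0)); last by case: B_lin.
  rewrite (appE (sa_functional sa) (y := 0)); last by case: DL.
  by rewrite !addr0 innerNl => /eqP; rewrite subr_eq0 => /eqP.
have ortB y : dom B y -> dom D y -> '[app B y, u] + '[app D y - l%:C *: y, v] = 0.
  move=> dB dD; have d0 : dom A 0 by exists 0; case: AL.
  have := ort _ (mem 0 y d0 dB dD); rewrite /val /= scaler0 bs0 oppr0 !addr0 add0r.
  by rewrite (appE (sa_functional A_sa) (y := 0)) ?add0r//; case: AL.
have tf := coercive_fa; have tc := coercive_schur.
have kf : (1 - (l + 1 - k))%:C = (k - l)%:C :> R[i] by congr (_%:C); lra.
have [K K0 hK] := bs_bounded.
have fbd z : X z -> nsq (bs z) <= K * complex.Re (shifted_form fa (l + 1 - k) z z).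
  move=> Xz; apply: le_trans (hK z Xz) _; rewrite ler_wpM2l// !shifted_diag.
  have := schur_le B fa sa D_above spec_le z dl; lra.
have [||u' Xu' hu'] := riesz (shifted_hermitian tf) (shifted_nonneg tf)
  (f := fun z => '[v, bs z]) (C := nsq v * K) (shifted_complete tf).
- by move=> c x y Xx Xy; rewrite bs_lin// innerDr innerZr.
- move=> z Xz; apply: le_trans (inner_CS _ _) _.
  by rewrite -mulrA ler_wpM2l ?nsq_ge0// fbd.
(* [u'] solves the first equation weakly. The difference is tested with x such that (A - l + k) x =
   u - u'; self-adjointness of [A] places this resolvent vector of the form in dom(A). *)
have uu : u = u'.
  apply/eqP; rewrite -subr_eq0; apply/eqP/inner_eq0.
  set d := u - u'; pose x := fres tf d.
  have xA : A (x, d - (1 - (l + 1 - k))%:C *: x).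
    apply: (sa_max A_sa) => r Ar.
    have h2 : form_operator fa (x, d - (1 - (l + 1 - k))%:C *: x).
      by apply/(form_operatorP tf); rewrite subrK.
    exact: (form_operator_sym fac (A_form Ar) h2).
  have dA : dom A x by eexists; exact: xA.
  have Xx : X x by exact: fres_dom.
  have := ortA x dA; rewrite (appE (sa_functional A_sa) xA) kf subrK => e1.
  have e2 : '[d, u'] = '[bs x, v].
    rewrite -(fresE tf)// -/x (formC (shifted_hermitian tf) Xu' Xx) hu'//.
    by rewrite -innerC.
  by rewrite {2}/d innerBr e1 e2 subrr.
rewrite -uu in Xu' hu'.
(* The second equation is known on dom(B) inside dom(D) only; the core property extends it to
   dom(D). A factor of modulus 1 treats real and imaginary parts alike. *)
have Dv : D (v, l%:C *: v - bs u).
  apply: (sa_max sa) => -[y y'] Dyy' /=; apply/eqP; rewrite -subr_eq0; apply/eqP.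
  have core y0 v0 : dom B y0 -> D (y0, v0) -> '[v0, v] = '[y0, l%:C *: v - bs u].
    move=> dB Dy; have dD : dom D y0 by exists v0.
    have := ortB y0 dB dD; rewrite (bsE (app_in dB) Xu') (appE (sa_functional sa) Dy).
    rewrite innerBl innerBr innerZl innerZr conj_real => e1.
    by apply/eqP; rewrite -subr_eq0; apply/eqP; rewrite -e1; ring.
  have zero (z : R[i]) C' : (forall e : R, 0 < e -> complex.Re z ^+ 2 <= e * C') ->
      (forall e : R, 0 < e -> complex.Im z ^+ 2 <= e * C') -> z = 0.
    move=> /le0_eps r0 /le0_eps i0; rewrite [z]complexE.
    have -> : complex.Re z = 0 by apply/eqP; rewrite -sqrf_eq0 eq_le r0 sqr_ge0.
    have -> // : complex.Im z = 0 by apply/eqP; rewrite -sqrf_eq0 eq_le i0 sqr_ge0.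
  set w0 := l%:C *: v - bs u.
  have est (e1 : R) : 0 < e1 -> forall c : R[i], complex.Re c ^+ 2 + complex.Im c ^+ 2 = 1 ->
      complex.Re (c * ('[y', v] - '[y, w0])) ^+ 2 <= e1 * (2 * nsq v + 2 * nsq w0).
    move=> e10 c c1; have [y0 [v0 [dB Dy n1 n2]]] := B_core Dyy' e10.
    have -> : '[y', v] - '[y, w0] = '[y' - v0, v] - '[y - y0, w0].
      by rewrite !innerBl (core _ _ dB Dy) -/w0; ring.
    rewrite mulrBr -!innerZl ReD ReN.
    have s1 := inner_CS (c *: (y' - v0)) v; have s2 := inner_CS (c *: (y - y0)) w0.
    rewrite nsqZ c1 mul1r in s1; rewrite nsqZ c1 mul1r in s2.
    set P := complex.Re _ in s1 *; set Q := complex.Re _ in s2 *.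
    have : P ^+ 2 <= e1 * nsq v by apply: le_trans s1 _; rewrite ler_wpM2r ?nsq_ge0// ltW.
    have : Q ^+ 2 <= e1 * nsq w0 by apply: le_trans s2 _; rewrite ler_wpM2r ?nsq_ge0// ltW.
    have := sqr_ge0 (P + Q); rewrite !expr2; lra.
  apply: (zero _ (2 * nsq v + 2 * nsq w0)) => e1 e10.
    by have := est e1 e10 1; rewrite mul1r; apply; rewrite /= expr0n/= addr0 expr1n.
  have := est e1 e10 (Complex 0 1).
  have -> (z : R[i]) : complex.Re (Complex 0 1 * z) = - complex.Im z by case: z => zr zi /=; ring.
  by rewrite sqrrN; apply; rewrite /= expr0n/= add0r expr1n.
have vE : v = res (bs u) by apply/(resP sa spec_le _ _ dl).
have u0 : u = 0.
  apply: nsq_eq0; apply/eqP; rewrite eq_le nsq_ge0 andbT.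
  apply: le_trans (shifted_ge tc Xu') _; rewrite hE schurE.
  have := hu' u Xu'; rewrite vE /shifted_form kf rmorphB/= mulrBl => e1.
  have -> : fa u u - l%:C * '[u, u] - '[res (bs u), bs u] + k%:C * '[u, u] = 
     fa u u + (k%:C * '[u, u] - l%:C * '[u, u]) - '[res (bs u), bs u] by ring.
  by rewrite e1 subrr.
by split=> //; rewrite vE u0 bs0 res0.
Qed.

(** The weak graph is closed and contains the graph of the unclosed matrix, hence its closure.
    Conversely the shifted range is dense, and the bounded solution operator carries an
    approximation of the right-hand side back to all components of the graph. *)
Theorem block_weak p : shift M l%:C p <-> weak_graph p.
Proof.
case: p => [[x y] [u v]]; rewrite /shift /block_operator /=; split.
  move=> /closure4_nsqP hc; apply: weak_graph_closed => e e0.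
  have C0 : 0 <= l ^+ 2 by exact: sqr_ge0.
  have d0 : 0 < e / (2 + 2 * l ^+ 2 + 1) by rewrite divr_gt0//; lra.
  have [[[x' y'] [u' v']] M0 [/= e1 e2 e3 e4]] := hc _ d0.
  exists ((x', y'), (u' - l%:C *: x', v' - l%:C *: y')).
    apply: block0_weak; rewrite /= (_ : (u' - l%:C *: x', v' - l%:C *: y') + _ = (u', v'))//.
    by rewrite -[LHS]/(_ - _ + _, _ - _ + _) !subrK.
  have d1 : e / (2 + 2 * l ^+ 2 + 1) <= e by rewrite ler_pdivrMr ?ler_peMr ?(ltW e0)//; lra.
  have key (K : hilbertType R) (r r' z z' : K) : nsq (r + l%:C *: z - r') < e / (2 + 2 * l ^+ 2 + 1) ->
     nsq (z - z') < e / (2 + 2 * l ^+ 2 + 1) -> nsq (r - (r' - l%:C *: z')) < e.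
    move=> n1 n2.
    have -> : r - (r' - l%:C *: z') = (r + l%:C *: z - r') - l%:C *: (z - z').
      by rewrite scalerBr !opprB [r + _ - r']addrAC -[RHS]addrA [l%:C *: z + (_ - _)]addrC subrK addrA addrAC.
    apply: le_lt_trans (nsqD_le _ _) _; rewrite nsqN nsqZ /= expr0n/= addr0.
    have := ler_wpM2l C0 (ltW n2); set m := e / _ in d0 n1 n2 *.
    have -> : e = (2 + 2 * l ^+ 2 + 1) * m by rewrite /m mulrCA divff ?mulr1// gt_eqF//; lra.
    lra.
  split=> /=; [exact: lt_le_trans e1 d1|exact: lt_le_trans e2 d1| |].
    exact: (key _ u u' x x').
  exact: (key _ v v' y y').
move=> /weak_graphP[/= e1 e2]; apply/closure4_nsqP => e e0.
have [C C0 hC] := weak_bounded.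
(* [L] collects the factors by which an error [d] in the data spreads to the four components,
   including the shifts by [k] and [l]. *)
pose L := 1 + C + 2 * (k ^+ 2 + l ^+ 2) * C.
pose d := e / (4 * (1 + L)).
have L0 : 0 <= L by rewrite !addr_ge0// !mulr_ge0// addr_ge0// sqr_ge0.
have d0 : 0 < d by rewrite divr_gt0//; lra.
have [[[x' y'] [u' v']] MB0p /= hd] := block0_dense (u + k%:C *: x, v) d0.
have /weak_graphP[/= f1 f2] := block0_weak MB0p.
exists ((x', y'), (u' + l%:C *: x', v' + l%:C *: y')) => //=.
have [] := hC (u + k%:C *: x - (u' + k%:C *: x')) (v - v').
rewrite weak_sub -e1 -f1; set n := nsq _ + nsq _ in hd *.
have Xx : X x by rewrite e1; exact: weak_dom.
have Xx' : X x' by rewrite f1; exact: weak_dom.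
rewrite bsB// addrACA -opprD resD resN -[res _ - _]opprK opprB nsqN.
rewrite -[res (v' + bs x')]opprK -f2 -[res (v + bs x)]opprK -e2 [- y' - - y]addrC opprK => t1 t2.
have nd : n <= d by exact: ltW.
have Cn : C * n <= C * d by rewrite ler_wpM2l.
have ed : e = 4 * (1 + L) * d by rewrite /d mulrCA divff ?mulr1// gt_eqF//; lra.
have k0 := sqr_ge0 k; have l0 := sqr_ge0 l.
have Cd : 0 <= C * d by rewrite mulr_ge0// ltW.
have kC : 0 <= k ^+ 2 * (C * d) by rewrite mulr_ge0.
have lC : 0 <= l ^+ 2 * (C * d) by rewrite mulr_ge0.
have n1 : nsq (u + k%:C *: x - (u' + k%:C *: x')) <= d by apply: le_trans nd; rewrite /n lerDl nsq_ge0.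
have n2 : nsq (v - v') <= d by apply: le_trans nd; rewrite /n lerDr nsq_ge0.
have eL : e = 4 * d + 4 * d + 4 * (C * d) + 8 * (k ^+ 2 * (C * d)) + 8 * (l ^+ 2 * (C * d)).
  by rewrite ed /L; ring.
have key (K : hilbertType R) (r r' z z' : K) (g : R) :
    nsq (r + g%:C *: z - (r' + g%:C *: z')) <= 2 * nsq (r - r') + 2 * (g ^+ 2 * nsq (z - z')).
  rewrite opprD addrACA -scalerBr; apply: le_trans (nsqD_le _ _) _.
  by rewrite nsqZ /= expr0n/= addr0.
have m1 := ler_wpM2l l0 (le_trans t1 Cn); have m2 := ler_wpM2l l0 (le_trans t2 Cn).
have m3 := ler_wpM2l k0 (le_trans t1 Cn).
have nu : nsq (u - u') <= 2 * d + 2 * (k ^+ 2 * (C * d)).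
  have := key _ (u + k%:C *: x) (u' + k%:C *: x') x x' (- k).
  rewrite rmorphN/= !scaleNr !addrK sqrrN; lra.
split.
- lra.
- lra.
- have := key _ u u' x x' l; have k1 := sqr_ge0 (l * k); have : 0 <= (k ^+ 2 + l ^+ 2) * (C * d) by rewrite mulr_ge0// addr_ge0.
  lra.
- have := key _ v v' y y' l; lra.
Qed.

Local Notation S := (form_operator (s l)).

Lemma functional_sub u v u' v' z : f (u - u') (v - v') z = f u v z - f u' v' z.
Proof. by rewrite /f resD resN !innerBl; ring. Qed.

Lemma functional0 z : f 0 0 z = 0.
Proof. by rewrite /f res0 !inner0l addr0. Qed.

Lemma ker_blockP p : ker (shift M l%:C) p <-> ker S p.1 /\ p.2 = - res (bs p.1).
Proof.
rewrite /ker /=; split=> [/block_weak[/= Xx e hx]|[[/= Xx hx] e]].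
  rewrite add0r in e; split=> //; split=> //= z Xz.
  by rewrite hx// functional0 inner0l.
by apply/block_weak; split=> //=; [rewrite add0r|move=> z Xz; rewrite hx// functional0 inner0l].
Qed.

Lemma ker_block_dim m : has_dim (ker (shift M l%:C)) m <-> has_dim (ker S) m.
Proof.
have sS := ker_subsp schur_sb; have KX x : ker S x -> X x by case.
apply: (has_dim_iso (psi := fst)) => //.
- split; first by apply/ker_blockP; split; [exact: subsp0 sS|rewrite /= bs0 res0 oppr0].
  move=> c p r /ker_blockP[p1 p2] /ker_blockP[r1 r2]; apply/ker_blockP; split.
    exact: (subspP sS).
  by rewrite /= bs_lin ?resL ?p2 ?r2; [rewrite opprD scalerN|exact: KX|exact: KX].
- by move=> p /ker_blockP[].
- by move=> x Sx; exists (x, - res (bs x)) => //; apply/ker_blockP.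
- move=> [x y] /ker_blockP[/= _ e] x0; rewrite x0 bs0 res0 oppr0 in e.
  by rewrite x0 e.
Qed.

(** It embeds the range of S(l) into that of M - l, so that closedness is inherited. *)
Lemma ran_block_fst u : ran (shift M l%:C) (u, 0) <-> ran S u.
Proof.
have fE z : f u 0 z = '[u, z] by rewrite /f res0 inner0l addr0.
split=> [[p /block_weak[/= Xx _ hx]]|[x [/= Xx hx]]].
  by exists p.1; split=> //= z Xz; rewrite hx.
exists (x, - res (bs x)); apply/block_weak; split=> //=; first by rewrite add0r.
by move=> z Xz; rewrite fE hx.
Qed.

Lemma fredholm_schur : fredholm (shift M l%:C) ->
  closed (ran S) /\ exists m, has_dim (ker S) m.
Proof.
move=> [_ [m hm] /closure_id cR _]; split; last by exists m; apply/ker_block_dim.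
apply/closure_id/seteqP; split; first exact: subset_closure.
move=> u /closure_nsqP cu; apply/ran_block_fst; rewrite cR; apply/closure2_nsqP => e e0.
have [u' ru' uu] := cu e e0; exists (u', 0); first exact/ran_block_fst.
by rewrite /= subrr nsq0.
Qed.

(** * Fredholm theory of the block operator under a spectral gap *)

Section Gap.
Variables (E : pvm H1) (e : R).
Hypothesis sm : is_spectral_measure E S.
Hypothesis e0 : 0 < e.
Hypothesis gap : spectral_gap E e.

Lemma weak_solvable : exists2 C, 0 <= C & forall u v, (forall z, S (z, 0) -> f u v z = 0) ->
  exists x, [/\ X x, forall z, X z -> s l x z = f u v z & nsq x <= C * (nsq u + nsq v)].
Proof.
have tc := coercive_schur; have [C' C'0 hC'] := gap_solvable tc sm e0 gap.
have [C C0 hC] := functional_bounded; exists (C' * C) => [|u v hf]; first exact: mulr_ge0.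
have [||||x [Xx hx nx]] := hC' (f u v) (C * (nsq u + nsq v)) => //.
- by rewrite mulr_ge0// addr_ge0// nsq_ge0.
- by move=> c x y; exact: functional_antilinear.
- by move=> z; exact: hC.
- by exists x; split=> //; rewrite -mulrA.
Qed.

(** A Fredholm alternative: the gap solves the weak equation whenever the data vanish on the kernel
    of S(l). The conditions are continuous in the data, which will give closed range. *)
Lemma ran_blockP p : ran (shift M l%:C) p <-> forall z, S (z, 0) -> f p.1 p.2 z = 0.
Proof.
have ht : hermitian_on X (s l) by case: schur_sb.
split=> [[q' /block_weak[Xx _ hx]] z [Xz hz]|hf].
  have {}hx : s l q'.1 z = f p.1 p.2 z := hx z Xz.
  have {}hz : s l z q'.1 = '[0, q'.1] := hz _ Xx.
  by rewrite -hx (formC ht Xz Xx) hz inner0l conjC0.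
have [C _ hC] := weak_solvable; have [x [Xx hx _]] := hC _ _ hf.
by exists (x, - res (p.2 + bs x)); apply/block_weak.
Qed.

Lemma ker_complete : complete_on (ker S) (@inner R H1).
Proof.
have tc := schur_sb; have m0 : measurable ([set 0] : set (measurableTypeR R)) by exact: measurable_set1.
move=> u Su /(hilbert_complete (fun n => I))[y _ hy]; exists y => //.
apply: (ker_zero tc sm); apply/esym/eqP; rewrite -subr_eq0; apply/eqP/nsq_eq0/eqP.
rewrite eq_le nsq_ge0 andbT; apply: (@le0_eps _ _ 4) => r /hy[N /(_ N (leqnn N))].
rewrite -/(nsq _) => hN.
have -> : y - E [set 0] y = E [set 0] (u N - y) - (u N - y).
  by rewrite projB// (ker_nonpos tc sm (Su N)) opprB [RHS]addrC addrA subrK.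
apply: le_trans (nsqD_le _ _) _; rewrite nsqN; have := nsq_proj_le E (u N - y) m0; lra.
Qed.

(** The pairs (z, 0) with z in the kernel of S(l) complement the range: the functional of [p] on the
    kernel is represented by some z0 there, and subtracting (z0, 0) from [p] meets the solvability
    condition. *)
Lemma gap_fredholm m : has_dim (ker S) m -> fredholm (shift M l%:C).
Proof.
move=> hm; have tc := schur_sb; have sS := ker_subsp tc.
have [C C0 hC] := functional_bounded.
have hSE z : S (z, 0) -> complex.Re (h z z) = k * nsq z.
  move=> Sz; rewrite hE ReD ReZ -/(nsq z) (_ : s l z z = 0) ?add0r//.
  by case: Sz => /= Xz ->//; rewrite inner0l.
split.
- apply/closure_id/seteqP; split; first exact: subset_closure.
  move=> p /closure4_nsqP hp; apply/block_weak/weak_graph_closed => r r0.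
  by have [q' /block_weak ? ?] := hp r r0; exists q'.
- by exists m; apply/ker_block_dim.
- apply/closure_id/seteqP; split; first exact: subset_closure.
  move=> p /closure2_nsqP hp; apply/ran_blockP.
  have re z : S (z, 0) -> complex.Re (f p.1 p.2 z) = 0.
    move=> Sz; apply/eqP; rewrite -sqrf_eq0 eq_le sqr_ge0 andbT.
    have Xz : X z by case: Sz.
    apply: (@le0_eps _ _ (2 * C * complex.Re (h z z))) => r r0.
    have [q' /ran_blockP hq [n1 n2]] := hp r r0.
    have -> : f p.1 p.2 z = f (p.1 - q'.1) (p.2 - q'.2) z by rewrite functional_sub (hq z Sz) subr0.
    apply: le_trans (hC _ _ _ Xz) _.
    have G0 : 0 <= complex.Re (h z z) by exact: (shifted_nonneg coercive_schur).
    have : C * (nsq (p.1 - q'.1) + nsq (p.2 - q'.2)) <= C * (2 * r) by rewrite ler_wpM2l//; lra.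
    move=> /(ler_wpM2r G0); lra.
  move=> z Sz; rewrite [f _ _ _]complexE re//.
  have Xz : X z by case: Sz.
  have := re (Complex 0 1 *: z) (subspZ sS (Complex 0 1) Sz).
  rewrite -[Complex 0 1 *: z]addr0 functional_antilinear//; last exact: subsp0 sX.
  rewrite (_ : f p.1 p.2 0 = 0) ?addr0; last by rewrite /f bs0 !inner0r addr0.
  by case: (f p.1 p.2 z) => zr zi /= h0; rewrite (_ : zi = 0)//; lra.
- exists [set q' | S (q'.1, 0) /\ q'.2 = 0].
    exists m; apply/(has_dim_iso (psi := fst) (M := ker S)); last exact: hm.
    - by [].
    - split; first by split=> //; exact: subsp0 sS.
      by move=> c p r [p1 p2] [r1 r2]; split; [exact: (subspP sS)|rewrite /= p2 r2 scaler0 addr0].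
    - exact: sS.
    - by move=> x [].
    - by move=> z Sz; exists (z, 0).
    - by move=> [x y] [/= _ ->] ->.
  move=> p; have hI : hermitian_on (ker S) (@inner R H1).
    by split=> // *; [exact: (formPl inner_hermitian)|exact: innerC].
  have [|||z0 Sz0 hz0] := riesz hI _ (f := f p.1 p.2) (C := C * (nsq p.1 + nsq p.2) * k) ker_complete.
  - by move=> x _; exact: nsq_ge0.
  - by move=> c x y [Xx _] [Xy _]; exact: functional_antilinear.
  - by move=> z Sz; rewrite -/(nsq z) -[leRHS]mulrA -hSE//; apply: hC; case: Sz.
  exists (p.1 - z0, p.2), (z0, 0); split=> //.
    apply/ran_blockP => z Sz /=; rewrite -[p.2]subr0 functional_sub -hz0//.
    by rewrite /f res0 inner0l addr0 subrr.
  by case: p {hz0} => u v /=; rewrite -[LHS]/(u, v); congr pair; rewrite /= ?subrK ?addr0.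
Qed.

(** With trivial kernel the weak equation is solvable for all data with a bound. By uniqueness
    differences of solutions solve for differences of data, so the bound yields continuity of the
    inverse. *)
Lemma gap_resolvent : (forall x, S (x, 0) -> x = 0) -> resolvent_set M l%:C.
Proof.
move=> inj; have [C C0 hC] := weak_solvable; have [C' C'0 hC'] := weak_bounded.
have ht : hermitian_on X (s l) by case: schur_sb.
have uniq x x' u v : X x -> X x' -> (forall z, X z -> s l x z = f u v z) ->
    (forall z, X z -> s l x' z = f u v z) -> x = x'.
  move=> Xx Xx' hx hx'; apply/eqP; rewrite -subr_eq0; apply/eqP/inj; split=> /=; first exact: subspB.
  by move=> z Xz; change (s l (x - x') z = '[0, z]); rewrite (formBl ht)// hx// hx'// subrr inner0l.
have /boolp.choice[xs hxs] (q' : H1 * H2) : exists x, [/\ X x, forall z, X z -> s l x z = f q'.1 q'.2 z &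
    nsq x <= C * (nsq q'.1 + nsq q'.2)].
  by apply: hC => z /inj ->; rewrite /f bs0 !inner0r addr0.
have XS r : X (xs r) by case: (hxs r).
pose Q (r : H1 * H2) : H1 * H2 := (xs r, - res (r.2 + bs (xs r))).
exists Q; last first.
  move=> p r; split=> [/block_weak[/= Xx e1 hx]|->].
    have ex : p.1 = xs r by apply: (uniq _ _ r.1 r.2) => // z Xz; case: (hxs r) => _ ->.
    by case: p ex e1 {Xx hx} => x y /= ex ->; rewrite /Q ex.
  by apply/block_weak; case: (hxs r) => hX hs _; split.
have sub r r' : xs r - xs r' = xs (r.1 - r'.1, r.2 - r'.2).
  apply: (uniq _ _ (r.1 - r'.1) (r.2 - r'.2)) => [| |z Xz|z Xz]; [exact: subspB|by []| |].
    by rewrite (formBl ht)// functional_sub; case: (hxs r) => _ -> // _; case: (hxs r') => _ ->.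
  by case: (hxs (r.1 - r'.1, r.2 - r'.2)) => _ ->.
pose K := C + C' * (2 + 2 * k ^+ 2 * C).
have kC : 0 <= k ^+ 2 * C by rewrite mulr_ge0// sqr_ge0.
have KC : 0 <= C' * (2 + 2 * k ^+ 2 * C) by rewrite mulr_ge0//; lra.
apply: (@bounded_continuous2 _ _ _ Q K) => [|r r'|r r'].
- by rewrite /K; lra.
- rewrite /Q /= sub; case: (hxs (r.1 - r'.1, r.2 - r'.2)) => _ _ /= h1.
  apply: le_trans h1 _; rewrite ler_wpM2r ?addr_ge0 ?nsq_ge0// /K; lra.
rewrite /Q /= -opprD nsqN -resN -resD opprD addrACA -bsB// sub.
set d := (r.1 - r'.1, r.2 - r'.2); case: (hxs d) => Xd hd nd.
have : weak_graph ((xs d, - res (d.2 + bs (xs d))), d) by [].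
move=> /weak_graphP[/= ed _]; have [_] := hC' (d.1 + k%:C *: xs d) d.2; rewrite -ed => h1.
apply: le_trans h1 _; rewrite /= in nd *; set u := r.1 - r'.1 in nd *; set v := r.2 - r'.2 in nd *.
have n1 := nsqD_le u (k%:C *: xs d); rewrite nsqZ /= expr0n/= addr0 in n1.
have n2 := ler_wpM2l (sqr_ge0 k) nd.
have u0 := nsq_ge0 u; have v0 := nsq_ge0 v.
have h2 : nsq (u + k%:C *: xs d) + nsq v <= (2 + 2 * k ^+ 2 * C) * (nsq u + nsq v) by lra.
have := ler_wpM2l C'0 h2; have : 0 <= C * (nsq u + nsq v) by rewrite mulr_ge0// addr_ge0.
rewrite /K; lra.
Qed.

End Gap.

Lemma ker_eigenvalue : (exists2 x, x != 0 & S (x, 0)) -> eigenvalue M l%:C.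
Proof.
move=> [x x0 Sx]; exists (x, - res (bs x)).
  by apply: contraNneq x0 => -[->].
have : M ((x, - res (bs x)), 0 + l%:C *: (x, - res (bs x))).
  exact: (ker_blockP (x, - res (bs x))).2 (conj Sx erefl).
by rewrite add0r.
Qed.

End BlockSchur.

Lemma kappa_minusP (R : realType) (H : hilbertType R) (t : form H) c k :
  closed_form t c -> kappa_minus (form_operator t) k <-> form_index t k.
Proof.
move=> tc; split=> [[E sm] /(neg_part_dim tc sm)//|ik].
have [E sm] := closed_form_spectral tc; exists E => //.
exact/(neg_part_dim tc sm).
Qed.

(** * Spectrum and variational principle *)

Section BlockSpectrum.
Context {R : realType} {H1 H2 : hilbertType R}.
Variables (A : op H1 H1) (B : op H2 H1) (D : op H2 H2) (fa : form H1) (a b delta c0 : R).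
Hypothesis A_sa : self_adjoint A.
Hypothesis A_form : A `<=` form_operator fa.
Hypothesis B_lin : linear_operator B.
Hypothesis B_dense : densely_defined B.
Hypothesis sa : self_adjoint D.
Hypothesis D_above : bounded_from_above D.
Hypothesis spec_le : forall z, spectrum D z -> z <= delta%:C.
Hypothesis fac : closed_form fa c0.
Local Notation X := (fdom fa).
Local Notation bs := (app (adjoint B)).
Hypothesis fa_B : X `<=` dom (adjoint B).
Hypothesis b_ge0 : 0 <= b.
Hypothesis ab : forall x, X x -> nsq (bs x) <= a * nsq x + b * complex.Re (fa x x).
Hypothesis B_core : forall y v, D (y, v) -> forall e : R, 0 < e ->
  exists y' v', [/\ dom B y', D (y', v'), nsq (y - y') < e & nsq (v - v') < e].
Local Notation mu := (delta + b + Num.sqrt (Num.max (b * delta + b ^+ 2 + a) 0)).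
Local Notation M := (block_operator A B D).
Local Notation s := (fun l => fval (schur_form B D fa l)).
Local Notation S l := (schur_complement B D fa l).
Local Notation p := (rayleigh B D fa mu).
Local Notation fin := (fin X s).
Local Notation nu := (nu X s).
Local Notation good := (good X mu s).

Let bsl := bs_lin B_dense fa_B.
Let scl l (ml : mu < l) : closed_form (Form X (s l)) (schur_bound a b delta c0 l).
Proof. exact: (schur_closed sa D_above spec_le fac bsl b_ge0 ab ml). Qed.
Let mono l1 l2 (m1 : mu < l1) (l12 : l1 < l2) := schur_mono sa D_above spec_le b_ge0 ab m1 l12.
Let cont l (ml : mu < l) := schur_cont sa D_above spec_le fac bsl b_ge0 ab ml.
Let decay l x (ml : mu < l) (Xx : X x) :
  complex.Re (s l x x) <= complex.Re (fa x x) - l * nsq x.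
Proof. by apply: (schur_le B fa sa D_above spec_le x); case: (mu_gt b_ge0 ml). Qed.
Let fah : hermitian_on X fa. Proof. by case: fac. Qed.

Lemma good_fredholm l : good l -> fredholm (shift M l%:C).
Proof.
move=> gl; have [ml [l2 ll f2]] := gl; have [E sm] := closed_form_spectral (scl ml).
have [e e0 ge] := fin_gap scl mono ml sm ll f2; have [m hm] := good_ker scl mono gl.
exact: (gap_fredholm A_sa A_form B_lin B_dense sa D_above spec_le fac fa_B b_ge0 ab B_core ml sm e0 ge hm).
Qed.

(** At a Fredholm point S(l) has closed range and finite-dimensional kernel, and then the index
    stays finite slightly beyond [l]. *)
Lemma not_good_ess l : mu < l -> (forall l', mu < l' -> l' < l -> fin l') -> ~ good l ->
  ess_spectrum M l%:C.
Proof.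
move=> ml hf ng fr; apply: ng; split=> //.
have [cS [m hm]] := fredholm_schur A_sa A_form B_lin B_dense sa D_above spec_le fac fa_B b_ge0 ab B_core ml fr.
exact: (closed_range_fin scl cont ml hf cS hm).
Qed.

Lemma good_eigenvalue l : good l -> spectrum M l%:C -> exists2 x, x != 0 & S l (x, 0).
Proof.
move=> gl sl; have [ml [l2 ll f2]] := gl; have [E sm] := closed_form_spectral (scl ml).
have [e e0 ge] := fin_gap scl mono ml sm ll f2; apply: contrapT => no; apply: sl.
apply: (gap_resolvent A_sa A_form B_lin B_dense sa D_above spec_le fac fa_B b_ge0 ab B_core ml sm e0 ge).
by move=> x Sx; apply/eqP; apply: contrapT => /negP x0; apply: no; exists x.
Qed.

Lemma good_ker_pos l m : (exists2 x, x != 0 & S l (x, 0)) -> has_dim (ker (S l)) m -> (0 < m)%N.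
Proof.
move=> [x x0 Sx]; case: m => // -[v [_ e]].
have : ker (S l) x by []; rewrite e => -[c _ xe].
by move: xe; rewrite big_ord0 => xe; rewrite -xe eqxx in x0.
Qed.

Lemma spectrum_nu l l' : good l -> spectrum M l%:C -> l < l' -> fin l' -> (nu l < nu l')%N.
Proof.
move=> gl sl ll f'; have [m hm] := good_ker scl mono gl.
have m0 := good_ker_pos (good_eigenvalue gl sl) hm.
apply: leq_trans (nu_ker_le scl mono cont (proj1 gl) ll f' hm).
by rewrite -[X in (X < _)%N]addn0 ltn_add2l.
Qed.

Hypothesis gamma_fin : exists gamma, mu < gamma /\ fin gamma.
Definition threshold : \bar R := ereal_inf [set l%:E | l in [set l : R | mu < l /\ ess_spectrum M l%:C]].
Local Notation lam_e := threshold.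

(** Good points are Fredholm points. If a point below lambda_e were not good, the supremum of the
    points of finite index would not exceed it, would not be good either, and would belong to the
    essential spectrum. *)
Lemma lt_threshold l : mu < l -> (l%:E < lam_e)%E <-> good l.
Proof.
move=> ml; split=> [ll|[_ [l2 ll2 f2]]]; last first.
  apply: (@lt_le_trans _ _ l2%:E); first by rewrite lte_fin.
  apply: le_ereal_inf_tmp => _ [x [mx ex] <-]; rewrite lee_fin leNgt; apply/negP => xl.
  by apply: ex; apply: good_fredholm; split=> //; exists l2.
apply: contrapT => ng; have [ga [mga fga]] := gamma_fin.
pose F : set R := [set x | mu < x /\ fin x].
have Fl x : F x -> x <= l.
  by move=> [mx fx]; rewrite leNgt; apply/negP => lx; apply: ng; split=> //; exists x.
have hF : has_sup F by split; [exists ga|exists l].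
pose L := sup F; have gL : ga <= L by apply: (sup_upper_bound hF).
have mL : mu < L by exact: lt_le_trans gL.
have Ll : L <= l by apply: ge_sup => //; exists ga.
have eL : ess_spectrum M L%:C.
  apply: not_good_ess => // [l' ml' l'L|[_ [l2 Ll2 f2]]].
    have [x [mx fx] lx] := sup_adherent (eps := L - l') ltac:(lra) hF.
    have l'x : l' < x by move: lx; rewrite -/L; lra.
    by case: (fin_le scl mono ml' l'x fx).
  have : l2 <= L by apply: (sup_upper_bound hF); split=> //; exact: lt_trans Ll2.
  by rewrite leNgt Ll2.
have : (lam_e <= L%:E)%E by apply: ereal_inf_lbound; exists L.
by move=> /(lt_le_trans ll); rewrite lte_fin ltNge Ll.
Qed.

Lemma mu_lt_threshold : (mu%:E < lam_e)%E.
Proof.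
have [ga [mga fga]] := gamma_fin; apply: (@lt_le_trans _ _ ga%:E); first by rewrite lte_fin.
apply: le_ereal_inf_tmp => _ [x [mx ex] <-]; rewrite lee_fin leNgt; apply/negP => xl.
by apply: ex; apply: good_fredholm; split=> //; exists ga.
Qed.

Definition point_set : set R := [set l : R | [/\ spectrum M l%:C, mu < l & (l%:E < lam_e)%E]].

Lemma point_good l : point_set l -> good l.
Proof. by move=> [_ ml ll]; apply/lt_threshold. Qed.

Lemma point_nu l l' : point_set l -> point_set l' -> l < l' -> (nu l < nu l')%N.
Proof.
move=> pl pl' ll; have gl' := point_good pl'; case: (pl) => sl _ _.
by apply: (spectrum_nu (point_good pl) sl ll); exact: (good_fin scl mono gl').
Qed.

Lemma point_nu_inj : {in point_set &, injective nu}.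
Proof.
move=> l l'; rewrite !inE => pl pl' e; case: (ltgtP l l') => // h.
  by have := point_nu pl pl' h; rewrite e ltnn.
by have := point_nu pl' pl h; rewrite e ltnn.
Qed.

(** [nu] grows strictly past each spectral point, so its value labels the point. *)
Lemma point_countable : countable point_set.
Proof. by apply/countable_injP; exists nu; exact: point_nu_inj. Qed.

Lemma point_eigenvalue l : point_set l -> eigenvalue M l%:C.
Proof.
move=> pl; have gl := point_good pl; have [sl ml _] := pl.
apply: (ker_eigenvalue A_sa A_form B_lin B_dense sa D_above spec_le fac fa_B b_ge0 ab B_core ml).
exact: good_eigenvalue.
Qed.

(** Below a good [r] there are finitely many spectral points, since [nu] is injective on them and
    bounded by [nu r]. The extended reals cover lambda_e = oo; for [z] at or below [mu], a good [r]
    between [mu] and a point of finite index is used. *)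
Lemma point_limit (z : \bar R) : limit_point [set l%:E | l in point_set] z -> z = lam_e.
Proof.
move=> hz; case: (ltgtP z lam_e) => // h; last first.
  have [|_ [_ [l [_ _ ll] <-] /= lz]] := hz [set y | (lam_e < y)%E].
    by apply: open_nbhs_nbhs; split=> //; exact: open_ereal_gt_ereal.
  by have := lt_trans lz ll; rewrite ltxx.
have [ga [mga fga]] := gamma_fin; have mg : mu < (mu + ga) / 2 by lra.
have gg : good ((mu + ga) / 2).
  by split=> //; exists ga => //; lra.
have [r gr zr] : exists2 r, good r & (z < r%:E)%E.
  case: z h {hz} => [z||] h.
  - have [mz|zm] := ltP mu z.
      have [_ [l2 zl f2]] := (lt_threshold mz).1 h.
      exists ((z + l2) / 2); last by rewrite lte_fin; lra.
      split; first lra.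
      by exists l2 => //; lra.
    by exists ((mu + ga) / 2) => //; rewrite lte_fin; lra.
  - by move: h; rewrite ltNge leey.
  - by exists ((mu + ga) / 2) => //; exact: ltNyr.
pose Fp : set R := point_set `&` [set l | l < r].
have fr := good_fin scl mono gr.
have finF : finite_set Fp.
  have fn : finite_set (nu @` Fp).
    apply: (@sub_finite_set _ _ `I_(nu r)); last exact: finite_II.
    move=> _ [l [pl lr] <-] /=; case: (pl) => sl _ _.
    exact: (spectrum_nu (point_good pl) sl lr fr).
  apply: card_le_finite fn; rewrite (card_le_eqr (inj_card_eq _))// => x y /set_mem[px _] /set_mem[py _].
  by apply: point_nu_inj; rewrite inE.
(* [z] is removed because a limit point may itself belong to the set. *)
pose Fz : set (\bar R) := (EFin @` Fp) `\ z.
have clF : closed Fz.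
  apply: ((accessible_finite_set_closed (T := \bar R)).1 (hausdorff_accessible (@ereal_hausdorff R))).
  by apply: finite_setD; exact: finite_image.
have [|y [yz [l pl ly] [/= yr nFz]]] := hz ([set y | (y < r%:E)%E] `&` ~` Fz).
  apply: open_nbhs_nbhs; split; last by split=> // -[_]; exact.
  by apply: openI; [exact: open_ereal_lt_ereal|exact: closed_openC].
exfalso; apply: nFz; split; last by move/eqP; rewrite (negPf yz).
by exists l => //; split=> //; rewrite /= -lte_fin ly.
Qed.

Lemma good_index l : good l -> kappa_minus (S l) (nu l).
Proof.
move=> gl; apply: (kappa_minusP _ (scl (proj1 gl))).2; apply: nuP.
exact: (good_fin scl mono gl).
Qed.

Section ListedEigenvalues.
Variables (g0 : R) (N : option nat) (lam : nat -> R).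
Hypothesis mg : mu < g0.
Hypothesis gl0 : (g0%:E < lam_e)%E.
Hypothesis lists : lists_eigenvalues M [set l : R | g0 <= l /\ (l%:E < lam_e)%E] N lam.

Let lamI j : index_le N j -> g0 <= lam j /\ good (lam j).
Proof.
case: lists => h _ _ /h[gl ll]; split=> //; apply/lt_threshold => //.
exact: lt_le_trans gl.
Qed.

Let lamC x : g0 <= x -> good x -> exists2 m, has_dim (ker (S x)) m
  & ([set j | index_le N j /\ lam j = x] #= `I_m)%card.
Proof.
move=> gx gdx; have mx : mu < x by exact: lt_le_trans gx.
have [|m hm hJ] := let: And3 _ _ h := lists in h x.
  by split=> //; apply/lt_threshold.
exists m => //; apply: (ker_block_dim A_sa A_form B_lin B_dense sa D_above spec_le fac fa_B b_ge0 ab B_core mx m).1 => //.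
Qed.

Lemma index_count l j : g0 <= l -> good l -> (0 < j)%N ->
  index_le N j /\ lam j < l <-> (nu g0 + j <= nu l)%N.
Proof.
have lamM := let: And3 _ h _ := lists in h.
exact: (counting scl mono cont mg lamI lamM lamC).
Qed.

Lemma minmax_listed n : index_le N n ->
  [/\ sups_attained X p (nu g0 + n)%N, is_min (sups X p (nu g0 + n)%N) (lam n)%:E
    & is_max (infs X p (nu g0 + n - 1)%N) (lam n)%:E].
Proof.
move=> iN; have [gl gdl] := lamI iN; have n0 : (0 < n)%N by case/andP: iN.
have [ml [l2 ll2 f2]] := gdl; have [m hm] := good_ker scl mono gdl.
apply: (minmax_eigenvalue scl mono cont fah decay gdl hm).
  by rewrite ltnNge; apply/negP => /(index_count gl gdl n0)[_]; rewrite ltxx.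
(* Just to the right of [lam n], where [lam n] is counted, [nu] has already jumped by [m]; this
   gives nu(g0) + n <= nu(lam n) + m. *)
have [d d0 hd] := nu_jump scl mono cont ml ll2 f2 hm.
have [//||_ <-] := hd (lam n + d / 2); [by lra|by lra|].
have [||f3 _] := hd (lam n + d / 2 / 2 + d / 2); [by lra|by lra|].
apply/index_count => //; first by lra.
  split; first by lra.
  by exists (lam n + d / 2 / 2 + d / 2) => //; lra.
by split=> //; lra.
Qed.

(** With N0 listed eigenvalues the index never exceeds nu(g0) + N0 below lambda_e. Negative
    subspaces of arbitrary dimension occur for large lambda when [H1] is infinite-dimensional, so
    lambda_e is finite. *)
Lemma minmax_beyond N0 : N = Some N0 -> ~ finite_dim [set: H1] -> (lam_e < +oo)%E /\
  forall n, (N0 < n)%N -> [/\ sups_attained X p (nu g0 + n)%N,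
    lam_e = ereal_inf (sups X p (nu g0 + n)%N) & lam_e = ereal_sup (infs X p (nu g0 + n - 1)%N)].
Proof.
move=> NE infH.
have small n l : (N0 < n)%N -> good l -> (nu l < nu g0 + n)%N.
  move=> n0 gdl; have [gl|lg] := leP g0 l; last first.
    apply: (@leq_ltn_trans (nu g0)); last by rewrite -[X in (X < _)%N]addn0 ltn_add2l (leq_ltn_trans _ n0).
    have gg : good g0 by apply/lt_threshold.
    by apply: (nu_le scl mono (proj1 gdl) (ltW lg)); exact: (good_fin scl mono gg).
  rewrite ltnNge; apply/negP => /(index_count gl gdl (leq_ltn_trans (leq0n _) n0))[].
  by rewrite NE /index_le => /andP[_]; rewrite leqNgt n0.
have lt_oo : (lam_e < +oo)%E.
  rewrite ltNge; apply/negP => le.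
  have [l [ml [L hL nL]]] := index_infinite scl fah decay infH (nu g0 + N0.+1).
  have gdl : good l by apply/lt_threshold => //; exact: lt_le_trans (ltry l) le.
  have [_ mx] := nuP (good_fin scl mono gdl).
  by have := mx _ _ hL nL; rewrite leqNgt small.
split=> // n nn.
have [Lam LamE] : exists Lam, lam_e = Lam%:E.
  by move: mu_lt_threshold lt_oo; case: lam_e => [r _ _|//|//]; exists r.
have mL : mu < Lam by rewrite -lte_fin -LamE; exact: mu_lt_threshold.
rewrite LamE; apply: (minmax_threshold scl mono cont fah decay mL) => // l.
- move=> ml lL; have gdl : good l by apply/lt_threshold => //; rewrite LamE lte_fin.
  by split; [exact: (good_fin scl mono gdl)|exact: small].
- move=> Ll fl; have : good ((Lam + l) / 2).
    split; first by lra.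
    by exists l => //; lra.
  move=> /lt_threshold; rewrite LamE lte_fin => h.
  have := h ltac:(lra); lra.
Qed.

End ListedEigenvalues.

End BlockSpectrum.

Theorem theorem5p6 (R : realType) (H1 H2 : hilbertType R)
    (A : op H1 H1) (B : op H2 H1) (D : op H2 H2)
    (fa : form H1) (fd : form H2) (a b delta : R)
    (A_sa : self_adjoint A) (A_below : bounded_from_below A)
    (B_lin : linear_operator B) (B_dense : densely_defined B)
    (B_closable : closable B)
    (D_sa : self_adjoint D) (D_above : bounded_from_above D)
    (fa_A : is_form_of A fa) (fd_D : is_form_of D fd)
    (fa_B : fdom fa `<=` dom (adjoint B))
    (B_D : (dom B `<=` dom D /\ is_core D (dom B)) \/ (fdom fd `<=` dom B))
    (b_ge0 : 0 <= b)
    (ab_bound : forall x, fdom fa x ->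
       `|app (adjoint B) x| ^+ 2 <= a%:C * `|x| ^+ 2 + b%:C * fa x x)
    (delta_max : spectrum D delta%:C /\
       forall z, spectrum D z -> z <= delta%:C) :
  let M := block_operator A B D in
  let mu := delta + b + Num.sqrt (Num.max (b * delta + b ^+ 2 + a) 0) in
  let S := schur_complement B D fa in
  let p := rayleigh B D fa mu in
  forall gamma_fin : exists gamma : R,
    mu < gamma /\ exists k, kappa_minus (S gamma) k,
  let lam_e := ereal_inf
    [set l%:E | l in [set l : R | mu < l /\ ess_spectrum M l%:C]] in
  let sigma := [set l : R | [/\ spectrum M l%:C, mu < l & (l%:E < lam_e)%E]] in
  [/\ (mu%:E < lam_e)%E,
      countable sigma,
      (forall l, sigma l -> eigenvalue M l%:C),
      (forall z : \bar R, limit_point [set l%:E | l in sigma] z -> z = lam_e)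
    & forall gamma0 : R, mu < gamma0 -> (gamma0%:E < lam_e)%E ->
      exists2 kappa : nat, kappa_minus (S gamma0) kappa &
      forall (N : option nat) (lam : nat -> R),
        lists_eigenvalues M
          [set l : R | gamma0 <= l /\ (l%:E < lam_e)%E] N lam ->
        (forall n : nat, index_le N n ->
           [/\ sups_attained (fdom fa) p (kappa + n)%N,
               is_min (sups (fdom fa) p (kappa + n)%N) (lam n)%:E
             & is_max (infs (fdom fa) p (kappa + n - 1)%N) (lam n)%:E]) /\
        (forall N0 : nat, N = Some N0 -> ~ finite_dim [set: H1] ->
           (lam_e < +oo)%E /\
           forall n : nat, (N0 < n)%N ->
             [/\ sups_attained (fdom fa) p (kappa + n)%N,
                 lam_e = ereal_inf (sups (fdom fa) p (kappa + n)%N)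
               & lam_e = ereal_sup (infs (fdom fa) p (kappa + n - 1)%N)])].
Proof.
move=> M mu S p gamma_fin lam_e sigma.
have [c0 fac A_form] := is_form_of_closed A_sa A_below fa_A.
(* The diagonal of [fa] is real, so the inequality in [R[i]] is one between real numbers. *)
have ab x : fdom fa x ->
    nsq (app (adjoint B) x) <= a * nsq x + b * complex.Re (fa x x).
  move=> Xx; have := ab_bound x Xx; rewrite !norm_nsq.
  rewrite (form_diag_real (let: And4 h _ _ _ := fac in h) Xx) -!rmorphM/= -rmorphD/=.
  by rewrite lecR.
have spec_le := delta_max.2.
(* In case (I) this is the core property read in squared norms. In case (II) dom(D) lies in the form
   domain of [D], hence in dom(B), and the vector approximates itself. *)
have B_core y v : D (y, v) -> forall e : R, 0 < e ->
    exists y' v', [/\ dom B y', D (y', v'), nsq (y - y') < e & nsq (v - v') < e].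
  move=> Dy e e0; case: B_D => [[BD [_ core]]|dB].
    have : closure (restrict D (dom B)) (y, v) by rewrite core.
    move=> /closure2_nsqP/(_ e e0)[[y' v'] [/= Dy' By'] [h1 h2]].
    by exists y', v'.
  exists y, v; split => //; last by rewrite subrr nsq0.
  - by apply: dB; apply: (form_of_dom_sub fd_D); exists v.
  - by rewrite subrr nsq0.
have bsl := bs_lin B_dense fa_B.
have scl l (ml : mu < l) : closed_form (schur_form B D fa l) (schur_bound a b delta c0 l).
  exact: (schur_closed D_sa D_above spec_le fac bsl b_ge0 ab ml).
have gf : exists ga, mu < ga /\ fin (fdom fa) (fun l => schur_form B D fa l) ga.
  have [ga [mga [k hk]]] := gamma_fin; exists ga; split=> //; exists k.
  exact: (kappa_minusP k (scl _ mga)).1.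
split.
- exact: (mu_lt_threshold A_sa A_form B_lin B_dense D_sa D_above spec_le fac fa_B b_ge0 ab B_core gf).
- exact: (point_countable A_sa A_form B_lin B_dense D_sa D_above spec_le fac fa_B b_ge0 ab B_core gf).
- exact: (point_eigenvalue A_sa A_form B_lin B_dense D_sa D_above spec_le fac fa_B b_ge0 ab B_core gf).
- exact: (point_limit A_sa A_form B_lin B_dense D_sa D_above spec_le fac fa_B b_ge0 ab B_core gf).
move=> g0 mg gl0.
exists (nu (fdom fa) (fun l => schur_form B D fa l) g0).
  apply: (good_index B_dense D_sa D_above spec_le fac fa_B b_ge0 ab) => //.
  exact/(lt_threshold A_sa A_form B_lin B_dense D_sa D_above spec_le fac fa_B b_ge0 ab B_core gf).
move=> N lam lists; split.
- exact: (minmax_listed A_sa A_form B_lin B_dense D_sa D_above spec_le fac fa_B b_ge0 ab B_core gf mg lists).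
- exact: (minmax_beyond A_sa A_form B_lin B_dense D_sa D_above spec_le fac fa_B b_ge0 ab B_core gf mg gl0 lists).
Qed.
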